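(* There exists a constant $\delta>0$ such that, for $n\equiv 1,3\pmod 6$, if $S$ is chosen uniformly at random from the set $\mathcal{S}_n$ of all Steiner triple systems on $n$ vertices, then asymptotically almost surely $$\mathrm{mc}_3(S)\geq n-2n^{1-\delta}.$$
   Context: A Steiner triple system is a $3$-uniform hypergraph in which each pair of distinct vertices is contained in exactly one edge; $\mathcal{S}_n$ is the family of all Steiner triple systems on a fixed (labelled) vertex set of size $n$, e.g. $\{1,\dots,n\}$. ''Asymptotically almost surely'' (a.a.s.) means with probability tending to $1$ as $n\to\infty$ (through $n\equiv 1,3 \pmod 6$). The shadow-graph $H^{(2)}$ of a hypergraph $H$ is the graph on $V(H)$ in which $\{x,y\}$ is an edge if and only if some $e\in E(H)$ satisfies $\{x,y\}\subseteq e$. $H$ is connected if $H^{(2)}$ is connected, and the components of $H$ are its maximal connected subgraphs (so an isolated vertex is a component on one vertex). An $r$-coloring of $H$ is a partition $\{E_1,\dots,E_r\}$ of $E(H)$ in which some of the sets may be empty. A monochromatic component of $H$ (with respect to this coloring) is a component of the hypergraph $(V(H),E_i)$ for some $i\in\{1,\dots,r\}$. $\mathrm{mc}_r(H)$ is the largest integer $m$ such that in every $r$-coloring of the edges of $H$ there is a monochromatic component on at least $m$ vertices. *)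

(* Defs.v *)
From HB Require Import structures.
From mathcomp Require Import all_boot all_order all_algebra.
From mathcomp Require Import all_classical all_reals all_analysis.

Set Implicit Arguments.
Unset Strict Implicit.
Unset Printing Implicit Defensive.

Import Order.TTheory GRing.Theory Num.Theory.
Import numFieldNormedType.Exports.

Local Open Scope ring_scope.

(* A hypergraph on the vertex set T (all of it) is given by its set of edges
   H : {set {set T}}; vertices lying in no edge are isolated. *)

Definition shadow (T : finType) (H : {set {set T}}) : rel T :=
  fun x y => (x != y) && [exists e in H, [set x; y]%SET \subset e].

(* (A, F) is a connected sub-hypergraph of (T, H).  As the edges of F lie
   inside A, paths of shadow F starting in A stay in A. *)
Definition connected_sub (T : finType) (H : {set {set T}})
    (A : {set T}) (F : {set {set T}}) : bool :=
  [&& A != finset.set0, F \subset H, [forall e in F, e \subset A] &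
      [forall x in A, forall y in A, connect (shadow F) x y]].

(* C is the vertex set of a maximal connected sub-hypergraph of (T, H). *)
Definition component (T : finType) (H : {set {set T}}) (C : {set T}) : bool :=
  [exists F : {set {set T}}, connected_sub H C F &&
    [forall A : {set T}, forall G : {set {set T}},
      [&& connected_sub H A G, C \subset A & F \subset G] ==>
      (A == C) && (G == F)]].

(* An r-coloring is a function c from sets to 'I_r, of which only the
   restriction to H matters: this is the i-th part E_i of the partition. *)
Definition color_class (T : finType) (H : {set {set T}}) (r : nat)
    (c : {ffun {set T} -> 'I_r}) (i : 'I_r) : {set {set T}} :=
  [set e in H | c e == i]%SET.

Definition has_large_mono_component (T : finType) (r : nat)
    (H : {set {set T}}) (m : nat) : bool :=
  [forall c : {ffun {set T} -> 'I_r}, exists i : 'I_r, exists C : {set T},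
    component (color_class H c i) C && (m <= #|C|)%N].

(* The largest m as above; no component has more than #|T| vertices, so the
   bound on m loses nothing. *)
Definition mc (T : finType) (r : nat) (H : {set {set T}}) : nat :=
  (\max_(m < #|T|.+1 | has_large_mono_component r H m) m)%N.

Definition is_steiner (n : nat) (H : {set {set 'I_n}}) : bool :=
  [forall e in H, #|e| == 3%N] &&
  [forall x : 'I_n, forall y : 'I_n,
    (x != y) ==> (#|[set e in H | [set x; y]%SET \subset e]%SET| == 1%N)].

Definition STS (n : nat) : {set {set {set 'I_n}}} :=
  [set H | is_steiner H]%SET.

(* Probability of P for a uniformly random element of A; it is 0 when A is
   empty, so probabilities tending to 1 force A to be eventually nonempty. *)
Definition finite_uniform_prob (R : realType) (T : finType) (A : {set T})
    (P : pred T) : R :=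
  #|[set x in A | P x]%SET|%:R / #|A|%:R.

Definition admissible : set nat :=
  [set n : nat | n = 1 %[mod 6] \/ n = 3 %[mod 6]]%classic.

(* Submission.v *)
(* Call three disjoint vertex sets of size h = floor(n/K) + 1, where K is about n^(1/1700), a hole of S if no
   triple of S meets all three. A system without holes has mc_3 >= n - 4h: if all components of the three colour
   classes are small, each class i admits a bipartition into large sides that none of its edges crosses; the
   three bipartitions cut the vertex set into the cells of a cube, and three large cells can be found such that
   a triple meeting all of them crosses each bipartition, so that it has no colour.

   There are at most 8^n candidates for a hole, so it suffices that a fixed one occurs in a proportion of the
   systems that is at most exp(- n^2 / (2 K^3)). This compares two estimates of the entropy.
   Upper bound: if S has a given hole, all its triples lie among the n^3/6 - (n/K)^3 non-crossing ones, and a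
   random greedy packing restricted to these produces S with probability at least that given by Jensen's
   inequality over the orders of the triples of S.
   Lower bound: write n = 4v + 3^j with 3^j about n/K^8. The random greedy triangle packing on 4v points,
   controlled by an exponential supermartingale, yields many partial systems with small leave. Each of them is
   turned into a system on n points by altering few triples, so that the map has small fibres: split the points
   at random into four parts, two per half; remove and exchange triples such that no uncovered pair lies within
   a part (type 0), that the uncovered pairs joining the two parts of a half (type 1) form a q-regular graph,
   and that those joining the two halves (type 2) form a w-regular graph, with q + w = 3^j. These bipartite
   graphs split into 3^j perfect matchings, one for each point of the affine Steiner triple system over F_3. *)

Require Import Defs.
From HB Require Import structures.
From mathcomp Require Import all_boot all_order all_algebra.
From mathcomp Require Import reals sequences exp.
From mathcomp Require Import ring lra zify.

Set Implicit Arguments.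
Unset Strict Implicit.
Unset Printing Implicit Defensive.

Import Order.TTheory GRing.Theory Num.Theory.

Local Open Scope ring_scope.

(** * Logarithms *)

(** Two opposite demands fix the scales. Undoing the alterations costs a factor exp(O(n z log n)),
    where z = 3^j points are added; with [ln n <= 3400 K] this must stay far below the gain n^2 /
    K^3 of a hole, so z is only about n / K^8. Yet two points of a part share only about z^2 / n
    absorbing points, and this number must exceed all degrees and loads that occur; hence the leave
    is made as sparse as n / K^60, and n has to be a large power of K. The degrees must come out
    exactly. Three defects remain after the random choices: the difference of the two degrees at a
    point, repaired by deleting triples with that point as apex; the variation inside a part,
    repaired by exchanges; and one congruence modulo the size of a part, met by choosing how many
    type 0 pairs are absorbed within their half rather than from the other half. It is solvable
    because n = 1, 3 mod 6 and 3 divides z. *)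

Section LnFacts.
Variable R : realType.
Implicit Types x y : R.

Lemma ln_ge_1B x : 0 < x -> 1 - x^-1 <= ln x.
Proof.
move=> x0; have h : ln (x^-1) <= x^-1 - 1.
  have -> : x^-1 = 1 + (x^-1 - 1) by ring.
  have xi : 0 < x^-1 by rewrite invr_gt0.
  rewrite (_ : _ - 1 = x^-1 - 1); last by ring.
  by apply: le_ln1Dx; lra.
by move: h; rewrite lnV ?posrE//; lra.
Qed.

Lemma ln_leB1 x : 0 < x -> ln x <= x - 1.
Proof.
move=> x0; have {1}-> : x = 1 + (x - 1) by ring.
by apply: le_ln1Dx; lra.
Qed.

(** Jensen for [ln]: each [ln (f i)] lies below the tangent at [m], so [m] may be any upper bound of
    the mean. *)
Lemma ln_avg (I : finType) (S : {set I}) (f : I -> R) (m : R) :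
  0 < m -> (forall i, i \in S -> 0 < f i) ->
  \sum_(i in S) f i <= #|S|%:R * m ->
  \sum_(i in S) ln (f i) <= #|S|%:R * ln m.
Proof.
move=> m0 f0 fm.
have h i : i \in S -> ln (f i) <= ln m + (f i / m - 1).
  move=> iS; have fi := f0 i iS.
  have /ln_leB1 : 0 < f i / m by rewrite divr_gt0.
  by rewrite ln_div ?posrE//; lra.
apply: le_trans (ler_sum _ h) _.
rewrite big_split/= sumrB -mulr_suml !sumr_const -[ln m *+ _]mulr_natl.
suff : (\sum_(i in S) f i) / m <= #|S|%:R by lra.
by rewrite ler_pdivrMr.
Qed.

Lemma ln_sum_ge (I : finType) (S : {set I}) (f : I -> R) :
  (0 < #|S|)%N -> (forall i, i \in S -> 0 < f i) ->
  ln #|S|%:R + #|S|%:R^-1 * (\sum_(i in S) ln (f i)) <= ln (\sum_(i in S) f i).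
Proof.
move=> S0 f0.
have n0 : 0 < #|S|%:R :> R by rewrite ltr0n.
have s0 : 0 < \sum_(i in S) f i.
  case/card_gt0P: S0 => j jS; rewrite (bigD1 j)//=.
  apply: ltr_wpDr (f0 _ jS); apply: sumr_ge0 => i /andP[iS _].
  exact/ltW/f0.
have m0 : 0 < (\sum_(i in S) f i) / #|S|%:R by rewrite divr_gt0.
have := ln_avg m0 f0; rewrite mulrC divfK ?gt_eqF// => /(_ (lexx _)).
rewrite ln_div ?posrE// => h.
have : #|S|%:R^-1 * (\sum_(i in S) ln (f i)) <=
   ln (\sum_(i in S) f i) - ln #|S|%:R by rewrite ler_pdivrMl.
by lra.
Qed.

Lemma ln_fact_le k : (0 < k)%N ->
  ln (k`!%:R) <= k%:R * ln k%:R - k%:R + ln k%:R + 1 :> R.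
Proof.
case: k => // k _; elim: k => [|k IH]; first by rewrite ln1; lra.
rewrite factS natrM lnM ?posrE ?ltr0n ?fact_gt0//.
set a : R := k.+1%:R; have a0 : 0 < a by rewrite ltr0n.
have eb : k.+2%:R = a + 1 by rewrite -natr1.
rewrite eb.
have h := @ln_ge_1B ((a + 1) / a) (divr_gt0 (ltr_wpDr ler01 a0) a0).
move: h; rewrite invf_div ln_div ?posrE//; last by lra.
move=> h.
have : 1 <= (a + 1) * (ln (a + 1) - ln a).
  rewrite mulrC -ler_pdivrMr; last by lra.
  apply: le_trans h; rewrite le_eqVlt; apply/orP; left; apply/eqP.
  by field; lra.
move: IH; rewrite -/a; lra.
Qed.

Lemma harmonic_le k : (0 < k)%N ->
  \sum_(j < k) (j.+1%:R)^-1 <= 1 + ln k%:R :> R.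
Proof.
case: k => // k _; elim: k => [|k IH]; first by rewrite big_ord1 ln1 invr1 addr0.
rewrite big_ord_recr/=; apply: le_trans (lerD IH (lexx _)) _.
set a : R := k.+1%:R; have a0 : 0 < a by rewrite ltr0n.
have -> : k.+2%:R = a + 1 by rewrite -natr1.
have := @ln_ge_1B ((a + 1) / a) (divr_gt0 (ltr_wpDr ler01 a0) a0).
rewrite invf_div ln_div ?posrE//; last by lra.
have -> : 1 - a / (a + 1) = (a + 1)^-1 by field; lra.
by lra.
Qed.

(** With y the root of [x], 1 + y^2 <= (1 + y)^2 <= exp(2y). It tames error terms c / (k - i)^2 with
    a large c: the root of c appears instead, and the sum over the steps becomes harmonic. *)
Lemma ln1D_le_sqrt x : 0 <= x -> ln (1 + x) <= 2 * Num.sqrt x.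
Proof.
move=> x0; rewrite -ler_expR lnK ?posrE; last by lra.
set y := Num.sqrt x; have y0 : 0 <= y by apply: sqrtr_ge0.
have -> : x = y ^+ 2 by rewrite sqr_sqrtr.
rewrite expRM_natl; apply: (@le_trans _ _ ((1 + y) ^+ 2)); first by lra.
by rewrite lerXn2r ?nnegrE ?expR_ge0 ?expR_ge1Dx//; lra.
Qed.
End LnFacts.

(** * Entropy bound for families of packings *)

Section Greedy.
Variables (R : realType) (X : finType) (cf : rel X) (TT : {set X}).
Hypothesis cf_sym : symmetric cf.

Definition avail (B : {set X}) : {set X} :=
  [set t in TT | (t \notin B) && [forall b in B, ~~ cf t b]].

Definition packing (B : {set X}) :=
  (B \subset TT) && [forall b in B, forall b' in B, (b != b') ==> ~~ cf b b'].

(* The probability that the random greedy packing is [B] after [i = #|B|] steps. *)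
Fixpoint greedy_weight (i : nat) (B : {set X}) : R :=
  if i is j.+1 then
    \sum_(b in B) greedy_weight j (B :\ b) / #|avail (B :\ b)|%:R
  else 1.

Lemma greedy_weight_ge0 i B : 0 <= greedy_weight i B.
Proof.
elim: i B => [|i IH] B //=; apply: sumr_ge0 => b _.
by rewrite divr_ge0.
Qed.

Lemma packing_rem (B : {set X}) b : packing B -> b \in B ->
  packing (B :\ b) /\ b \in avail (B :\ b).
Proof.
move=> /andP[BT /forall_inP Bp] bB; split.
  apply/andP; split; first exact: subset_trans (subD1set _ _) BT.
  apply/forall_inP => x /setD1P[_ xB]; apply/forall_inP => y /setD1P[_ yB].
  by have /forall_inP := Bp x xB; apply.
rewrite inE (subsetP BT)// setD11/=; apply/forall_inP => x /setD1P[xb xB].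
by have /forall_inP /(_ x xB) := Bp b bB; rewrite eq_sym xb.
Qed.

Lemma packingS (B M : {set X}) : packing M -> B \subset M -> packing B.
Proof.
move=> pM BM; case/andP: pM => MT /forall_inP h; apply/andP; split.
  exact: subset_trans BM MT.
apply/forall_inP => x xB; apply/forall_inP => y yB.
by have /forall_inP/(_ y (subsetP BM _ yB)) := h x (subsetP BM _ xB).
Qed.

Lemma avail_gt0 (B : {set X}) b : packing B -> b \in B -> (0 < #|avail (B :\ b)|)%N.
Proof.
move=> pB bB; have [_ h] := packing_rem pB bB.
by apply/card_gt0P; exists b.
Qed.

Lemma greedy_weight_gt0 i (B : {set X}) :
  packing B -> #|B| = i -> 0 < greedy_weight i B.
Proof.
elim: i B => [|i IH] B pB cB //=.
have /card_gt0P[b bB] : (0 < #|B|)%N by rewrite cB.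
have Bb x : x \in B -> 0 < greedy_weight i (B :\ x) / #|avail (B :\ x)|%:R.
  move=> xB; rewrite divr_gt0//; last by rewrite ltr0n; exact: avail_gt0.
  apply: IH; first by have [] := packing_rem pB xB.
  by move: cB; rewrite (cardsD1 x) xB add1n => -[].
rewrite (bigD1 b)//=; apply: ltr_wpDr; last exact: Bb.
by apply: sumr_ge0 => x /andP[/Bb/ltW].
Qed.

(** The total may be below 1 because the process can get stuck: a packing hands its weight on to its
    extensions unless nothing is available. *)
Lemma sum_greedy_weight i :
  \sum_(B : {set X} | packing B && (#|B| == i)) greedy_weight i B <= 1.
Proof.
elim: i => [|i IH].
  rewrite (eq_bigl (pred1 set0)); last first.
    move=> B /=; rewrite cards_eq0; case: eqP => [->|_]; last by rewrite andbF.
    by rewrite andbT; apply/andP; split; [exact: sub0set|apply/forall_inP => b; rewrite inE].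
  by rewrite big_pred1_eq.
apply: le_trans IH => /=.
have -> : \sum_(B : {set X} | packing B && (#|B| == i.+1))
     \sum_(b in B) greedy_weight i (B :\ b) / #|avail (B :\ b)|%:R =
   \sum_b \sum_(B : {set X} | [&& packing B, #|B| == i.+1 & b \in B])
      greedy_weight i (B :\ b) / #|avail (B :\ b)|%:R.
  rewrite (exchange_big_dep xpredT)//=; apply: eq_bigr => b _.
  by apply: eq_bigl => B; rewrite andbA.
(* A stuck packing passes nothing on; the weight of these packings is split off as a nonnegative sum
   and then dropped. *)
have -> : \sum_(B : {set X} | packing B && (#|B| == i)) greedy_weight i B =
    \sum_(B : {set X} | packing B && (#|B| == i))
      \sum_b (if b \in avail B then greedy_weight i B / #|avail B|%:R else 0)
  + \sum_(B : {set X} | packing B && (#|B| == i))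
      (if #|avail B| == 0%N then greedy_weight i B else 0).
  rewrite -big_split/=; apply: eq_bigr => B _.
  rewrite -big_mkcond/= sumr_const; case: eqVneq => [->|n0].
    by rewrite mulr0n add0r.
  by rewrite addr0 -[RHS]mulr_natr divfK// pnatr_eq0.
rewrite exchange_big/=; apply: ler_wpDr.
  by apply: sumr_ge0 => B _; case: ifP => // _; exact: greedy_weight_ge0.
apply: ler_sum => b _.
rewrite (reindex_onto (fun B => b |: B) (fun B => B :\ b))/=; last first.
  by move=> B /and3P[_ _ bB]; rewrite setD1K.
rewrite big_mkcond [leRHS]big_mkcond/=; apply: ler_sum => B _.
case: ifP => [/andP[/and3P[pB cB _] /eqP e]|_]; last first.
  case: ifP => // _; case: ifP => // _.
  by rewrite divr_ge0 ?greedy_weight_ge0.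
have bB : b \in b |: B by rewrite setU11.
have [] := packing_rem pB bB; rewrite e => -> ->.
suff -> : #|B| == i by [].
move: cB; rewrite cardsU1 -{1}e setD11 => /eqP; rewrite add1n => -[->].
exact: eqxx.
Qed.

Lemma sum_subsets (M : {set X}) i (F : {set X} -> R) :
  \sum_(B : {set X} | (B \subset M) && (#|B| == i.+1)) \sum_(b in B) F (B :\ b) =
  (#|M| - i)%:R * \sum_(B : {set X} | (B \subset M) && (#|B| == i)) F B.
Proof.
rewrite (exchange_big_dep xpredT)//= mulr_sumr.
transitivity (\sum_(b : X) \sum_(B : {set X} | (B \subset M) && (#|B| == i))
    (if b \in M :\: B then F B else 0)).
  apply: eq_bigr => b _.
  rewrite (reindex_onto (fun B => b |: B) (fun B => B :\ b))/=; last first.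
    by move=> B /andP[_ bB]; rewrite setD1K.
  rewrite big_mkcond [RHS]big_mkcond/=.
  apply: eq_bigr => B _.
  have [bB|bB] := boolP (b \in B).
    have ne : (b |: B) :\ b == B = false.
      by apply/eqP => e; move: bB; rewrite -e setD11.
    rewrite ne !andbF inE bB/=; by case: ifP.
  rewrite setU1K// eqxx setU11 !andbT inE bB/= subUset sub1set cardsU1 bB add1n eqSS.
  by case: (b \in M); case: (B \subset M); case: (#|B| == i).
rewrite exchange_big/=; apply: eq_bigr => B /andP[BM /eqP cB].
by rewrite -big_mkcond/= sumr_const cardsDS// cB mulr_natl.
Qed.

(* Jensen over the orders in which [M] can be built: only the average number of choices at a set of
   size [i] matters. *)
Lemma ln_greedy_weight (M : {set X}) (A : nat -> R) k :
  packing M -> #|M| = k -> (forall i, (i < k)%N -> 0 < A i) ->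
  (forall i, (i < k)%N ->
    \sum_(B : {set X} | (B \subset M) && (#|B| == i)) #|avail B|%:R
      <= 'C(k, i)%:R * A i) ->
  forall i, (i <= k)%N ->
  'C(k, i)%:R * (ln (i`!%:R) - \sum_(j < i) ln (A j)) <=
  \sum_(B : {set X} | (B \subset M) && (#|B| == i)) ln (greedy_weight i B).
Proof.
move=> pM cM A0 hA.
have pS (B : {set X}) : B \subset M -> packing B by exact: packingS.
have av0 (B : {set X}) b : B \subset M -> b \in B -> (0 < #|avail (B :\ b)|)%N.
  by move=> /pS; exact: avail_gt0.
have w0 i (B : {set X}) : B \subset M -> #|B| = i -> 0 < greedy_weight i B.
  by move=> /pS; exact: greedy_weight_gt0.
elim=> [|i IH] ik.
  rewrite big_ord0 fact0 ln1 subrr mulr0 big1// => B _; exact: ln1.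
have {}IH := IH (ltnW ik).
set S := fun j => [set B : {set X} | (B \subset M) && (#|B| == j)].
have cS j : #|S j| = 'C(k, j) by rewrite /S cards_draws cM.
(* [ln_sum_ge] over the last element chosen: the logarithm of a sum is replaced by an average of
   logarithms. *)
have step : \sum_(B : {set X} | (B \subset M) && (#|B| == i.+1))
    (ln i.+1%:R + i.+1%:R^-1 * \sum_(b in B)
      (ln (greedy_weight i (B :\ b)) - ln #|avail (B :\ b)|%:R)) <=
  \sum_(B : {set X} | (B \subset M) && (#|B| == i.+1)) ln (greedy_weight i.+1 B).
  apply: ler_sum => B /andP[BM /eqP cB] /=.
  have Bb x : x \in B -> 0 < greedy_weight i (B :\ x) / #|avail (B :\ x)|%:R.
    move=> xB; rewrite divr_gt0//; last by rewrite ltr0n; exact: av0.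
    apply: w0; first exact: subset_trans (subD1set _ _) BM.
    by move: cB; rewrite (cardsD1 x) xB add1n => -[].
  have B0 : (0 < #|B|)%N by rewrite cB.
  have := ln_sum_ge B0 Bb; rewrite cB; apply: le_trans.
  rewrite lerD2l ler_pM2l ?invr_gt0 ?ltr0n//; apply: ler_sum => b bB.
  rewrite ln_div// ?posrE ?ltr0n ?av0//.
  apply: w0; first exact: subset_trans (subD1set _ _) BM.
  by move: cB; rewrite (cardsD1 b) bB add1n => -[].
apply: le_trans step.
rewrite big_split/= sumr_const -mulr_sumr.
rewrite (@sum_subsets M i (fun B => ln (greedy_weight i B) - ln #|avail B|%:R)).
have cS' : #|[pred B : {set X} | (B \subset M) && (#|B| == i.+1)]| = 'C(k, i.+1).
  by rewrite -cS; apply: eq_card => B; rewrite !inE.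
rewrite cS' sumrB.
have hln : \sum_(B : {set X} | (B \subset M) && (#|B| == i)) ln #|avail B|%:R <=
    'C(k, i)%:R * ln (A i) :> R.
  have := @ln_avg R _ (S i) (fun B => #|avail B|%:R) (A i) (A0 _ ik).
  have eS (F : {set X} -> R) : \sum_(B in S i) F B =
      \sum_(B : {set X} | (B \subset M) && (#|B| == i)) F B.
    by apply: eq_bigl => B; rewrite inE.
  rewrite cS !eS.
  apply; last exact: hA.
  move=> B; rewrite inE => /andP[BM /eqP cB]; rewrite ltr0n.
  have /subsetPn[b bM bB] : ~~ (M \subset B).
    by apply/negP => /subset_leq_card; rewrite cM cB leqNgt ik.
  have : b |: B \subset M by rewrite subUset sub1set bM.
  by move/av0 => /(_ b (setU11 _ _)); rewrite setU1K.
have hC : 'C(k, i.+1)%:R = i.+1%:R^-1 * (k - i)%:R * 'C(k, i)%:R :> R.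
  apply: (@mulfI _ i.+1%:R); first by rewrite pnatr_eq0.
  by rewrite -mulrA mulVKf ?pnatr_eq0// -!natrM mul_bin_left.
rewrite big_ord_recr/= factS natrM lnM ?posrE ?ltr0n ?fact_gt0// cM.
rewrite -[ln _ *+ _]mulr_natl.
have c0 : 0 <= i.+1%:R^-1 * (k - i)%:R :> R by rewrite mulr_ge0 ?invr_ge0.
have := lerB IH hln => /(ler_wpM2l c0).
rewrite hC; set a := i.+1%:R^-1; set b := (k - i)%:R; set c := 'C(k, i)%:R.
set d := ln _; set e := \sum_(j < i) _; set f := ln (A i); set g := ln _.
set p := \sum_(B | _) _; set q := \sum_(B | _) _.
have -> : a * (b * (p - q)) = a * b * (p - q) by rewrite mulrA.
move: (a * b) => ab; clearbody c d e f g p q; clear; nra.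
Qed.

(** Every member of the family has weight at least k! divided by the product of the [A i], and all
    weights together are at most 1. *)
Lemma greedy_count k (Fam : {set {set X}}) (A : nat -> R) :
  (forall i, (i < k)%N -> 0 < A i) ->
  (forall M, M \in Fam -> [/\ packing M, #|M| = k &
    forall i, (i < k)%N ->
    \sum_(B : {set X} | (B \subset M) && (#|B| == i)) #|avail B|%:R
      <= 'C(k, i)%:R * A i]) ->
  (0 < #|Fam|)%N ->
  ln #|Fam|%:R + ln k`!%:R <= \sum_(i < k) ln (A i).
Proof.
move=> A0 hF F0.
have lb M : M \in Fam ->
    expR (ln k`!%:R - \sum_(i < k) ln (A i)) <= greedy_weight k M.
  move=> MF; have [pM cM hM] := hF M MF.
  have := ln_greedy_weight pM cM A0 hM (leqnn k).
  rewrite binn mul1r (big_pred1 M); last first.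
    move=> B; apply/andP/eqP => [[BM /eqP cB]|->]; last by rewrite cM.
    by apply/eqP; rewrite eqEcard BM cB cM leqnn.
  have wp := greedy_weight_gt0 pM cM.
  by move=> h; rewrite -[leRHS]lnK ?posrE// ler_expR.
have : #|Fam|%:R * expR (ln k`!%:R - \sum_(i < k) ln (A i)) <= 1 :> R.
  apply: le_trans (sum_greedy_weight k).
  rewrite mulr_natl -sumr_const big_mkcond [leRHS]big_mkcond/=.
  apply: ler_sum => M _; case: ifP => [MF|_].
    by have [-> -> _] := hF M MF; rewrite eqxx; apply: lb.
  by case: ifP => // _; exact: greedy_weight_ge0.
rewrite -ler_ln ?posrE// ?mulr_gt0 ?expR_gt0 ?ltr0n//.
by rewrite ln1 lnM ?posrE ?expR_gt0 ?ltr0n// expRK; lra.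
Qed.

(* An element outside [M] remains available only if none of its at least three conflicts in [M] has been
   chosen, whence the cubic decay. *)
Lemma sum_avail_le (M : {set X}) k i :
  packing M -> #|M| = k -> (i < k)%N ->
  (forall t, t \in TT -> t \notin M -> (2 < #|[set b in M | cf t b]|)%N) ->
  \sum_(B : {set X} | (B \subset M) && (#|B| == i)) #|avail B|%:R
    <= 'C(k, i)%:R * (((k - i)%:R / k%:R) ^+ 3 * #|TT|%:R + (k - i)%:R) :> R.
Proof.
move=> pM cM ik h3.
have MT : M \subset TT by case/andP: pM.
have k0 : 0 < k%:R :> R by rewrite ltr0n; apply: leq_ltn_trans ik.
set s : R := (k - i)%:R / k%:R.
have s0 : 0 <= s by rewrite divr_ge0.
(* The quotient is (m - i) / m, at most (k - i) / k for m <= k. Used three times it gives the factor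
   s^3 for an element with three conflicts in [M]. *)
have hb m : (0 < m)%N -> (m <= k)%N -> 'C(m.-1, i)%:R <= s * 'C(m, i)%:R :> R.
  case: m => // m _ mk /=.
  have [im|im] := leqP i m.+1; last first.
    have -> : 'C(m, i) = 0%N by apply: bin_small; exact: ltnW.
    by rewrite mulr_ge0.
  have hm := mul_bin_down m.+1 i.
  have e : m.+1%:R * 'C(m, i)%:R = (m.+1 - i)%:R * 'C(m.+1, i)%:R :> R.
    by rewrite -!natrM -hm.
  rewrite -(ler_pM2l (ltr0Sn R m)) e mulrA ler_wpM2r//.
  rewrite /s mulrA ler_pdivlMr// -!natrM ler_nat.
  by move: im mk; clear; nia.
have cnt (D : {set X}) m : D \subset M -> (m <= #|D|)%N ->
    (#|[set B : {set X} | (B \subset M :\: D) && (#|B| == i)]| <= 'C(k - m, i))%N.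
  by move=> DM mD; rewrite cards_draws cardsDS// cM; apply: leq_bin2l; exact: leq_sub2l.
have -> : \sum_(B : {set X} | (B \subset M) && (#|B| == i)) #|avail B|%:R =
    \sum_(t in TT) #|[set B : {set X} | [&& B \subset M, #|B| == i & t \in avail B]]|%:R :> R.
  under eq_bigr do rewrite -sum1_card natr_sum.
  rewrite (exchange_big_dep (mem TT))/=; last by move=> B t _; rewrite inE => /andP[].
  apply: eq_bigr => t tT; rewrite -sum1_card natr_sum; apply: eq_bigl => B.
  by rewrite inE andbA.
have bound t : t \in TT ->
    #|[set B : {set X} | [&& B \subset M, #|B| == i & t \in avail B]]|%:R <=
    (s ^+ 3 + (if t \in M then s else 0)) * 'C(k, i)%:R :> R.
  move=> tT; have [tM|tM] := boolP (t \in M).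
    apply: (@le_trans _ _ 'C(k - 1, i)%:R).
      rewrite ler_nat; apply: leq_trans (cnt [set t] 1%N _ _); rewrite ?sub1set ?cards1//.
      apply: subset_leq_card; apply/subsetP => B; rewrite !inE => /and3P[BM -> /andP[_ /andP[tB _]]].
      by rewrite subsetD1 BM tB.
    rewrite subn1; apply: le_trans (hb k _ (leqnn _)) _; first exact: leq_ltn_trans ik.
    by rewrite ler_wpM2r// lerDr exprn_ge0.
  rewrite addr0; have k3 := h3 t tT tM.
  have : (#|[set b in M | cf t b]| <= k)%N.
    by rewrite -cM; apply: subset_leq_card; apply/subsetP => b; rewrite inE => /andP[].
  move=> /(leq_trans k3) kk.
  apply: (@le_trans _ _ 'C(k - 3, i)%:R).
    rewrite ler_nat; apply: leq_trans (cnt [set b in M | cf t b] 3%N _ k3); last first.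
      by apply/subsetP => b; rewrite inE => /andP[].
    apply: subset_leq_card; apply/subsetP => B; rewrite !inE => /and3P[BM -> /andP[_ /andP[tB /forall_inP h]]].
    rewrite andbT; apply/subsetP => b bB; rewrite !inE (subsetP BM)// andbT.
    exact: h.
  have := hb k; have := hb k.-1; have := hb k.-2.
  case: k kk {k0 s0 hb cnt cM ik k3} @s => [|[|[|k]]]// _ s; rewrite subSS subSS subSS subn0 /=.
  move=> /(_ isT) h1 /(_ isT) h2 /(_ isT) h3'.
  have s0 : 0 <= s by rewrite divr_ge0.
  clearbody s; have := h1 (leq_trans (leqnSn _) (leqnSn _)); have := h2 (leqnSn _); have := h3' (leqnn _).
  move: s0; rewrite !exprS expr0 mulr1 => s0 q1 q2 q3.
  apply: le_trans q3 _; rewrite -!mulrA ler_wpM2l//.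
  by apply: le_trans q2 _; rewrite ler_wpM2l//.
apply: le_trans (ler_sum _ bound) _.
rewrite -mulr_suml mulrC ler_wpM2l// big_split/= sumr_const -[_ *+ _]mulr_natr lerD2l.
rewrite -big_mkcondr/= sumr_const.
have -> : #|[pred i | (i \in TT) && (i \in M)]| = k.
  by rewrite -cM; apply: eq_card => x; rewrite !inE andb_idl// => /(subsetP MT).
by rewrite -[s *+ _]mulr_natr /s divfK// gt_eqF.
Qed.

(** With s = (k - i) / k the logarithms of s^3 add up to 3 (ln k! - k ln k), about -3k; moving ln k!
    to the right leaves k (ln tb - ln k - 2). The summand k - i of [A i], which stands for the
    elements of [M] itself, is responsible for the square root term. *)
Lemma greedy_count_le (Fam : {set {set X}}) k (tb : R) :
  (0 < k)%N -> 0 < tb -> #|TT|%:R <= tb ->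
  (forall M, M \in Fam -> [/\ packing M, #|M| = k &
    forall t, t \in TT -> t \notin M -> (2 < #|[set b in M | cf t b]|)%N]) ->
  (0 < #|Fam|)%N ->
  ln #|Fam|%:R <= k%:R * (ln tb - ln k%:R - 2) + 2 * (ln k%:R + 1)
     + 2 * Num.sqrt (k%:R ^+ 3 / tb) * (1 + ln k%:R).
Proof.
move=> k0 tb0 TTtb hF F0.
have k0' : 0 < k%:R :> R by rewrite ltr0n.
pose s (i : nat) : R := (k - i)%:R / k%:R.
pose A (i : nat) : R := s i ^+ 3 * tb + (k - i)%:R.
have s0 i : (i < k)%N -> 0 < s i by move=> ik; rewrite divr_gt0// ltr0n subn_gt0.
have A0 i : (i < k)%N -> 0 < A i.
  by move=> ik; rewrite /A ltr_wpDr// mulr_gt0// exprn_gt0// s0.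
have hF' M : M \in Fam -> [/\ packing M, #|M| = k &
    forall i, (i < k)%N ->
    \sum_(B : {set X} | (B \subset M) && (#|B| == i)) #|avail B|%:R
      <= 'C(k, i)%:R * A i].
  move=> /hF[pM cM h3]; split => // i ik.
  apply: le_trans (sum_avail_le pM cM ik h3) _.
  by rewrite ler_wpM2l// /A lerD2r ler_wpM2l// exprn_ge0// ltW// s0.
have := greedy_count A0 hF' F0.
set q := Num.sqrt (k%:R ^+ 3 / tb).
have lnA i : (i < k)%N -> ln (A i) <= 3 * ln (s i) + ln tb + 2 * q * ((k - i)%:R)^-1.
  move=> ik; have si := s0 i ik.
  have ki : 0 < (k - i)%:R :> R by rewrite ltr0n subn_gt0.
  have -> : A i = s i ^+ 3 * tb * (1 + k%:R ^+ 3 / tb * ((k - i)%:R ^- 1) ^+ 2).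
    by rewrite /A /s; field; rewrite !gt_eqF.
  have x0 : 0 <= k%:R ^+ 3 / tb by rewrite divr_ge0 ?exprn_ge0// ltW.
  have y0 : 0 <= k%:R ^+ 3 / tb * ((k - i)%:R ^- 1) ^+ 2 by rewrite mulr_ge0 ?exprn_ge0 ?invr_ge0// ltW.
  have z0 : 0 < 1 + k%:R ^+ 3 / tb * ((k - i)%:R ^- 1) ^+ 2 by lra.
  have si3 : 0 < s i ^+ 3 by rewrite exprn_gt0.
  have si3t : 0 < s i ^+ 3 * tb by rewrite mulr_gt0.
  rewrite [ln (_ * (1 + _))]lnM ?posrE//.
  rewrite [ln (_ * tb)]lnM ?posrE//.
  rewrite (lnXn 3 si) -[ln (s i) *+ 3]mulr_natl lerD2l.
  apply: le_trans (ln1D_le_sqrt y0) _; rewrite -[2 * q * _]mulrA ler_pM2l// sqrtrM//.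
  by rewrite sqrtr_sqr ger0_norm// invr_ge0 ltW.
move=> h; have h2 : \sum_(i < k) ln (A i) <= \sum_(i < k) (3 * ln (s i) + ln tb + 2 * q * ((k - i)%:R)^-1).
  by apply: ler_sum => i _; exact: lnA.
have {h h2} := le_trans h h2.
rewrite !big_split/= -!mulr_sumr sumr_const card_ord.
have rev (F : nat -> R) : \sum_(i < k) F (k - i)%N = \sum_(i < k) F i.+1.
  rewrite (reindex_inj rev_ord_inj)/=; apply: eq_bigr => i _; congr F.
  by have := ltn_ord i; lia.
have -> : \sum_(i < k) ln (s i) = ln k`!%:R - k%:R * ln k%:R.
  under eq_bigr => i _.
    rewrite /s ln_div ?posrE ?ltr0n ?subn_gt0//.
    over.
  rewrite sumrB sumr_const card_ord -[ln _ *+ _]mulr_natl; congr (_ - _).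
  rewrite (rev (fun j => ln j%:R)).
  elim: k {k0 k0' s A s0 A0 hF hF' q lnA rev} => [|k IH]; first by rewrite big_ord0 fact0 ln1.
  by rewrite big_ord_recr/= IH factS natrM lnM ?posrE ?ltr0n ?fact_gt0// addrC.
rewrite (rev (fun j => (j%:R)^-1)).
have H := @harmonic_le R k k0; have L := @ln_fact_le R k k0.
have q0 : 0 <= q by exact: sqrtr_ge0.
have := ler_wpM2l q0 H; rewrite -[ln tb *+ k]mulr_natl.
set a := ln k`!%:R in L *; set b := ln k%:R in L H *; set c := \sum_(i < k) _ in H *.
move: L; nra.
Qed.
End Greedy.

(** * Counting the outcomes of a random greedy process *)

Section Process.
Variables (R : realType) (T : finType) (avail : {set T} -> {set T}).
Variables (inv : nat -> pred {set T}) (Phi : nat -> {set T} -> R) (B Qm : nat -> R) (k : nat).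
Let good i M := inv i M && (Phi i M <= B i).
Hypothesis inv0 : inv 0 set0.
Hypothesis inv_card : forall i M, inv i M -> #|M| = i.
Hypothesis inv_step : forall i M t, (i < k)%N -> good i M -> t \in avail M ->
  (t \notin M) && inv i.+1 (t |: M).
Hypothesis Qm_gt0 : forall i, (i < k)%N -> 0 < Qm i.
Hypothesis Qm_le : forall i M, (i < k)%N -> good i M -> Qm i <= #|avail M|%:R.
Hypothesis B_gt0 : forall i, 0 < B i.
Hypothesis Phi_ge0 : forall i M, 0 <= Phi i M.
Hypothesis drift : forall i M, (i < k)%N -> good i M ->
  \sum_(t in avail M) Phi i.+1 (t |: M) <= B i.+1 / B i * #|avail M|%:R * Phi i M.

(* The process is killed as soon as it leaves the good states. *)
Fixpoint proc_wt i M : R :=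
  if i is j.+1 then
    \sum_(t in M | good j (M :\ t) && (t \in avail (M :\ t)))
       proc_wt j (M :\ t) / #|avail (M :\ t)|%:R
  else (M == set0)%:R.

Lemma proc_wt_ge0 i M : 0 <= proc_wt i M.
Proof.
elim: i M => [|i IH] M /=; first by rewrite ler0n.
by apply: sumr_ge0 => t _; rewrite divr_ge0.
Qed.

Lemma proc_wt_supp i M : (i <= k)%N -> ~~ inv i M -> proc_wt i M = 0.
Proof.
case: i => [|i] ik; rewrite /=.
  by case: eqVneq => [->|//]; rewrite inv0.
move=> nM; rewrite big1// => t /andP[tM /andP[g ta]].
by have /andP[_] := inv_step ik g ta; rewrite setD1K// (negbTE nM).
Qed.

Lemma proc_wt_sum i (F : {set T} -> R) : (i < k)%N ->
  \sum_M proc_wt i.+1 M * F M =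
  \sum_(M | good i M) proc_wt i M / #|avail M|%:R * \sum_(t in avail M) F (t |: M).
Proof.
move=> ik; rewrite /=.
under eq_bigr do rewrite mulr_suml.
rewrite (exchange_big_dep predT)//=.
under [RHS]eq_bigr do rewrite mulr_sumr.
rewrite [RHS](exchange_big_dep predT)//=.
apply: eq_bigr => t _.
rewrite (reindex_onto (fun M => t |: M) (fun M => M :\ t))/=; last first.
  by move=> M /andP[tM _]; rewrite setD1K.
apply: eq_big => [M|M].
  rewrite setU11/=; have [tM|tM] := boolP (t \in M).
    rewrite [RHS]andbC; case: (boolP (good i M)) => [gM|]; last first.
      by rewrite andbF => _; apply/negP => /andP[_ /eqP e]; move: tM; rewrite -e setD11.
    case: (boolP (t \in avail M)) => [ta|_]; first by have /andP[] := inv_step ik gM ta; rewrite tM.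
    by apply/negP => /andP[_ /eqP e]; move: tM; rewrite -e setD11.
  by rewrite setU1K// eqxx andbT.
case/andP => /andP[_ /andP[gM ta]] /eqP e; rewrite e //.
Qed.

(** At most [j.+1] elements can have come last at step j, each with conditional probability at most
    1 / [Qm j]; the numerators multiply to the number of orders. *)
Lemma proc_wt_le i M : (i <= k)%N -> proc_wt i M <= \prod_(j < i) (j.+1%:R / Qm j).
Proof.
elim: i M => [|i IH] M ik; first by rewrite big_ord0 /=; case: (M == set0); rewrite ?ler01 ?lexx.
have p0 : 0 <= \prod_(j < i.+1) (j.+1%:R / Qm j).
  by apply: prodr_ge0 => j _; rewrite divr_ge0// ltW// Qm_gt0// (leq_trans (ltn_ord j)).
have [iM|/proc_wt_supp -> //] := boolP (inv i.+1 M).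
rewrite big_ord_recr/=.
apply: (@le_trans _ _ (\sum_(t in M) (\prod_(j < i) (j.+1%:R / Qm j)) / Qm i)).
  rewrite big_mkcondr/=; apply: ler_sum => t tM.
  have q0 := Qm_gt0 ik.
  case: ifP => [/andP[g ta]|_]; last first.
    rewrite mulr_ge0 ?invr_ge0 ?ltW//; apply: prodr_gt0 => j _.
    by rewrite divr_gt0// Qm_gt0// (ltn_trans (ltn_ord j)).
  apply: ler_pM => //; rewrite ?invr_ge0 ?proc_wt_ge0//; first exact: IH (ltnW ik).
  rewrite lef_pV2 ?posrE ?Qm_le//.
  by apply: lt_le_trans (Qm_le ik g).
rewrite sumr_const (inv_card iM) -[_ *+ _]mulr_natl [leRHS]mulrA [leLHS]mulrCA.
by rewrite -[leRHS]mulrA lexx.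
Qed.

(** By [drift], 1 - Phi / B does not decrease in expectation. Killing a state that is not good only
    helps: there Phi exceeds B, so a negative term is dropped. *)
Lemma proc_supermartingale i : (i <= k)%N ->
  1 - Phi 0 set0 / B 0 <= \sum_M proc_wt i M * (1 - Phi i M / B i).
Proof.
elim: i => [|i IH] ik.
  rewrite (bigD1 set0)//= eqxx mul1r big1 ?addr0// => M /negbTE ->.
  by rewrite mul0r.
apply: le_trans (IH (ltnW ik)) _.
rewrite (proc_wt_sum _ ik).
apply: (@le_trans _ _ (\sum_(M | good i M) proc_wt i M * (1 - Phi i M / B i))).
  rewrite [leRHS]big_mkcond; apply: ler_sum => M _; case: ifP => // gM.
  have [iM|niM] := boolP (inv i M); last by rewrite proc_wt_supp ?mul0r// ltnW.
  rewrite mulr_ge0_le0 ?proc_wt_ge0// subr_le0 ler_pdivlMr ?B_gt0// mul1r.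
  by move: gM; rewrite /good iM/=; case: leP => // /ltW.
apply: ler_sum => M gM.
have q0 : 0 < #|avail M|%:R :> R by apply: lt_le_trans (Qm_le ik gM); rewrite Qm_gt0.
rewrite -[leRHS]mulrA ler_wpM2l ?proc_wt_ge0// [leRHS]mulrC ler_pdivlMr//.
rewrite sumrB sumr_const -mulr_suml mulrBl mul1r lerB//.
have := drift ik gM; rewrite -(ler_pM2r (_ : 0 < (B i.+1)^-1)) ?invr_gt0//.
move/le_trans; apply.
have b1 := B_gt0 i; have b2 := B_gt0 i.+1.
rewrite le_eqVlt; apply/orP; left; apply/eqP; field.
by rewrite !gt_eqF.
Qed.

(** The good states at time k carry mass at least 1 - Phi / B, evaluated at the start, and
    [proc_wt_le] bounds the weight of each; dividing bounds their number from below. *)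
Lemma process_count :
  (1 - Phi 0 set0 / B 0) * \prod_(i < k) (Qm i / i.+1%:R) <= #|[set M | good k M]|%:R.
Proof.
have pp : 0 < \prod_(i < k) (i.+1%:R / Qm i).
  by apply: prodr_gt0 => i _; rewrite divr_gt0// Qm_gt0.
have -> : \prod_(i < k) (Qm i / i.+1%:R) = (\prod_(i < k) (i.+1%:R / Qm i))^-1.
  by rewrite -prodfV; apply: eq_bigr => i _; rewrite invf_div.
rewrite ler_pdivrMr//.
apply: le_trans (proc_supermartingale (leqnn k)) _.
apply: (@le_trans _ _ (\sum_(M | good k M) proc_wt k M)).
  rewrite [leRHS]big_mkcond; apply: ler_sum => M _; case: ifP => gM.
    rewrite -[leRHS]mulr1 ler_wpM2l ?proc_wt_ge0// gerBl divr_ge0//.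
    by rewrite ltW.
  have [iM|niM] := boolP (inv k M); last by rewrite proc_wt_supp ?mul0r.
  rewrite mulr_ge0_le0 ?proc_wt_ge0// subr_le0 ler_pdivlMr ?B_gt0// mul1r.
  by move: gM; rewrite /good iM/=; case: leP => // /ltW.
apply: le_trans (ler_sum _ (fun M _ => proc_wt_le M (leqnn k))) _.
rewrite sumr_const -[_ *+ _]mulr_natl ler_wpM2r//; first exact: ltW.
by rewrite ler_nat; apply: subset_leq_card; apply/subsetP => M; rewrite inE.
Qed.
End Process.

(** * Random greedy matchings in regular linear 3-graphs *)

Lemma expR_quadratic (R : realType) (y : R) : y <= 1 / 2 -> expR y <= 1 + y + y ^+ 2.
Proof.
move=> y2; have g1 z : 1 - z <= expR (- z) :> R by have := expR_ge1Dx (- z).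
have [y0|y0] := leP y 0.
  have h : expR y * (1 - y) <= 1.
    apply: (@le_trans _ _ (expR y * expR (- y))); last by rewrite expRxMexpNx_1.
    by rewrite ler_wpM2l ?expR_ge0.
  rewrite -(ler_pM2r (_ : 0 < 1 - y)); last by lra.
  apply: le_trans h _; have : 0 <= - y * y ^+ 2 by rewrite mulr_ge0 ?sqr_ge0 ?oppr_ge0.
  nra.
(* For positive y the bound exp y <= 1 / (1 - y) is too weak; applied to y / 4 and raised to the
   fourth power it suffices up to 1 / 2. *)
have h : expR y * (1 - y / 4) ^+ 4 <= 1.
  have -> : expR y = expR (y / 4) ^+ 4 by rewrite -expRM_natl; congr expR; field.
  rewrite -exprMn exprn_ile1//.
    rewrite mulr_ge0 ?expR_ge0//; lra.
  apply: (@le_trans _ _ (expR (y / 4) * expR (- (y / 4)))); last by rewrite expRxMexpNx_1.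
  by rewrite ler_wpM2l ?expR_ge0.
have p4 : 0 < (1 - y / 4) ^+ 4 by rewrite exprn_gt0//; lra.
rewrite -(ler_pM2r p4); apply: le_trans h _; rewrite -subr_ge0.
have -> : (1 + y + y ^+ 2) * (1 - y / 4) ^+ 4 - 1 = y ^+ 2 * ((6 - 11 * y) / 16 + y ^+ 2 * (81 - 15 * y + y ^+ 2) / 256) by field.
rewrite mulr_ge0 ?sqr_ge0// addr_ge0//; first lra.
rewrite divr_ge0// mulr_ge0 ?sqr_ge0//; have := sqr_ge0 y; lra.
Qed.

Section Nibble.
Variables (R : realType) (E : finType) (HH : {set {set E}}) (D : nat).
Hypothesis HH3 : forall t, t \in HH -> #|t| = 3%N.
Hypothesis HHlin : forall t t' e f, t \in HH -> t' \in HH -> e != f ->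
  e \in t -> f \in t -> e \in t' -> f \in t' -> t = t'.
Hypothesis HHreg : forall e, #|[set t in HH | e \in t]| = D.
Implicit Types (M : {set {set E}}) (t : {set E}) (e f : E).

Definition alive M := ~: cover M.
(** Only the other two points of [t] have to be alive. So the degree of [e] keeps its meaning after
    [e] is covered, and every [e] can be tracked through the whole process. *)
Definition alive_deg M e := #|[set t in HH | (e \in t) && (t :\ e \subset alive M)]|.
Definition avail_edges M := [set t in HH | t \subset alive M].
Definition hmatching i M := [&& M \subset HH, trivIset M & #|M| == i].
Definition alive_loss M e t :=
  #|[set t' in HH | [&& e \in t', t' :\ e \subset alive M & ~~ [disjoint t' :\ e & t]]]|.

Lemma cover_setU1 (t : {set E}) M : cover (t |: M) = t :|: cover M.
Proof. by rewrite /cover bigcup_setU big_set1. Qed.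

Lemma hmatching_alive i M : hmatching i M -> (#|alive M| + 3 * i = #|E|)%N.
Proof.
case/and3P => MH tM /eqP cM; rewrite /alive -(cardsC (cover M)) addnC; congr (_ + _)%N.
rewrite -(eqP tM) -cM (eq_bigr (fun _ => 3%N)) ?sum_nat_const 1?mulnC//.
by move=> t tm; rewrite HH3// (subsetP MH).
Qed.

Lemma hmatching_step i M t : hmatching i M -> t \in avail_edges M ->
  (t \notin M) && hmatching i.+1 (t |: M).
Proof.
case/and3P => MH tM /eqP cM; rewrite inE => /andP[tH ta].
have tc f : f \in t -> f \in cover M -> False.
  by move=> /(subsetP ta); rewrite inE => /negbTE ->.
have t3 := HH3 tH.
have tM' : t \notin M.
  apply/negP => tM'; have /card_gt0P[f ft] : (0 < #|t|)%N by rewrite t3.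
  by apply: (tc f ft); apply/bigcupP; exists t.
rewrite tM'/= /hmatching cardsU1 tM' cM add1n eqxx andbT subUset sub1set tH MH/=.
apply/trivIsetP => A B; rewrite !inE => /orP[/eqP ->|AM] /orP[/eqP ->|BM] AB.
- by rewrite eqxx in AB.
- rewrite disjoint_subset; apply/subsetP => f ft; rewrite !inE; apply/negP => fB.
  by apply: (tc f ft); apply/bigcupP; exists B.
- rewrite disjoint_sym disjoint_subset; apply/subsetP => f ft; rewrite !inE; apply/negP => fB.
  by apply: (tc f ft); apply/bigcupP; exists A.
- by move/trivIsetP: tM => /(_ A B AM BM AB).
Qed.

Lemma alive_setU1 t M : alive (t |: M) = alive M :\: t.
Proof. by rewrite /alive cover_setU1 setCU setDE setIC. Qed.

Lemma alive_deg_step M t e : (alive_deg (t |: M) e + alive_loss M e t = alive_deg M e)%N.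
Proof.
rewrite /alive_deg -(cardsID [set t' | [disjoint t' :\ e & t]] [set t0 in HH | _ && (t0 :\ e \subset alive M)]).
congr (_ + _)%N; apply: eq_card => t'; rewrite !inE.
  by rewrite alive_setU1 subsetD !andbA.
by rewrite [RHS]andbC -!andbA.
Qed.

(** By linearity each of the three points of [t] lies together with [e] in at most one edge. *)
Lemma alive_loss_le3 M e t : #|t| = 3%N -> (alive_loss M e t <= 3)%N.
Proof.
move=> t3; rewrite -t3 /alive_loss -sum1_card.
apply: (@leq_trans (\sum_(t' in [set t' in HH | e \in t']) \sum_(f in t | f \in t' :\ e) 1)%N).
  rewrite [leqLHS]big_mkcond [leqRHS]big_mkcond/=; apply: leq_sum => t' _.
  rewrite !inE; case: (t' \in HH) => //=; case: (e \in t') => //=.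
  case: (_ \subset _) => //=; case: ifP => // /pred0Pn[f /andP[/= f1 f2]].
  by rewrite (bigD1 f) ?f2.
rewrite (exchange_big_dep (mem t))/=; last by move=> t' f _ /andP[].
rewrite -[leqRHS]sum1_card; apply: leq_sum => f ft.
rewrite sum1dep_card; apply/card_le1_eqP => t1 t2.
rewrite !inE => /and3P[/andP[h1 e1] _ /andP[fe f1]] /and3P[/andP[h2 e2] _ /andP[_ f2]].
exact: (HHlin h2 h1 fe).
Qed.

Lemma alive_degE M e : e \in alive M -> alive_deg M e = #|[set t in avail_edges M | e \in t]|.
Proof.
move=> eA; apply: eq_card => t; rewrite !inE -andbA; congr (_ && _).
rewrite andbC; case et : (e \in t); rewrite ?andbF ?andbT//.
by rewrite -{2}(setD1K et) subUset sub1set eA.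
Qed.

Lemma card_avail M : (3 * #|avail_edges M| = \sum_(e in alive M) alive_deg M e)%N.
Proof.
rewrite -sum1_card big_distrr/= [RHS](eq_bigr (fun e => \sum_(t in avail_edges M | e \in t) 1)%N); last first.
  by move=> e eA; rewrite alive_degE// -sum1_card; apply: eq_bigl => t; rewrite inE.
rewrite (exchange_big_dep (mem (avail_edges M)))/=; last by move=> e t _ /andP[].
apply: eq_bigr => t; rewrite inE => /andP[tH ta]; rewrite muln1 -(HH3 tH) sum1dep_card.
apply: eq_card => e; rewrite !inE; apply/idP/idP => [et|/and3P[]//].
by rewrite et; move: (subsetP ta e et); rewrite inE => ->; rewrite tH ta.
Qed.

Lemma alive_loss_sum M e : (\sum_(t in avail_edges M) alive_loss M e t =
  \sum_(t' in HH | (e \in t') && (t' :\ e \subset alive M))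
    #|[set t in avail_edges M | ~~ [disjoint t' :\ e & t]]|)%N.
Proof.
under eq_bigr do rewrite /alive_loss -sum1_card.
rewrite (exchange_big_dep (fun t' => [&& t' \in HH, e \in t' & t' :\ e \subset alive M]))/=; last first.
  by move=> t t' _; rewrite !inE => /and4P[-> -> ->].
apply: eq_bigr => t' /and3P[h1 h2 h3]; rewrite -sum1_card; apply: eq_bigl => t.
by rewrite !inE h1 h2 h3.
Qed.

(** The edge [t'] at [e] is destroyed through one of its two other points. Adding the degrees of
    these points overcounts by at most 1, as at most one edge contains both. *)
Lemma alive_loss_term M e t' (lo hi : R) :
  (forall f, lo <= (alive_deg M f)%:R <= hi) ->
  t' \in HH -> e \in t' -> t' :\ e \subset alive M ->
  2 * lo - 1 <= #|[set t in avail_edges M | ~~ [disjoint t' :\ e & t]]|%:R <= 2 * hi.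
Proof.
move=> hX tH et ts.
have /eqP/cards2P[f [f' [ff' def]]] : #|t' :\ e| = 2%N by have := cardsD1 e t'; rewrite et HH3//= add1n => -[<-].
have [fA f'A] : f \in alive M /\ f' \in alive M.
  by split; apply: (subsetP ts); rewrite def !inE eqxx ?orbT.
have -> : [set t in avail_edges M | ~~ [disjoint t' :\ e & t]] =
    [set t in avail_edges M | f \in t] :|: [set t in avail_edges M | f' \in t].
  apply/setP => t; rewrite !inE -andb_orr; congr (_ && _); rewrite def.
  apply/pred0Pn/orP => [[h]|]; first by rewrite !inE => /andP[/orP[]/eqP -> ->]; [left|right].
  by case=> h; [exists f|exists f']; rewrite !inE eqxx ?orbT.
have := cardsUI [set t in avail_edges M | f \in t] [set t in avail_edges M | f' \in t].
rewrite -!alive_degE//.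
have : (#|[set t in avail_edges M | f \in t] :&: [set t in avail_edges M | f' \in t]| <= 1)%N.
  apply/card_le1_eqP => t1 t2; rewrite !inE => /andP[/andP[/andP[h1 _] f1] /andP[_ g1]] /andP[/andP[/andP[h2 _] f2] /andP[_ g2]].
  exact: (HHlin h2 h1 ff').
set u := #|_ :|: _|; set w := #|_ :&: _| => w1 /(congr1 (fun n : nat => n%:R : R)).
rewrite !natrD; have /andP[] := hX f; have /andP[] := hX f'.
have : (w%:R : R) <= 1 by rewrite (_ : 1 = 1%:R)// ler_nat.
have : (0 : R) <= w%:R by [].
by move=> *; apply/andP; split; lra.
Qed.

Lemma alive_loss_sum_bounds M e (lo hi : R) :
  (forall f, lo <= (alive_deg M f)%:R <= hi) ->
  (alive_deg M e)%:R * (2 * lo - 1) <= (\sum_(t in avail_edges M) alive_loss M e t)%:R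
    <= (alive_deg M e)%:R * (2 * hi).
Proof.
move=> hX; rewrite alive_loss_sum natr_sum.
have e1 (c : R) : (alive_deg M e)%:R * c = \sum_(t in HH | (e \in t) && (t :\ e \subset alive M)) c.
  by rewrite mulr_natl -sumr_const; apply: eq_bigl => t; rewrite inE.
rewrite !e1.
apply/andP; split; apply: ler_sum => t /and3P[h1 h2 h3].
  by have /andP[] := alive_loss_term hX h1 h2 h3.
by have /andP[] := alive_loss_term hX h1 h2 h3.
Qed.

Section Drift.
Variables (s x m p : R) (M : {set {set E}}) (gam : R).
Let N : R := #|E|%:R.
Hypothesis hX : forall f, x - m <= (alive_deg M f)%:R <= x + m.
Hypothesis hA : #|alive M|%:R = N * p.
Hypothesis p0 : 0 < p.
Hypothesis p1 : p <= 1.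
Hypothesis N0 : 0 < N.
Hypothesis xE : x = D%:R * p ^+ 2.
Hypothesis D1 : (0 < D)%N.
Hypothesis DN : 6 * D%:R <= N.
Hypothesis gamE : gam = D%:R * (p ^+ 2 - (p - 3 / N) ^+ 2).
Hypothesis p3 : 3 / N <= p.
Hypothesis m0 : 0 <= m.
Hypothesis mx : m <= x / 4.
Hypothesis s0 : 0 < s.
Hypothesis s3 : s <= 1 / 6.
Hypothesis sD : s ^+ 2 * D%:R <= 1.
Let Q : R := #|avail_edges M|%:R.

Lemma drift_Q : N * p * (x - m) / 3 <= Q <= N * p * (x + m) / 3.
Proof.
have : 3 * Q = \sum_(e in alive M) (alive_deg M e)%:R by rewrite /Q -natr_sum -card_avail natrM.
have e1 : \sum_(e in alive M) (x - m) = N * p * (x - m) by rewrite sumr_const -hA mulr_natl.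
have e2 : \sum_(e in alive M) (x + m) = N * p * (x + m) by rewrite sumr_const -hA mulr_natl.
have h1 : \sum_(e in alive M) (x - m) <= \sum_(e in alive M) (alive_deg M e)%:R.
  by apply: ler_sum => e _; have /andP[] := hX e.
have h2 : \sum_(e in alive M) (alive_deg M e)%:R <= \sum_(e in alive M) (x + m).
  by apply: ler_sum => e _; have /andP[] := hX e.
by rewrite e1 in h1; rewrite e2 in h2 => h3; apply/andP; split; lra.
Qed.

Let S1 e : R := (\sum_(t in avail_edges M) alive_loss M e t)%:R.

Lemma x_gt0 : 0 < x.
Proof. by rewrite xE mulr_gt0// ?ltr0n// exprn_gt0. Qed.

Lemma drift_gam : [/\ 0 <= gam, gam <= 6 * D%:R * p / N, gam <= 1 & 6 * D%:R * p / N - 9 * D%:R / N ^+ 2 <= gam].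
Proof.
have d0 : 0 < D%:R :> R by rewrite ltr0n.
have e : gam = 6 * D%:R * p / N - 9 * D%:R / N ^+ 2 by rewrite gamE; field; rewrite gt_eqF.
have h1 : gam <= 6 * D%:R * p / N by rewrite e gerBl !divr_ge0 ?mulr_ge0// ?exprn_ge0 ltW.
split => //; last by rewrite e.
  rewrite gamE mulr_ge0// subr_ge0 lerXn2r ?nnegrE//; first by rewrite subr_ge0.
    exact: ltW.
  by rewrite gerBl divr_ge0// ltW.
apply: le_trans h1 _; rewrite ler_pdivrMr// mul1r; apply: le_trans DN.
by rewrite ler_piMr// mulr_ge0// ltW.
Qed.

(** Both quantities are near 2 x^2: [Q] is about N p x / 3 and [gam] about 6 D p / N, while each of
    about x edges at [e] is hit by about 2 x available ones. So the first order term of the drift is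
    proportional to the deviation [m], up to a lower order term. *)
Lemma drift_first e : `|Q * gam - S1 e| <= 8 * x * m + 2 * x.
Proof.
have mx' := mx; have m0' := m0; have p0' := p0; have p1' := p1; have DN' := DN; have N0' := N0; have s0' := s0; have s3' := s3.
have d0 : 0 < D%:R :> R by rewrite ltr0n.
have x0 := x_gt0; have [g0 g1 _ g2] := drift_gam; have /andP[Q1 Q2] := drift_Q.
have /andP[X1 X2] := hX e.
have /andP[] := alive_loss_sum_bounds e hX; rewrite -/(S1 e).
set X : R := (alive_deg M e)%:R in X1 X2 *; set S := S1 e => S_1 S_2.
have hxm : 0 <= x - m by lra.
have Qg1 : Q * gam <= 2 * x * (x + m).
  apply: (@le_trans _ _ (N * p * (x + m) / 3 * (6 * D%:R * p / N))).
    by apply: ler_pM => //; rewrite ler0n.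
  by rewrite le_eqVlt xE; apply/orP; left; apply/eqP; field; rewrite gt_eqF.
have Qg2 : 2 * x * (x - m) - x * (3 * D%:R * p / N) <= Q * gam.
  apply: (@le_trans _ _ (N * p * (x - m) / 3 * (6 * D%:R * p / N - 9 * D%:R / N ^+ 2))); last first.
    apply: le_trans (_ : _ <= N * p * (x - m) / 3 * gam) _.
      by rewrite ler_wpM2l// !mulr_ge0// ?invr_ge0 ltW.
    by rewrite ler_wpM2r.
  rewrite -subr_ge0.
  have -> : N * p * (x - m) / 3 * (6 * D%:R * p / N - 9 * D%:R / N ^+ 2) - (2 * x * (x - m) - x * (3 * D%:R * p / N))
    = m * (3 * D%:R * p / N) by rewrite xE; field; rewrite gt_eqF.
  by rewrite mulr_ge0// !mulr_ge0// ?invr_ge0 ltW.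
have dn : 3 * D%:R * p / N <= 1.
  rewrite ler_pdivrMr// mul1r; apply: (@le_trans _ _ (3 * D%:R)); last by lra.
  by rewrite ler_piMr// mulr_ge0// ltW.
have xdn : x * (3 * D%:R * p / N) <= x by rewrite ler_piMr// ltW.
have mm : m * m <= x / 4 * m by rewrite ler_wpM2r.
have S2' : S <= 2 * (x + m) * (x + m).
  apply: le_trans S_2 _; rewrite mulrC ler_wpM2l//; lra.
have S1' : (x - m) * (2 * (x - m) - 1) <= S.
  have [h|h] := leP 0 (2 * (x - m) - 1).
    by apply: le_trans S_1; rewrite ler_wpM2r.
  apply: (@le_trans _ _ 0); last by rewrite /S /S1 ler0n.
  by rewrite mulr_ge0_le0// ltW.
rewrite ler_norml; apply/andP; split; nra.
Qed.

Lemma drift_Q' : N * p * x / 4 <= Q.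
Proof.
have mx' := mx; have m0' := m0; have p0' := p0; have p1' := p1; have DN' := DN; have N0' := N0; have s0' := s0; have s3' := s3.
have /andP[Q1 _] := drift_Q; apply: le_trans Q1.
have np : 0 < N * p by rewrite mulr_gt0.
have -> : N * p * x / 4 = N * p * (x / 4) by ring.
have -> : N * p * (x - m) / 3 = N * p * ((x - m) / 3) by ring.
by rewrite ler_pM2l//; lra.
Qed.

(** The second order term. A loss is at most 3, so its square is at most three times the loss, whose
    sum is already known. As s^2 D <= 1, the result costs only a constant over N p. *)
Lemma drift_second e : Q * gam ^+ 2 + 3 * S1 e <= Q * (45 * D%:R / (N * p)).
Proof.
have mx' := mx; have m0' := m0; have p0' := p0; have p1' := p1; have DN' := DN; have N0' := N0; have s0' := s0; have s3' := s3.
have d0 : 0 < D%:R :> R by rewrite ltr0n.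
have x0 := x_gt0; have [g0 g1 g2 _] := drift_gam.
have q0 : 0 <= Q by [].
have np : 0 < N * p by rewrite mulr_gt0.
have /andP[X1 X2] := hX e.
have /andP[_] := alive_loss_sum_bounds e hX; rewrite -/(S1 e).
set X : R := (alive_deg M e)%:R in X1 X2 *; set S := S1 e => S_2.
have S2' : S <= 25 / 8 * x ^+ 2.
  apply: le_trans S_2 _; rewrite expr2.
  have : X * (2 * (x + m)) <= 5 / 4 * x * (5 / 2 * x) by apply: ler_pM; rewrite ?ler0n//; lra.
  lra.
have h1 : Q * gam ^+ 2 <= Q * (6 * D%:R / (N * p)).
  rewrite ler_wpM2l// expr2; apply: (@le_trans _ _ gam); first by rewrite ler_piMr.
  apply: le_trans g1 _; rewrite ler_pdivlMr// [_ / N * _]mulrAC ler_pdivrMr//.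
  have -> : 6 * D%:R * p * (N * p) = 6 * D%:R * N * (p * p) by ring.
  rewrite -[leRHS]mulr1 ler_wpM2l//; first by rewrite !mulr_ge0// ltW.
  by rewrite mulr_ile1// ltW.
have h2 : 25 / 2 * (D%:R * p ^+ 2) * x <= Q * (50 * D%:R * p / N).
  apply: (@le_trans _ _ (N * p * x / 4 * (50 * D%:R * p / N))).
    by rewrite le_eqVlt; apply/orP; left; apply/eqP; field; rewrite gt_eqF.
  by rewrite ler_wpM2r ?drift_Q'// !mulr_ge0// ?invr_ge0 ltW.
have h3 : Q * (50 * D%:R * p / N) <= Q * (50 * D%:R / (N * p)).
  rewrite ler_wpM2l// ler_pdivlMr// [_ / N * _]mulrAC ler_pdivrMr//.
  have -> : 50 * D%:R * p * (N * p) = 50 * D%:R * N * (p * p) by ring.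
  rewrite -[leRHS]mulr1 ler_wpM2l//; first by rewrite !mulr_ge0// ltW.
  by rewrite mulr_ile1// ltW.
have e1 : Q * (50 * D%:R / (N * p)) = 50 * (Q * (D%:R / (N * p))) by ring.
have e2 : Q * (6 * D%:R / (N * p)) = 6 * (Q * (D%:R / (N * p))) by ring.
have -> : Q * (45 * D%:R / (N * p)) = 45 * (Q * (D%:R / (N * p))) by ring.
rewrite -xE in h2.
rewrite e1 in h3; rewrite e2 in h1; rewrite expr2 in S2'.
have w0 : 0 <= Q * (D%:R / (N * p)) by rewrite mulr_ge0// divr_ge0// ltW.
lra.
Qed.

(** The sign [sg] treats upward and downward deviations at once. *)
Lemma drift_one e (sg : R) : `|sg| = 1 ->
  \sum_(t in avail_edges M) expR (sg * s * ((alive_deg (t |: M) e)%:R - (x - gam)))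
  <= (1 + (s * (32 * m + 8) + 45) / (N * p)) * Q * expR (sg * s * ((alive_deg M e)%:R - x)).
Proof.
have mx' := mx; have m0' := m0; have p0' := p0; have p1' := p1; have DN' := DN; have N0' := N0; have s0' := s0; have s3' := s3.
move=> sg1; set X : R := (alive_deg M e)%:R.
have d0 : 0 < D%:R :> R by rewrite ltr0n.
have x0 := x_gt0; have [g0 g1 g2 _] := drift_gam.
have q0 : 0 <= Q by [].
have np : 0 < N * p by rewrite mulr_gt0.
have e1 t : t \in avail_edges M -> (alive_deg (t |: M) e)%:R - (x - gam) = (X - x) + (gam - (alive_loss M e t)%:R).
  by move=> _; rewrite /X -(alive_deg_step M t e) natrD; ring.
have sg2 : sg ^+ 2 = 1 by rewrite -(real_normK (num_real sg)) sg1 expr1n.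
have step t : t \in avail_edges M ->
   expR (sg * s * ((alive_deg (t |: M) e)%:R - (x - gam))) <=
   expR (sg * s * (X - x)) * (1 + sg * s * (gam - (alive_loss M e t)%:R) + s ^+ 2 * (gam ^+ 2 + 3 * (alive_loss M e t)%:R)).
  move=> ta; rewrite e1// mulrDr expRD ler_wpM2l ?expR_ge0//.
  have l3 : (alive_loss M e t)%:R <= 3 :> R.
    by rewrite ler_nat alive_loss_le3// HH3//; move: ta; rewrite inE => /andP[].
  have l0 : 0 <= (alive_loss M e t)%:R :> R by [].
  set l : R := (alive_loss M e t)%:R in l3 l0 *.
  (* The change [gam - l] is at most 3 in absolute value, so s <= 1 / 6 keeps the exponent below 1 /
     2. *)
  apply: le_trans (expR_quadratic _) _.
    apply: le_trans (ler_norm _) _; rewrite !normrM sg1 mul1r gtr0_norm//.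
    have : `|gam - l| <= 3 by rewrite ler_norml; apply/andP; split; lra.
    move=> h; have : s * `|gam - l| <= 1 / 6 * 3 by apply: ler_pM => //; exact: ltW.
    lra.
  rewrite lerD2l !exprMn sg2 mul1r ler_wpM2l ?exprn_ge0//; first exact: ltW.
  have : 0 <= gam * l by rewrite mulr_ge0.
  have : l * l <= 3 * l by rewrite ler_wpM2r.
  by rewrite !expr2; nra.
apply: le_trans (ler_sum _ step) _.
rewrite -mulr_sumr mulrC ler_wpM2r ?expR_ge0//.
have -> : \sum_(t in avail_edges M) (1 + sg * s * (gam - (alive_loss M e t)%:R) + s ^+ 2 * (gam ^+ 2 + 3 * (alive_loss M e t)%:R))
  = Q + sg * s * (Q * gam - S1 e) + s ^+ 2 * (Q * gam ^+ 2 + 3 * S1 e).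
  rewrite !big_split/= -!mulr_sumr !big_split/= -!mulr_sumr sumrN !sumr_const /S1 natr_sum /Q.
  by rewrite -[gam *+ _]mulr_natl; ring.
have hf := drift_first e; have hs := drift_second e; have hq := drift_Q'.
have f1 : sg * s * (Q * gam - S1 e) <= s * (8 * x * m + 2 * x).
  apply: le_trans (ler_norm _) _; rewrite !normrM sg1 mul1r gtr0_norm//.
  by rewrite ler_pM2l.
have f2 : s * (8 * x * m + 2 * x) <= Q * (s * (32 * m + 8) / (N * p)).
  apply: (@le_trans _ _ (N * p * x / 4 * (s * (32 * m + 8) / (N * p)))).
    by rewrite le_eqVlt; apply/orP; left; apply/eqP; field; rewrite !gt_eqF.
  rewrite ler_wpM2r// divr_ge0 ?(ltW np)// mulr_ge0 ?(ltW s0)//; lra.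
have f3 : s ^+ 2 * (Q * gam ^+ 2 + 3 * S1 e) <= Q * (45 / (N * p)).
  apply: (@le_trans _ _ (s ^+ 2 * (Q * (45 * D%:R / (N * p))))).
    by rewrite ler_wpM2l// exprn_ge0// ltW.
  have -> : s ^+ 2 * (Q * (45 * D%:R / (N * p))) = Q * (45 / (N * p)) * (s ^+ 2 * D%:R).
    by field; rewrite !gt_eqF.
  by rewrite ler_piMr// mulr_ge0// divr_ge0// ltW.
have -> : (1 + (s * (32 * m + 8) + 45) / (N * p)) * Q = Q + Q * (s * (32 * m + 8) / (N * p)) + Q * (45 / (N * p)) by ring.
lra.
Qed.
End Drift.

Section NibbleCount.
Variables (k : nat) (beta theta : R).
Let N : R := #|E|%:R.
Let p (i : nat) : R := 1 - 3 * i%:R / N.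
Let s : R := (Num.sqrt D%:R)^-1.
(** The drift dictates the exponent 11. The logarithm of the potential may grow per step by (32 b +
    8 s + 45) / (N p), which is at most 33 b / (N p) because b >= 53 and s <= 1 / 6. As p loses 3 /
    N per step, p^-11 grows by a relative amount of at least 33 / (N p). *)
Let b i : R := beta / p i ^+ 11.
Let x i : R := D%:R * p i ^+ 2.
(** Summing both exponentials over all [e] builds the union bound into the potential: Phi <= exp b
    bounds every deviation by b / s. *)
Let Phi i M : R := \sum_e (expR (1 * s * ((alive_deg M e)%:R - x i)) + expR (-1 * s * ((alive_deg M e)%:R - x i))).
Hypothesis D_gt0 : (0 < D)%N.
Hypothesis DN : 6 * D%:R <= N.
Hypothesis beta53 : 53 <= beta.
Hypothesis betaN : 4 * N <= expR beta.
Hypothesis theta0 : 0 <= theta.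
Hypothesis theta4 : theta <= 1 / 4.
Hypothesis pk_gt0 : 0 < p k.
Hypothesis beta_le : beta <= theta * Num.sqrt D%:R * p k ^+ 13.

Let d0 : 0 < D%:R :> R. Proof. by rewrite ltr0n. Qed.
Let N_gt0 : 0 < N.
Proof. by apply: lt_le_trans DN; rewrite mulr_gt0. Qed.

Let p_le1 i : p i <= 1.
Proof. by rewrite /p gerBl divr_ge0// ?mulr_ge0// ltW. Qed.

Let p_anti i j : (i <= j)%N -> p j <= p i.
Proof.
move=> ij; rewrite /p lerD2l lerN2 ler_pM2r ?invr_gt0// ler_pM2l//.
by rewrite ler_nat.
Qed.

Let p_gt0 i : (i <= k)%N -> 0 < p i.
Proof. by move=> ik; apply: lt_le_trans pk_gt0 (p_anti ik). Qed.

Let p_step i : p i.+1 = p i - 3 / N.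
Proof. by rewrite /p -[i.+1]addn1 natrD; field; rewrite gt_eqF. Qed.

Let s_gt0 : 0 < s. Proof. by rewrite invr_gt0 sqrtr_gt0. Qed.

Let sD : s ^+ 2 * D%:R = 1.
Proof. by rewrite /s exprVn sqr_sqrtr ?mulVf ?gt_eqF// ltW. Qed.

(** The exponent 13 in [beta_le] is 11 from [b] plus 2 from [x]. *)
Let m_le i : (i <= k)%N -> b i / s <= theta * x i.
Proof.
move=> ik; have pi0 := p_gt0 ik.
rewrite /b /s invrK /x mulrAC ler_pdivrMr ?exprn_gt0//.
have sq : Num.sqrt D%:R * Num.sqrt D%:R = D%:R :> R by rewrite -expr2 sqr_sqrtr// ltW.
have -> : theta * (D%:R * p i ^+ 2) * p i ^+ 11 = theta * Num.sqrt D%:R * p i ^+ 13 * Num.sqrt D%:R.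
  by rewrite -[in LHS]sq; ring.
rewrite ler_wpM2r ?sqrtr_ge0//; apply: le_trans beta_le _.
rewrite ler_wpM2l ?mulr_ge0 ?sqrtr_ge0// lerXn2r ?nnegrE ?(ltW pk_gt0) ?(ltW pi0)//.
exact: p_anti.
Qed.

Let s_le : s <= 1 / 6.
Proof.
have h1 := beta53; have h2 := theta4; have h3 := theta0; have h4 := beta_le.
have p13 : p k ^+ 13 <= 1 by rewrite exprn_ile1 ?(ltW pk_gt0).
have p13' : 0 <= p k ^+ 13 by rewrite exprn_ge0 ?(ltW pk_gt0).
have sq0 : 0 < Num.sqrt D%:R :> R by rewrite sqrtr_gt0.
have h5 : theta * Num.sqrt D%:R * p k ^+ 13 <= theta * Num.sqrt D%:R.
  by rewrite ler_piMr// mulr_ge0// ltW.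
have h6 : theta * Num.sqrt D%:R <= 1 / 4 * Num.sqrt D%:R by rewrite ler_pM2r.
rewrite /s -[1 / 6]invf_div divr1 lef_pV2 ?posrE//; lra.
Qed.

Let good_dev i M e : (i <= k)%N -> Phi i M <= expR (b i) ->
  x i - b i / s <= (alive_deg M e)%:R <= x i + b i / s.
Proof.
move=> ik h.
have hF f : 0 <= expR (1 * s * ((alive_deg M f)%:R - x i)) + expR (-1 * s * ((alive_deg M f)%:R - x i)).
  by rewrite addr_ge0 ?expR_ge0.
have : expR (1 * s * ((alive_deg M e)%:R - x i)) + expR (-1 * s * ((alive_deg M e)%:R - x i)) <= expR (b i).
  by apply: le_trans h; rewrite /Phi (bigD1 e)//= lerDl sumr_ge0.
set X : R := (alive_deg M e)%:R => h'.
have h1 : 1 * s * (X - x i) <= b i.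
  by rewrite -ler_expR; apply: le_trans h'; rewrite lerDl expR_ge0.
have h2 : -1 * s * (X - x i) <= b i.
  by rewrite -ler_expR; apply: le_trans h'; rewrite lerDr expR_ge0.
have h1' : X - x i <= b i / s by rewrite ler_pdivlMr// mulrC; lra.
have h2' : x i - X <= b i / s by rewrite ler_pdivlMr// mulrC; lra.
by apply/andP; split; lra.
Qed.

Let b_step i : (i < k)%N -> b i + 33 * b i / (N * p i) <= b i.+1.
Proof.
move=> ik; have pi0 := p_gt0 (ltnW ik); have pi1 := p_gt0 ik.
have pe := p_step i.
set u := 3 / (N * p i).
have u0 : 0 <= u by rewrite divr_ge0// mulr_ge0// ltW.
have be0 : 0 <= beta by have := beta53; lra.
have h1 : 1 + u <= p i / p i.+1.
  rewrite ler_pdivlMr// pe.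
  have -> : (1 + u) * (p i - 3 / N) = p i - u * (3 / N).
    by rewrite /u; field; rewrite !gt_eqF.
  by rewrite gerBl mulr_ge0// divr_ge0// ltW.
have h2 : 1 + 11 * u <= (p i / p i.+1) ^+ 11.
  have hn n : 1 + n%:R * u <= (1 + u) ^+ n.
    elim: n => [|n IH]; first by rewrite mul0r addr0 expr0.
    rewrite exprS -[n.+1]addn1 natrD.
    have : (1 + u) * (1 + n%:R * u) <= (1 + u) * (1 + u) ^+ n by rewrite ler_wpM2l// addr_ge0.
    have : 0 <= n%:R * (u * u) by rewrite mulr_ge0// mulr_ge0.
    lra.
  apply: le_trans (hn 11%N) _; rewrite lerXn2r ?nnegrE ?addr_ge0//.
  by rewrite divr_ge0// ltW.
rewrite /b; have -> : beta / p i.+1 ^+ 11 = beta / p i ^+ 11 * (p i / p i.+1) ^+ 11.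
  by rewrite expr_div_n; field; rewrite !gt_eqF.
have -> : beta / p i ^+ 11 + 33 * (beta / p i ^+ 11) / (N * p i) = beta / p i ^+ 11 * (1 + 11 * u).
  by rewrite /u; field; rewrite !gt_eqF.
by rewrite ler_wpM2l// divr_ge0// exprn_ge0// ltW.
Qed.

Let card_alive i M : hmatching i M -> #|alive M|%:R = N * p i.
Proof.
move/hmatching_alive/(congr1 (fun n : nat => n%:R : R)); rewrite natrD natrM -/N => h.
by rewrite /p mulrBr mulr1 mulrCA divff ?gt_eqF// mulr1 -h addrK.
Qed.

(** The factor 1 / 2 is the surviving mass: the potential starts at 2 N, at most half of exp
    beta. *)
Lemma nibble_count :
  1 / 2 * \prod_(i < k) (N * D%:R * p i ^+ 3 * (1 - theta) / 3 / i.+1%:R) <=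
  #|[set M | hmatching k M &&
      [forall e, `|(alive_deg M e)%:R - x k| <= theta * x k]]|%:R.
Proof.
have be53 := beta53; have th4 := theta4; have th0 := theta0.
have bge i : (i <= k)%N -> beta <= b i.
  move=> ik; rewrite /b ler_pdivlMr ?exprn_gt0 ?p_gt0//.
  by rewrite ler_piMr// ?exprn_ile1 ?(ltW (p_gt0 ik))//; lra.
have hm i : (i <= k)%N -> 0 <= b i / s /\ b i / s <= x i / 4.
  move=> ik; split; first by rewrite divr_ge0 ?(ltW s_gt0)//; have := bge i ik; lra.
  apply: le_trans (m_le ik) _; rewrite [leRHS]mulrC ler_wpM2r; [by []| |lra].
  by rewrite mulr_ge0 ?exprn_ge0 ?(ltW (p_gt0 ik)) ?ler0n.
have key := @process_count R _ avail_edges hmatching Phi (fun i => expR (b i))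
  (fun i => N * D%:R * p i ^+ 3 * (1 - theta) / 3) k.
apply: le_trans (_ : (1 - Phi 0 set0 / expR (b 0)) * \prod_(i < k) (N * D%:R * p i ^+ 3 * (1 - theta) / 3 / i.+1%:R) <= _).
  apply: ler_wpM2r.
    apply: prodr_ge0 => i _; have pi0 := p_gt0 (ltnW (ltn_ord i)); have t1 : 0 <= 1 - theta by lra.
    by rewrite divr_ge0// divr_ge0// mulr_ge0// mulr_ge0 ?exprn_ge0 ?(ltW pi0)// mulr_ge0// ltW.
  have p0e : p 0 = 1 by rewrite /p mulr0 mul0r subr0.
  have -> : b 0 = beta by rewrite /b p0e expr1n divr1.
  have a0 e : alive_deg set0 e = D.
    rewrite -(HHreg e); apply: eq_card => t; rewrite !inE /alive /cover big_set0 setC0 subsetT.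
    by rewrite andbT.
  have -> : Phi 0 set0 = 2 * N.
    rewrite /Phi (eq_bigr (fun _ => 2)).
      by rewrite sumr_const -[_ *+ _]mulr_natl mulrC.
    move=> e _; rewrite a0 /x p0e expr1n mulr1 subrr !mulr0 expR0; ring.
  have : 2 * N / expR beta <= 1 / 2.
    by rewrite ler_pdivrMr ?expR_gt0//; move: betaN; lra.
  lra.
apply: le_trans (key _ _ _ _ _ _ _ _) _.
- by rewrite /hmatching sub0set cards0 eqxx andbT; apply/trivIsetP => A B; rewrite inE.
- by move=> i M /and3P[_ _ /eqP].
- by move=> i M t ik /andP[hM _] ta; exact: hmatching_step.
- move=> i ik; have pi0 := p_gt0 (ltnW ik).
  by rewrite divr_gt0// mulr_gt0 ?mulr_gt0 ?exprn_gt0//; lra.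
- move=> i M ik /andP[hM gM].
  have /andP[q1 _] := @drift_Q (x i) (b i / s) (p i) M (fun f => good_dev f (ltnW ik) gM) (card_alive hM).
  apply: le_trans q1; have pi0 := p_gt0 (ltnW ik).
  rewrite -/N ler_pM2r ?invr_gt0//.
  have -> : N * D%:R * p i ^+ 3 * (1 - theta) = N * p i * (x i - theta * x i) by rewrite /x; ring.
  rewrite ler_pM2l ?mulr_gt0// lerD2l lerN2; exact: m_le (ltnW ik).
- by move=> i; exact: expR_gt0.
- by move=> i M; apply: sumr_ge0 => e _; rewrite addr_ge0 ?expR_ge0.
- move=> i M ik /andP[hM gM]; have pi0 := p_gt0 (ltnW ik); have [m0 mx] := hm i (ltnW ik).
  pose gam := D%:R * (p i ^+ 2 - (p i - 3 / N) ^+ 2).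
  have xS : x i.+1 = x i - gam by rewrite /x /gam p_step; ring.
  have p3 : 3 / N <= p i by rewrite -subr_ge0 -p_step ltW// p_gt0.
  have sD1 : s ^+ 2 * D%:R <= 1 by rewrite sD.
  have d1 := @drift_one s (x i) (b i / s) (p i) M gam (fun f => good_dev f (ltnW ik) gM)
     (card_alive hM) pi0 (p_le1 i) N_gt0 erefl D_gt0 DN erefl p3 m0 mx s_gt0 s_le sD1.
  rewrite -/N in d1.
  rewrite exchange_big/= /Phi mulr_sumr; apply: ler_sum => e _.
  rewrite big_split/= mulrDr.
  have lam : 1 + (s * (32 * (b i / s) + 8) + 45) / (N * p i) <= expR (b i.+1) / expR (b i).
    rewrite -expRB; apply: le_trans (expR_ge1Dx _) _; rewrite ler_expR.
    rewrite lerBrDl; apply: le_trans (b_step ik); rewrite lerD2l ler_pM2r ?invr_gt0 ?mulr_gt0//.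
    have -> : s * (32 * (b i / s) + 8) = 32 * b i + 8 * s by field; rewrite gt_eqF.
    have := bge i (ltnW ik); have := s_le; lra.
  have q0 : 0 <= #|avail_edges M|%:R :> R by [].
  rewrite xS; apply: lerD.
    apply: le_trans (d1 e 1 (normr1 _)) _.
    by rewrite !ler_wpM2r ?expR_ge0.
  apply: le_trans (d1 e (-1) _) _; first by rewrite normrN normr1.
  by rewrite !ler_wpM2r ?expR_ge0.
rewrite ler_nat; apply: subset_leq_card; apply/subsetP => M; rewrite !inE => /andP[-> gM]/=.
apply/forallP => e; have /andP[h1 h2] := good_dev e (leqnn k) gM.
have h3 := m_le (leqnn k).
by rewrite ler_norml; apply/andP; split; lra.
Qed.
End NibbleCount.
End Nibble.

(** * Partial Steiner triple systems with a small leave *)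

Section Psts.
Variable V : finType.
Implicit Types (T : {set {set V}}) (x y u v w : V) (a b : {set V}).

Definition psts T :=
  [forall t in T, #|t| == 3%N] &&
  [forall t in T, forall t' in T, (1 < #|t :&: t'|)%N ==> (t == t')].

Definition uncov T x y := (x != y) && [forall t in T, ~~ ((x \in t) && (y \in t))].

Definition lv T x := #|[set y | uncov T x y]|.

Lemma card_gt1_setI a b x y : x != y -> x \in a -> y \in a -> x \in b -> y \in b ->
  (1 < #|a :&: b|)%N.
Proof.
move=> xy xa ya xb yb; apply: (@leq_trans #|[set x; y]|); first by rewrite cards2 xy.
by apply: subset_leq_card; rewrite subUset !sub1set !inE xa ya xb yb.
Qed.

Lemma pstsP T : reflect
  ((forall t, t \in T -> #|t| = 3%N) /\
   (forall t t' x y, t \in T -> t' \in T -> x != y ->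
      x \in t -> y \in t -> x \in t' -> y \in t' -> t = t'))
  (psts T).
Proof.
apply: (iffP andP) => [[/forall_inP h1 /forall_inP h2]|[h1 h2]].
  split=> [t /h1/eqP//|t t' x y tT t'T xy xt yt xt' yt'].
  have /forall_inP/(_ t' t'T) := h2 t tT.
  by rewrite (card_gt1_setI xy)//= => /eqP.
split; apply/forall_inP => t tT; first by rewrite h1.
apply/forall_inP => t' t'T; apply/implyP => /card_gt1P[x [y [xI yI xy]]].
by move: xI yI; rewrite !inE => /andP[xt xt'] /andP[yt yt']; apply/eqP; apply: (h2 t t' x y).
Qed.

Lemma uncovC T x y : uncov T x y = uncov T y x.
Proof. by rewrite /uncov eq_sym; congr (_ && _); apply: eq_forallb => t; rewrite [(x \in t) && _]andbC. Qed.

Lemma uncovP T x y : reflect (x != y /\ forall t, t \in T -> x \in t -> y \in t -> False) (uncov T x y).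
Proof.
apply: (iffP andP) => [[xy /forall_inP h]|[xy h]]; split=> //.
  by move=> t tT xt yt; have := h t tT; rewrite xt yt.
by apply/forall_inP => t tT; apply/negP => /andP[xt yt]; exact: (h t).
Qed.

(** The pairs are the vertices of the 3-graph on which the greedy process runs; its edges are the
    triangles, linear since two pairs determine a triangle, and regular of degree [#|V| - 2]. *)
Definition vpair := {e : {set V} | #|e| == 2%N}.

Lemma mkpair_subproof x y : x != y -> #|[set x; y]| == 2%N.
Proof. by rewrite cards2 => ->. Qed.
Definition mkpair x y (xy : x != y) : vpair := Sub [set x; y] (mkpair_subproof xy).

Lemma vpairP (e : vpair) : exists x y (xy : x != y), e = mkpair xy.
Proof.
have /cards2P[x [y [xy h]]] := valP e.
by exists x, y, xy; apply: val_inj.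
Qed.

Definition pairs_in a : {set vpair} := [set e : vpair | val e \subset a].
Definition triangles : {set {set vpair}} := [set pairs_in a | a in [set a : {set V} | #|a| == 3%N]].

Lemma mem_pairs_in a x y (xy : x != y) : (mkpair xy \in pairs_in a) = (x \in a) && (y \in a).
Proof. by rewrite inE /= subUset !sub1set. Qed.

Lemma card_pairs_in a : #|pairs_in a| = 'C(#|a|, 2).
Proof.
rewrite -cards_draws -(card_imset (pairs_in a) val_inj); apply: eq_card => e.
apply/imsetP/idP => [[e' h ->]|]; first by rewrite inE in h; rewrite !inE h (valP e').
by rewrite inE => /andP[h1 h2]; exists (Sub e h2 : vpair); rewrite ?inE.
Qed.

Lemma card_vpair : #|[set: vpair]| = 'C(#|V|, 2).
Proof.
rewrite -cardsT -card_pairs_in; apply: eq_card => e; rewrite !inE.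
by apply/esym/subsetP => x; rewrite inE.
Qed.

Lemma triangles3 (t : {set vpair}) : t \in triangles -> #|t| = 3%N.
Proof. by case/imsetP => a; rewrite inE => /eqP a3 ->; rewrite card_pairs_in a3. Qed.

Lemma trianglesP (t : {set vpair}) : reflect (exists2 a : {set V}, #|a| = 3%N & t = pairs_in a) (t \in triangles).
Proof.
apply: (iffP imsetP) => -[a h ->]; exists a => //; first by move: h; rewrite inE => /eqP.
by rewrite inE h.
Qed.

Lemma pairs_in_inj a b : #|a| = 3%N -> pairs_in a \subset pairs_in b -> a \subset b.
Proof.
move=> a3 /subsetP h; apply/subsetP => x xa.
have : (0 < #|a :\ x|)%N by have := cardsD1 x a; rewrite xa a3 add1n => -[<-].
case/card_gt0P => y; rewrite !inE => /andP[yx ya].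
by have := h (mkpair yx); rewrite !mem_pairs_in ya xa => /(_ isT)/andP[].
Qed.

Lemma triangles_lin (t t' : {set vpair}) (e f : vpair) : t \in triangles -> t' \in triangles -> e != f ->
  e \in t -> f \in t -> e \in t' -> f \in t' -> t = t'.
Proof.
case/trianglesP => a a3 -> /trianglesP[b b3 ->] ef; rewrite !inE => ea fa eb fb.
have c3 : (3 <= #|val e :|: val f|)%N.
  rewrite leqNgt; apply/negP => h; case/negP: ef; apply/eqP/val_inj.
  have e2 := eqP (valP e); have f2 := eqP (valP f).
  have h1 : val e = val e :|: val f by apply/eqP; rewrite eqEcard subsetUl/= e2.
  by apply/eqP; rewrite eq_sym eqEcard e2 f2 leqnn andbT h1 subsetUr.
have aE : val e :|: val f = a by apply/eqP; rewrite eqEcard subUset ea fa a3.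
have bE : val e :|: val f = b by apply/eqP; rewrite eqEcard subUset eb fb b3.
by rewrite -aE bE.
Qed.

Lemma triangles_star (e : vpair) (P : pred {set vpair}) :
  #|[set t in triangles | (e \in t) && P t]| = #|[set w | (w \notin val e) && P (pairs_in (w |: val e))]|.
Proof.
have e2 := eqP (valP e).
have inj : {in [set w | (w \notin val e) && P (pairs_in (w |: val e))] &, injective (fun w => pairs_in (w |: val e))}.
  move=> w w'; rewrite !inE => /andP[we _] /andP[we' _] h.
  have : w |: val e \subset w' |: val e.
    by apply: pairs_in_inj; rewrite ?h// cardsU1 we e2.
  by move=> /subsetP/(_ w); rewrite !inE eqxx /= (negbTE we) orbF => /(_ isT)/eqP.
rewrite -(card_in_imset inj); apply: eq_card => t; apply/idP/imsetP => [|[w]].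
  rewrite inE => /and3P[/trianglesP[a a3 ->]]; rewrite inE => ea Pa.
  have : (0 < #|a :\: val e|)%N by rewrite cardsD (setIidPr ea) a3 e2.
  case/card_gt0P => w; rewrite inE => /andP[we wa].
  have aE : a = w |: val e.
    by apply/esym/eqP; rewrite eqEcard subUset sub1set wa ea/= cardsU1 we e2 a3.
  by exists w; rewrite -?aE// inE we -aE.
rewrite inE => /andP[we Pw] ->; rewrite !inE Pw subsetUr andbT andbT.
by apply/trianglesP; exists (w |: val e) => //; rewrite cardsU1 we e2.
Qed.

Lemma triangles_reg e : #|[set t in triangles | e \in t]| = (#|V| - 2)%N.
Proof.
have -> : #|[set t in triangles | e \in t]| = #|[set t in triangles | (e \in t) && predT t]|.
  by apply: eq_card => t; rewrite !inE andbT.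
rewrite triangles_star -(cardsC (val e)) (eqP (valP e)) addKn.
by apply: eq_card => w; rewrite !inE andbT.
Qed.

Definition triples_of (M : {set {set vpair}}) := [set a : {set V} | (#|a| == 3%N) && (pairs_in a \in M)].

Section OfMatching.
Variables (k : nat) (M : {set {set vpair}}).
Hypothesis hM : hmatching triangles k M.
Let T := triples_of M.

Lemma triples_ofK : [set pairs_in a | a in T] = M.
Proof.
have /and3P[/subsetP Ms _ _] := hM.
apply/setP => t; apply/imsetP/idP => [[a]|tM]; first by rewrite inE => /andP[_ h] ->.
by have /trianglesP[a a3 e] := Ms _ tM; exists a; rewrite ?inE ?a3 -?e.
Qed.

Lemma card_triples_of : #|T| = k.
Proof.
have /and3P[_ _ /eqP <-] := hM; rewrite -triples_ofK card_in_imset// => a b.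
rewrite !inE => /andP[/eqP a3 _] /andP[/eqP b3 _] e.
by apply/eqP; rewrite eqEsubset !pairs_in_inj// e.
Qed.

Lemma psts_triples_of : psts T.
Proof.
have /and3P[_ /trivIsetP tr _] := hM.
apply/pstsP; split => [t|t t' x y]; first by rewrite inE => /andP[/eqP].
rewrite !inE => /andP[/eqP t3 tM] /andP[/eqP t3' tM'] xy xt yt xt' yt'.
suff e : pairs_in t = pairs_in t' by apply/eqP; rewrite eqEsubset !pairs_in_inj// e.
apply/eqP; apply: contraT => /(tr _ _ tM tM'); rewrite disjoint_subset => /subsetP/(_ (mkpair xy)).
by rewrite [_ \in [predC _]]inE/= !mem_pairs_in xt yt xt' yt'=> /(_ isT).
Qed.

Lemma alive_uncov x y (xy : x != y) : (mkpair xy \in alive M) = uncov T x y.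
Proof.
rewrite inE -triples_ofK; apply/idP/uncovP => [/negP h|[_ h]].
  split=> // a aT xa ya; apply: h; apply/bigcupP; exists (pairs_in a); first exact: imset_f.
  by rewrite mem_pairs_in xa.
apply/negP => /bigcupP[t /imsetP[a aT ->]]; rewrite mem_pairs_in => /andP[xa ya].
exact: (h a).
Qed.

(** It does not matter whether the pair itself is covered. Hence the process controls the codegrees
    in the leave of all pairs of points, as [lv_codeg] requires. *)
Lemma alive_deg_uncov x y (xy : x != y) :
  alive_deg triangles M (mkpair xy) = #|[set w | uncov T x w && uncov T y w]|.
Proof.
rewrite /alive_deg triangles_star; apply: eq_card => w; rewrite !inE negb_or.
have [->|wx] := eqVneq w x; first by rewrite /uncov eqxx.
have [->|wy] := eqVneq w y; first by rewrite /uncov eqxx /= andbF.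
rewrite /=; apply/subsetP/andP => [h|[h1 h2] e].
  split; rewrite uncovC.
    rewrite -(alive_uncov wx); apply: h; rewrite !inE /= subUset !sub1set !inE !eqxx ?orbT /= andbT.
    apply/negP => /eqP/(congr1 val)/setP/(_ w); rewrite /= !inE eqxx (negbTE wx) (negbTE wy).
    by [].
  rewrite -(alive_uncov wy); apply: h; rewrite !inE /= subUset !sub1set !inE !eqxx ?orbT /= andbT.
  apply/negP => /eqP/(congr1 val)/setP/(_ w); rewrite /= !inE eqxx (negbTE wx) (negbTE wy).
  by [].
have [u [v [uv ->]]] := vpairP e.
rewrite alive_uncov !inE /= subUset !sub1set !inE => /andP[ne].
have neq : ~~ ((u == x) && (v == y) || (u == y) && (v == x)).
  apply: contra ne => /orP[]/andP[/eqP eu /eqP ev]; apply/eqP/val_inj; rewrite /= eu ev//.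
  by rewrite setUC.
move=> /andP[/or3P hu /or3P hv]; move: uv neq {ne}.
by case: hu => /eqP ->; case: hv => /eqP ->; rewrite ?eqxx ?orbT //= => _ _; rewrite uncovC.
Qed.
End OfMatching.

Section DegBound.
Variables (R : realType) (T : {set {set V}}) (x th : R).
Let n : R := #|V|%:R.
Let cd u v : R := #|[set w | uncov T u w && uncov T v w]|%:R.
Hypothesis hcd : forall u v, u != v -> `|cd u v - x| <= th * x.
Hypothesis th4 : th <= 1 / 4.
Hypothesis x4 : 4 <= x.

(** The process controls codegrees; degrees follow by counting two neighbours w, w' of [u] together
    with a common neighbour v other than [u]. The sum of the squares of the codegrees is at most n
    (5x / 4)^2, and each pair w, w' contributes at least 3x / 4 - 1, which is at least x / 2 because
    x >= 4. *)
Lemma lv_codeg u : (lv T u)%:R * ((lv T u)%:R - 1) <= 25 / 8 * n * x.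
Proof.
have xx := x4; have tt := th4.
have hx : 0 <= x by lra.
have cdb v w : v != w -> 3 / 4 * x <= cd v w <= 5 / 4 * x.
  move=> vw; have := hcd vw; have : th * x <= 1 / 4 * x by rewrite ler_wpM2r.
  by rewrite ler_norml => h /andP[h1 h2]; apply/andP; split; lra.
pose A v w : R := (uncov T v w)%:R.
have A2 v w : A v w * A v w = A v w by rewrite /A; case: (uncov _ _ _); rewrite ?mulr1 ?mulr0.
have AC v w : A v w = A w v by rewrite /A uncovC.
have A0 v w : 0 <= A v w by rewrite ler0n.
have cdE v w : cd v w = \sum_z A v z * A w z.
  rewrite /cd -sum1_card natr_sum big_mkcond/=; apply: eq_bigr => z _.
  by rewrite inE /A; case: (uncov _ _ _); case: (uncov _ _ _); rewrite ?mulr1 ?mulr0 ?mul0r.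
have dE : (lv T u)%:R = \sum_w A u w.
  rewrite /lv -sum1_card natr_sum big_mkcond/=; apply: eq_bigr => z _.
  by rewrite inE /A; case: (uncov _ _ _).
set d : R := (lv T u)%:R in dE *.
have up : \sum_(v | v != u) cd u v * cd u v <= n * (25 / 16 * (x * x)).
  apply: (@le_trans _ _ (\sum_(v : V) (25 / 16 * (x * x)))); last by rewrite sumr_const -[_ *+ _]mulr_natl.
  rewrite big_mkcond/=; apply: ler_sum => v _; case: ifP => [vu|_]; last by rewrite !mulr_ge0//; lra.
  rewrite eq_sym in vu; have /andP[c1 c2] := cdb _ _ vu.
  have : cd u v * cd u v <= 5 / 4 * x * (5 / 4 * x) by apply: ler_pM => //; rewrite ler0n.
  lra.
have lo : d * (d - 1) * (x / 2) <= \sum_(v | v != u) cd u v * cd u v.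
  have -> : \sum_(v | v != u) cd u v * cd u v =
    \sum_w \sum_w' A u w * A u w' * \sum_(v | v != u) A v w * A v w'.
    under [RHS]eq_bigr => w _ do (under eq_bigr => w' _ do rewrite mulr_sumr).
    under [RHS]eq_bigr => w _ do rewrite exchange_big/=.
    rewrite [RHS]exchange_big/=; apply: eq_bigr => v _.
    rewrite !cdE mulr_suml; apply: eq_bigr => w _; rewrite mulr_sumr.
    by apply: eq_bigr => w' _; ring.
  apply: (@le_trans _ _ (\sum_w \sum_(w' | w' != w) A u w * A u w' * (x / 2))).
    rewrite le_eqVlt; apply/orP; left; apply/eqP.
    under eq_bigr => w _ do rewrite -mulr_suml -mulr_sumr.
    rewrite -mulr_suml; congr (_ * _).
    rewrite mulrBr mulr1 {1 3}dE mulr_suml -sumrB; apply: eq_bigr => w _.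
    by rewrite dE [X in _ * X - _](bigD1 w)//= mulrDr A2 addrC addKr.
  apply: ler_sum => w _; rewrite [leRHS](bigD1 w)//=.
  rewrite -[leLHS]add0r; apply: lerD.
    by rewrite !mulr_ge0// sumr_ge0// => v _; rewrite mulr_ge0.
  apply: ler_sum => w' ww'; have [Auw|] := boolP (uncov T u w && uncov T u w'); last first.
    by rewrite /A; case: (uncov T u w) => /=; rewrite ?mul0r// => /negbTE ->; rewrite mulr0 !mul0r.
  rewrite ler_wpM2l ?mulr_ge0//.
  rewrite eq_sym in ww'; have /andP[c1 _] := cdb _ _ ww'.
  move: c1; rewrite cdE (bigD1 u)//=.
  under [X in _ + X]eq_bigr => v _ do rewrite [A w v]AC [A w' v]AC.
  have : A w u * A w' u <= 1 by rewrite /A; case: (uncov _ _ _); case: (uncov _ _ _); rewrite ?mulr1 ?mulr0.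
  lra.
have h := le_trans lo up.
have x0 : 0 < x / 2 by lra.
rewrite -(ler_pM2r x0); lra.
Qed.
End DegBound.

Section PstsCount.
Variables (R : realType) (k : nat) (beta theta : R) (Delta : nat).
Let n : R := #|V|%:R.
Let N : R := 'C(#|V|, 2)%:R.
Let D := (#|V| - 2)%N.
Let p (i : nat) : R := 1 - 3 * i%:R / N.
Hypothesis k_gt0 : (0 < k)%N.
Hypothesis DN : 6 * D%:R <= N.
Hypothesis beta53 : 53 <= beta.
Hypothesis betaN : 4 * N <= expR beta.
Hypothesis theta0 : 0 <= theta.
Hypothesis theta4 : theta <= 1 / 4.
Hypothesis pk_gt0 : 0 < p k.
Hypothesis beta_le : beta <= theta * Num.sqrt D%:R * p k ^+ 13.
Hypothesis Dp4 : 4 <= D%:R * p k ^+ 2.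
Hypothesis np8 : 8 <= n * p k.
Hypothesis npD : 2 * n * p k <= Delta%:R.

Definition good_psts := [set T | [&& psts T, #|T| == k & [forall v, (lv T v <= Delta)%N]]].

Let D_gt0 : (0 < D)%N.
Proof.
rewrite lt0n; apply/negP => /eqP D0; have := Dp4; rewrite D0 mul0r; lra.
Qed.

Lemma good_psts_ge :
  1 / 2 * \prod_(i < k) (N * D%:R * p i ^+ 3 * (1 - theta) / 3 / i.+1%:R) <= #|good_psts|%:R.
Proof.
have cN : #|{: vpair}| = 'C(#|V|, 2) by have := card_vpair; rewrite cardsT.
have := @nibble_count R vpair triangles D triangles3 triangles_lin triangles_reg k beta theta D_gt0.
rewrite cN => /(_ DN beta53 betaN theta0 theta4 pk_gt0 beta_le) h.
apply: le_trans h _; rewrite ler_nat.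
rewrite -(@card_in_imset _ _ triples_of); last first.
  move=> M M'; rewrite !inE => /andP[hM _] /andP[hM' _] e.
  by rewrite -(triples_ofK hM) e (triples_ofK hM').
apply: subset_leq_card; apply/subsetP => T' /imsetP[M]; rewrite inE => /andP[hM /forallP hd] ->.
rewrite inE (psts_triples_of hM) (card_triples_of hM) eqxx/=; apply/forallP => v.
rewrite -(ler_nat R); apply: le_trans npD.
have tt := theta4; have pk0 := pk_gt0; have np := np8.
have hcd u w : u != w -> `|#|[set z | uncov (triples_of M) u z && uncov (triples_of M) w z]|%:R - D%:R * p k ^+ 2|
    <= theta * (D%:R * p k ^+ 2).
  by move=> uw; rewrite -(alive_deg_uncov hM uw); exact: hd.
have := lv_codeg hcd theta4 Dp4 v; rewrite -/n.
set d : R := (lv _ _)%:R => h; rewrite leNgt; apply/negP => dn.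
have n0 : 0 <= n by [].
have Dn : D%:R <= n by rewrite ler_nat leq_subr.
have h1 : 25 / 8 * n * (D%:R * p k ^+ 2) <= 25 / 8 * (n * p k) ^+ 2.
  have -> : 25 / 8 * (n * p k) ^+ 2 = 25 / 8 * n * (n * p k ^+ 2) by ring.
  by apply: ler_wpM2l; [apply: mulr_ge0 => //; lra|rewrite ler_wpM2r// exprn_ge0// ltW].
set y := n * p k in h1 np dn *.
have dn' : 2 * y < d by rewrite mulrA.
have : 2 * y * (2 * y - 1) <= d * (d - 1) by apply: ler_pM; lra.
have : 8 * y <= y * y by rewrite ler_wpM2r//; lra.
rewrite expr2 in h1; lra.
Qed.

Let N_gt0 : 0 < N.
Proof. by apply: lt_le_trans DN; rewrite mulr_gt0// ltr0n. Qed.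

Lemma sum_ln_p (i : nat) : (i <= k)%N -> - (N / 3) <= \sum_(j < i) ln (p j).
Proof.
move=> ik.
have pj j : (j <= k)%N -> 0 < p j.
  move=> jk; apply: lt_le_trans pk_gt0 _; rewrite /p lerD2l lerN2 ler_pM2r ?invr_gt0// ler_pM2l//.
  by rewrite ler_nat.
(* Comparison with an integral: p ln p - p is a primitive of ln, and on the interval of length 3 / N
   from p (j + 1) to p j the logarithm is largest at p j. *)
have step j : (j < k)%N -> (N / 3) * ((p j * ln (p j) - p j) - (p j.+1 * ln (p j.+1) - p j.+1)) <= ln (p j).
  move=> jk; have a0 := pj j (ltnW jk); have b0 := pj _ jk.
  have e : p j - p j.+1 = 3 / N by rewrite /p -[j.+1]addn1 natrD; field; rewrite gt_eqF.
  have : (p j * ln (p j) - p j) - (p j.+1 * ln (p j.+1) - p j.+1) <= (p j - p j.+1) * ln (p j).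
    have : p j.+1 * ln (p j / p j.+1) <= p j - p j.+1.
      have /(ler_wpM2l (ltW b0)) : ln (p j / p j.+1) <= p j / p j.+1 - 1 by apply: ln_leB1; rewrite divr_gt0.
      by rewrite mulrBr mulr1 mulrCA divff ?gt_eqF// mulr1.
    rewrite ln_div ?posrE//; lra.
  rewrite e => h; apply: le_trans (ler_wpM2l (_ : 0 <= N / 3) h) _; first by rewrite divr_ge0// ltW.
  have -> // : N / 3 * (3 / N * ln (p j)) = ln (p j) by field; rewrite gt_eqF.
have tel i' : (i' <= k)%N -> (N / 3) * ((p 0 * ln (p 0) - p 0) - (p i' * ln (p i') - p i')) <= \sum_(j < i') ln (p j).
  elim: i' => [|j IH] jk; first by rewrite big_ord0 subrr mulr0.
  rewrite big_ord_recr/=; have := IH (ltnW jk); have := step j jk; lra.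
apply: le_trans (tel i ik).
have -> : p 0 = 1 by rewrite /p mulr0 mul0r subr0.
rewrite ln1; have i0 := pj i ik.
have p1 : p i <= 1 by rewrite /p gerBl divr_ge0// ?mulr_ge0// ltW.
have l1 : ln (p i) <= 0 by rewrite ln_le0.
have : 0 <= p i * (- ln (p i)) by rewrite mulr_ge0 ?oppr_ge0// ltW.
have N3 : 0 <= N / 3 by rewrite divr_ge0// ltW.
move=> h; rewrite -subr_ge0.
have -> : N / 3 * (1 * 0 - 1 - (p i * ln (p i) - p i)) - - (N / 3) = N / 3 * (p i * - ln (p i) + p i) by ring.
by rewrite mulr_ge0// addr_ge0// ltW.
Qed.

(** With k near N / 3, the factors N D / 3 divided by k! contribute N / 3 (ln D + 1) and the cubes
    of p take off 3 (N / 3). This is the same -2 as in [greedy_count_le], so the main terms will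
    cancel. *)
Lemma ln_good_psts :
  N / 3 * (ln D%:R - 2) - p k * (N / 3) * (ln D%:R + 1) - 2 * theta * (N / 3) - ln N - 3 <= ln #|good_psts|%:R.
Proof.
have pj j : (j <= k)%N -> 0 < p j.
  move=> jk; apply: lt_le_trans pk_gt0 _; rewrite /p lerD2l lerN2 ler_pM2r ?invr_gt0// ler_pM2l//.
  by rewrite ler_nat.
have tt := theta4; have t0 := theta0; have D0 : 0 < D%:R :> R by rewrite ltr0n.
have k0 : 0 < k%:R :> R by rewrite ltr0n.
have kN : k%:R <= N / 3.
  have := pk_gt0; rewrite /p subr_gt0 ltr_pdivrMr// mul1r; lra.
have prodE i : (i <= k)%N -> 0 < \prod_(j < i) (N * D%:R * p j ^+ 3 * (1 - theta) / 3 / j.+1%:R) /\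
    ln (\prod_(j < i) (N * D%:R * p j ^+ 3 * (1 - theta) / 3 / j.+1%:R)) =
    i%:R * (ln (N * D%:R / 3) + ln (1 - theta)) + 3 * \sum_(j < i) ln (p j) - ln i`!%:R.
  elim: i => [|i IH] ik.
    by rewrite !big_ord0 mul0r mulr0 fact0 ln1; split => //; ring.
  have [IH1 IH2] := IH (ltnW ik); have pi0 := pj i (ltnW ik).
  have f0 : 0 < N * D%:R * p i ^+ 3 * (1 - theta) / 3 / i.+1%:R.
    rewrite divr_gt0 ?ltr0n// divr_gt0// mulr_gt0//; last by lra.
    by rewrite mulr_gt0 ?exprn_gt0// mulr_gt0.
  rewrite !big_ord_recr/=; split; first by rewrite mulr_gt0.
  rewrite lnM ?posrE// IH2 factS natrM.
  have -> : N * D%:R * p i ^+ 3 * (1 - theta) / 3 / i.+1%:R = N * D%:R / 3 * (1 - theta) * p i ^+ 3 / i.+1%:R by ring.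
  have q1 : 0 < N * D%:R / 3 by rewrite divr_gt0// mulr_gt0.
  have q2 : 0 < 1 - theta by lra.
  have gen (a b c d : R) : 0 < a -> 0 < b -> 0 < c -> 0 < d -> ln (a * b * c ^+ 3 / d) = ln a + ln b + 3 * ln c - ln d.
    move=> a0 b0 c0 d0; rewrite ln_div ?posrE ?mulr_gt0 ?exprn_gt0// lnM ?posrE ?mulr_gt0 ?exprn_gt0//.
    by rewrite lnM ?posrE// lnXn// -[_ *+ 3]mulr_natl.
  rewrite gen ?ltr0n// [ln (_ * _`!%:R)]lnM ?posrE ?ltr0n ?fact_gt0//.
  by rewrite -[i.+1]addn1 natrD; ring.
have [P0 PE] := prodE k (leqnn k).
set P := \prod_(j < k) _ in P0 PE.
have h1 : ln (1 / 2 * P) <= ln #|good_psts|%:R.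
  have g := good_psts_ge.
  have P2 : 0 < 1 / 2 * P by rewrite mulr_gt0// divr_gt0.
  by rewrite ler_ln ?posrE//; apply: lt_le_trans g.
apply: le_trans h1; rewrite [ln (1 / 2 * P)]lnM ?posrE ?divr_gt0// PE.
have hs := sum_ln_p (leqnn k).
have hf : ln (k`!%:R) <= k%:R * ln k%:R - k%:R + ln k%:R + 1 :> R := ln_fact_le R k_gt0.
have l2 : -1 <= ln (1 / 2 : R) by have := @ln_ge_1B R (1 / 2) ltac:(lra); lra.
have lth : - (2 * theta) <= ln (1 - theta).
  have t1 : 0 < 1 - theta by lra.
  apply: le_trans (ln_ge_1B t1); rewrite lerBrDr -lerBrDl.
  rewrite -div1r ler_pdivrMr//; have : theta * theta <= 1 / 4 * theta by rewrite ler_wpM2r.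
  lra.
have lk : ln k%:R <= ln N by rewrite ler_ln ?posrE//; lra.
have lND : ln D%:R + ln k%:R <= ln (N * D%:R / 3).
  have q1 : 0 < N * D%:R / 3 by rewrite divr_gt0// mulr_gt0.
  rewrite -lnM ?posrE// ler_ln ?posrE ?(mulr_gt0 D0 k0) ?q1//.
  have -> : N * D%:R / 3 = D%:R * (N / 3) by ring.
  by rewrite ler_pM2l.
have hk : k%:R = N / 3 - p k * (N / 3) by rewrite /p; field; rewrite gt_eqF.
set L := ln D%:R in lND *; set A := ln (N * D%:R / 3) in lND *; set lK := ln k%:R in lND lk hf *.
have a1 : k%:R * (L + lK) <= k%:R * A by rewrite ler_wpM2l// ltW.
have a2 : k%:R * (- (2 * theta)) <= k%:R * ln (1 - theta) by rewrite ler_wpM2l// ltW.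
have a3 : k%:R * (2 * theta) <= N / 3 * (2 * theta) by rewrite ler_wpM2r// mulr_ge0.
have a4 : k%:R * L = N / 3 * L - p k * (N / 3) * L by rewrite {1}hk; ring.
have a5 : k%:R * (ln (1 - theta)) + k%:R * A = k%:R * (A + ln (1 - theta)) by ring.
have a6 : k%:R * (L + lK) = k%:R * L + k%:R * lK by ring.
rewrite -/A -/lK.
have a7 : N / 3 * (L - 2) = N / 3 * L - 2 * (N / 3) by ring.
have a8 : p k * (N / 3) * (L + 1) = p k * (N / 3) * L + p k * (N / 3) by ring.
have a9 : 2 * theta * (N / 3) = N / 3 * (2 * theta) by ring.
rewrite a7 a8 a9; lra.
Qed.
End PstsCount.
End Psts.

(** * Concentration on product spaces *)

Section ProductAverage.
Variables (R : realType) (I A : finType) (a0 : A).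
Local Notation omega := {ffun I -> A}.
Implicit Types (F G : omega -> R) (al : omega) (i j : I) (l : seq I).

Definition upd al i (a : A) : omega := [ffun j => if j == i then a else al j].

Definition avg1 i F al : R := (\sum_a F (upd al i a)) / #|A|%:R.
Definition avgs l F : omega -> R := foldr avg1 F l.

Let A0 : 0 < #|A|%:R :> R.
Proof. by rewrite ltr0n; apply/card_gt0P; exists a0. Qed.

Lemma upd_id al i a b : upd (upd al i a) i b = upd al i b.
Proof. by apply/ffunP => j; rewrite !ffunE; case: eqP. Qed.

Lemma upd_comm al i j a b : i != j -> upd (upd al i a) j b = upd (upd al j b) i a.
Proof.
move=> ij; apply/ffunP => k; rewrite !ffunE.
by case: (eqVneq k j) => [->|//]; rewrite eq_sym (negbTE ij).
Qed.

Lemma avg1_le i F G : (forall al, F al <= G al) -> forall al, avg1 i F al <= avg1 i G al.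
Proof.
by move=> h al; rewrite ler_pM2r ?invr_gt0//; apply: ler_sum => a _.
Qed.

Lemma avgs_le l F G : (forall al, F al <= G al) -> forall al, avgs l F al <= avgs l G al.
Proof. by move=> h; elim: l => //= i l IH; exact: avg1_le. Qed.

Lemma avg1_cst i (c : R) al : avg1 i (fun=> c) al = c.
Proof. by rewrite /avg1 sumr_const -[_ *+ _]mulr_natl mulrC mulKf// gt_eqF. Qed.

Lemma avgs_cst l (c : R) al : avgs l (fun=> c) al = c.
Proof.
elim: l al => //= i l IH al; rewrite -[RHS](avg1_cst i c al) /avg1.
by congr (_ / _); apply: eq_bigr => a _; rewrite IH.
Qed.

Lemma avgs_eq l F G : (forall al, F al = G al) -> forall al, avgs l F al = avgs l G al.
Proof. by move=> h al; apply/eqP; rewrite eq_le !avgs_le// => b; rewrite h. Qed.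

Lemma avgs_sum (J : Type) (r : seq J) (P : pred J) l (F : J -> omega -> R) al :
  avgs l (fun al => \sum_(j <- r | P j) F j al) al = \sum_(j <- r | P j) avgs l (F j) al.
Proof.
elim: l al => //= i l IH al; rewrite /avg1 -mulr_suml; congr (_ / _).
by rewrite exchange_big/=; apply: eq_bigr => a _; rewrite IH.
Qed.

Lemma avgs_scale l (c : R) F al : avgs l (fun al => c * F al) al = c * avgs l F al.
Proof.
elim: l al => //= i l IH al; rewrite /avg1 mulrA; congr (_ / _).
by rewrite mulr_sumr; apply: eq_bigr => a _; rewrite IH.
Qed.

Lemma avg1_scale i (c : R) F al : avg1 i (fun al => c * F al) al = c * avg1 i F al.
Proof. exact: (avgs_scale [:: i]). Qed.

Definition bdiff F (c : I -> R) :=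
  forall i al a b, `|F (upd al i a) - F (upd al i b)| <= c i.

Lemma bdiff_ge0 F c i : bdiff F c -> 0 <= c i.
Proof. by move=> h; apply: le_trans (h i [ffun=> a0] a0 a0). Qed.

Lemma bdiff_avg1 F c i : bdiff F c -> bdiff (avg1 i F) c.
Proof.
move=> h j al a b; rewrite /avg1 -mulrBl -sumrB normrM normfV (gtr0_norm A0).
have [->|ij] := eqVneq j i.
  rewrite big1 ?normr0 ?mul0r ?(bdiff_ge0 _ h)// => d _.
  by rewrite !upd_id subrr.
rewrite ler_pdivrMr// mulr_natr -sumr_const.
apply: le_trans (ler_norm_sum _ _ _) _; apply: ler_sum => d _.
by rewrite !(upd_comm _ _ _ ij).
Qed.

Lemma bdiff_avgs F c l : bdiff F c -> bdiff (avgs l F) c.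
Proof. by move=> h; elim: l => //= i l; exact: bdiff_avg1. Qed.

(** Since [avg1 i F al] is the mean over the coordinate, the linear term of [expR_quadratic]
    averages out. *)
Lemma avg1_expR F c i (s : R) al : bdiff F c -> 0 <= s -> s * c i <= 1 / 2 ->
  avg1 i (fun al => expR (s * F al)) al <= expR (s ^+ 2 * c i ^+ 2) * expR (s * avg1 i F al).
Proof.
move=> h s0 sc; have c0 := bdiff_ge0 i h.
set m := avg1 i F al.
have mE : \sum_a (F (upd al i a) - m) = 0.
  by rewrite sumrB sumr_const -[_ *+ _]mulr_natl /m /avg1 mulrC mulfVK ?subrr// gt_eqF.
have hm a : `|F (upd al i a) - m| <= c i.
  have -> : F (upd al i a) - m = (\sum_b (F (upd al i a) - F (upd al i b))) / #|A|%:R.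
    rewrite sumrB sumr_const mulrBl -[_ *+ _]mulr_natl mulrAC divff ?gt_eqF// mul1r.
    by [].
  rewrite normrM normfV (gtr0_norm A0) ler_pdivrMr// mulr_natr -sumr_const.
  by apply: le_trans (ler_norm_sum _ _ _) _; apply: ler_sum => b _; exact: h.
have step a : expR (s * F (upd al i a)) <=
    expR (s * m) * (1 + s * (F (upd al i a) - m) + s ^+ 2 * c i ^+ 2).
  have -> : s * F (upd al i a) = s * m + s * (F (upd al i a) - m) by ring.
  rewrite expRD ler_wpM2l ?expR_ge0//.
  have hb : `|s * (F (upd al i a) - m)| <= s * c i.
    by rewrite normrM ger0_norm// ler_wpM2l.
  apply: le_trans (expR_quadratic _) _.
    by apply: le_trans (ler_norm _) _; apply: le_trans hb _.
  rewrite lerD2l -exprMn -[leLHS]real_normK ?num_real//.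
  by rewrite lerXn2r ?nnegrE// mulr_ge0.
rewrite /avg1 ler_pdivrMr//; apply: le_trans (ler_sum _ (fun a _ => step a)) _.
rewrite -mulr_sumr !big_split/= -mulr_sumr mE mulr0 addr0 !sumr_const -mulrnDl -[_ *+ _]mulr_natr.
rewrite mulrA ler_pM2r// mulrC ler_pM2r ?expR_gt0//; exact: expR_ge1Dx.
Qed.

Lemma avgs_expR F c (s : R) l al : bdiff F c -> 0 <= s -> (forall i, s * c i <= 1 / 2) ->
  avgs l (fun al => expR (s * F al)) al <=
    expR (s ^+ 2 * \sum_(i <- l) c i ^+ 2) * expR (s * avgs l F al).
Proof.
move=> h s0 sc; elim: l al => [|i l IH] al; first by rewrite big_nil mulr0 expR0 mul1r.
rewrite /= big_cons mulrDr expRD.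
apply: (le_trans (@avg1_le i _ _ IH al)).
rewrite avg1_scale -[leRHS]mulrA [leRHS]mulrCA ler_pM2l ?expR_gt0//.
exact: (avg1_expR al (bdiff_avgs l h) s0 (sc i)).
Qed.

(* Bounded differences and a union bound: some point of the product space has no upward deviation. *)
Lemma avoid_deviations (J : finType) (F : J -> omega -> R) (c : J -> I -> R) (e : J -> R) (s t B : R) :
  (forall j : J, bdiff (F j) (c j)) ->
  (forall (j : J) al, avgs (enum I) (F j) al <= e j) ->
  (forall j : J, \sum_i c j i ^+ 2 <= B) -> 0 < s -> (forall (j : J) i, s * c j i <= 1 / 2) ->
  #|J|%:R * expR (s ^+ 2 * B - s * t) < 1 ->
  exists al, forall j : J, F j al < e j + t.
Proof.
move=> hF he hB s0 sc hlt.
pose G al := \sum_j expR (s * (F j al - e j - t)).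
have [/existsP[al hal]|] := boolP [exists al, G al < 1].
  exists al => j; rewrite -subr_lt0.
  have : expR (s * (F j al - e j - t)) < 1.
    apply: le_lt_trans hal; rewrite /G (bigD1 j)//= lerDl sumr_ge0// => k _.
    exact: expR_ge0.
  by rewrite expR_lt1 pmulr_rlt0// opprD addrA.
rewrite negb_exists => /forallP h1.
have al0 : omega := [ffun=> a0].
suff : avgs (enum I) G al0 < 1.
  have : 1 <= avgs (enum I) G al0.
    rewrite -[leLHS](avgs_cst (enum I) 1 al0); apply: avgs_le => al.
    by rewrite leNgt.
  by move/le_lt_trans => h /h; rewrite ltxx.
apply: le_lt_trans hlt; rewrite avgs_sum mulr_natl -sumr_const.
apply: ler_sum => j _.
rewrite (@avgs_eq _ _ (fun al => expR (- s * (e j + t)) * expR (s * F j al))); last first.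
  by move=> al; rewrite -expRD; congr expR; ring.
rewrite avgs_scale.
apply: (@le_trans _ _ (expR (- s * (e j + t)) * (expR (s ^+ 2 * B) * expR (s * e j)))).
  rewrite ler_pM2l ?expR_gt0//.
  apply: le_trans (avgs_expR (enum I) al0 (hF j) (ltW s0) (sc j)) _.
  apply: ler_pM; rewrite ?expR_ge0// ler_expR.
    by rewrite big_enum/= ler_pM2l ?exprn_gt0.
  by rewrite ler_pM2l.
rewrite -!expRD ler_expR le_eqVlt; apply/orP; left; apply/eqP; ring.
Qed.

Lemma avgs_prod (phi : I -> A -> R) l al : uniq l ->
  avgs l (fun al => \prod_i phi i (al i)) al =
    \prod_i (if i \in l then (\sum_a phi i a) / #|A|%:R else phi i (al i)).
Proof.
elim: l al => [|j l IH] al //= /andP[jl ul]; rewrite /avg1.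
transitivity ((\sum_a (\prod_i (if i \in l then (\sum_b phi i b) / #|A|%:R else phi i (upd al j a i)) : R)) / #|A|%:R).
  by congr (_ / _); apply: eq_bigr => a _; exact: IH.
have e1 a : \prod_i (if i \in l then (\sum_b phi i b) / #|A|%:R else phi i (upd al j a i)) =
    phi j a * \prod_(i | i != j) (if i \in l then (\sum_b phi i b) / #|A|%:R else phi i (al i)) :> R.
  rewrite (bigD1 j)//= (negbTE jl) ffunE eqxx; congr (_ * _); apply: eq_bigr => i ij.
  by rewrite ffunE (negbTE ij).
rewrite (eq_bigr _ (fun a _ => e1 a)).
rewrite [RHS](bigD1 j)//= inE eqxx/= mulrAC -mulr_suml; congr (_ * _ / _).
by apply: eq_bigr => i ij; rewrite inE (negbTE ij).
Qed.

Definition sat (cs : seq (I * {set A})) al := all (fun c : I * {set A} => al c.1 \in c.2) cs.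

(** Constraints on distinct coordinates are independent, hence the product of their
    probabilities. *)
Lemma avgs_sat (cs : seq (I * {set A})) al : uniq (unzip1 cs) ->
  avgs (enum I) (fun al => (sat cs al)%:R) al = \prod_(c <- cs) (#|c.2|%:R / #|A|%:R).
Proof.
move=> uc.
pose phi i a : R := \prod_(c <- cs) (if c.1 == i then (a \in c.2)%:R else 1).
rewrite (@avgs_eq _ _ (fun al => \prod_i phi i (al i))); last first.
  move=> be; transitivity (\prod_(c <- cs) (be c.1 \in c.2)%:R : R).
    elim: cs {uc phi} => [|c cs IH]; first by rewrite big_nil.
    by rewrite big_cons -IH /=; case: (_ \in c.2); rewrite ?mul1r ?mul0r.
  transitivity (\prod_i \prod_(c <- cs) (if c.1 == i then (be i \in c.2)%:R else 1) : R); last by [].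
  rewrite [RHS]exchange_big/=; apply: eq_bigr => c _; rewrite (bigD1 c.1)//= eqxx big1 ?mulr1// => i /negbTE ci.
  by rewrite eq_sym ci.
rewrite avgs_prod ?enum_uniq//.
under eq_bigr => i _ do rewrite mem_enum inE /phi.
elim: cs uc phi => [|c cs IH] /=.
  by move=> _ phi; rewrite big_nil big1// => i _; under eq_bigr do rewrite big_nil; rewrite sumr_const divff ?gt_eqF.
case/andP => cn uc phi; rewrite big_cons -IH//.
rewrite (bigD1 c.1)//= [in RHS](bigD1 c.1)//= mulrA; congr (_ * _); last first.
  apply: eq_bigr => i /negbTE ci; congr (_ / _); apply: eq_bigr => a _.
  by rewrite big_cons eq_sym ci mul1r.
have e1 a : \prod_(j <- cs) (if j.1 == c.1 then (a \in j.2)%:R else 1) = 1 :> R.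
  rewrite big_seq big1// => j jc; case: eqP => // e; case/negP: cn; rewrite -e.
  by apply/mapP; exists j.
under eq_bigr => a _ do rewrite big_cons eqxx e1 mulr1.
under [X in _ = _ * (X / _)]eq_bigr => a _ do rewrite e1.
rewrite sumr_const divff ?gt_eqF// mulr1; congr (_ / _).
by rewrite -sum1_card natr_sum [RHS]big_mkcond/=; apply: eq_bigr => a _; case: (a \in c.2).
Qed.
End ProductAverage.

(** * Random labellings of points and triples *)

Lemma inl_eq (A B : eqType) (x y : A) : (inl x == inl y :> A + B) = (x == y).
Proof. by []. Qed.

Lemma inr_eq (A B : eqType) (x y : B) : (inr x == inr y :> A + B) = (x == y).
Proof. by []. Qed.

Section LocalSum.
Variables (R : realType) (I A : finType) (a0 : A).
Variables (X : finType) (g : pred X) (cs : X -> seq (I * {set A})).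
Implicit Types (al : {ffun I -> A}).

Definition lsum al : R := \sum_(x | g x) (sat (cs x) al)%:R.
(** Only these [x] can gain or lose their indicator when coordinate [i] changes: a Lipschitz
    constant in direction [i]. *)
Definition lsum_mult (i : I) : R := #|[set x | g x && (i \in unzip1 (cs x))]|%:R.

Lemma sat_upd (s : seq (I * {set A})) al i a : i \notin unzip1 s -> sat s (upd al i a) = sat s al.
Proof.
elim: s => //= c s IH; rewrite inE negb_or => /andP[ic h].
by rewrite IH// ffunE eq_sym (negbTE ic).
Qed.

Lemma lsum_bdiff : bdiff lsum lsum_mult.
Proof.
move=> i al a b; rewrite /lsum -sumrB /lsum_mult -sum1_card natr_sum.
apply: le_trans (ler_norm_sum _ _ _) _.
rewrite [leLHS]big_mkcond [leRHS]big_mkcond/=; apply: ler_sum => x _.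
rewrite inE; case: (g x) => //=; have [|ni] := boolP (i \in _); last by rewrite !sat_upd// subrr normr0.
by move=> _; case: (sat _ _); case: (sat _ _); rewrite ?subrr ?subr0 ?sub0r ?normrN ?normr0 ?normr1.
Qed.

Lemma lsum_avg (r : R) al :
  (forall x, g x -> uniq (unzip1 (cs x)) /\ \prod_(c <- cs x) (#|c.2|%:R / #|A|%:R) = r) ->
  avgs (enum I) lsum al = #|[set x | g x]|%:R * r.
Proof.
move=> h; rewrite /lsum avgs_sum mulr_natl -sumr_const.
rewrite [RHS](eq_bigl g); last by move=> x; rewrite inE.
by apply: eq_bigr => x /h[u <-]; rewrite avgs_sat.
Qed.

Lemma lsum_mult_sum (m : nat) : (forall x, g x -> (size (cs x) <= m)%N) ->
  \sum_i lsum_mult i <= #|[set x | g x]|%:R * m%:R.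
Proof.
move=> h; rewrite -natr_sum -natrM ler_nat.
apply: (@leq_trans (\sum_i \sum_(x | g x && (i \in unzip1 (cs x))) 1)).
  by apply: leq_sum => i _; rewrite sum1dep_card.
rewrite (exchange_big_dep g)/=; last by move=> i x _ /andP[].
rewrite -sum_nat_const [leqRHS](eq_bigl g); last by move=> x; rewrite inE.
apply: leq_sum => x gx; apply: leq_trans (h x gx).
rewrite (eq_bigl (fun i => i \in unzip1 (cs x))); last by move=> i; rewrite gx.
by rewrite sum1_card -(size_map fst); exact: card_size.
Qed.

Lemma lsumE al : lsum al = #|[set x | g x && sat (cs x) al]|%:R.
Proof.
rewrite /lsum -sum1_card natr_sum (eq_bigl (fun x => g x && sat (cs x) al)); last by move=> x; rewrite inE.
by rewrite big_mkcondr/=; apply: eq_bigr => x _; case: (sat _ _).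
Qed.
End LocalSum.

Lemma sum_sqr_le (R : realType) (I : finType) (c : I -> R) (m B : R) :
  0 <= m -> (forall i, 0 <= c i <= m) -> \sum_i c i <= B -> \sum_i c i ^+ 2 <= m * B.
Proof.
move=> m0 h hB; apply: le_trans (_ : m * \sum_i c i <= _); last by rewrite ler_wpM2l.
rewrite mulr_sumr; apply: ler_sum => j _; have /andP[c0 cm] := h j.
by rewrite expr2 ler_wpM2r.
Qed.

Section Third.
Variables (V : finType) (T : {set {set V}}).
Hypothesis hT : psts T.
Implicit Types x y w : V.

(* [third y x = x] encodes that no triple contains [x] and [y]; this makes [third y] an involution. *)
Definition third y x := odflt x [pick w | [&& w != x, w != y & [set y; x; w] \in T]].
Definition tri y x := [set y; x; third y x].

Lemma thirdP y x : third y x != x ->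
  [/\ third y x != x, third y x != y, x != y & tri y x \in T].
Proof.
rewrite /tri /third; case: pickP => [w /and3P[wx wy wT]|_]; last by rewrite eqxx.
move=> _; split => //; apply: contraTneq wT => ->.
have /pstsP[c3 _] := hT; apply/negP => /c3; rewrite setUid cardsU1 cards1.
by case: (_ \in _).
Qed.

Lemma third_uniq y x t : t \in T -> y \in t -> x \in t -> x != y ->
  third y x != x /\ t = tri y x.
Proof.
move=> tT yt xt xy; have /pstsP[c3 un] := hT.
have : (0 < #|t :\ y :\ x|)%N.
  have := cardsD1 y t; rewrite yt c3// add1n => -[e1].
  by have := cardsD1 x (t :\ y); rewrite !inE xy xt -e1 add1n => -[<-].
case/card_gt0P => w; rewrite !inE => /and3P[wx wy wt].
have te : t = [set y; x; w].
  apply/esym/eqP; rewrite eqEcard !subUset !sub1set yt xt wt/= c3//.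
  by rewrite setUC cardsU1 cards2 !inE negb_or wx wy eq_sym xy.
have h : third y x != x.
  rewrite /third; case: pickP => [w' /and3P[]//|/(_ w)].
  by rewrite wx wy -te tT.
have [_ h2 _ h4] := thirdP h.
by split => //; apply: (un t _ y x) => //; rewrite ?inE ?eqxx ?orbT// eq_sym.
Qed.

Lemma third_uncov y x : x != y -> uncov T y x = (third y x == x).
Proof.
move=> xy; apply/uncovP/eqP => [[_ h]|e].
  apply/eqP; apply: contraT => /thirdP[_ _ _ tT].
  by case: (h _ tT); rewrite !inE eqxx ?orbT.
split=> [|t tT yt xt]; first by rewrite eq_sym.
by have [] := third_uniq tT yt xt xy; rewrite e eqxx.
Qed.

Lemma third_self y : third y y = y.
Proof. by apply/eqP; apply: contraT => /thirdP[_ _]; rewrite eqxx. Qed.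

Lemma thirdK y : involutive (third y).
Proof.
move=> x; have [e|h] := eqVneq (third y x) x; first by rewrite !e.
have [_ h2 xy tT] := thirdP h.
set w := third y x in h h2 *.
have yt : y \in tri y x by rewrite !inE eqxx.
have wt : w \in tri y x by rewrite !inE eqxx !orbT.
have [h3 e] := third_uniq tT yt wt h2.
have [_ h4 _ _] := thirdP h3.
have : third y w \in tri y x by rewrite e !inE eqxx orbT.
by rewrite !inE (negbTE h4)/= -/w (negbTE h3) orbF => /eqP.
Qed.

Lemma third_inj y : injective (third y).
Proof. exact: inv_inj (thirdK y). Qed.

Lemma card_third_fix y : #|[set x | third y x == x]| = (lv T y).+1.
Proof.
rewrite (cardsD1 y) !inE third_self eqxx add1n; congr _.+1; apply: eq_card => x.
rewrite !inE; have [->|xy] := eqVneq x y; first by rewrite /uncov eqxx.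
by rewrite third_uncov.
Qed.

Lemma card_tri_fiber y t : (#|[set x | tri y x == t]| <= 3)%N.
Proof.
have [/eqP->|/set0Pn[x0]] := boolP ([set x | tri y x == t] == set0); first by rewrite cards0.
rewrite inE => /eqP e0; apply: (@leq_trans #|t|).
  apply: subset_leq_card; apply/subsetP => x; rewrite inE => /eqP <-.
  by rewrite !inE eqxx orbT.
rewrite -e0 /tri; apply: leq_trans (leq_card_setU _ _) _; rewrite cards1 addn1 ltnS cards2.
by case: (_ != _).
Qed.

Section Labelling.
Variables (R : realType) (L : nat).
Local Notation I := (V + {set V})%type.
Local Notation A := ('I_4 * 'I_L.+1)%type.
Implicit Types (P Q : 'I_4) (S F : {set 'I_L.+1}) (al : {ffun I -> A}).

(** Points and triples share one alphabet, to fit a single product space: of its letter a point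
    reads only the part and a triple only the label. *)
Definition vtx x P : I * {set A} := (inl x, [set a : A | a.1 == P]).
Definition trp (t : {set V}) S : I * {set A} := (inr t, [set a : A | a.2 \in S]).

Definition part al x : 'I_4 := (al (inl x)).1.
Definition lab al (t : {set V}) : 'I_L.+1 := (al (inr t)).2.

Lemma sat_vtx x P s al : sat (vtx x P :: s) al = (part al x == P) && sat s al.
Proof. by rewrite /sat /= inE. Qed.

Lemma sat_trp t S s al : sat (trp t S :: s) al = (lab al t \in S) && sat s al.
Proof. by rewrite /sat /= inE. Qed.

Lemma ratio_vtx x P : #|(vtx x P).2|%:R / #|{: A}|%:R = 1 / 4 :> R.
Proof.
have -> : (vtx x P).2 = setX [set P] [set: 'I_L.+1].
  by apply/setP => -[a b]; rewrite !inE/= andbT.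
rewrite cardsX cards1 cardsT card_prod !card_ord mul1n natrM invfM mulrCA mulrA.
by rewrite mulfK ?mul1r// pnatr_eq0.
Qed.

Lemma ratio_trp t S : #|(trp t S).2|%:R / #|{: A}|%:R = #|S|%:R / L.+1%:R :> R.
Proof.
have -> : (trp t S).2 = setX [set: 'I_4] S.
  by apply/setP => -[a b]; rewrite !inE/=.
rewrite cardsX cardsT card_prod !card_ord !natrM invfM mulrACA divff ?mul1r//.
by rewrite pnatr_eq0.
Qed.

Definition cs_part P x := [:: vtx x P].
Definition cs_lab y S x := [:: trp (tri y x) S].
Definition cs_deg y P Q S x := [:: vtx x P; vtx (third y x) Q; trp (tri y x) S].
(** These [x] can absorb an uncovered pair [y], [z] of one part: if P and Q are distinct and differ
    from that part, then x y and x z are covered by rainbow triples with a label in [S], whose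
    removal makes room for the triple x y z. *)
Definition cs_abs y z P Q S x :=
  [:: vtx x P; vtx (third y x) Q; vtx (third z x) Q; trp (tri y x) S; trp (tri z x) S].
(** These [x] allow [y] to be exchanged for [z] in the triple of [y] and [x], which has a label in
    [F]: the two pairs that [z] needs are covered by triples labelled in [S], which will have been
    removed. *)
Definition cs_swap y z P Q S F x :=
  [:: vtx x P; vtx (third y x) Q; vtx (third z x) Q; vtx (third z (third y x)) P;
      trp (tri y x) F; trp (tri z x) S; trp (tri z (third y x)) S].
Definition cs_pair P (u : V * V) := [:: vtx u.1 P; vtx u.2 P].

Definition g_deg y x := third y x != x.
(** Uniqueness of the coordinates makes the constraints independent. The arguments [ord0] and [set0]
    are dummies, since the list of coordinates depends neither on parts nor on labels. *)
Definition g_abs y z x := uniq (unzip1 (cs_abs y z ord0 ord0 set0 x)) &&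
  (third y x != x) && (third z x != x).
Definition g_swap y z x := uniq (unzip1 (cs_swap y z ord0 ord0 set0 set0 x)) &&
  [&& third y x != x, third z x != x & third z (third y x) != third y x].

Definition n_part P := lsum R predT (cs_part P).
Definition n_lab y S := lsum R (g_deg y) (cs_lab y S).
Definition n_deg y P Q S := lsum R (g_deg y) (cs_deg y P Q S).
Definition n_abs y z P Q S := lsum R (g_abs y z) (cs_abs y z P Q S).
Definition n_swap y z P Q S F := lsum R (g_swap y z) (cs_swap y z P Q S F).
Definition n_pair P := lsum R (fun u => uncov T u.1 u.2) (cs_pair P).

Lemma avg_part P al : avgs (enum {: I}) (n_part P) al = #|V|%:R / 4.
Proof.
rewrite (@lsum_avg _ _ _ (ord0, ord0) _ _ _ (1 / 4)).
  by rewrite (_ : [set x | predT x] = [set: V]) ?cardsT ?mul1r//; apply/setP => x; rewrite !inE.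
by move=> x _; rewrite big_seq1 ratio_vtx.
Qed.

Lemma card_g_deg y : (#|[set x | g_deg y x]| + lv T y + 1 = #|V|)%N.
Proof.
rewrite -addnA addn1 -card_third_fix -(cardsC [set x | third y x == x]) addnC.
by congr (_ + _)%N; apply: eq_card => x; rewrite !inE.
Qed.

Lemma avg_lab y S al : avgs (enum {: I}) (n_lab y S) al = #|[set x | g_deg y x]|%:R * (#|S|%:R / L.+1%:R).
Proof.
by rewrite (@lsum_avg _ _ _ (ord0, ord0) _ _ _ (#|S|%:R / L.+1%:R))// => x _; rewrite big_seq1 ratio_trp.
Qed.

Lemma avg_deg y P Q S al : avgs (enum {: I}) (n_deg y P Q S) al =
  #|[set x | g_deg y x]|%:R * (#|S|%:R / L.+1%:R / 16).
Proof.
rewrite (@lsum_avg _ _ _ (ord0, ord0) _ _ _ (#|S|%:R / L.+1%:R / 16))// => x gx; split.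
  by rewrite /= !inE /= ?orbF !andbT inl_eq eq_sym.
by rewrite !big_cons big_nil !ratio_vtx ratio_trp; move: (#|S|%:R / _) => q; field.
Qed.

Lemma avg_abs y z P Q S al : avgs (enum {: I}) (n_abs y z P Q S) al =
  #|[set x | g_abs y z x]|%:R * ((#|S|%:R / L.+1%:R) ^+ 2 / 64).
Proof.
rewrite (@lsum_avg _ _ _ (ord0, ord0) _ _ _ ((#|S|%:R / L.+1%:R) ^+ 2 / 64))// => x /andP[/andP[u _] _]; split=> //.
by rewrite !big_cons big_nil !ratio_vtx !ratio_trp; move: (#|S|%:R / _) => q; field.
Qed.

Lemma avg_swap y z P Q S F al : avgs (enum {: I}) (n_swap y z P Q S F) al =
  #|[set x | g_swap y z x]|%:R * ((#|S|%:R / L.+1%:R) ^+ 2 * (#|F|%:R / L.+1%:R) / 256).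
Proof.
rewrite (@lsum_avg _ _ _ (ord0, ord0) _ _ _ ((#|S|%:R / L.+1%:R) ^+ 2 * (#|F|%:R / L.+1%:R) / 256))// => x /andP[u _]; split=> //.
by rewrite !big_cons big_nil !ratio_vtx !ratio_trp; move: (#|S|%:R / _) (#|F|%:R / _) => q q'; field.
Qed.

Lemma avg_pair P al : avgs (enum {: I}) (n_pair P) al = #|[set u : V * V | uncov T u.1 u.2]|%:R / 16.
Proof.
rewrite (@lsum_avg _ _ _ (ord0, ord0) _ _ _ (1 / 16)); first by rewrite mul1r.
move=> u /andP[u12 _]; split.
  by rewrite /= !inE !andbT.
by rewrite !big_cons big_nil !ratio_vtx; field.
Qed.

(** Two coordinates coincide only if [x] is fixed by one of the two involutions, or is [z] or the
    third point of the triple through [y] and [z]. *)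
Lemma card_g_abs y z : y != z -> (#|V| <= #|[set x | g_abs y z x]| + (lv T y + lv T z + 4))%N.
Proof.
move=> yz; rewrite -(cardsC [set x | g_abs y z x]) leq_add2l.
apply: (@leq_trans #|[set x | third y x == x] :|: [set x | third z x == x] :|: [set z; third y z]|); last first.
  have l (A B : {set V}) : (#|A :|: B| <= #|A| + #|B|)%N := leq_card_setU A B.
  apply: leq_trans (l _ _) _; apply: leq_trans (leq_add (l _ _) (leqnn _)) _; rewrite !card_third_fix.
  have : (#|[set z; third y z]| <= 2)%N by rewrite cards2; case: (_ != _).
  lia.
apply: subset_leq_card; apply/subsetP => x; rewrite !inE.
apply: contraR; rewrite !negb_or => /andP[/andP[h1 h2] /andP[xz yx]].
have [a1 a2 a3 a4] := thirdP h1; have [b1 b2 b3 b4] := thirdP h2.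
have /pstsP[_ un] := hT.
have e1 : third y x != third z x.
  apply: contraNneq yx => e; have e' : tri y x = tri z x.
    apply: (un _ _ x (third y x) a4 b4); rewrite 1?eq_sym//; first by rewrite !inE eqxx orbT.
    - by rewrite !inE eqxx !orbT.
    - by rewrite !inE eqxx orbT.
    - by rewrite e !inE eqxx !orbT.
  have : z \in tri y x by rewrite e' !inE eqxx.
  rewrite !inE eq_sym (negbTE yz) [z == x]eq_sym (negbTE xz)/= => /eqP ez.
  by rewrite -[x](thirdK y) -ez.
have e2 : tri y x != tri z x.
  apply/negP => /eqP e'; have : third y x \in tri z x by rewrite -e' !inE eqxx !orbT.
  rewrite !inE (negbTE e1) orbF => /orP[/eqP ez|/eqP ez]; last by rewrite ez eqxx in a1.
  by case/negP: yx; rewrite -[x](thirdK y) ez.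
rewrite /g_abs h1 h2 !andbT /= !inE !negb_or !andbT.
rewrite !inl_eq !inr_eq.
by rewrite e1 e2 ![x == third _ _]eq_sym h1 h2.
Qed.

Lemma card_g_swap y z : y != z -> (#|V| <= #|[set x | g_swap y z x]| + (lv T y + 2 * lv T z + 5))%N.
Proof.
move=> yz; rewrite -(cardsC [set x | g_swap y z x]) leq_add2l.
apply: (@leq_trans #|[set x | third y x == x] :|: [set x | third z x == x] :|: (third y @^-1: [set x | third z x == x]) :|: [set z; third y z]|); last first.
  have l (A B : {set V}) : (#|A :|: B| <= #|A| + #|B|)%N := leq_card_setU A B.
  apply: leq_trans (l _ _) _; apply: leq_trans (leq_add (l _ _) (leqnn _)) _.
  apply: leq_trans (leq_add (leq_add (l _ _) (leqnn _)) (leqnn _)) _.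
  have -> : #|third y @^-1: [set x | third z x == x]| = (lv T z).+1.
    rewrite -card_third_fix on_card_preimset//; exists (third y) => x _; exact: thirdK.
  rewrite !card_third_fix.
  have : (#|[set z; third y z]| <= 2)%N by rewrite cards2; case: (_ != _).
  lia.
apply: subset_leq_card; apply/subsetP => x; rewrite !inE.
apply: contraR; rewrite !negb_or => /andP[/andP[/andP[h1 h2] h3] /andP[xz yx]].
have [a1 a2 a3 a4] := thirdP h1; have [b1 b2 b3 b4] := thirdP h2; have [c1 c2 c3 c4] := thirdP h3.
have /pstsP[_ un] := hT.
set w := third y x in h3 a1 a2 c1 c2 c3 c4 *.
set u := third z x in b1 b2 *; set u' := third z w in c1 c2 *.
have zt : z \notin tri y x.
  by rewrite !inE !negb_or eq_sym yz [z == x]eq_sym xz eq_sym c3.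
have e1 : w != u.
  apply/negP => /eqP e; have e' : tri y x = tri z x.
    apply: (un _ _ x w a4 b4); rewrite 1?eq_sym//; first by rewrite !inE eqxx orbT.
    - by rewrite !inE eqxx !orbT.
    - by rewrite !inE eqxx orbT.
    - by rewrite e !inE eqxx !orbT.
  by case/negP: zt; rewrite e' !inE eqxx.
have wt : w \notin tri z x by rewrite !inE !negb_or c3 a1 -/u e1.
have e2 : tri y x != tri z x by apply/negP => /eqP e; case/negP: zt; rewrite e !inE eqxx.
have e3 : tri y x != tri z w by apply/negP => /eqP e; case/negP: zt; rewrite e !inE eqxx.
have e4 : tri z x != tri z w.
  by apply/negP => /eqP e; case/negP: wt; rewrite e !inE eqxx orbT.
have e5 : u != u'.
  by apply/negP => /eqP /(third_inj) e; rewrite e eqxx in a1.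
have e6 : x != u'.
  apply/negP => /eqP e; case/negP: e1; rewrite /u e /u' thirdK.
  by [].
rewrite /g_swap h1 h2 h3 !andbT /= !inE !negb_or !andbT.
rewrite !inl_eq !inr_eq.
rewrite -/w -/u -/u' e1 e2 e3 e4 e5 e6.
by rewrite [x == w]eq_sym a1 [x == u]eq_sym b1 [w == u']eq_sym c1.
Qed.

(** One pair of constants serves all statistics; both come from [cs_swap]: seven constraints for
    each point, and a triple occurs in each of three of them for at most three points. *)
Definition bdd (F : {ffun I -> A} -> R) := exists c : I -> R,
  [/\ bdiff F c, forall i, 0 <= c i <= 9 & \sum_i c i <= 7 * #|V|%:R].

Lemma lsum_bdd (X : finType) (g : pred X) (cs : X -> seq (I * {set A})) m :
  (m <= 7)%N -> (#|X| <= #|V|)%N -> (forall x : X, g x -> (size (cs x) <= m)%N) ->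
  (forall i, (#|[set x | g x && (i \in unzip1 (cs x))]| <= 9)%N) -> bdd (lsum R g cs).
Proof.
move=> m7 XV hs h9; exists (lsum_mult R g cs); split=> [|i|].
- exact: lsum_bdiff.
- by rewrite ler0n /lsum_mult ler_nat h9.
apply: le_trans (lsum_mult_sum _ hs) _; rewrite mulrC -natrM -natrM ler_nat.
by apply: leq_mul => //; apply: leq_trans XV; exact: max_card.
Qed.

Lemma card_fiber_inj (f : V -> V) (i : V) : injective f -> (#|[set x | f x == i]| <= 1)%N.
Proof.
move=> fi; apply/card_le1_eqP => x x'; rewrite !inE => /eqP e /eqP e'.
by apply: fi; rewrite e e'.
Qed.

Lemma card_tri_fiber_comp y z (t : {set V}) : (#|[set x | tri z (third y x) == t]| <= 3)%N.
Proof.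
apply: leq_trans (card_tri_fiber z t); rewrite -(card_imset _ (@third_inj y)).
by apply: subset_leq_card; apply/subsetP => u /imsetP[x]; rewrite inE => h ->; rewrite inE.
Qed.

Lemma card_or (p q : pred V) (a b : nat) :
  (#|[set x | p x]| <= a)%N -> (#|[set x | q x]| <= b)%N -> (#|[set x | p x || q x]| <= a + b)%N.
Proof.
move=> ha hb; apply: leq_trans (leq_add ha hb); apply: leq_trans (leq_card_setU _ _).
by apply: subset_leq_card; apply/subsetP => x; rewrite !inE.
Qed.

Lemma bdd_part P : bdd (n_part P).
Proof.
apply: (@lsum_bdd _ _ _ 1) => // -[u|t].
  apply: (@leq_trans 1) => //; apply: leq_trans (card_fiber_inj u (@inj_id V)).
  by apply: subset_leq_card; apply/subsetP => x; rewrite !inE /= inl_eq eq_sym.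
by rewrite (_ : [set x | _] = set0) ?cards0//; apply/setP => x; rewrite !inE.
Qed.

Lemma bdd_lab y S : bdd (n_lab y S).
Proof.
apply: (@lsum_bdd _ _ _ 1) => // -[u|t].
  by rewrite (_ : [set x | _] = set0) ?cards0//; apply/setP => x; rewrite !inE andbF.
apply: (@leq_trans 3) => //; apply: leq_trans (card_tri_fiber y t).
by apply: subset_leq_card; apply/subsetP => x; rewrite !inE /= inr_eq [t == _]eq_sym => /andP[].
Qed.

Lemma bdd_deg y P Q S : bdd (n_deg y P Q S).
Proof.
apply: (@lsum_bdd _ _ _ 3) => // -[u|t].
  apply: (@leq_trans (1 + 1)) => //.
  apply: leq_trans (card_or (card_fiber_inj u (@inj_id V)) (card_fiber_inj u (@third_inj y))).
  by apply: subset_leq_card; apply/subsetP => x; rewrite !inE /= !inl_eq !(eq_sym u) orbF => /andP[].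
apply: (@leq_trans 3) => //; apply: leq_trans (card_tri_fiber y t).
by apply: subset_leq_card; apply/subsetP => x; rewrite !inE /= inr_eq [t == _]eq_sym => /andP[].
Qed.

Lemma bdd_abs y z P Q S : bdd (n_abs y z P Q S).
Proof.
apply: (@lsum_bdd _ _ _ 5) => // -[u|t].
  apply: (@leq_trans (1 + (1 + 1))) => //.
  apply: leq_trans (card_or (card_fiber_inj u (@inj_id V)) (card_or (card_fiber_inj u (@third_inj y)) (card_fiber_inj u (@third_inj z)))).
  by apply: subset_leq_card; apply/subsetP => x; rewrite !inE /= !inl_eq !(eq_sym u) orbF => /andP[].
apply: (@leq_trans (3 + 3)) => //.
apply: leq_trans (card_or (card_tri_fiber y t) (card_tri_fiber z t)).
by apply: subset_leq_card; apply/subsetP => x; rewrite !inE /= !inr_eq !(eq_sym t) ?orbF => /andP[].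
Qed.

Lemma bdd_swap y z P Q S F : bdd (n_swap y z P Q S F).
Proof.
apply: (@lsum_bdd _ _ _ 7) => // -[u|t].
  apply: (@leq_trans (1 + (1 + (1 + 1)))) => //.
  have inj2 : injective (third z \o third y) by apply: inj_comp; exact: third_inj.
  apply: leq_trans (card_or (card_fiber_inj u (@inj_id V)) (card_or (card_fiber_inj u (@third_inj y))
    (card_or (card_fiber_inj u (@third_inj z)) (card_fiber_inj u inj2)))).
  by apply: subset_leq_card; apply/subsetP => x; rewrite !inE /= !inl_eq !(eq_sym u) orbF => /andP[].
apply: (@leq_trans (3 + (3 + 3))) => //.
apply: leq_trans (card_or (card_tri_fiber y t) (card_or (card_tri_fiber z t) (card_tri_fiber_comp y z t))).
by apply: subset_leq_card; apply/subsetP => x; rewrite !inE /= !inr_eq !(eq_sym t) ?orbF => /andP[].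
Qed.

Section Balance.
Variables (Delta v : nat).
Hypothesis lvT : forall x, (lv T x <= Delta)%N.
Hypothesis cV : #|V| = (4 * v)%N.

Lemma card_uncov_pairs : (#|[set u : V * V | uncov T u.1 u.2]| = \sum_x lv T x)%N.
Proof.
rewrite -sum1_card (eq_bigl (fun u : V * V => uncov T u.1 u.2)); last by move=> u; rewrite inE.
rewrite -(pair_big_dep predT (uncov T) (fun _ _ => 1%N)) /=.
by apply: eq_bigr => x _; rewrite sum1dep_card.
Qed.

(* Rescaled by the maximal leave degree so that all the statistics share one Lipschitz constant. *)
Definition n_pair' P al : R := (Delta.+1%:R)^-1 * n_pair P al.

Lemma bdd_pair P : bdd (n_pair' P).
Proof.
have D0 : 0 < Delta.+1%:R :> R by rewrite ltr0n.
pose c i : R := (Delta.+1%:R)^-1 * lsum_mult R (fun u : V * V => uncov T u.1 u.2) (cs_pair P) i.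
exists c; split=> [i al a b|i|].
- rewrite /n_pair' -mulrBr normrM gtr0_norm ?invr_gt0// /c ler_pM2l ?invr_gt0//.
  exact: lsum_bdiff.
- rewrite /c /lsum_mult mulr_ge0 ?invr_ge0 ?(ltW D0)//= ler_pdivrMl// -natrM ler_nat.
  case: i => [u|t]; last first.
    by rewrite (_ : [set x | _] = set0) ?cards0//; apply/setP => x; rewrite !inE andbF.
  apply: (@leq_trans #|setX [set u] [set x | uncov T u x] :|: setX [set x | uncov T u x] [set u]|).
    apply: subset_leq_card; apply/subsetP => -[x y]; rewrite !inE /= !inl_eq !(eq_sym u) ?orbF.
    case/andP => xy /orP[]/eqP e; rewrite -e eqxx ?xy ?andbT//.
    by rewrite uncovC xy orbT.
  have l (A B : {set V * V}) : (#|A :|: B| <= #|A| + #|B|)%N := leq_card_setU A B.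
  apply: leq_trans (l _ _) _; rewrite !cardsX cards1 mul1n muln1.
  have := lvT u; rewrite /lv; lia.
rewrite /c -mulr_sumr ler_pdivrMl//.
apply: le_trans (lsum_mult_sum (m := 2) _ _) _ => //.
rewrite card_uncov_pairs -!natrM ler_nat.
have : (\sum_x lv T x <= \sum_(x : V) Delta)%N by apply: leq_sum.
rewrite sum_nat_const cardT -cardE => h.
nia.
Qed.

(** Random parts have size v only approximately. A point is moved from a part that is too large to
    one that is too small; this changes one coordinate, hence every statistic by at most 9, and
    lowers the total excess by one. *)
Lemma balance k al : (\sum_P (#|[set x | part al x == P]| - v) <= k)%N ->
  exists be, [/\ forall P, #|[set x | part be x == P]| = v,
    forall t, lab be t = lab al t &
    forall G : {ffun I -> A} -> R, bdd G -> `|G be - G al| <= 9 * k%:R].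
Proof.
elim: k al => [|k IH] al hk.
  have le P : (#|[set x | part al x == P]| <= v)%N.
    by move: hk; rewrite (bigD1 P)//=; lia.
  exists al; split=> // [P|G _]; last by rewrite subrr normr0 mulr0.
  have : (\sum_P #|[set x | part al x == P]| = \sum_(P : 'I_4) v)%N.
    rewrite sum_nat_const card_ord -cV -sum1_card (partition_big (part al) predT)//=.
    by apply: eq_bigr => Q _; rewrite sum1dep_card.
  rewrite (bigD1 P)//= [RHS](bigD1 P)//= => h.
  have : (\sum_(Q | Q != P) #|[set x | part al x == Q]| <= \sum_(Q : 'I_4 | Q != P) v)%N by apply: leq_sum.
  by move=> hs; apply/eqP; rewrite eqn_leq le/= -(leq_add2r (\sum_(Q : 'I_4 | Q != P) v)) -h leq_add2l.
have [h0|] := leqP (\sum_P (#|[set x | part al x == P]| - v)) k.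
  have [be [h1 h2 h3]] := IH al h0; exists be; split=> // G /h3 h; apply: le_trans h _.
  by rewrite ler_pM2l// ler_nat.
move=> hk'.
have tot : (\sum_P #|[set x | part al x == P]| = \sum_(P : 'I_4) v)%N.
  rewrite sum_nat_const card_ord -cV -sum1_card (partition_big (part al) predT)//=.
  by apply: eq_bigr => Q _; rewrite sum1dep_card.
have [P hP] : exists P, (v < #|[set x | part al x == P]|)%N.
  apply/existsP; apply: contraLR hk'; rewrite negb_exists => /forallP h.
  by rewrite -leqNgt big1// => P _; apply/eqP; rewrite subn_eq0 leqNgt.
have [Q hQ] : exists Q, (#|[set x | part al x == Q]| < v)%N.
  apply/existsP; apply: contraT; rewrite negb_exists => /forallP h.
  move: tot; rewrite (bigD1 P)//= [RHS](bigD1 P)//=.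
  have : (\sum_(Q : 'I_4 | Q != P) v <= \sum_(Q | Q != P) #|[set x | part al x == Q]|)%N.
    by apply: leq_sum => Q _; rewrite leqNgt.
  by move=> h1 h2; have := leq_add hP h1; rewrite h2 addSn ltnn.
have [x] : exists x, x \in [set x | part al x == P] by apply/card_gt0P; lia.
rewrite inE => /eqP xP.
have PQ : P != Q by apply: contraTneq hP => ->; lia.
pose al' := upd al (inl x) (Q, (al (inl x)).2).
have pe z : part al' z = if z == x then Q else part al z.
  by rewrite /part /al' ffunE inl_eq; case: eqP.
have le t : lab al' t = lab al t by rewrite /lab /al' ffunE.
have QP : (Q == P) = false by rewrite eq_sym (negbTE PQ).
have sP : (#|[set z | part al' z == P]| + 1 = #|[set z | part al z == P]|)%N.
  rewrite [RHS](cardsD1 x) inE xP eqxx addnC; congr (_ + _)%N; apply: eq_card => z.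
  by rewrite !inE pe; case: (z == x); rewrite /= ?QP.
have sQ : (#|[set z | part al' z == Q]| = #|[set z | part al z == Q]| + 1)%N.
  rewrite [LHS](cardsD1 x) inE pe eqxx eqxx addnC; congr (_ + _)%N; apply: eq_card => z.
  by rewrite !inE pe; case: (eqVneq z x) => [->|//]; rewrite xP (negbTE PQ).
have sO W : W != P -> W != Q -> #|[set z | part al' z == W]| = #|[set z | part al z == W]|.
  move=> WP WQ; apply: eq_card => z; rewrite !inE pe; case: (eqVneq z x) => [->|//].
  by rewrite xP ![_ == W]eq_sym (negbTE WQ) (negbTE WP).
have [|be [h1 h2 h3]] := IH al'.
  move: hk; rewrite (bigD1 P)//= (bigD1 Q) 1?eq_sym//=.
  rewrite [X in _ -> (X <= k)%N](bigD1 P)//= [X in _ -> (_ + X <= k)%N](bigD1 Q) 1?eq_sym//=.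
  set S := (X in (_ + (_ + X) <= k.+1)%N); rewrite [X in _ -> (_ + (_ + X) <= k)%N](_ : _ = S).
    by clearbody S; lia.
  by apply: eq_bigr => W /andP[WP WQ]; rewrite sO.
exists be; split=> // [t|G bG]; first by rewrite h2.
have [c [bc c9 _]] := bG.
have h4 : `|G al' - G al| <= 9.
  have -> : al = upd al (inl x) (al (inl x)) by apply/ffunP => i; rewrite ffunE; case: eqP => [->|].
  by apply: le_trans (bc (inl x) al _ _) _; have /andP[] := c9 (inl x).
have -> : G be - G al = (G be - G al') + (G al' - G al) by ring.
apply: le_trans (ler_normD _ _) _.
by have h5 := h3 _ bG; rewrite -[k.+1%:R]natr1; lra.
Qed.

Section GoodLabelling.
Variables (SR SX SF : {set 'I_L.+1}).
Local Notation J := ('I_4 + V + (bool * V * 'I_4 * 'I_4) + (V * V * 'I_4 * 'I_4) + (V * V * 'I_4 * 'I_4) + 'I_4)%type.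
Local Notation omega := {ffun I -> A}.

Let rR : R := #|SR|%:R / L.+1%:R.
Let rX : R := #|SX|%:R / L.+1%:R.
Let rF : R := #|SF|%:R / L.+1%:R.

Definition stat (j : J) : omega -> R :=
  match j with
  | inl (inl (inl (inl (inl P)))) => n_part P
  | inl (inl (inl (inl (inr y)))) => n_lab y SX
  | inl (inl (inl (inr (b, y, P, Q)))) => n_deg y P Q (if b then SR else SX)
  | inl (inl (inr (y, z, P, Q))) => n_abs y z P Q SR
  | inl (inr (y, z, P, Q)) => n_swap y z P Q SR SF
  | inr P => n_pair' P
  end.

Definition stat_mean (j : J) : R :=
  match j with
  | inl (inl (inl (inl (inl P)))) => #|V|%:R / 4
  | inl (inl (inl (inl (inr y)))) => #|[set x | g_deg y x]|%:R * rX
  | inl (inl (inl (inr (b, y, P, Q)))) => #|[set x | g_deg y x]|%:R * ((if b then rR else rX) / 16)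
  | inl (inl (inr (y, z, P, Q))) => #|[set x | g_abs y z x]|%:R * (rR ^+ 2 / 64)
  | inl (inr (y, z, P, Q)) => #|[set x | g_swap y z x]|%:R * (rR ^+ 2 * rF / 256)
  | inr P => (Delta.+1%:R)^-1 * (#|[set u : V * V | uncov T u.1 u.2]|%:R / 16)
  end.

Lemma stat_bdd j : bdd (stat j).
Proof.
case: j => [[[[[P|y]|[[[b y] P] Q]]|[[[y z] P] Q]]|[[[y z] P] Q]]|P] /=.
- exact: bdd_part.
- exact: bdd_lab.
- exact: bdd_deg.
- exact: bdd_abs.
- exact: bdd_swap.
- exact: bdd_pair.
Qed.

Lemma stat_avg j al : avgs (enum {: I}) (stat j) al = stat_mean j.
Proof.
case: j => [[[[[P|y]|[[[b y] P] Q]]|[[[y z] P] Q]]|[[[y z] P] Q]]|P] /=.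
- exact: avg_part.
- exact: avg_lab.
- by rewrite avg_deg; case: b.
- exact: avg_abs.
- exact: avg_swap.
- by rewrite avgs_scale avg_pair.
Qed.

(** There are 8 + 33 n + 32 n^2 statistics, each with two signs, whence 200 n^2; 63 = 9 * 7 bounds
    the sum of squared Lipschitz constants per point. The excesses of the four parts are at most t
    each, so k >= 4 t moves balance them. *)
Lemma good_labelling (s t : R) (k : nat) :
  0 < s -> s * 9 <= 1 / 2 -> 4 * t <= k%:R -> (0 < v)%N ->
  200 * #|V|%:R ^+ 2 * expR (s ^+ 2 * (63 * #|V|%:R) - s * t) < 1 ->
  exists al, (forall P, #|[set x | part al x == P]| = v) /\
    forall j, `|stat j al - stat_mean j| <= t + 9 * k%:R.
Proof.
move=> s0 s9 tk v0 hlt.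
have [c hc] := @fin_all_exists J (fun=> I -> R) (fun j c =>
  [/\ bdiff (stat j) c, forall i, 0 <= c i <= 9 & \sum_i c i <= 7 * #|V|%:R]) stat_bdd.
pose F (j : bool * J) al := if j.1 then stat j.2 al else - stat j.2 al.
have [||||||al hal] := @avoid_deviations R _ _ (ord0, ord0) (bool * J)%type F (fun j => c j.2)
    (fun j => if j.1 then stat_mean j.2 else - stat_mean j.2) s t (63 * #|V|%:R).
- move=> [b j] i al x y; rewrite /F /=; have [hb _ _] := hc j; case: b; first exact: hb.
  by rewrite -opprD normrN; exact: hb.
- move=> [b j] al; rewrite /F /=; case: b; first by rewrite stat_avg.
  have -> : avgs (enum {: I}) (fun al0 => - stat j al0) al = avgs (enum {: I}) (fun al => -1 * stat j al) al.
    by apply: (avgs_eq (ord0, ord0)) => be; rewrite mulN1r.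
  by rewrite avgs_scale stat_avg mulN1r.
- move=> [b j] /=; have [_ h1 h2] := hc j.
  by apply: le_trans (sum_sqr_le _ h1 h2) _ => //; lra.
- by [].
- by move=> [b j] i /=; have [_ h1 _] := hc j; have /andP[_ h] := h1 i; apply: le_trans s9; rewrite ler_pM2l.
- apply: le_lt_trans hlt; rewrite ler_wpM2r ?expR_ge0//.
  rewrite -natrX -natrM ler_nat !card_prod !card_sum !card_prod card_bool !card_ord.
  have : (0 < #|V|)%N by rewrite cV muln_gt0 v0.
  move: #|V| => m m0; nia.
have hd j : `|stat j al - stat_mean j| <= t.
  have h1 := hal (true, j); have h2 := hal (false, j); rewrite /F /= in h1 h2.
  by rewrite ler_norml; apply/andP; split; lra.
have [|be [b1 _ b3]] := @balance k al.
  have h4 P : ((#|[set x | part al x == P]| - v)%N%:R : R) <= t.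
    have := hd (inl (inl (inl (inl (inl P))))) => /=; rewrite /n_part lsumE cV natrM.
    rewrite (_ : [set x | _] = [set x | part al x == P]); last first.
      by apply/setP => x; rewrite !inE /cs_part sat_vtx /= andbT.
    move=> h; have t0 : 0 <= t := le_trans (normr_ge0 _) h.
    have [le|/ltnW le] := leqP #|[set x | part al x == P]| v; first by move: le; rewrite -subn_eq0 => /eqP ->.
    rewrite natrB//; apply: le_trans h; apply: le_trans (ler_norm _).
    by rewrite lerD2l lerN2 le_eqVlt; apply/orP; left; apply/eqP; field.
  rewrite -(ler_nat R) natr_sum; apply: le_trans tk.
  apply: le_trans (ler_sum _ (fun P _ => h4 P)) _.
  by rewrite sumr_const card_ord -[_ *+ _]mulr_natl.
exists be; split=> // j.
have -> : stat j be - stat_mean j = (stat j be - stat j al) + (stat j al - stat_mean j) by ring.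
apply: le_trans (ler_normD _ _) _; rewrite addrC lerD//.
exact: b3 (stat_bdd j).
Qed.
End GoodLabelling.
End Balance.
End Labelling.
End Third.

(** * Greedy choice with bounded load *)

Lemma leq_card_bigcup (I T : finType) (A : {set I}) (F : I -> {set T}) :
  (#|\bigcup_(i in A) F i| <= \sum_(i in A) #|F i|)%N.
Proof.
elim/big_rec2: _ => [|i n B _ h]; first by rewrite cards0.
by apply: leq_trans (leq_card_setU _ _) _; rewrite leq_add2l.
Qed.

Section GreedyChoice.
Variables (J X W : finType) (opt : J -> {set X}) (ld : J -> X -> W -> bool).
Variables (conf : J -> X -> J -> X -> bool) (cap Bc Sb : nat).
Implicit Types (s : seq J) (f : J -> X).

Definition load s f w := count (fun j => ld j (f j) w) s.

(** One of the two directions suffices: a real clash between two choices will be a conflict in both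
    directions. So the later choice only has to avoid its own direction. *)
Definition valid s f := [/\ forall j, j \in s -> f j \in opt j,
  forall w, (load s f w <= cap)%N &
  forall j j', j \in s -> j' \in s -> j != j' ->
    ~~ conf j (f j) j' (f j') || ~~ conf j' (f j') j (f j)].

Lemma eq_load s f f' w : {in s, f =1 f'} -> load s f w = load s f' w.
Proof. by move=> h; apply: eq_in_count => j js; rewrite h. Qed.

(** Choices are made one by one. At most [Bc] options conflict with earlier choices. Every choice
    loads at most two targets, so at most 2 |s| / cap targets are saturated, and each of them
    excludes at most two options: in total at most [Sb]. *)
Lemma greedy_choice s :
  uniq s ->
  (forall j x, x \in opt j -> (#|[set w | ld j x w]| <= 2)%N) ->
  (forall j w, (#|[set x in opt j | ld j x w]| <= 2)%N) ->
  (forall s' f j, uniq s' -> {subset s' <= s} -> j \in s -> valid s' f ->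
    (#|[set x in opt j | has (fun j' => conf j x j' (f j')) s']| <= Bc)%N) ->
  (4 * size s <= cap * Sb)%N -> (0 < cap)%N ->
  (forall j, j \in s -> (Bc + Sb < #|opt j|)%N) ->
  (0 < #|X|)%N ->
  exists f, valid s f.
Proof.
move=> us h1 h2 h3 h4 c0 h5 /card_gt0P[x0 _].
suff: forall s', uniq s' -> {subset s' <= s} -> exists f, valid s' f by move=> /(_ s us); apply.
elim=> [|j s' IH] /=; first by exists (fun=> x0); split.
move=> /andP[js us'] sub; have [|f vf] := IH us'; first by move=> i is'; apply: sub; rewrite inE is' orbT.
have jS : j \in s by apply: sub; rewrite inE eqxx.
have sub' : {subset s' <= s} by move=> i is'; apply: sub; rewrite inE is' orbT.
have [v1 v2 v3] := vf.
pose sat := [set w | (cap <= load s' f w)%N].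
have hsat : (2 * #|sat| <= Sb)%N.
  rewrite -(leq_pmul2l c0); apply: leq_trans h4.
  have : (#|sat| * cap <= 2 * size s')%N.
    rewrite -sum_nat_const; apply: (@leq_trans (\sum_(w in sat) load s' f w)).
      by apply: leq_sum => w; rewrite inE.
    apply: (@leq_trans (\sum_w load s' f w)); first by rewrite [leqRHS](bigID (mem sat))/= leq_addr.
    rewrite /load; under eq_bigr do rewrite -sum1_count.
    rewrite (exchange_big_dep predT)//= -sum1_size big_distrr/=.
    rewrite !big_seq; apply: leq_sum => i is'.
    by rewrite sum1dep_card muln1; apply: h1; exact: v1.
  have : (size s' <= size s)%N by apply: uniq_leq_size.
  lia.
have [x xo] : exists x, x \in opt j :\: ([set x in opt j | has (fun j' => conf j x j' (f j')) s'] :|: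
    \bigcup_(w in sat) [set x in opt j | ld j x w]).
  apply/card_gt0P; rewrite cardsD subn_gt0; apply: leq_ltn_trans (h5 j jS).
  apply: leq_trans (subset_leq_card (subsetIr _ _)) _.
  apply: leq_trans (leq_card_setU _ _) _; apply: leq_add; first exact: h3.
  apply: leq_trans hsat; rewrite mulnC -sum_nat_const.
  apply: leq_trans (leq_card_bigcup _ _) _.
  by apply: leq_sum.
move: xo; rewrite !inE negb_or => /andP[/andP[xc xs] xo].
rewrite xo/= in xc.
pose f' i := if i == j then x else f i.
have ff : {in s', f' =1 f} by move=> i is'; rewrite /f'; case: eqP => // e; rewrite e (negbTE js) in is'.
have fj : f' j = x by rewrite /f' eqxx.
exists f'; split=> [i|w|i i'].
- by rewrite inE => /orP[/eqP ->|is']; rewrite ?fj// ff// v1.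
- rewrite /load /= fj -/(load s' f' w) (eq_load w ff).
  case e : (ld j x w) => /=; last by rewrite add0n.
  rewrite add1n ltnNge; apply: contra xs => hw; apply/bigcupP; exists w; first by rewrite inE.
  by rewrite inE xo.
- rewrite !inE => /orP[/eqP ->|is'] /orP[/eqP ->|is''].
  + by rewrite eqxx.
  + move=> _; rewrite fj ff//; apply/orP; left; apply: contra xc => hc; apply/hasP.
    by exists i'.
  + move=> _; rewrite fj ff//; apply/orP; right; apply: contra xc => hc; apply/hasP.
    by exists i.
  + by move=> ii; rewrite !ff//; exact: v3.
Qed.
End GreedyChoice.

(* The halves are [{0, 1}] and [{2, 3}]: type 0 is within a part, type 1 between the two parts of a half,
   type 2 between the halves. *)
Definition ptype (i j : 'I_4) : nat :=
  if i == j then 0%N else if (1 < i)%N == (1 < j)%N then 1%N else 2%N.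

Lemma ptypeC i j : ptype i j = ptype j i.
Proof. by rewrite /ptype eq_sym [((1 < i)%N == _)]eq_sym. Qed.

Lemma ptype0 i j : (ptype i j == 0%N) = (i == j).
Proof. by rewrite /ptype; case: (i == j) => //; case: ((1 < i)%N == (1 < j)%N). Qed.

Lemma ptype_le2 i j : (ptype i j <= 2)%N.
Proof. by rewrite /ptype; case: ifP => // _; case: ifP. Qed.

Lemma ptype11 i j k : ptype i j = 1%N -> ptype i k = 1%N -> j = k.
Proof.
move=> h1 h2; apply/val_inj; move: i j k h1 h2.
by do 3!(case=> [[|[|[|[|]]]]// ?]).
Qed.

(** * Degrees of the leave, counted by type of pair *)

Section Degrees.
Variables (V : finType) (part : V -> 'I_4).
Implicit Types (S T : {set {set V}}) (t : {set V}) (x y u w a b : V) (c : nat).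

Definition vtype x y := ptype (part x) (part y).

Lemma vtypeC x y : vtype x y = vtype y x. Proof. exact: ptypeC. Qed.

Definition nbr c t y := #|[set u in t | [&& y \in t, u != y & vtype y u == c]]|.
Definition cov c S y := (\sum_(t in S) nbr c t y)%N.
Definition ndeg c S y := #|[set u | uncov S y u && (vtype y u == c)]|.
Definition ntot c y := #|[set u | (u != y) && (vtype y u == c)]|.

Lemma nbr_notin c t y : y \notin t -> nbr c t y = 0%N.
Proof. by move=> /negbTE h; apply: eq_card0 => u; rewrite !inE h andbF. Qed.

(** No pair is covered twice, so [cov] counts each covered partner of [y] once. Questions about
    degrees thus become additive over triples. *)
Lemma ndeg_cov c S y : psts S -> (ndeg c S y + cov c S y = ntot c y)%N.
Proof.
move=> /pstsP[c3 un]; rewrite /ntot -(cardsID [set u | uncov S y u]); congr (_ + _)%N.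
  apply: eq_card => u; rewrite !inE; have [uy|nuy] := boolP (uncov S y u); last by rewrite andbF.
  have uy' : u != y by case/uncovP: uy => yu _; rewrite eq_sym.
  by rewrite uy' andbT.
rewrite /cov /nbr; under eq_bigr => t _ do rewrite -sum1_card.
rewrite (exchange_big_dep (fun u => (u \in [set u | (u != y) && (vtype y u == c)] :\: [set u | uncov S y u])))/=.
  rewrite -sum1_card; apply: eq_bigr => u; rewrite !inE => /and3P[nu uy tu].
  have [t [tS yt ut]] : exists t, [/\ t \in S, y \in t & u \in t].
    move: nu; rewrite /uncov eq_sym uy/= => /forall_inPn[t tS]; rewrite negbK => /andP[yt ut].
    by exists t.
  rewrite (big_pred1 t) // => t'; rewrite !inE; apply/idP/eqP => [/andP[t'S /and4P[ut' yt' _ _]]|->].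
    by apply: (un _ _ y u) => //; rewrite eq_sym.
  by rewrite tS yt ut uy tu.
move=> t u tS; rewrite !inE => /and4P[ut yt -> ->]; rewrite !andbT.
by apply/uncovP => -[_ /(_ t tS yt ut)].
Qed.

Lemma covU c S T y : [disjoint S & T] -> cov c (S :|: T) y = (cov c S y + cov c T y)%N.
Proof. by move=> d; rewrite /cov -bigU//; apply: eq_bigl => t; rewrite inE. Qed.

Lemma covD c S T y : T \subset S -> (cov c (S :\: T) y + cov c T y = cov c S y)%N.
Proof.
move=> TS; rewrite /cov [RHS](big_setID T)/= addnC; congr (_ + _)%N.
by apply: eq_bigl => t; rewrite (setIidPr TS).
Qed.

Lemma cov_imset (J : finType) (s : {set J}) (f : J -> {set V}) c y : {in s &, injective f} ->
  cov c [set f j | j in s] y = (\sum_(j in s) nbr c (f j) y)%N.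
Proof. by move=> fi; rewrite /cov big_imset. Qed.

Lemma nbr3 a b d c : a != b -> a != d -> b != d ->
  nbr c [set a; b; d] a = ((vtype a b == c) + (vtype a d == c))%N.
Proof.
move=> ab ad bd; rewrite /nbr -!sum1_card big_mkcond/= (bigD1 a)//= (bigD1 b) 1?eq_sym//= (bigD1 d)/=; last by rewrite eq_sym ad eq_sym bd.
rewrite big1 => [|u /andP[/andP[ua ub] ud]]; last by rewrite !inE (negbTE ua) (negbTE ub) (negbTE ud).
rewrite !inE !eqxx !orbT /= [b == a]eq_sym ab [d == a]eq_sym ad /= addn0 add0n.
by rewrite [c == _]eq_sym; case: (vtype a b == c); case: (vtype a d == c).
Qed.

Lemma nbr_le2 c t y : #|t| = 3%N -> (nbr c t y <= 2)%N.
Proof.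
move=> t3; have [yt|/nbr_notin ->//] := boolP (y \in t).
have := cardsD1 y t; rewrite yt t3 add1n => -[->]; apply: subset_leq_card.
by apply/subsetP => u; rewrite !inE => /and4P[-> _ -> _].
Qed.

Definition rainbow t := [forall x in t, forall y in t, (x != y) ==> (part x != part y)].

Lemma rainbowP t : reflect (forall x y, x \in t -> y \in t -> x != y -> part x != part y) (rainbow t).
Proof.
apply: (iffP forall_inP) => [h x y xt yt xy|h x xt]; last first.
  by apply/forall_inP => y yt; apply/implyP; exact: h.
by have /forall_inP/(_ y yt)/implyP/(_ xy) := h x xt.
Qed.

(** Three distinct parts are one full half and one part of the other half. The point in the latter,
    the apex, has no partner of type 1; the others have one each. *)
Lemma rainbow_nbr t y : rainbow t -> #|t| = 3%N -> y \in t ->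
  [/\ nbr 0 t y = 0%N, (nbr 1 t y <= 1)%N & (nbr 1 t y + nbr 2 t y = 2)%N].
Proof.
move=> /rainbowP r t3 yt; split.
- apply: eq_card0 => u; rewrite !inE; apply/negP => /and4P[ut _ uy].
  by rewrite /vtype ptype0 eq_sym (negbTE (r _ _ ut yt uy)).
- apply/card_le1_eqP => u u'; rewrite !inE => /and4P[ut _ uy /eqP tu] /and4P[ut' _ uy' /eqP tu'].
  have e := ptype11 tu tu'; apply/eqP; apply: contraT => nu.
  by have := r _ _ ut' ut nu; rewrite e eqxx.
have := cardsD1 y t; rewrite yt t3 add1n => -[e2]; rewrite [RHS]e2.
rewrite -(cardsID [set u | vtype y u == 1%N] (t :\ y)); congr (_ + _)%N; apply: eq_card => u.
  by rewrite !inE yt/= [RHS]andbC; case: (u \in t); rewrite ?andbF ?andbT //=; rewrite andbC.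
rewrite !inE yt/=; have [ut|] := boolP (u \in t); rewrite ?andbF//= andbT.
have [//|uy] := eqVneq u y; rewrite ?andbF//= ?andbT.
have := ptype_le2 (part y) (part u); rewrite -/(vtype y u).
have : vtype y u != 0%N by rewrite /vtype ptype0; apply: r => //; rewrite eq_sym.
by case: (vtype y u) => [|[|[|]]].
Qed.

Lemma rainbow_setT a b d : a != b -> a != d -> b != d ->
  part a != part b -> part a != part d -> part b != part d -> rainbow [set a; b; d].
Proof.
move=> ab ad bd pab pad pbd; apply/rainbowP => x y.
rewrite !inE -!orbA => /or3P[]/eqP-> /or3P[]/eqP->; rewrite ?eqxx// => _; by rewrite // eq_sym.
Qed.

Lemma sum_ndeg c S : (\sum_y ndeg c S y = #|[set u : V * V | uncov S u.1 u.2 && (vtype u.1 u.2 == c)]|)%N.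
Proof.
rewrite -sum1_card (eq_bigl (fun u : V * V => uncov S u.1 u.2 && (vtype u.1 u.2 == c))); last by move=> u; rewrite inE.
rewrite -(pair_big_dep predT (fun x y => uncov S x y && (vtype x y == c)) (fun _ _ => 1%N)) /=.
by apply: eq_bigr => x _; rewrite sum1dep_card.
Qed.
End Degrees.

(** * Absorbing the uncovered pairs of type 0 *)

Section Absorb.
Variables (V : finType) (part : V -> 'I_4).
Implicit Types (S T : {set {set V}}) (t e : {set V}) (x y u w a b : V) (c : nat).
Local Notation vtype := (vtype part).
Local Notation nbr := (nbr part).
Local Notation cov := (cov part).
Local Notation ndeg := (ndeg part).

Definition covby S x y := [exists t in S, (x \in t) && (y \in t)].

Lemma covbyP S x y : reflect (exists t, [/\ t \in S, x \in t & y \in t]) (covby S x y).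
Proof.
by apply: (iffP exists_inP) => [[t tS /andP[h1 h2]]|[t [tS h1 h2]]]; exists t => //; rewrite h1.
Qed.

Lemma uncovE S x y : uncov S x y = (x != y) && ~~ covby S x y.
Proof. by rewrite /uncov /covby negb_exists_in. Qed.

Definition zero_edges T :=
  [set e : {set V} | [exists x, exists y, [&& uncov T x y, vtype x y == 0%N & e == [set x; y]]]].

Lemma zero_edgesP T e : reflect (exists x y, [/\ uncov T x y, part x = part y & e = [set x; y]])
  (e \in zero_edges T).
Proof.
rewrite inE; apply: (iffP existsP) => [[x /existsP[y /and3P[h1 h2 /eqP h3]]]|[x [y [h1 h2 h3]]]]; exists x.
  by exists y; split=> //; apply/eqP; rewrite -ptype0.
by apply/existsP; exists y; rewrite h1 h3 eqxx /vtype ptype0 h2 eqxx.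
Qed.

Lemma zero_edges_at T y : (#|[set e in zero_edges T | y \in e]| <= lv T y)%N.
Proof.
rewrite /lv -(card_in_imset (f := fun u => [set y; u])); last first.
  move=> u u'; rewrite !inE => /uncovP[yu _] _ /setP /(_ u).
  by rewrite !inE eqxx orbT [u == y]eq_sym (negbTE yu)/= => /esym/eqP.
apply: subset_leq_card; apply/subsetP => e; rewrite inE => /andP[/zero_edgesP[a [b [h1 _ ->]]]].
rewrite !inE => /orP[]/eqP ->; apply/imsetP; first by exists b; rewrite ?inE.
by exists a; rewrite ?inE 1?uncovC// setUC.
Qed.

Variables (y0 : V) (T R : {set {set V}}) (Delta cap tau Sb : nat).
Hypothesis hT : psts T.
Hypothesis RT : R \subset T.
Hypothesis Rr : forall t, t \in R -> rainbow part t.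
Hypothesis lvT : forall y, (lv T y <= Delta)%N.
Let E0 := zero_edges T.
Hypothesis hopt : forall a b c, a != b -> part a = part b -> (c == 1%N) || (c == 2%N) ->
  (tau <= #|[set x | [&& vtype a x == c, covby R a x & covby R b x]]|)%N.
Hypothesis hcap : (0 < cap)%N.
Hypothesis hSb : (4 * #|E0| <= cap * Sb)%N.
Hypothesis htau : (6 * (Delta + cap) + Sb < tau)%N.

Section Choice.
Variable B : {set {set V}}.
Let cls e := if e \in B then 1%N else 2%N.
Let opt e := [set x | [forall a in e, (vtype a x == cls e) && covby R a x]].
Let conf e x e' x' := [exists a in e, (a \in x' |: e') && (x \in x' |: e')].

Let cls12 e : (cls e == 1%N) || (cls e == 2%N).
Proof. by rewrite /cls; case: ifP. Qed.

(** Edges in [B] take their new point from the other part of their half, the remaining ones from the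
    other half. *)
Lemma absorb_choice : exists f : {set V} -> V,
  [/\ forall e, e \in E0 -> f e \in opt e,
      forall y, (#|[set e in E0 | f e == y]| <= cap)%N &
      forall e e', e \in E0 -> e' \in E0 -> e != e' ->
        ~~ conf e (f e) e' (f e') || ~~ conf e' (f e') e (f e)].
Proof.
have [||||||||f [f1 f2 f3]] := @greedy_choice {set V} V V opt (fun e x w => x == w) conf cap (6 * (Delta + cap)) Sb (enum E0).
- exact: enum_uniq.
- move=> e x _; rewrite (eq_card (_ : _ =i [set x])) ?cards1// => w.
  by rewrite !inE eq_sym.
- move=> e w; apply: (@leq_trans #|[set w]|); last by rewrite cards1.
  by apply: subset_leq_card; apply/subsetP => x; rewrite !inE => /andP[_].
- move=> s f e us sE; rewrite mem_enum => eE [v1 v2 _].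
  have /zero_edgesP[a [b [/uncovP[ab _] pab ee]]] := eE.
  (* The points of all earlier new triples through [y]: at most [Delta] of these triples contain [y]
     in their edge and at most [cap] have it as the chosen point. A conflict of [x] with an earlier
     choice puts [x] into [bad a] or [bad b]. *)
  pose bad y := \bigcup_(e' in [set e' in s | y \in f e' |: e']) (f e' |: e').
  have hbad y : (#|bad y| <= 3 * (Delta + cap))%N.
    apply: leq_trans (leq_card_bigcup _ _) _.
    apply: (@leq_trans (\sum_(e' in [set e' in s | y \in f e' |: e']) 3)).
      apply: leq_sum => e'; rewrite inE => /andP[/sE]; rewrite mem_enum => /zero_edgesP[u [v [_ _ ->]]] _.
      rewrite cardsU1 cards2; by case: (_ \in _); case: (_ != _).
    rewrite sum_nat_const mulnC leq_pmul2l//.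
    apply: (@leq_trans #|[set e' in zero_edges T | y \in e'] :|: [set e' in s | f e' == y]|).
      apply: subset_leq_card; apply/subsetP => e'; rewrite !inE => /andP[e's /orP[/eqP ->|ye']].
        by rewrite e's eqxx orbT.
      by have := sE _ e's; rewrite mem_enum /E0 inE ye' => ->.
    apply: leq_trans (leq_card_setU _ _) _; apply: leq_add.
      by apply: leq_trans (zero_edges_at _ _) _.
    apply: leq_trans (v2 y); rewrite /load -size_filter -(card_uniqP _) ?filter_uniq//.
    by apply: subset_leq_card; apply/subsetP => e'; rewrite inE mem_filter andbC.
  apply: (@leq_trans #|bad a :|: bad b|).
    apply: subset_leq_card; apply/subsetP => x; rewrite !inE => /andP[_ /hasP[e' e's /exists_inP[y]]].
    rewrite ee => ye /andP[h1 h2].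
    have h3 : x \in bad y by apply/bigcupP; exists e'; rewrite // inE e's.
    by move: ye; rewrite in_set2 => /orP[]/eqP <-; rewrite h3 ?orbT.
  apply: leq_trans (leq_card_setU _ _) _.
  by have := hbad a; have := hbad b; lia.
- by rewrite -cardE.
- by [].
- move=> e; rewrite mem_enum => /zero_edgesP[a [b [/uncovP[ab _] pab ee]]].
  apply: leq_trans htau _; apply: leq_trans (hopt ab pab (cls12 e)) _.
  apply: subset_leq_card; apply/subsetP => x; rewrite !inE => /and3P[h1 h2 h3].
  apply/forall_inP => y; rewrite ee !inE => /orP[]/eqP ->; rewrite -?ee ?h2 ?h3 ?andbT//.
  by rewrite /vtype -pab.
- by apply/card_gt0P; exists y0.
exists f; split=> [e eE|y|e e' eE e'E]; last by apply: f3; rewrite mem_enum.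
  by apply: f1; rewrite mem_enum.
have u : uniq (filter (fun e => f e == y) (enum E0)) by rewrite filter_uniq// enum_uniq.
apply: leq_trans (f2 y); rewrite /load -size_filter -(card_uniqP u).
by apply: subset_leq_card; apply/subsetP => e; rewrite inE mem_filter mem_enum andbC.
Qed.

(** Removing [R] frees the two pairs that a type 0 edge needs for its new triple, and uncovers no
    type 0 pair because [R] is rainbow. Each new triple covers two pairs of type 1 or two of type 2,
    hence the factors 4; the set [B] steers the distribution. *)
Lemma absorb : exists A, [/\
  [/\ psts ((T :\: R) :|: A), [disjoint T & A] & #|A| = #|E0|],
  forall t u w, t \in A -> u \in t -> w \in t -> u != w -> vtype u w != 0%N -> covby R u w,
  forall y, ndeg 0 ((T :\: R) :|: A) y = 0%N,
  forall y, (#|[set t in A | y \in t]| <= Delta + cap)%N &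
  (\sum_y cov 1 A y = 4 * #|B :&: E0|)%N /\ (\sum_y cov 2 A y = 4 * #|E0 :\: B|)%N].
Proof.
have [f [f1 f2 f3]] := absorb_choice.
have /pstsP[c3 un] := hT.
have E0P e : e \in E0 -> exists a b, [/\ a != b, uncov T a b, part a = part b & e = [set a; b]].
  by case/zero_edgesP => a [b [h1 h2 h3]]; exists a, b; split=> //; case/uncovP: h1.
have fty e a : e \in E0 -> a \in e -> vtype a (f e) = cls e /\ covby R a (f e).
  by move=> /f1; rewrite inE => /forall_inP h /h/andP[/eqP].
have cls0 e : cls e != 0%N by rewrite /cls; case: ifP.
have fne e : e \in E0 -> f e \notin e.
  move=> eE; apply/negP => h; have [h1 _] := fty e _ eE h; move: (cls0 e); rewrite -h1.
  by rewrite /vtype ptype0 eqxx.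
(* A pair of a new triple is either the absorbed edge, uncovered in [T], or it contains [f e] and
   was covered by [R]. *)
have pairs e u w : e \in E0 -> u \in f e |: e -> w \in f e |: e -> u != w ->
    (e = [set u; w] /\ uncov T u w /\ part u = part w) \/
    (vtype u w = cls e /\ covby R u w /\ (f e == u) || (f e == w)).
  move=> eE; have [a [b [ab uab pab ee]]] := E0P e eE.
  have ae : a \in e by rewrite ee !inE eqxx.
  have be : b \in e by rewrite ee !inE eqxx orbT.
  have sy x : covby R x (f e) -> covby R (f e) x.
    by case/covbyP => t [h1 h2 h3]; apply/covbyP; exists t.
  have cb x y : uncov T x y -> uncov T y x by rewrite uncovC.
  rewrite !inE => /orP[/eqP ->|ue] /orP[/eqP ->|we] uw.
  - by rewrite eqxx in uw.
  - by right; have [h1 h2] := fty e _ eE we; rewrite vtypeC h1 eqxx sy.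
  - by right; have [h1 h2] := fty e _ eE ue; rewrite h1 eqxx orbT h2.
  - left; move: ue we uw; rewrite ee !inE => /orP[]/eqP -> /orP[]/eqP ->; rewrite ?eqxx// => _.
    by rewrite setUC; split=> //; split; [exact: cb|].
have finj : {in E0 &, injective (fun e => f e |: e)}.
  move=> e e' eE e'E /= h; apply/eqP; apply: contraT => ee'.
  have [a [b [ab uab pab de]]] := E0P e eE.
  have ae : a \in e by rewrite de !inE eqxx.
  have be : b \in e by rewrite de !inE eqxx orbT.
  have ae' : a \in f e' |: e' by rewrite -h !inE ae orbT.
  have be' : b \in f e' |: e' by rewrite -h !inE be orbT.
  have [[h1 _]|[h1 _]] := pairs e' a b e'E ae' be' ab; first by rewrite de h1 eqxx in ee'.
  by move: (cls0 e'); rewrite -h1 /vtype ptype0 pab eqxx.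
pose A := [set f e |: e | e in E0].
have A3 t : t \in A -> #|t| = 3%N.
  case/imsetP => e eE ->; have [a [b [ab _ _ de]]] := E0P e eE.
  by rewrite cardsU1 (fne e eE) de cards2 ab.
have RT' x y : covby R x y -> covby T x y.
  by case/covbyP => t [h1 h2 h3]; apply/covbyP; exists t; rewrite (subsetP RT).
have TA t t' u w : t \in T -> t' \in A -> u != w -> u \in t -> w \in t -> u \in t' -> w \in t' -> t \in R.
  move=> tT /imsetP[e eE ->] uw ut wt ut' wt'.
  have [[_ [/uncovP[_ h] _]]|[_ [/covbyP[r [rR ur wr]] _]]] := pairs e u w eE ut' wt' uw.
    by case: (h t tT ut wt).
  have rT := subsetP RT _ rR; by rewrite (un t r u w tT rT uw ut wt ur wr).
have dTA : [disjoint T & A].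
  rewrite -setI_eq0; apply/eqP/setP => t; rewrite !inE; apply/negP => /andP[tT tA].
  have /imsetP[e eE te] := tA; have [a [b [ab uab _ de]]] := E0P e eE.
  have /uncovP[_ h] := uab; apply: (h t tT); by rewrite te de !inE eqxx ?orbT.
have AA e e' u w : e \in E0 -> e' \in E0 -> u != w -> u \in f e |: e -> w \in f e |: e ->
    u \in f e' |: e' -> w \in f e' |: e' -> e = e'.
  move=> eE e'E uw ue we ue' we'; apply/eqP; apply: contraT => ee'.
  have h1 := pairs e u w eE ue we uw; have h2 := pairs e' u w e'E ue' we' uw.
  case: h1 => [[d1 [_ p1]]|[q1 [_ x1]]]; case: h2 => [[d2 [_ p2]]|[q2 [_ x2]]].
  - by rewrite d1 d2 eqxx in ee'.
  - by move: (cls0 e'); rewrite -q2 /vtype ptype0 p1 eqxx.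
  - by move: (cls0 e); rewrite -q1 /vtype ptype0 p2 eqxx.
  (* A shared pair of nonzero type contains the chosen point of both triples, so it is a conflict in
     both directions, which [f3] excludes. *)
  have cf e1 e2 : e1 \in E0 -> u \in f e1 |: e1 -> w \in f e1 |: e1 -> u \in f e2 |: e2 -> w \in f e2 |: e2 ->
      (f e1 == u) || (f e1 == w) -> conf e1 (f e1) e2 (f e2).
    move=> e1E ue1 we1 ue2 we2 /orP[]/eqP fe; apply/exists_inP.
      by exists w; [move: we1; rewrite !inE fe eq_sym (negbTE uw)|rewrite we2 fe ue2].
    by exists u; [move: ue1; rewrite !inE fe (negbTE uw)|rewrite ue2 fe we2].
  by have := f3 e e' eE e'E ee'; rewrite !cf.
exists A; split.
- split=> //; last by rewrite card_in_imset.
  apply/pstsP; split=> [t|t t' u w]; first by rewrite !inE => /orP[/andP[_ /c3]|/A3].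
  rewrite 2!in_setU !in_setD => /orP[/andP[tR tT]|tA] /orP[/andP[t'R t'T]|t'A] uw ut wt ut' wt'.
  + exact: (un _ _ u w).
  + by rewrite (TA t t' u w) in tR.
  + by rewrite (TA t' t u w) in t'R.
  + move: tA t'A ut wt ut' wt' => /imsetP[e eE ->] /imsetP[e' e'E ->] ue we ue' we'.
    by rewrite (AA e e' u w).
- move=> t u w /imsetP[e eE ->] ut wt uw ty.
  have [[_ [_ p]]|[_ [h _]]] := pairs e u w eE ut wt uw => //.
  by rewrite /vtype ptype0 p eqxx in ty.
- move=> y; apply: eq_card0 => u; rewrite !inE; apply/negP => /andP[].
  rewrite uncovE => /andP[yu /covbyP nc] /eqP ty.
  have pyu : part y = part u by apply/eqP; rewrite -ptype0; apply/eqP.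
  have [cT|ncT] := boolP (covby T y u).
    have /covbyP[t [tT yt ut]] := cT; apply: nc; exists t; split=> //; rewrite !inE tT andbT.
    apply/orP; left; apply/negP => /Rr/rainbowP/(_ y u yt ut yu).
    by rewrite pyu eqxx.
  have uE : [set y; u] \in E0 by apply/zero_edgesP; exists y, u; rewrite uncovE yu ncT.
  apply: nc; exists (f [set y; u] |: [set y; u]); split.
  - by rewrite in_setU (imset_f (fun e => f e |: e) uE) orbT.
  - by rewrite !inE eqxx !orbT.
  - by rewrite !inE eqxx !orbT.
- move=> y; apply: (@leq_trans #|[set e in E0 | y \in e] :|: [set e in E0 | f e == y]|).
    apply: leq_trans (_ : #|[set f e |: e | e in [set e in E0 | y \in e] :|: [set e in E0 | f e == y]]| <= _)%N.
      apply: subset_leq_card; apply/subsetP => t; rewrite inE => /andP[/imsetP[e eE ->]].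
      by case/setU1P => [->|ye]; apply: imset_f; apply/setUP; [right|left]; rewrite in_set eE ?eqxx.
    exact: leq_imset_card.
  apply: leq_trans (leq_card_setU _ _) _; apply: leq_add; last exact: f2.
  by apply: leq_trans (zero_edges_at _ _) _.
have key c e : c != 0%N -> e \in E0 -> (\sum_y nbr c (f e |: e) y = if cls e == c then 4 else 0)%N.
  move=> c0 eE; have [a [b [ab uab pab de]]] := E0P e eE.
  have ae : a \in e by rewrite de !inE eqxx.
  have be : b \in e by rewrite de !inE eqxx orbT.
  have fa : f e != a by apply: contraNneq (fne e eE) => ->.
  have fb : f e != b by apply: contraNneq (fne e eE) => ->.
  have [ta _] := fty e a eE ae; have [tb _] := fty e b eE be.
  have tab : vtype a b = 0%N by apply/eqP; rewrite /vtype ptype0 pab.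
  have te : f e |: e = [set f e; a; b] by rewrite de setUA.
  rewrite te (bigD1 (f e))//= (bigD1 a) 1?eq_sym//= (bigD1 b)/=; last by rewrite eq_sym fb eq_sym ab.
  rewrite big1 ?addn0; last first.
    by move=> y /andP[/andP[yf ya] yb]; apply: nbr_notin; rewrite !inE (negbTE yf) (negbTE ya) (negbTE yb).
  rewrite nbr3//.
  have -> : [set f e; a; b] = [set a; f e; b] by rewrite (setUC [set f e] [set a]).
  rewrite nbr3// 1?eq_sym//.
  have -> : [set a; f e; b] = [set b; f e; a] by apply/setP => y; rewrite !inE; case: (y == a); case: (y == b); rewrite ?orbT ?orbF.
  rewrite nbr3// 1?eq_sym// 1?eq_sym//.
  rewrite (vtypeC part (f e) a) (vtypeC part (f e) b) (vtypeC part b a) ta tb tab.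
  by rewrite ![c == cls e]eq_sym [0%N == c]eq_sym (negbTE c0) !addn0; case: (cls e == c).
have sumc c : c != 0%N -> (\sum_y cov c A y = \sum_(e in E0) if cls e == c then 4 else 0)%N.
  move=> c0; rewrite /Submission.cov exchange_big/= big_imset//=.
  by apply: eq_bigr => e eE; rewrite key.
have sE c : (\sum_(e in E0) (if cls e == c then 4 else 0) = 4 * #|[set e in E0 | cls e == c]|)%N.
  by rewrite -big_mkcondr/= mulnC -sum_nat_const; apply: eq_bigl => e; rewrite [RHS]in_set.
split; rewrite sumc// sE; congr (_ * _)%N; apply: eq_card => e.
  by rewrite in_set in_setI /cls; case: (e \in B); case: (e \in E0).
by rewrite in_set in_setD /cls; case: (e \in B); case: (e \in E0).
Qed.

End Choice.
End Absorb.

(** * Moving degree between two points of a part *)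

Section Transfer.
Variables (V : finType) (part : V -> 'I_4).
Implicit Types (S T : {set {set V}}) (t e : {set V}) (x y u w a b : V) (c : nat).
Local Notation vtype := (vtype part).
Local Notation nbr := (nbr part).
Local Notation cov := (cov part).
Local Notation ndeg := (ndeg part).

Lemma nbr3b a b d c : a != b -> a != d -> b != d ->
  nbr c [set a; b; d] b = ((vtype b a == c) + (vtype b d == c))%N.
Proof.
by move=> ab ad bd; rewrite (setUC [set a] [set b]) nbr3// eq_sym.
Qed.

Lemma nbr3c a b d c : a != b -> a != d -> b != d ->
  nbr c [set a; b; d] d = ((vtype d a == c) + (vtype d b == c))%N.
Proof.
move=> ab ad bd; have -> : [set a; b; d] = [set d; a; b] by rewrite setUC setUA.
by rewrite nbr3// eq_sym.
Qed.

Variables (T F : {set {set V}}) (k kappa cap Sb tau : nat) (ya yb : 'I_k -> V) (y0 : V).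
Hypothesis hT : psts T.
Hypothesis FT : F \subset T.
Hypothesis yab : forall j, ya j != yb j.
Hypothesis pab : forall j, part (ya j) = part (yb j).
Hypothesis hka : forall y, (#|[set j | ya j == y]| <= kappa)%N.
Hypothesis hkb : forall y, (#|[set j | yb j == y]| <= kappa)%N.
Local Notation q j p := (third T (ya j) p).
(** The other two points of the removed triple lie in the other part of the half of [ya j] and in
    the other half, so one exchange moves one unit of either degree. *)
Let opt j := [set p | [&& vtype (ya j) p == 1%N, vtype (ya j) (q j p) == 2%N, q j p != p,
  tri T (ya j) p \in F, uncov T (yb j) p & uncov T (yb j) (q j p)]].
Hypothesis hopt : forall j, (tau <= #|opt j|)%N.
Hypothesis hcap : (0 < cap)%N.
Hypothesis hSb : (4 * k <= cap * Sb)%N.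
Hypothesis htau : (9 * (kappa + cap) + Sb < tau)%N.

(* Replacing [yset] by [aset] lowers both degrees of [yb j] in the leave by one, raises those of [ya j] by one,
   and changes no other degree, as [ya j] and [yb j] lie in the same part. *)
Let yset j p := [set ya j; p; q j p].
Let aset j p := [set yb j; p; q j p].
Let conf j p j' p' := (yset j p == yset j' p') ||
  (yb j \in aset j' p') && ((p \in aset j' p') || (q j p \in aset j' p')).
Let ld j p w := (p == w) || (q j p == w).

Lemma card_set3 a b d : (#|[set a; b; d]| <= 3)%N.
Proof.
apply: leq_trans (leq_card_setU _ _) _; rewrite cards1 addn1 ltnS cards2.
by case: (_ != _).
Qed.

Lemma transfer_choice : exists f : 'I_k -> V,
  (forall j, f j \in opt j) /\
  forall j j', j != j' -> ~~ conf j (f j) j' (f j') || ~~ conf j' (f j') j (f j).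
Proof.
have [||||||||f [f1 _ f3]] := @greedy_choice 'I_k V V opt ld conf cap (9 * (kappa + cap)) Sb (enum 'I_k).
- exact: enum_uniq.
- move=> j p _; apply: leq_trans (_ : #|[set p; q j p]| <= _)%N; last by rewrite cards2; case: (_ != _).
  by apply: subset_leq_card; apply/subsetP => w; rewrite !inE ![w == _]eq_sym.
- move=> j w; apply: leq_trans (_ : #|[set w; q j w]| <= _)%N; last by rewrite cards2; case: (_ != _).
  apply: subset_leq_card; apply/subsetP => p; rewrite !inE => /andP[_ /orP[/eqP ->|/eqP <-]].
    by rewrite eqxx.
  by rewrite thirdK// eqxx orbT.
- move=> s f j us _ _ [_ v2 _].
  have hld (y : 'I_k -> V) z : (#|[set i | y i == z]| <= kappa)%N ->
      (#|[set i in s | (z == y i) || ld i (f i) z]| <= kappa + cap)%N.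
    move=> hy; apply: leq_trans (_ : #|[set i | y i == z] :|: [set i in s | ld i (f i) z]| <= _)%N.
      apply: subset_leq_card; apply/subsetP => i; rewrite !inE => /andP[-> /orP[/eqP ->|->]].
        by rewrite eqxx.
      by rewrite orbT.
    apply: leq_trans (leq_card_setU _ _) _; apply: leq_add => //.
    apply: leq_trans (v2 z); rewrite /load -size_filter.
    have u : uniq (filter (fun i => ld i (f i) z) s) by rewrite filter_uniq.
    rewrite -(card_uniqP u); apply: subset_leq_card; apply/subsetP => i.
    by rewrite inE mem_filter andbC.
  (* [b1] collects the options that would remove an earlier triple again, [b2] those that would
     reuse a pair of an earlier new triple; the image under [third] is there because it may be
     [q j p] that lies in that triple. *)
  pose b1 := \bigcup_(i in [set i in s | (ya j == ya i) || ld i (f i) (ya j)]) yset i (f i).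
  pose b2 := \bigcup_(i in [set i in s | (yb j == yb i) || ld i (f i) (yb j)])
     (aset i (f i) :|: third T (ya j) @: aset i (f i)).
  have h1 : (#|b1| <= 3 * (kappa + cap))%N.
    apply: leq_trans (leq_card_bigcup _ _) _.
    apply: leq_trans (leq_sum _ _) _; first by move=> i _; exact: card_set3.
    by rewrite sum_nat_const mulnC leq_pmul2l// hld.
  have h2 : (#|b2| <= 6 * (kappa + cap))%N.
    apply: leq_trans (leq_card_bigcup _ _) _.
    apply: leq_trans (_ : \sum_(i in [set i in s | (yb j == yb i) || ld i (f i) (yb j)]) 6 <= _)%N.
      apply: leq_sum => i _; apply: leq_trans (leq_card_setU _ _) _.
      have c3 := card_set3 (yb i) (f i) (q i (f i)).
      have := leq_imset_card (third T (ya j)) (aset i (f i)).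
      move: c3; rewrite -/(aset i (f i)); lia.
    by rewrite sum_nat_const mulnC leq_pmul2l// hld.
  have : (#|[set x in opt j | has (fun j' => conf j x j' (f j')) s]| <= #|b1 :|: b2|)%N.
    apply: subset_leq_card; apply/subsetP => p; rewrite inE => /andP[_ /hasP[i is_ /orP[/eqP e|/andP[e1 e2]]]].
      have yi : ya j \in yset i (f i) by rewrite -e !inE eqxx.
      have pi : p \in yset i (f i) by rewrite -e !inE eqxx orbT.
      rewrite in_setU; apply/orP; left; apply/bigcupP; exists i => //.
      rewrite in_set is_ /ld; move: yi; rewrite !inE -!orbA /=.
      by rewrite [f i == _]eq_sym [q i _ == _]eq_sym.
    rewrite in_setU; apply/orP; right; apply/bigcupP; exists i => //.
      rewrite in_set is_ /ld; move: e1; rewrite !inE -!orbA /=.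
      by rewrite [f i == _]eq_sym [q i _ == _]eq_sym.
    rewrite in_setU; case/orP: e2 => [->//|h]; apply/orP; right.
    by apply/imsetP; exists (q j p); rewrite ?thirdK.
  move/leq_trans; apply; apply: leq_trans (leq_card_setU _ _) _; lia.
- by rewrite size_enum_ord.
- by [].
- by move=> j _; apply: leq_trans htau _.
- by apply/card_gt0P; exists y0.
exists f; split=> [j|j j' jj]; first by apply: f1; rewrite mem_enum.
by apply: f3; rewrite ?mem_enum.
Qed.

Lemma transfer : exists T', [/\ psts T', (#|T' :\: T| <= k)%N, (#|T :\: T'| <= k)%N &
  forall c w, (cov c T' w + #|[set j | ya j == w]| * ((1 == c) + (2 == c)) =
               cov c T w + #|[set j | yb j == w]| * ((1 == c) + (2 == c)))%N].
Proof.
have [f [f1 f2]] := transfer_choice.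
have /pstsP[c3 un] := hT.
pose ys j := yset j (f j); pose as_ j := aset j (f j).
have fP j : [/\ vtype (ya j) (f j) = 1%N, vtype (ya j) (q j (f j)) = 2%N,
    ys j \in T, uncov T (yb j) (f j) & uncov T (yb j) (q j (f j))].
  have := f1 j; rewrite in_set => /and5P[/eqP h1 /eqP h2 _ h4 /andP[h5 h6]]; split=> //.
  exact: (subsetP FT).
have dP j : [/\ ya j != f j, ya j != q j (f j), f j != q j (f j), yb j != f j & yb j != q j (f j)].
  have := f1 j; rewrite in_set => /and5P[_ _ h3 _ /andP[/uncovP[h5 _] /uncovP[h6 _]]].
  by have [_ h7 h8 _] := thirdP hT h3; split=> //; rewrite eq_sym.
have ys_in j : [/\ ya j \in ys j, f j \in ys j & q j (f j) \in ys j].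
  by rewrite /ys /yset !inE !eqxx !orbT.
have pairs j u w : u \in as_ j -> w \in as_ j -> u != w ->
    (u \in ys j) && (w \in ys j) \/ uncov T u w /\ ((u = yb j /\ ((w == f j) || (w == q j (f j)))) \/
       (w = yb j /\ ((u == f j) || (u == q j (f j))))).
  have [_ _ _ u1 u2] := fP j; have [i1 i2 i3] := ys_in j.
  have cb x y : uncov T x y -> uncov T y x by rewrite uncovC.
  have asP x : x \in as_ j -> [\/ x = yb j, x = f j | x = q j (f j)].
    by rewrite /as_ /aset !inE -!orbA => /or3P[]/eqP ->; [constructor 1|constructor 2|constructor 3].
  move=> /asP[]-> /asP[]-> uw; try by rewrite eqxx in uw.
  - by right; split=> //; left; rewrite eqxx.
  - by right; split=> //; left; rewrite eqxx orbT.
  - by right; split; [exact: cb|right; rewrite eqxx].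
  - by left; rewrite i2 i3.
  - by right; split; [exact: cb|right; rewrite eqxx orbT].
  - by left; rewrite i2 i3.
have conflict j j' u w : u \in as_ j -> w \in as_ j -> u \in as_ j' -> w \in as_ j' -> u != w ->
    conf j (f j) j' (f j').
  move=> uj wj uj' wj' uw; have h1 := pairs j u w uj wj uw; have h2 := pairs j' u w uj' wj' uw.
  have [_ _ yT _ _] := fP j; have [_ _ yT' _ _] := fP j'.
  (* A shared pair that was covered in [T] lies in the removed triples of both exchanges, which are
     then equal; an uncovered one contains [yb j] and is a conflict of the second kind. It cannot be
     covered for one exchange and uncovered for the other. *)
  case: h1 => [/andP[a1 a2]|[n1 b1]]; case: h2 => [/andP[a3 a4]|[n2 b2]].
  - by rewrite /conf (un (yset j (f j)) (yset j' (f j')) u w) ?eqxx.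
  - by case/uncovP: n2 => _ /(_ _ yT a1 a2).
  - by case/uncovP: n1 => _ /(_ _ yT' a3 a4).
  apply/orP; right; case: b1 => -[e1 /orP[]/eqP e2].
  - by rewrite -e1 uj' -e2 wj'.
  - by rewrite -e1 uj' -e2 wj' orbT.
  - by rewrite -e1 wj' -e2 uj'.
  - by rewrite -e1 wj' -e2 uj' orbT.
have noconf j j' u w : u \in as_ j -> w \in as_ j -> u \in as_ j' -> w \in as_ j' -> u != w -> j = j'.
  move=> uj wj uj' wj' uw; apply/eqP; apply: contraT => /f2.
  by rewrite (conflict j j' u w)// (conflict j' j u w).
have yinj : injective ys.
  move=> j j' e; apply/eqP; apply: contraT => /f2.
  by rewrite /conf -/(ys j) -/(ys j') e eqxx.
have as_in j : [/\ yb j \in as_ j, f j \in as_ j & q j (f j) \in as_ j].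
  by rewrite /as_ /aset !inE !eqxx !orbT.
have ainj : injective as_.
  move=> j j' e; have [i1 i2 _] := as_in j; have [_ _ _ d _] := dP j.
  by apply: (noconf j j' (yb j) (f j)) => //; rewrite -e.
pose Y := [set ys j | j in [set: 'I_k]]; pose A := [set as_ j | j in [set: 'I_k]].
have YT : Y \subset T by apply/subsetP => t /imsetP[j _ ->]; have [] := fP j.
have AT j : as_ j \notin T.
  apply/negP => h; have [i1 i2 _] := as_in j; have [_ _ _ /uncovP[_ n] _] := fP j.
  exact: (n _ h i1 i2).
have dA : [disjoint T :\: Y & A].
  rewrite -setI_eq0; apply/eqP/setP => t; rewrite !inE; apply/negP => /andP[/andP[_ tT] /imsetP[j _ e]].
  by have := AT j; rewrite -e tT.
exists ((T :\: Y) :|: A); split.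
- apply/pstsP; split=> [t|t t' u w].
    rewrite !inE => /orP[/andP[_ /c3]//|/imsetP[j _ ->]].
    have [d1 d2 d3 d4 d5] := dP j.
    by rewrite /as_ /aset setUC cardsU1 cards2 !inE negb_or eq_sym d5 eq_sym d3 d4.
  have TA t1 j : t1 \in T -> t1 \notin Y -> u != w -> u \in t1 -> w \in t1 -> u \in as_ j -> w \in as_ j -> False.
    move=> t1T t1Y uw u1 w1 u2 w2; case: (pairs j u w u2 w2 uw) => [/andP[a1 a2]|[/uncovP[_ /(_ _ t1T u1 w1)]//]].
    have [_ _ yT _ _] := fP j; case/negP: t1Y.
    by rewrite (un t1 (ys j) u w)//; apply: imset_f.
  rewrite 2!in_setU !in_setD => /orP[/andP[tY tT]|/imsetP[j _ ->]] /orP[/andP[t'Y t'T]|/imsetP[j' _ ->]] uw ut wt ut' wt'.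
  + exact: (un _ _ u w).
  + by case: (TA t j').
  + by case: (TA t' j).
  + by rewrite (noconf j j' u w).
- apply: leq_trans (_ : #|A| <= _)%N.
    by apply: subset_leq_card; apply/subsetP => t; rewrite !inE; case: (t \in T) => //=; rewrite andbF.
  by apply: leq_trans (leq_imset_card _ _) _; rewrite cardsT card_ord.
- apply: leq_trans (_ : #|Y| <= _)%N.
    apply: subset_leq_card; apply/subsetP => t; rewrite !inE; case: (t \in T); rewrite ?andbF//= !andbT.
    by rewrite negb_or negbK => /andP[].
  by apply: leq_trans (leq_imset_card _ _) _; rewrite cardsT card_ord.
move=> c w; set d := ((1 == c) + (2 == c))%N.
have sa (y : 'I_k -> V) : (#|[set j | y j == w]| * d = \sum_j (y j == w) * d)%N.
  rewrite -sum1_card big_distrl/= big_mkcond; apply: eq_bigr => j _.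
  by rewrite inE; case: (y j == w); rewrite ?mul0n.
have sc (g : 'I_k -> {set V}) : injective g -> cov c [set g j | j in [set: 'I_k]] w = (\sum_j nbr c (g j) w)%N.
  move=> gi; rewrite cov_imset; first by apply: eq_bigl => j; rewrite inE.
  by move=> j j' _ _; exact: gi.
suff key : (cov c A w + #|[set j | ya j == w]| * d = cov c Y w + #|[set j | yb j == w]| * d)%N.
  rewrite covU//; have := covD part c w YT; move: key.
  by move: (cov c A w) (cov c Y w) (cov c T w) (cov c (T :\: Y) w) (#|_| * d)%N (#|_| * d)%N => n1 n2 n3 n4 n5 n6; lia.
rewrite !sa !sc// -!big_split/=; apply: eq_bigr => j _.
have [t1 t2 _ _ _] := fP j; have [d1 d2 d3 d4 d5] := dP j.
have t1' : vtype (yb j) (f j) = 1%N by rewrite /vtype -pab.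
have t2' : vtype (yb j) (q j (f j)) = 2%N by rewrite /vtype -pab.
have ab := yab j.
rewrite /ys /as_ /yset /aset.
have ba : yb j != ya j by rewrite eq_sym.
have ap : ya j != f j by []. have bp : yb j != f j by [].
have [wa|wa] := eqVneq (ya j) w.
  rewrite -wa (negbTE ba) nbr3// t1 t2 [nbr c _ _]nbr_notin; last by rewrite !inE !negb_or ab d1 d2.
  by rewrite add0n addn0 mul1n.
have [wb|wb] := eqVneq (yb j) w.
  rewrite -wb nbr3// t1' t2' [nbr c [set ya j; _; _] _]nbr_notin; last by rewrite !inE !negb_or ba d4 d5.
  by rewrite add0n addn0 mul1n.
rewrite !mul0n !addn0.
have [wp|wp] := eqVneq (f j) w.
  by rewrite -wp !nbr3b// ![vtype (f j) (ya j)]vtypeC ![vtype (f j) (yb j)]vtypeC t1 t1'.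
have [wq|wq] := eqVneq (q j (f j)) w.
  by rewrite -wq !nbr3c// ![vtype (q j (f j)) (ya j)]vtypeC ![vtype (q j (f j)) (yb j)]vtypeC t2 t2'.
by rewrite !nbr_notin// !inE !negb_or ![w == _]eq_sym ?wa ?wb ?wp ?wq.
Qed.
End Transfer.

(** * Regularizing the leave *)

(** While some point lies below [q], equality of the sums gives a point above [q] in the same part;
    they are matched, the deficient one first. Each point occurs exactly as often as its
    deviation. *)
Lemma transfer_list (V : finType) (part : V -> 'I_4) (d : V -> nat) (q : nat) :
  (forall P, \sum_(y | part y == P) d y = \sum_(y | part y == P) q)%N ->
  exists s : seq (V * V), [/\ forall e, e \in s -> e.1 != e.2 /\ part e.1 = part e.2,
    forall y, count (fun e => e.1 == y) s = (q - d y)%N,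
    forall y, count (fun e => e.2 == y) s = (d y - q)%N &
    size s = (\sum_y (q - d y))%N].
Proof.
move=> hd; have [n hn] : exists n, (\sum_y (q - d y) <= n)%N by exists (\sum_y (q - d y))%N.
elim: n d hd hn => [|n IH] d hd hn.
  have le y : (q <= d y)%N.
    by rewrite -subn_eq0 -leqn0; apply: leq_trans hn; rewrite (bigD1 y)//= leq_addr.
  have eq y : d y = q.
    have := hd (part y); rewrite (bigD1 y)//= [RHS](bigD1 y)//= => h.
    have h2 : (\sum_(x | (part x == part y) && (x != y)) q <= \sum_(x | (part x == part y) && (x != y)) d x)%N by apply: leq_sum.
    by apply/eqP; rewrite eqn_leq le andbT -(leq_add2r (\sum_(x | (part x == part y) && (x != y)) d x)) h leq_add2l.
  exists [::]; split=> // [y|y|]; rewrite ?eq ?subnn//.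
  by rewrite big1// => y _; rewrite eq subnn.
have [/existsP[y hy]|] := boolP [exists y, d y < q]%N; last first.
  rewrite negb_exists => /forallP h; apply: IH => //.
  by rewrite big1// => y _; apply/eqP; rewrite subn_eq0 leqNgt.
have [/existsP[x /andP[/eqP px hx]]|] := boolP [exists x, (part x == part y) && (q < d x)]%N; last first.
  rewrite negb_exists => /forallP h.
  have := hd (part y); rewrite (bigD1 y)//= [RHS](bigD1 y)//= => e.
  have h2 : (\sum_(x | (part x == part y) && (x != y)) d x <= \sum_(x | (part x == part y) && (x != y)) q)%N.
    by apply: leq_sum => x /andP[px _]; have := h x; rewrite px/= -leqNgt.
  by have := leq_add hy h2; rewrite addSn e ltnn.
have xy : x != y by apply: contraTneq hx => ->; rewrite -leqNgt ltnW.
pose d' u := if u == y then (d y).+1 else if u == x then (d x).-1 else d u.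
have dy : d' y = (d y).+1 by rewrite /d' eqxx.
have dx : d' x = (d x).-1 by rewrite /d' (negbTE xy) eqxx.
have du u : u != y -> u != x -> d' u = d u by move=> /negbTE a /negbTE b; rewrite /d' a b.
have [||s [s1 s2 s3 s4]] := IH d'.
- move=> P; rewrite -hd; have [<-|nP] := eqVneq (part y) P; last first.
    apply: eq_bigr => u /eqP pu; rewrite du//; apply: contraNneq nP => e; first by rewrite -e pu.
    by rewrite -px -e pu.
  rewrite (bigD1 y)//= (bigD1 x)/=; last by rewrite px eqxx xy.
  rewrite [RHS](bigD1 y)//= [X in (_ = _ + X)%N](bigD1 x)/=; last by rewrite px eqxx xy.
  rewrite dy dx; set A := \sum_(_ | _) _; set A' := \sum_(_ | _) _.
  have -> : A = A' by apply: eq_bigr => u /andP[/andP[_ uy] ux]; rewrite du.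
  by case: (d x) hx => // e _; rewrite /= !addSn !addnS.
- move: hn; rewrite (bigD1 y)//= [X in _ -> (X <= _)%N](bigD1 y)//= dy.
  have -> : (\sum_(i | i != y) (q - d' i) = \sum_(i | i != y) (q - d i))%N.
    apply: eq_bigr => u uy; have [->|ux] := eqVneq u x; last by rewrite du.
    rewrite dx; move: hx; case: (d x) => // e; rewrite ltnS /= => h.
    lia.
  by rewrite subnS; move: hy; rewrite -subn_gt0; case: (q - d y)%N.
exists ((y, x) :: s); split=> [e|u|u|].
- by rewrite inE => /orP[/eqP ->/=|/s1//]; rewrite eq_sym xy px.
- rewrite /= s2; have [<-|uy] := eqVneq y u; first by rewrite dy subnS add1n prednK// subn_gt0.
  rewrite add0n; have [->|ux] := eqVneq u x; last by rewrite du// eq_sym.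
  rewrite dx; move: hx; case: (d x) => // e; rewrite ltnS /= => h.
  lia.
- rewrite /= s3; have [<-|ux] := eqVneq x u.
    by rewrite dx; move: hx; case: (d x) => // e; rewrite ltnS /= add1n => h; rewrite subSn.
  rewrite add0n; have [->|uy] := eqVneq u y; last by rewrite du// eq_sym.
  rewrite dy; lia.
rewrite /= s4 [RHS](bigD1 y)//= (bigD1 y)//= dy.
have -> : (\sum_(i | i != y) (q - d' i) = \sum_(i | i != y) (q - d i))%N.
  apply: eq_bigr => u uy; have [->|ux] := eqVneq u x; last by rewrite du.
  rewrite dx; move: hx; case: (d x) => // e; rewrite ltnS /= => h.
  lia.
by rewrite subnS; move: hy; rewrite -subn_gt0; case: (q - d y)%N.
Qed.

Section Counting.
Variables (V : finType) (part : V -> 'I_4).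
Implicit Types (S T : {set {set V}}) (t e : {set V}) (x y u w a b : V) (c : nat).
Local Notation vtype := (vtype part).
Local Notation nbr := (nbr part).
Local Notation cov := (cov part).
Local Notation ndeg := (ndeg part).

Lemma card3P t : #|t| = 3%N -> exists a b d, [/\ a != b, a != d, b != d & t = [set a; b; d]].
Proof.
move=> t3; have : (0 < #|t|)%N by rewrite t3.
case/card_gt0P => a aT; have := cardsD1 a t; rewrite aT t3 add1n => -[] /esym/eqP/cards2P[b [d [bd e]]].
have /setP/(_ b) := e; have /setP/(_ d) := e; rewrite !inE !eqxx orbT => /andP[da _] /andP[ba _].
exists a, b, d; split; rewrite // 1?eq_sym//.
by rewrite -setUA -e setD1K.
Qed.

Lemma sum_nbr3 a b d c : a != b -> a != d -> b != d ->
  (\sum_y nbr c [set a; b; d] y = 2 * ((vtype a b == c) + (vtype a d == c) + (vtype b d == c)))%N.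
Proof.
move=> ab ad bd; rewrite (bigD1 a)//= (bigD1 b)/=; last by rewrite eq_sym.
rewrite (bigD1 d)/=; last by rewrite eq_sym ad eq_sym bd.
rewrite big1 ?addn0; last first.
  by move=> y /andP[/andP[ya yb] yd]; apply: nbr_notin; rewrite !inE (negbTE ya) (negbTE yb) (negbTE yd).
rewrite nbr3// nbr3b// nbr3c// (vtypeC part b a) (vtypeC part d a) (vtypeC part d b); lia.
Qed.

Lemma sum_nbr_rainbow t : rainbow part t -> #|t| = 3%N ->
  (\sum_y nbr 1 t y = 2 /\ \sum_y nbr 2 t y = 4)%N.
Proof.
move=> /rainbowP r /card3P[a [b [d [ab ad bd e]]]].
have pab : part a != part b by apply: r => //; rewrite e !inE eqxx ?orbT.
have pad : part a != part d by apply: r => //; rewrite e !inE eqxx ?orbT.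
have pbd : part b != part d by apply: r => //; rewrite e !inE eqxx ?orbT.
rewrite e !sum_nbr3// /vtype; move: (part a) (part b) (part d) pab pad pbd.
by do 3!(case=> [[|[|[|[|]]]]// ?]).
Qed.

(** A triple has either no pair or two pairs between the halves, and each is counted at both
    ends. *)
Lemma sum_nbr2_mod t : #|t| = 3%N -> (4 %| \sum_y nbr 2 t y)%N.
Proof.
move=> /card3P[a [b [d [ab ad bd ->]]]]; rewrite sum_nbr3// /vtype.
move: (part a) (part b) (part d).
by do 3!(case=> [[|[|[|[|]]]]// ?]).
Qed.

Lemma sum_nbr_all t : #|t| = 3%N -> (\sum_y nbr 0 t y + \sum_y nbr 1 t y + \sum_y nbr 2 t y = 6)%N.
Proof.
move=> /card3P[a [b [d [ab ad bd ->]]]]; rewrite !sum_nbr3// /vtype.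
move: (part a) (part b) (part d).
by do 3!(case=> [[|[|[|[|]]]]// ?]).
Qed.

Lemma sum_cov c S : (\sum_y cov c S y = \sum_(t in S) \sum_y nbr c t y)%N.
Proof. by rewrite /Submission.cov exchange_big. Qed.

Lemma sum_ndeg_part S c P : (\sum_(y | part y == P) ndeg c S y =
  \sum_(Q : 'I_4 | ptype P Q == c) #|[set u : V * V | [&& uncov S u.1 u.2, part u.1 == P & part u.2 == Q]]|)%N.
Proof.
have -> : (\sum_(y | part y == P) ndeg c S y =
    \sum_(y | part y == P) \sum_(u | uncov S y u && (vtype y u == c)) 1)%N.
  by apply: eq_bigr => y _; rewrite sum1dep_card.
rewrite pair_big_dep/= (partition_big (fun u : V * V => part u.2) (fun Q => ptype P Q == c))/=; last first.
  by move=> u /andP[/eqP <- /andP[_]].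
apply: eq_bigr => Q /eqP pQ; rewrite sum1dep_card; apply: eq_card => u; rewrite !inE.
case: (eqVneq (part u.1) P) => [pu|]; rewrite ?andbF//= ?andbT.
case: (eqVneq (part u.2) Q) => [pv|]; rewrite ?andbF//= ?andbT.
by rewrite /vtype pu pv pQ eqxx andbT.
Qed.

Lemma cross_sym S P Q : #|[set u : V * V | [&& uncov S u.1 u.2, part u.1 == P & part u.2 == Q]]| =
  #|[set u : V * V | [&& uncov S u.1 u.2, part u.1 == Q & part u.2 == P]]|.
Proof.
have sw : injective (fun u : V * V => (u.2, u.1)) by move=> [a b] [a' b'] [-> ->].
rewrite -(card_imset _ sw); apply: eq_card => -[a b]; rewrite !inE /=.
apply/imsetP/and3P => [[[a' b']]|[h1 h2 h3]].
  by rewrite !inE /= => /and3P[h1 h2 h3] [-> ->]; rewrite uncovC h1 h2 h3.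
by exists (b, a); rewrite ?inE /= ?[uncov _ b a]uncovC ?h1 ?h2 ?h3.
Qed.

(** Transfers stay inside a part, so each part must have the right total beforehand. The two parts
    of a half have equal type 1 totals, counting the pairs between them. The type 2 totals of the
    two halves agree as well; as they exceed the type 1 totals by the same amount 2 v g, the halves
    agree too. *)
Lemma balanced_degrees S (g v : nat) : (forall y, ndeg 2 S y = ndeg 1 S y + g)%N ->
  (forall P, #|[set x | part x == P]| = v) ->
  forall P, (4 * \sum_(y | part y == P) ndeg 1 S y = \sum_y ndeg 1 S y)%N.
Proof.
move=> hg hv.
pose M P Q := #|[set u : V * V | [&& uncov S u.1 u.2, part u.1 == P & part u.2 == Q]]|.
have MC P Q : M P Q = M Q P := cross_sym S P Q.
pose D P := (\sum_(y | part y == P) ndeg 1 S y)%N.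
have D2 P : (\sum_(y | part y == P) ndeg 2 S y = D P + v * g)%N.
  rewrite (eq_bigr (fun y => ndeg 1 S y + g)%N) => [|y _]; last exact: hg.
  by rewrite big_split/= sum_nat_cond_const -(hv P).
have tot : (\sum_y ndeg 1 S y = \sum_(P : 'I_4) D P)%N.
  by rewrite (partition_big part predT).
have D1E P : D P = (\sum_(Q : 'I_4 | ptype P Q == 1) M P Q)%N := sum_ndeg_part S 1 P.
have D2E P : (D P + v * g = \sum_(Q : 'I_4 | ptype P Q == 2) M P Q)%N.
  by rewrite -D2; exact: sum_ndeg_part S 2 P.
pose o (i : nat) (h : (i < 4)%N) := Ordinal h.
pose o0 := @o 0%N isT; pose o1 := @o 1%N isT; pose o2 := @o 2%N isT; pose o3 := @o 3%N isT.
have ex (F : 'I_4 -> nat) : (\sum_(P : 'I_4) F P = F o0 + F o1 + F o2 + F o3)%N.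
  rewrite !big_ord_recl big_ord0 addn0 !addnA.
  by congr (F _ + F _ + F _ + F _)%N; apply: val_inj.
have e1 := D1E o0; have e2 := D1E o1; have e3 := D1E o2; have e4 := D1E o3.
have f1 := D2E o0; have f2 := D2E o1; have f3 := D2E o2; have f4 := D2E o3.
rewrite big_mkcond ex /= in e1; rewrite big_mkcond ex /= in e2.
rewrite big_mkcond ex /= in e3; rewrite big_mkcond ex /= in e4.
rewrite big_mkcond ex /= in f1; rewrite big_mkcond ex /= in f2.
rewrite big_mkcond ex /= in f3; rewrite big_mkcond ex /= in f4.
have s1 := MC o0 o1; have s2 := MC o2 o3; have s3 := MC o0 o2; have s4 := MC o0 o3; have s5 := MC o1 o2; have s6 := MC o1 o3.
have all : [/\ D o0 = D o1, D o0 = D o2 & D o0 = D o3].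
  split; lia.
have [a1 a2 a3] := all.
move=> P; rewrite tot ex -a1 -a2 -a3.
have -> : (\sum_(y | part y == P) ndeg 1 S y = D o0)%N; last by lia.
rewrite -/(D P); case: P => -[|[|[|[|//]]]] h.
- by congr D; apply: val_inj.
- by rewrite a1; congr D; apply: val_inj.
- by rewrite a2; congr D; apply: val_inj.
- by rewrite a3; congr D; apply: val_inj.
Qed.
End Counting.

Lemma psts_sub (V : finType) (S T : {set {set V}}) : S \subset T -> psts T -> psts S.
Proof.
move=> /subsetP ST /pstsP[h1 h2]; apply/pstsP; split=> [t /ST/h1//|t t' x y /ST tT /ST t'T].
exact: h2.
Qed.

Lemma subset_of_card (X : finType) (A : {set X}) (n : nat) : (n <= #|A|)%N ->
  exists B : {set X}, B \subset A /\ #|B| = n.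
Proof.
move=> h; have : (0 < #|[set B : {set X} | (B \subset A) && (#|B| == n)]|)%N by rewrite cards_draws bin_gt0.
by case/card_gt0P => B; rewrite inE => /andP[h1 /eqP h2]; exists B.
Qed.

Lemma residue_shift (v : nat) (x : int) : (0 < v)%N ->
  exists (m : nat) (k : int), (m < v)%N /\ x + m%:Z = v%:Z * k.
Proof.
move=> v0; exists `|((- x) %% v%:Z)%Z|%N, (- ((- x) %/ v%:Z)%Z)%R.
have vz : v%:Z != 0 by rewrite -lt0n.
have h0 : 0 <= ((- x) %% v%:Z)%Z by rewrite modz_ge0.
split; first by rewrite -ltz_nat gez0_abs// ltz_mod.
rewrite gez0_abs//; have := divz_eq (- x) v%:Z; set a := (_ %/ _)%Z; set b := (_ %% _)%Z => e.
have xe : x = - (a * v%:Z + b) by rewrite -e opprK.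
by rewrite {1}xe; ring.
Qed.

Section FixCore.
Variables (V : finType) (part : V -> 'I_4).
Implicit Types (S T : {set {set V}}) (t e : {set V}) (x y u w a b : V) (c : nat).
Local Notation vtype := (vtype part).
Local Notation nbr := (nbr part).
Local Notation cov := (cov part).
Local Notation ndeg := (ndeg part).

Lemma ndeg_zero T y : ndeg 0 T y = #|[set e in zero_edges part T | y \in e]|.
Proof.
rewrite /Submission.ndeg -(card_in_imset (f := fun u => [set y; u])); last first.
  move=> u u'; rewrite !inE => /andP[/uncovP[yu _] _] _ /setP /(_ u).
  by rewrite !inE eqxx orbT [u == y]eq_sym (negbTE yu)/= => /esym/eqP.
apply: eq_card => e; rewrite inE; apply/imsetP/andP => [[u]|[/zero_edgesP[a [b [h1 h2 ->]]]]].
  rewrite inE => /andP[h1 h2] ->; split; last by rewrite !inE eqxx.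
  by apply/zero_edgesP; exists y, u; split=> //; apply/eqP; rewrite -ptype0.
rewrite !inE => /orP[]/eqP ->; first by exists b; rewrite ?inE ?h1 /Submission.vtype ?ptype0 ?h2 ?eqxx.
by exists a; rewrite ?inE 1?uncovC ?h1 /Submission.vtype ?ptype0 ?h2 ?eqxx// setUC.
Qed.

Lemma sum_ndeg_zero T : (\sum_y ndeg 0 T y = 2 * #|zero_edges part T|)%N.
Proof.
rewrite (eq_bigr (fun y => \sum_(e in zero_edges part T | y \in e) 1)%N); last first.
  by move=> y _; rewrite ndeg_zero sum1dep_card.
rewrite (exchange_big_dep (mem (zero_edges part T)))/=; last by move=> y e _ /andP[].
rewrite mulnC -sum_nat_const; apply: eq_bigr => e eE; rewrite (eq_bigl (mem e)); last by move=> y; rewrite eE.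
rewrite sum1_card; case/zero_edgesP: eE => a [b [/uncovP[ab _] _ ->]].
by rewrite cards2 ab.
Qed.

Lemma sum_ndeg_cov c S : psts S ->
  (\sum_y ndeg c S y + \sum_y cov c S y = \sum_y ntot part c y)%N.
Proof. by move=> hS; rewrite -big_split/=; apply: eq_bigr => y _; rewrite ndeg_cov. Qed.

Lemma cov_all S y : psts S -> (cov 0 S y + cov 1 S y + cov 2 S y = 2 * #|[set t in S | y \in t]|)%N.
Proof.
move=> /pstsP[c3 _]; rewrite /Submission.cov -!big_split/= mulnC -sum_nat_const (bigID (fun t => y \in t))/= addnC big1 ?add0n.
  apply: eq_big => [t|t /andP[tS yt]]; first by rewrite inE.
  have := cardsD1 y t; rewrite yt c3// add1n => -[] e.
  rewrite /Submission.nbr [RHS]e -(cardsID [set u | vtype y u == 2%N] (t :\ y)) addnC; congr (_ + _)%N.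
    apply: eq_card => u; rewrite !inE yt/=; case: (u \in t); rewrite ?andbF//= ?andbT.
    by case: (u != y); rewrite ?andbF.
  rewrite -(cardsID [set u | vtype y u == 1%N] (_ :\: _)) addnC; congr (_ + _)%N.
    apply: eq_card => u; rewrite !inE yt/=; case: (u \in t); rewrite ?andbF//= ?andbT.
    by case: (u != y); rewrite ?andbF ?andbT//=; case: (vtype y u) => [|[|[|n]]]; rewrite ?andbF ?andbT.
  apply: eq_card => u; rewrite !inE yt/=; case: (u \in t); rewrite ?andbF//= ?andbT.
  case: (u != y); rewrite ?andbF//= ?andbT.
  by have := ptype_le2 (part y) (part u); rewrite -/(vtype y u); case: (vtype y u) => [|[|[|]]].
by move=> t /andP[_ yt]; rewrite !nbr_notin.
Qed.

Section Parts.
Variable v : nat.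
Hypothesis hv : forall P, #|[set x | part x == P]| = v.

Lemma card_parts : #|V| = (4 * v)%N.
Proof.
rewrite -sum1_card (partition_big part predT)//= (eq_bigr (fun _ => v)).
  by rewrite sum_nat_const card_ord.
by move=> P _; rewrite sum1dep_card hv.
Qed.

Lemma ntotE y : [/\ (ntot part 0 y + 1 = v)%N, ntot part 1 y = v & ntot part 2 y = (2 * v)%N].
Proof.
have ex (c : nat) : (ntot part c y + (c == 0) = \sum_(Q : 'I_4 | ptype (part y) Q == c) v)%N.
  have -> : (\sum_(Q : 'I_4 | ptype (part y) Q == c) v = #|[set u | vtype y u == c]|)%N.
    rewrite -sum1_card (partition_big part (fun Q => ptype (part y) Q == c))/=; last first.
      by move=> u; rewrite inE.
    apply: eq_bigr => Q /eqP hQ; rewrite -(hv Q) -sum1dep_card; apply: eq_bigl => u.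
    rewrite inE /Submission.vtype; case: (eqVneq (part u) Q) => [->|]; rewrite ?andbF// hQ eqxx.
    by [].
  rewrite [RHS](cardsD1 y) inE.
  have -> : (vtype y y == c) = (c == 0)%N by rewrite /Submission.vtype /ptype eqxx eq_sym.
  by rewrite addnC; congr (_ + _)%N; apply: eq_card => u; rewrite !inE.
have e0 := ex 0%N; have e1 := ex 1%N; have e2 := ex 2%N.
move: e0 e1 e2; rewrite !(big_mkcond (fun Q => ptype _ Q == _)) !big_ord_recl !big_ord0 /=.
move: (part y) (ntot part 0 y) (ntot part 1 y) (ntot part 2 y) => P n0 n1 n2.
by case: P => -[|[|[|[|//]]]] h; rewrite /ptype /= ?addn0 ?add0n => e0 e1 e2; split; lia.
Qed.

(** The triples at [y] cover its 4v - 1 partners two at a time, so the leave has odd degree. This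
    forces the final difference of the two degrees to be odd. *)
Lemma ndeg_parity S y : psts S -> exists j, (ndeg 0 S y + ndeg 1 S y + ndeg 2 S y + 2 * j + 1 = 4 * v)%N.
Proof.
move=> hS; exists #|[set t in S | y \in t]|; rewrite -cov_all//.
have [h0 h1 h2] := ntotE y.
have := ndeg_cov part 0 y hS; have := ndeg_cov part 1 y hS; have := ndeg_cov part 2 y hS.
lia.
Qed.
End Parts.

(* Removing a rainbow triple adds 2 to the type 2 degree of its apex, the point whose half it meets only once,
   and 1 to both degrees of its two other points: this is how the differences of the degrees are equalized. *)
Lemma apex_removal (X : {set {set V}}) (k : V -> nat) : (forall t, t \in X -> rainbow part t) ->
  (forall t, t \in X -> #|t| = 3%N) ->
  (forall y, (k y <= #|[set t in X | (y \in t) && (nbr 1 t y == 0%N)]|)%N) ->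
  exists X' : {set {set V}}, X' \subset X /\ forall w, (cov 2 X' w = cov 1 X' w + 2 * k w)%N.
Proof.
move=> Xr X3 hk.
have [Xs hXs] := @fin_all_exists V (fun=> {set {set V}}) (fun y S =>
  S \subset [set t in X | (y \in t) && (nbr 1 t y == 0%N)] /\ #|S| = k y) (fun y => subset_of_card (hk y)).
have XsP y t : t \in Xs y -> [/\ t \in X, y \in t & nbr 1 t y = 0%N].
  by have [/subsetP h _] := hXs y => /h; rewrite inE => /and3P[h1 h2 /eqP].
have apex t y w : t \in X -> y \in t -> w \in t -> nbr 1 t y = 0%N -> nbr 1 t w = 0%N -> y = w.
  move=> tX yt wt n1 n2; apply/eqP; apply: contraT => yw.
  have [] := sum_nbr_rainbow (Xr t tX) (X3 t tX).
  rewrite (bigD1 y)//= (bigD1 w) 1?eq_sym//= n1 n2 !add0n => h _.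
  have : (\sum_(i | (i != y) && (i != w)) nbr 1 t i <= \sum_(i in t :\ y :\ w) 1)%N.
    rewrite [leqRHS]big_mkcond [leqLHS]big_mkcond; apply: leq_sum => i _; rewrite !inE.
    case: (i != y); case: (i != w) => //=; have [it|it] := boolP (i \in t); last by rewrite nbr_notin.
    by have [_] := rainbow_nbr (Xr t tX) (X3 t tX) it.
  rewrite h sum1_card; have := cardsD1 y t; rewrite yt X3// add1n => -[e].
  by have := cardsD1 w (t :\ y); rewrite !inE eq_sym yw wt -e add1n => -[<-].
exists (\bigcup_y Xs y); split.
  by apply/bigcupsP => y _; apply/subsetP => t /XsP[].
move=> w; have [_ <-] := hXs w.
have -> : Xs w = [set t in \bigcup_y Xs y | (w \in t) && (nbr 1 t w == 0%N)].
  apply/setP => t; rewrite inE; apply/idP/andP => [tw|[/bigcupP[y _ ty] /andP[wt /eqP n]]].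
    by have [h1 h2 ->] := XsP _ _ tw; rewrite h2; split=> //; apply/bigcupP; exists w.
  by have [h1 h2 h3] := XsP _ _ ty; rewrite -(apex t y w).
rewrite /Submission.cov mulnC -sum_nat_const [X in (_ = _ + X)%N]big_mkcond [X in (X = _)%N]big_mkcond [X in (_ = X + _)%N]big_mkcond/=.
rewrite -big_split/=; apply: eq_bigr => t _; rewrite !inE; case: ifP => //= /bigcupP[y _ /XsP[tX _ _]].
have [wt|wt] := boolP (w \in t); last by rewrite !nbr_notin.
have [_] := rainbow_nbr (Xr t tX) (X3 t tX) wt.
by case: (nbr 1 t w) => [|[|//]] _ /=; lia.
Qed.

(** The exchanges are counted through pairs covered by [R], which its removal frees. Triples of [A]
    may have covered some again: at most 3 bA points for [p], and as many for its third point,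
    whence 6 bA. *)
Lemma fix_transfers T (F R A : {set {set V}}) (y0 : V) v q g (kappa cap Sb tau bA : nat) :
  (forall P, #|[set x | part x == P]| = v) ->
  psts T -> F \subset T ->
  (forall y, ndeg 2 T y = ndeg 1 T y + g)%N -> (\sum_y ndeg 1 T y = 4 * v * q)%N ->
  (forall y, q <= ndeg 1 T y + kappa)%N -> (forall y, ndeg 1 T y <= q + kappa)%N ->
  (forall y u, y != u -> covby R y u -> ~~ covby A y u -> uncov T y u) ->
  (forall t, t \in A -> #|t| = 3%N) -> (forall y, #|[set t in A | y \in t]| <= bA)%N ->
  (forall y w, y != w -> part y = part w ->
     (tau <= #|[set p | [&& vtype y p == 1%N, vtype y (third T y p) == 2%N, third T y p != p,
        tri T y p \in F, covby R w p & covby R w (third T y p)]]|)%N) ->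
  (0 < cap)%N -> (16 * v * kappa <= cap * Sb)%N -> (9 * (kappa + cap) + Sb + 6 * bA < tau)%N ->
  exists T' : {set {set V}}, [/\ psts T', (#|T' :\: T| <= 4 * v * kappa)%N, (#|T :\: T'| <= 4 * v * kappa)%N &
    forall y, [/\ ndeg 0 T' y = ndeg 0 T y, ndeg 1 T' y = q & ndeg 2 T' y = (q + g)%N]].
Proof.
move=> hv hT FT hg htot hlo hhi huc A3 hA hopt c0 hSb htau.
have hpart P : (\sum_(y | part y == P) ndeg 1 T y = \sum_(y | part y == P) q)%N.
  have h1 := balanced_degrees hg hv P; rewrite htot in h1.
  by rewrite sum_nat_cond_const hv; nia.
have [s [s1 s2 s3 s4]] := transfer_list hpart.
have sk : (size s <= 4 * v * kappa)%N.
  rewrite s4 -(card_parts hv) -sum_nat_const; apply: leq_sum => y _.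
  by rewrite leq_subLR.
pose ya (j : 'I_(size s)) := (nth (y0, y0) s j).1; pose yb (j : 'I_(size s)) := (nth (y0, y0) s j).2.
have cnt (p : pred (V * V)) : #|[set j : 'I_(size s) | p (nth (y0, y0) s j)]| = count p s.
  by rewrite -sum1_card -sum1_count (big_nth (y0, y0)) big_mkord; apply: eq_bigl => j; rewrite inE.
have ka y : #|[set j | ya j == y]| = (q - ndeg 1 T y)%N by rewrite -s2 -cnt.
have kb y : #|[set j | yb j == y]| = (ndeg 1 T y - q)%N by rewrite -s3 -cnt.
have sj j : ya j != yb j /\ part (ya j) = part (yb j) by apply: s1; apply: mem_nth.
have bad w : (#|[set p | covby A w p]| <= 3 * bA)%N.
  apply: (@leq_trans #|\bigcup_(t in [set t in A | w \in t]) t|).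
    apply: subset_leq_card; apply/subsetP => p; rewrite inE => /covbyP[t [tA wt pt]].
    by apply/bigcupP; exists t; rewrite ?inE ?tA.
  apply: leq_trans (leq_card_bigcup _ _) _.
  rewrite (eq_bigr (fun _ => 3%N)) => [|t]; last by rewrite inE => /andP[/A3].
  by rewrite sum_nat_const mulnC leq_mul2l hA.
have [||||||||T' [t1 t2 t3 t4]] := @transfer V part T F (size s) kappa cap Sb (tau - 6 * bA) ya yb y0 hT FT.
- by move=> j; have [] := sj j.
- by move=> j; have [] := sj j.
- by move=> y; rewrite ka leq_subLR.
- by move=> y; rewrite kb leq_subLR.
- move=> j; have [h1 h2] := sj j; rewrite leq_subLR; apply: leq_trans (hopt _ _ h1 h2) _.
  set O := [set p | _]; set O' := [set p | _].
  have : (#|O| <= #|[set p | covby A (yb j) p] :|: (third T (ya j) @^-1: [set p | covby A (yb j) p]) :|: O'|)%N.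
    apply: subset_leq_card; apply/subsetP => p; rewrite !inE => /and5P[v1 v2 -> -> /andP[r1 r2]] /=.
    have n0 u (c : nat) : (0 < c)%N -> vtype (ya j) u == c -> yb j != u.
      move=> c0' /eqP e; apply/eqP => e'; move: e; rewrite /Submission.vtype h2 e'.
      by have := ptype0 (part u) (part u); rewrite eqxx => /eqP ->; case: (c) c0'.
    have m1 := n0 p 1%N isT v1; have m2 := n0 _ 2%N isT v2; rewrite v1 v2 /=.
    have [//|n1] := boolP (covby A (yb j) p).
    have [//|n2] := boolP (covby A (yb j) (third T (ya j) p)).
    by rewrite !huc.
  move/leq_trans; apply; apply: leq_trans (leq_card_setU _ _) _; rewrite leq_add2r.
  apply: leq_trans (leq_card_setU _ _) _.
  have -> : #|third T (ya j) @^-1: [set p | covby A (yb j) p]| = #|[set p | covby A (yb j) p]|.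
    by rewrite on_card_preimset//; exists (third T (ya j)) => x _; exact: thirdK.
  by have := bad (yb j); lia.
- by [].
- by apply: leq_trans hSb; nia.
- by lia.
exists T'; split=> //; [exact: leq_trans t2 _|exact: leq_trans t3 _|].
move=> y; have := ndeg_cov part 0 y t1; have := ndeg_cov part 1 y t1; have := ndeg_cov part 2 y t1.
have := ndeg_cov part 0 y hT; have := ndeg_cov part 1 y hT; have := ndeg_cov part 2 y hT.
have := t4 0%N y; have := t4 1%N y; have := t4 2%N y; have := hg y.
rewrite ka kb /= ?addn0 ?add0n ?muln0 ?muln1 ?addn0.
by move=> *; split; lia.
Qed.
End FixCore.

Lemma third_sub (V : finType) (S T : {set {set V}}) (y p : V) : psts S -> psts T ->
  tri S y p \in T -> third S y p != p -> third T y p = third S y p.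
Proof.
move=> hS hT tT h; have [h1 h2 h3 h4] := thirdP hS h.
have yt : y \in tri S y p by rewrite !inE eqxx.
have pt : p \in tri S y p by rewrite !inE eqxx orbT.
have [h5 e] := third_uniq hT tT yt pt h3.
have : third S y p \in tri T y p by rewrite -e !inE eqxx !orbT.
by rewrite !inE (negbTE h2) (negbTE h) => /eqP.
Qed.

(** The equation for the difference g of the final degrees q and q + g = z - q. Apex removals raise
    the type 1 total by S1 - S2 + 4 v g, and the result has to be 4 v q = 2 v (z - g). One more edge
    in [B] raises S2 - 2 S1 by 12, while g + 2 in place of g raises 6 v g by 12 v: so [NB] has to
    hit one residue modulo v, and g can be kept odd. *)
Lemma leave_balance_residue (v z n d E NB S1 S2 : int) (g k u2 : int) :
  3 * (v + 2 * u2) = v * (z - 4 * v + 4) -> u2 + n - d + NB = v * k -> g = 2 * k + 1 ->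
  forall r C0 C1 : int,
  S2 = 8 * v ^+ 2 - 4 * d + 4 * r - 4 * (E - NB) ->
  S1 = 4 * v ^+ 2 - C1 + 2 * r - 4 * NB -> C0 + C1 + 4 * d = 6 * n ->
  C0 = 4 * v * (v - 1) - 2 * E ->
  6 * v * g = 2 * v * z + S2 - 2 * S1.
Proof.
move=> h1 h2 -> r C0 C1 -> -> h3 h4.
have -> : C1 = 6 * n - 4 * d - C0 by rewrite -h3; ring.
have -> : 6 * v * (2 * k + 1) = 12 * (v * k) + 6 * v by ring.
rewrite -h2 h4.
have -> : 2 * v * z = 2 * (3 * (v + 2 * u2) + 4 * v * v - 4 * v) by rewrite h1; ring.
ring.
Qed.

Lemma leave_balance_solvable (v z : nat) : odd z -> (3 %| v * (z + 2 * v + 1))%N ->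
  exists u2 : int, 3 * (v%:Z + 2 * u2) = v%:Z * (z%:Z - 4 * v%:Z + 4).
Proof.
move=> oz /dvdnP[w3 e3].
have [w2 e2] : exists w2, w3 = (2 * w2)%N.
  have /dvdnP[w2 ->] : (2 %| w3)%N; last by exists w2; rewrite mulnC.
  have o2 : odd (2 * v) = false by rewrite mul2n odd_double.
  have : (2 %| w3 * 3)%N by rewrite -e3 dvdn_mull// dvdn2 addn1 /= oddD oz o2.
  by rewrite Gauss_dvdl.
exists (w2%:Z - v%:Z * v%:Z).
have e : v%:Z * (z%:Z + 2 * v%:Z + 1) = 6 * w2%:Z.
  have -> : v%:Z * (z%:Z + 2 * v%:Z + 1) = (v * (z + 2 * v + 1))%N by lia.
  by rewrite e3 e2; lia.
have -> : v%:Z * (z%:Z - 4 * v%:Z + 4) = v%:Z * (z%:Z + 2 * v%:Z + 1) - 6 * (v%:Z * v%:Z) + 3 * v%:Z by ring.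
by rewrite e; ring.
Qed.

(** S2 and 2 S1 differ by at most 4 v eta, so 3 g differs from z by at most 2 eta; as z >= 7 eta, g
    is positive. *)
Lemma degree_gap (v z eta S1 S2 : nat) (k : int) : (0 < v)%N -> odd z -> (7 * eta <= z)%N ->
  (S2 <= 2 * S1 + 4 * v * eta)%N -> (2 * S1 <= S2 + 4 * v * eta)%N ->
  6 * v%:Z * (2 * k + 1) = 2 * v%:Z * z%:Z + S2%:Z - 2 * S1%:Z ->
  exists g, [/\ (6 * v * g + 2 * S1 = 2 * v * z + S2)%N, odd g, (3 * g <= z + 2 * eta)%N &
    (z <= 3 * g + 2 * eta)%N].
Proof.
move=> v0 oz hz b1 b2 key; have z0 : (0 < z)%N by case: z oz {hz key}.
have kp : 0 <= k.
  rewrite leNgt; apply/negP => kn.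
  have : 6 * v%:Z * (2 * k + 1) <= - (6 * v%:Z) by nia.
  rewrite key; nia.
have e : (6 * v * (2 * `|k| + 1) + 2 * S1 = 2 * v * z + S2)%N by nia.
exists (2 * `|k| + 1)%N; split=> //; first by rewrite oddD mul2n odd_double.
  by move: (2 * `|k| + 1)%N e => g e; rewrite -(@leq_pmul2l (2 * v)) ?muln_gt0//; nia.
by move: (2 * `|k| + 1)%N e => g e; rewrite -(@leq_pmul2l (2 * v)) ?muln_gt0//; nia.
Qed.

(** The number of triples with apex y to remove is half of g + d1 - d2. It is an integer because g
    and d1 + d2 are odd; since it is about (z / 3 - m1) / 2, the margin 7 eta keeps it nonnegative
    and 9 eta keeps it below [kX]. *)
Lemma apex_count (v z m1 eps Delta cap kX d1 d2 g j : nat) (eta := (2 * eps + 6 * Delta + 4 * cap)%N) :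
  (d2 <= 2 * d1 + eta)%N -> (2 * d1 <= d2 + eta)%N ->
  (m1 <= d1 + 2 * (Delta + cap))%N -> (d1 <= m1 + eps + Delta)%N ->
  (d1 + d2 + 2 * j + 1 = 4 * v)%N -> odd g -> (3 * g <= z + 2 * eta)%N -> (z <= 3 * g + 2 * eta)%N ->
  (3 * m1 + 7 * eta <= z <= 3 * m1 + 9 * eta)%N -> (3 * eta <= kX)%N ->
  (d2 + 2 * ((g + d1 - d2) %/ 2) = d1 + g)%N /\ ((g + d1 - d2) %/ 2 <= kX)%N.
Proof.
move=> h1 h2 h3 h4 hj og gz1 gz2 hz hk.
have [i ei] : exists i, g = (2 * i + 1)%N.
  by exists g./2; have := odd_double_half g; rewrite og; lia.
by move: h1 h2 h3 h4 gz1 gz2 hz hk; rewrite /eta => *; split; lia.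
Qed.

Section FixCore.
Variables (V : finType) (part : V -> 'I_4).
Implicit Types (S T R X F : {set {set V}}) (t e : {set V}) (x y u w a b : V) (c : nat).
Local Notation vtype := (vtype part).
Local Notation nbr := (nbr part).
Local Notation cov := (cov part).
Local Notation ndeg := (ndeg part).

Lemma ndeg_surgery c T R A y : psts T -> R \subset T -> psts (T :\: R :|: A) -> [disjoint T & A] ->
  (ndeg c (T :\: R :|: A) y + cov c A y = ndeg c T y + cov c R y)%N.
Proof.
move=> hT RT hT2 dTA; have d : [disjoint T :\: R & A] by apply: disjointWl dTA; apply: subsetDl.
have := ndeg_cov part c y hT2; have := ndeg_cov part c y hT.
have := covD part c y RT; rewrite (covU part c y d).
move: (ndeg c T y) (cov c (T :\: R) y) => n1 n2; clear; lia.
Qed.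

Lemma ndeg_removal c T X y : psts T -> X \subset T ->
  ndeg c (T :\: X) y = (ndeg c T y + cov c X y)%N.
Proof.
move=> hT XT; have hT' := psts_sub (subsetDl T X) hT.
have := ndeg_cov part c y hT; have := ndeg_cov part c y hT'; have := covD part c y XT.
move: (ndeg c T y) (cov c X y) => n1 n2; clear; lia.
Qed.

(** Three disjoint stocks of triples keep the repairs apart: [R] is removed entirely to make room
    for absorbing triples, apexes are deleted from [X], exchanges take their triples from [F].
    [kappa] bounds how far a type 1 degree is from its target before the exchanges. *)
Lemma fix_core T R X F (y0 : V) (v z m1 eps Delta kX bX cap Sb tau cap4 Sb4 : nat) :
  let eta := (2 * eps + 6 * Delta + 4 * cap)%N in
  let kappa := (4 * eta + bX)%N in
  (forall P, #|[set x | part x == P]| = v) -> (0 < v)%N ->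
  psts T -> R \subset T -> X \subset T -> F \subset T ->
  [disjoint R & X] -> [disjoint R & F] -> [disjoint X & F] ->
  (forall t, t \in R -> rainbow part t) -> (forall t, t \in X -> rainbow part t) ->
  (forall y, lv T y <= Delta)%N ->
  (forall a b c, a != b -> part a = part b -> (c == 1%N) || (c == 2%N) ->
    (tau <= #|[set x | [&& vtype a x == c, covby R a x & covby R b x]]|)%N) ->
  (0 < cap)%N -> (4 * #|zero_edges part T| <= cap * Sb)%N -> (6 * (Delta + cap) + Sb < tau)%N ->
  (forall y, (m1 <= cov 1 R y <= m1 + eps) && (2 * m1 <= cov 2 R y <= 2 * m1 + eps))%N ->
  (forall y, kX <= #|[set t in X | (y \in t) && (nbr 1 t y == 0%N)]|)%N ->
  (forall y, #|[set t in X | y \in t]| <= bX)%N ->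
  (forall y w, y != w -> part y = part w ->
     (tau <= #|[set p | [&& vtype y p == 1%N, vtype y (third T y p) == 2%N, third T y p != p,
        tri T y p \in F, covby R w p & covby R w (third T y p)]]|)%N) ->
  (v <= #|zero_edges part T|)%N ->
  (3 * m1 + 7 * eta <= z <= 3 * m1 + 9 * eta)%N -> (3 * eta <= kX)%N ->
  (0 < cap4)%N -> (16 * v * kappa <= cap4 * Sb4)%N ->
  (9 * (kappa + cap4) + Sb4 + 6 * (Delta + cap) < tau)%N ->
  odd z -> (3 %| v * (z + 2 * v + 1))%N ->
  exists (T' : {set {set V}}) (q w : nat), [/\ psts T', (q + w = z)%N,
    forall y, [/\ ndeg 0 T' y = 0%N, ndeg 1 T' y = q & ndeg 2 T' y = w],
    (#|T' :\: T| <= #|zero_edges part T| + 4 * v * kappa)%N &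
    (#|T :\: T'| <= #|R| + #|X| + 4 * v * kappa)%N].
Proof.
move=> eta kappa hv v0 hT RT XT FT RX RF XF Rr Xr lvT hopt c0 hSb htau hm1 hkX hbX hswap hE hz hkX2 c40 hSb4 htau4 oz z3.
have /pstsP[T3c _] := hT.
have card3 S t : S \subset T -> t \in S -> #|t| = 3%N by move=> /subsetP h /h/T3c.
set E := #|zero_edges part T| in hSb hE *.
pose d := (\sum_(t in T) (\sum_y nbr 2 t y) %/ 4)%N.
have hd : (\sum_y cov 2 T y = 4 * d)%N.
  rewrite sum_cov /d big_distrr/=; apply: eq_bigr => t tT.
  by rewrite mulnC divnK// sum_nbr2_mod// T3c.
have hall : (\sum_y cov 0 T y + \sum_y cov 1 T y + \sum_y cov 2 T y = 6 * #|T|)%N.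
  rewrite !sum_cov -!big_split/= mulnC -sum_nat_const; apply: eq_bigr => t tT.
  by rewrite sum_nbr_all// T3c.
have hVc := card_parts hv.
have snt : [/\ (\sum_y ntot part 0 y + 4 * v = 4 * v * v)%N, (\sum_y ntot part 1 y = 4 * v * v)%N &
    (\sum_y ntot part 2 y = 8 * v * v)%N].
  split.
  - rewrite -[X in (_ + X = _)%N]hVc -sum1_card -big_split/=.
    rewrite (eq_bigr (fun _ => v)) => [|y _]; first by rewrite sum_nat_const hVc.
    by have [] := ntotE hv y.
  - rewrite (eq_bigr (fun _ => v)) => [|y _]; first by rewrite sum_nat_const hVc.
    by have [] := ntotE hv y.
  rewrite (eq_bigr (fun _ => 2 * v)%N) => [|y _]; first by rewrite sum_nat_const hVc; clear; lia.
  by have [] := ntotE hv y.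
have [sn0 sn1 sn2] := snt.
have sumR c k : (forall t, t \in R -> \sum_y nbr c t y = k)%N -> (\sum_y cov c R y = k * #|R|)%N.
  by move=> h; rewrite sum_cov (eq_bigr (fun _ => k)) ?sum_nat_const 1?mulnC.
have sR1 : (\sum_y cov 1 R y = 2 * #|R|)%N.
  by apply: sumR => t tR; have [] := sum_nbr_rainbow (Rr t tR) (card3 _ _ RT tR).
have sR2 : (\sum_y cov 2 R y = 4 * #|R|)%N.
  by apply: sumR => t tR; have [] := sum_nbr_rainbow (Rr t tR) (card3 _ _ RT tR).
have [u2 hu2] := leave_balance_solvable oz z3.
(* There are at least v type 0 edges, so every residue modulo v is available for the number [NB] of
   those in [B]. *)
have [NB [k0 [hNB hk0]]] := residue_shift (u2 + #|T|%:Z - d%:Z) v0.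
have [B [BE cB]] := subset_of_card (leq_trans (ltnW hNB) hE).
have [A [[hT2 dTA cA] hA1 hA2 hA3 [hA4 hA5]]] := absorb y0 hT RT Rr lvT hopt c0 hSb htau B.
set T2 := (T :\: R) :|: A in hT2 hA2.
have bE : B :&: zero_edges part T = B by apply/setIidPl.
have eB : #|zero_edges part T :\: B| = (E - NB)%N by rewrite cardsD setIC bE cB.
rewrite bE cB in hA4; rewrite eB in hA5.
have nd2 c y : (ndeg c T2 y + cov c A y = ndeg c T y + cov c R y)%N.
  by exact: ndeg_surgery.
have sumnd c : (\sum_y ndeg c T2 y + \sum_y cov c A y = \sum_y ndeg c T y + \sum_y cov c R y)%N.
  by rewrite -!big_split; apply: eq_bigr => y _; apply: nd2.
have s0 := sum_ndeg_cov part 0 hT; have s1 := sum_ndeg_cov part 1 hT; have s2 := sum_ndeg_cov part 2 hT.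
have sz := sum_ndeg_zero part T; rewrite -/E in sz.
set S1 := (\sum_y ndeg 1 T2 y)%N; set S2 := (\sum_y ndeg 2 T2 y)%N.
have key : 6 * v%:Z * (2 * k0 + 1) = 2 * v%:Z * z%:Z + S2%:Z - 2 * S1%:Z.
  have lNB : (NB <= E)%N by exact: leq_trans (ltnW hNB) hE.
  have e1 := sumnd 1%N; have e2 := sumnd 2%N; rewrite -/S1 -/S2 in e1 e2.
  move: e1 e2 s0 s1 s2 sR1 sR2 sn0 sn1 sn2 hall sz hA4 hA5; rewrite hd.
  move: (\sum_y ntot part 0 y)%N (\sum_y ntot part 1 y)%N (\sum_y ntot part 2 y)%N => N0 N1 N2.
  move: (\sum_y cov 1 A y)%N (\sum_y cov 2 A y)%N => A1 A2.
  move: (\sum_y cov 1 R y)%N (\sum_y cov 2 R y)%N => R1 R2.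
  move: (\sum_y ndeg 0 T y)%N (\sum_y ndeg 1 T y)%N (\sum_y ndeg 2 T y)%N => D0 D1 D2.
  move: (\sum_y cov 0 T y)%N (\sum_y cov 1 T y)%N => C0 C1.
  move=> e1 e2 s0 s1 s2 sR1 sR2 sn0 sn1 sn2 hall sz hA4 hA5.
  have hNBE : (E - NB)%:Z = E%:Z - NB%:Z by rewrite subzn.
  clear - e1 e2 s0 s1 s2 sR1 sR2 sn0 sn1 sn2 hall sz hA4 hA5 hu2 hk0 hNBE.
  apply: (leave_balance_residue (u2 := u2) (n := #|T|%:Z) (d := d%:Z) (E := E%:Z) (NB := NB%:Z) (r := #|R|%:Z) (C0 := C0%:Z) (C1 := C1%:Z) _ hk0 erefl).
  - exact: hu2.
  - have -> : 8 * v%:Z ^+ 2 = (8 * v * v)%N by lia.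
    by clear - s2 e2 sR2 sn2 hA5 hNBE; lia.
  - have -> : 4 * v%:Z ^+ 2 = (4 * v * v)%N by lia.
    by clear - s1 e1 sR1 sn1 hA4; lia.
  - by clear - hall; lia.
  - have -> : 4 * v%:Z * (v%:Z - 1) = (4 * v * v)%N%:Z - (4 * v)%N%:Z by lia.
    by clear - s0 sn0 sz; lia.
have degA c y : (cov c A y <= 2 * (Delta + cap))%N.
  apply: (@leq_trans (2 * #|[set t in A | y \in t]|)); last by rewrite leq_mul2l hA3.
  rewrite /Submission.cov mulnC -sum_nat_const [leqRHS]big_mkcond [leqLHS]big_mkcond/=.
  apply: leq_sum => t _; rewrite inE; case tA : (t \in A) => //=.
  case yt : (y \in t); last by rewrite nbr_notin ?yt.
  apply: nbr_le2; have /pstsP[h _] := hT2; apply: h; rewrite /T2 in_setU tA orbT; exact: isT.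
have degT c y : (ndeg c T y <= Delta)%N.
  apply: leq_trans (lvT y); apply: subset_leq_card; apply/subsetP => u.
  by rewrite !inE => /andP[].
have bnd y : [/\ (ndeg 2 T2 y <= 2 * ndeg 1 T2 y + eta)%N, (2 * ndeg 1 T2 y <= ndeg 2 T2 y + eta)%N,
    (m1 <= ndeg 1 T2 y + 2 * (Delta + cap))%N & (ndeg 1 T2 y <= m1 + eps + Delta)%N].
  have := nd2 1%N y; have := nd2 2%N y; have := degA 1%N y; have := degA 2%N y.
  have := degT 1%N y; have := degT 2%N y; have /andP[/andP[r1 r2] /andP[r3 r4]] := hm1 y.
  by move: (ndeg 1 T2 y) (ndeg 2 T2 y) r1 r2 r3 r4 => n1 n2; rewrite /eta; clear; split; lia.
have b1 : (S2 <= 2 * S1 + 4 * v * eta)%N.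
  rewrite -hVc -sum_nat_const /S1 big_distrr/= -big_split/=; apply: leq_sum => y _.
  by have [] := bnd y.
have b2 : (2 * S1 <= S2 + 4 * v * eta)%N.
  rewrite -hVc -sum_nat_const /S1 big_distrr/= -big_split/=; apply: leq_sum => y _.
  by have [] := bnd y.
have hz7 : (7 * eta <= z)%N by case/andP: hz => h _; apply: leq_trans h; apply: leq_addl.
have [g [hg og gz1 gz2]] := degree_gap v0 oz hz7 b1 b2 key.
pose ky y := ((g + ndeg 1 T2 y - ndeg 2 T2 y) %/ 2)%N.
have hky y : (ndeg 2 T2 y + 2 * ky y = ndeg 1 T2 y + g)%N /\ (ky y <= kX)%N.
  have [h1 h2 h3 h4] := bnd y.
  have [j hj] := ndeg_parity hv y hT2; rewrite hA2 add0n in hj.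
  exact: apex_count h1 h2 h3 h4 hj og gz1 gz2 hz hkX2.
have hkX3 y : (ky y <= #|[set t in X | (y \in t) && (nbr 1 t y == 0%N)]|)%N.
  by have [_ h] := hky y; apply: leq_trans h (hkX y).
have [X' [X'X hX']] := apex_removal Xr (fun t => card3 X t XT) hkX3.
have X'T2 : X' \subset T2.
  apply/subsetP => t /(subsetP X'X) tX; rewrite /T2 !in_setU in_setD (subsetP XT)// andbT.
  by rewrite (disjointFl RX tX).
pose T3 := T2 :\: X'.
have hT3 : psts T3 by apply: psts_sub hT2; apply: subsetDl.
have nd3 c y : (ndeg c T3 y = ndeg c T2 y + cov c X' y)%N.
  by exact: ndeg_removal.
have X'3 t : t \in X' -> rainbow part t /\ #|t| = 3%N.
  by move=> /(subsetP X'X) tX; split; [exact: Xr|exact: card3 XT tX].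
have c1X y : (cov 1 X' y <= bX)%N.
  apply: leq_trans (hbX y); rewrite /Submission.cov -sum1_card [leqRHS]big_mkcond [leqLHS]big_mkcond/=.
  apply: leq_sum => t _; rewrite inE; case tX : (t \in X') => //=.
  rewrite (subsetP X'X)//=.
  case yt : (y \in t); last by rewrite nbr_notin ?yt.
  by have [r3 t3] := X'3 t tX; have [] := rainbow_nbr r3 t3 yt.
have c0X y : cov 0 X' y = 0%N.
  rewrite /Submission.cov big1// => t tX.
  case yt : (y \in t); last by rewrite nbr_notin ?yt.
  by have [r3 t3] := X'3 t tX; have [] := rainbow_nbr r3 t3 yt.
have hg3 y : (ndeg 2 T3 y = ndeg 1 T3 y + g)%N.
  have [h _] := hky y; rewrite !nd3 hX'; move: (ky y) (ndeg 1 T2 y) (ndeg 2 T2 y) h; clear; lia.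
have sX1 : (\sum_y cov 1 X' y = 2 * \sum_y ky y)%N.
  have e1 : (\sum_y cov 1 X' y = 2 * #|X'|)%N.
    rewrite sum_cov (eq_bigr (fun _ => 2%N)) ?sum_nat_const 1?mulnC// => t tX.
    by have [r3 t3] := X'3 t tX; have [] := sum_nbr_rainbow r3 t3.
  have e2 : (\sum_y cov 2 X' y = 4 * #|X'|)%N.
    rewrite sum_cov (eq_bigr (fun _ => 4%N)) ?sum_nat_const 1?mulnC// => t tX.
    by have [r3 t3] := X'3 t tX; have [] := sum_nbr_rainbow r3 t3.
  have : (\sum_y cov 2 X' y = \sum_y cov 1 X' y + 2 * \sum_y ky y)%N.
    by rewrite [X in (_ + X)%N]big_distrr -big_split; apply: eq_bigr => y _; rewrite hX'.
  by rewrite e1 e2; move: (\sum_y ky y)%N; clear; lia.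
have sky : (S2 + 2 * \sum_y ky y = S1 + 4 * v * g)%N.
  rewrite -hVc -sum_nat_const /S1 /S2 big_distrr -!big_split; apply: eq_bigr => y _.
  by have [] := hky y.
(* The final degrees q and q + g must add up to z; both z and g are odd. *)
have [q hq] : exists q, (2 * q + g = z)%N.
  exists ((z - g) %/ 2)%N; have le : (g <= z)%N by clear - gz1 hz7; lia.
  have : (2 %| z - g)%N by rewrite dvdn2 oddB// oz og.
  by move/divnK; clear - le; lia.
have tot3 : (\sum_y ndeg 1 T3 y = 4 * v * q)%N.
  rewrite (eq_bigr (fun y => ndeg 1 T2 y + cov 1 X' y)%N) => [|y _]; last exact: nd3.
  rewrite big_split/= sX1 -/S1; move: (\sum_y ky y)%N sky => K sky; clear - sky hg hq; nia.
have uncA y u : y != u -> covby R y u -> ~~ covby A y u -> uncov T3 y u.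
  move=> yu /covbyP[r [rR yr ur]] nA; rewrite uncovE yu; apply/covbyP => -[t [tT3 yt ut]].
  have /pstsP[_ un2] := hT.
  move: tT3; rewrite in_setD in_setU in_setD => /andP[_ /orP[/andP[tnR tT]|tA]].
    by move: tnR; rewrite (un2 t r y u)// ?rR// (subsetP RT).
  by move/negP: nA; apply; apply/covbyP; exists t.
have FT3 : F \subset T3.
  apply/subsetP => t tF; rewrite in_setD in_setU in_setD (subsetP FT)// andbT (disjointFl RF tF) andbT.
  by apply: contraFN (disjointFl XF tF) => /(subsetP X'X).
have A3 t : t \in A -> #|t| = 3%N.
  by move=> tA; have /pstsP[h _] := hT2; apply: h; rewrite /T2 in_setU tA orbT.
have [||||T' [t1 t2 t3 t4]] := @fix_transfers V part T3 F R A y0 v q g kappa cap4 Sb4 tau (Delta + cap)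
  hv hT3 FT3 hg3 tot3 _ _ uncA A3 hA3 _ c40 hSb4.
- move=> y; have [h1 h2 h3 h4] := bnd y; rewrite nd3; clear - h1 h2 h3 h4 hz gz1 gz2 hq; rewrite /kappa /eta in hz gz1 gz2 *; lia.
- move=> y; have [h1 h2 h3 h4] := bnd y; have h5 := c1X y.
  by rewrite nd3; clear - h1 h2 h3 h4 h5 hz gz1 gz2 hq; rewrite /kappa /eta in hz gz1 gz2 *; lia.
- move=> y w yw pyw; apply: leq_trans (hswap y w yw pyw) _.
  apply: subset_leq_card; apply/subsetP => p; rewrite !inE => /and5P[a1 a2 a3 a4 a5].
  have e : third T3 y p = third T y p by apply: third_sub => //; apply: (subsetP FT3).
  by rewrite /tri e a1 a2 a3 a4 a5.
- by [].
exists T', q, (q + g)%N; split=> //.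
- by clear - hq; lia.
- move=> y; have [h1 h2 h3] := t4 y; split=> //.
  by rewrite h1 nd3 hA2 c0X.
- apply: leq_trans (_ : (#|A :|: (T' :\: T3)| <= _)%N).
    apply: subset_leq_card; apply/subsetP => t; rewrite in_setU !in_setD in_setU in_setD.
    by case: (t \in T); case: (t \in A); case: (t \in X'); rewrite /= ?andbF ?andbT ?orbT /=.
  have l (P Q : {set {set V}}) : (#|P :|: Q| <= #|P| + #|Q|)%N := leq_card_setU P Q.
  by apply: leq_trans (l _ _) _; rewrite cA leq_add2l.
apply: leq_trans (_ : (#|R :|: X :|: (T3 :\: T')| <= _)%N).
  apply: subset_leq_card; apply/subsetP => t; rewrite !in_setU !in_setD in_setU in_setD.
  move=> /andP[-> ->]; case tR : (t \in R) => //=; case tX : (t \in X) => //=.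
  by rewrite !andbT; apply: contraFN tX => /(subsetP X'X).
have l (P Q : {set {set V}}) : (#|P :|: Q| <= #|P| + #|Q|)%N := leq_card_setU P Q.
apply: leq_trans (l _ _) _; apply: leq_add => //; exact: l.
Qed.
End FixCore.

(** * From a regular leave to a Steiner triple system *)

(* Rado's proof: while some [A x] has two elements, one of them can be deleted, because two tight
   obstructions would contradict submodularity. *)
Lemma hall (I B : finType) (A : I -> {set B}) :
  (forall X : {set I}, #|X| <= #|\bigcup_(x in X) A x|)%N ->
  exists f : I -> B, injective f /\ forall x, f x \in A x.
Proof.
have [n] := ubnP (\sum_x #|A x|)%N; elim: n A => // n IH A hn hA.
have A1 x : (0 < #|A x|)%N.
  by have := hA [set x]; rewrite cards1 big_set1.
have [x x2|no2] := pickP (fun x => (1 < #|A x|)%N); last first.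
  have ex' x : exists b, A x = [set b].
    by apply/cards1P; rewrite eqn_leq A1 andbT leqNgt no2.
  have [f hf] := fin_all_exists ex'.
  exists f; split=> [x y e|x]; last by rewrite hf inE.
  apply/eqP; apply: contraT => xy; have := hA [set x; y].
  by rewrite cards2 xy bigcup_setU !big_set1 !hf e setUid cards1.
have [b1 [b2 [b1A b2A b12]]] : exists b1 b2, [/\ b1 \in A x, b2 \in A x & b1 != b2].
  have [b1 b1A] := card_gt0P (A1 x); have := cardsD1 b1 (A x); rewrite b1A => e.
  have : (0 < #|A x :\ b1|)%N by lia.
  by case/card_gt0P => b2; rewrite !inE eq_sym => /andP[h1 h2]; exists b1, b2.
pose A' b y := if y == x then A x :\ b else A y.
have dec b : b \in A x -> (\sum_y #|A' b y| < n)%N.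
  move=> bA; have : (\sum_y #|A' b y| < \sum_y #|A y|)%N; last by lia.
  rewrite (bigD1 x)//= [ltnRHS](bigD1 x)//= /A' eqxx [#|A x|](cardsD1 b) bA add1n ltnS.
  by rewrite leq_add2l; apply: leq_sum => y /negbTE ->.
have sub b y : A' b y \subset A y by rewrite /A'; case: eqP => [->|]; rewrite ?subsetDl.
have go b : b \in A x -> (forall X : {set I}, (#|X| <= #|\bigcup_(y in X) A' b y|)%N) ->
    exists f : I -> B, injective f /\ forall y, f y \in A y.
  move=> bA h; have [f [f1 f2]] := IH _ (dec b bA) h.
  by exists f; split=> // y; apply: (subsetP (sub b y)).
(* If deleting [b] from [A x] breaks the condition, the violating set contains [x]; what remains of
   it without [x] is the tight obstruction. *)
have bad b : (exists X : {set I}, x \notin X /\ (#|\bigcup_(y in X) A y :|: (A x :\ b)| <= #|X|)%N) \/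
    (forall X : {set I}, (#|X| <= #|\bigcup_(y in X) A' b y|)%N).
  have [X hX|h] := pickP (fun X : {set I} => (#|\bigcup_(y in X) A' b y| < #|X|)%N); last first.
    by right=> X; rewrite leqNgt h.
  left; have xX : x \in X.
    apply: contraTT hX => xX; rewrite -leqNgt.
    rewrite (eq_bigr A); first exact: hA.
    by move=> y yX; rewrite /A'; case: eqP => // e; rewrite -e yX in xX.
  exists (X :\ x); rewrite !inE eqxx; split=> //.
  move: hX; rewrite [in leqRHS](cardsD1 x) xX add1n ltnS; apply: leq_trans.
  rewrite [X in (_ <= #|pred_of_set X|)%N](big_setD1 x)//= setUC; apply: subset_leq_card; apply: setUSS; first by rewrite /A' eqxx.
  by apply/bigcupsP => y yX; apply: (bigcup_max y) => //; rewrite /A'; move: yX; rewrite !inE => /andP[/negbTE ->].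
have [[X1 [x1 h1]]|] := bad b1; last exact: go.
have [[X2 [x2' h2]]|] := bad b2; last exact: go.
exfalso.
have uA (X Y : {set I}) : \bigcup_(y in X :|: Y) A y = \bigcup_(y in X) A y :|: \bigcup_(y in Y) A y by apply: bigcup_setU.
have hU := hA (x |: (X1 :|: X2)); have hI := hA (X1 :&: X2).
rewrite cardsU1 inE negb_or x1 x2' add1n in hU.
have cU := cardsUI X1 X2.
set U1 := _ :|: (A x :\ b1) in h1; set U2 := _ :|: (A x :\ b2) in h2.
have cU' := cardsUI U1 U2.
have le1 : (#|\bigcup_(y in x |: (X1 :|: X2)) A y| <= #|U1 :|: U2|)%N.
  apply: subset_leq_card; rewrite !uA big_set1 /U1 /U2; apply/subsetP => b; rewrite !inE.
  move=> /or3P[bA|->|->]; rewrite ?orbT// bA !andbT.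
  by have [->|] := eqVneq b b1; rewrite ?b12 ?orbT.
have le2 : (#|\bigcup_(y in X1 :&: X2) A y| <= #|U1 :&: U2|)%N.
  apply: subset_leq_card; apply/bigcupsP => y; rewrite inE => /andP[y1 y2].
  by rewrite subsetI !(subset_trans _ (subsetUl _ _))// (bigcup_max y).
move: hU hI cU cU' h1 h2 le1 le2.
move: #|\bigcup_(y in x |: (X1 :|: X2)) A y| #|\bigcup_(y in X1 :&: X2) A y| #|U1 :|: U2| #|U1 :&: U2| #|U1| #|U2| => n1 n2 n3 n4 n5 n6.
move: #|X1 :|: X2| #|X1 :&: X2| #|X1| #|X2| => m1 m2 m3 m4; clear; lia.
Qed.

Section Factorization.
Variables (V : finType) (side : V -> bool).
Implicit Types (e : rel V) (x y : V).

Lemma regular_perm e d : symmetric e -> (0 < d)%N -> (forall x, #|[set y | e x y]| = d) ->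
  exists f : V -> V, injective f /\ forall x, e x (f x).
Proof.
move=> es d0 hd; have [X|f [f1 f2]] := @hall V V (fun x => [set y | e x y]).
  rewrite -(leq_pmul2l d0); set N := \bigcup_(_ in _) _.
  have -> : (d * #|X| = \sum_(x in X) \sum_(y in N | e x y) 1)%N.
    rewrite mulnC -sum_nat_const; apply: eq_bigr => x xX; rewrite -(hd x) -sum1_card.
    apply: eq_bigl => y; rewrite inE; case exy : (e x y); rewrite ?andbF ?andbT//.
    by apply/esym/bigcupP; exists x; rewrite ?inE.
  rewrite (exchange_big_dep (mem N))/=; last by move=> x y _ /andP[].
  rewrite mulnC -sum_nat_const; apply: leq_sum => y yN.
  rewrite sum1dep_card -(hd y); apply: subset_leq_card; apply/subsetP => x.
  by rewrite !inE es => /andP[_ /andP[]].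
by exists f; split=> // x; have := f2 x; rewrite inE.
Qed.

Lemma factorization d e : symmetric e -> (forall x y, e x y -> side x != side y) ->
  (forall x, #|[set y | e x y]| = d) ->
  exists M : 'I_d -> V -> V, [/\ forall i, involutive (M i), forall i x, e x (M i x) &
    forall x y, e x y -> exists i, M i x = y /\ forall j, M j x = y -> j = i].
Proof.
elim: d e => [|d IH] e es eside hd.
  exists (fun _ => id); split=> [[]//|[]//|x y exy].
  by have /eqP := hd x; rewrite cards_eq0 => /eqP/setP/(_ y); rewrite !inE exy.
have [f [fi fe]] := regular_perm es (ltn0Sn d) hd.
(* The permutation runs along edges and so changes sides. Taking it on one side and its inverse on
   the other gives an involution, that is, a perfect matching. *)
pose M0 x := if side x then f x else invF fi x.
have sf x : side (f x) = ~~ side x by have := eside _ _ (fe x); case: (side _); case: (side _).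
have sfi x : side (invF fi x) = ~~ side x by rewrite -{2}(f_invF fi x) sf negbK.
have M0K : involutive M0.
  by move=> x; rewrite /M0; case sx : (side x); rewrite ?sf ?sfi sx /= ?invF_f ?f_invF.
have eM0 x : e x (M0 x).
  by rewrite /M0; case: (side x) => //; rewrite es -{2}(f_invF fi x).
pose e' x y := e x y && (y != M0 x).
have [x y|x y /andP[/eside]//|x|M [M1 M2 M3]] := IH e'.
- rewrite /e' es; congr (_ && ~~ _); rewrite -(inj_eq (inv_inj M0K)) M0K eq_sym.
  by [].
- apply/eqP; rewrite -eqSS -(hd x) [X in _ == X](cardsD1 (M0 x)) inE eM0 add1n eqSS.
  by apply/eqP; apply: eq_card => y; rewrite !inE andbC.
exists (fun i => oapp M M0 (unlift ord0 i)); split=> [i|i x|x y exy].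
- by case: unliftP => [j|] _ /=.
- by case: unliftP => [j|] _ //=; have /andP[] := M2 j x.
have [->|ny] := eqVneq y (M0 x).
  exists ord0; rewrite unlift_none; split=> // j; case: unliftP => [k ->|->]//= e1.
  by have := M2 k x; rewrite /e' e1 eqxx andbF.
have [|i [i1 i2]] := M3 x y; first by rewrite /e' exy.
exists (lift ord0 i); rewrite liftK; split=> // j; case: unliftP => [k ->|->]//=.
  by move=> /i2 ->.
by move=> e1; rewrite -e1 eqxx in ny.
Qed.
End Factorization.

Definition sts (V : finType) (S : {set {set V}}) := psts S /\ forall x y, x != y -> covby S x y.

Section Affine.
Variable k : nat.
Local Notation Z := {ffun 'I_k -> 'F_3}.

Lemma card_affine : #|{: Z}| = (3 ^ k)%N.
Proof. by rewrite card_ffun card_Fp// card_ord. Qed.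

Definition affine_sts : {set {set Z}} :=
  [set t : {set Z} | [exists x : Z, exists y : Z, (x != y) && (t == [set x; y; - x - y])]].

Lemma affine3 (x : Z) : x + x + x = 0.
Proof.
by apply/ffunP => i; rewrite !ffunE; case: (x i) => [[|[|[|//]]]] h; apply/val_inj.
Qed.

Lemma affine_third (x y : Z) : x != y -> (- x - y != x) /\ (- x - y != y).
Proof.
move=> xy; split; apply: contra xy => /eqP e.
  have e' : x - y = x + x + (- x - y) by rewrite addrA addrK.
  by rewrite -subr_eq0 e' e affine3.
rewrite eq_sym -subr_eq0 (_ : y - x = y + y + (- x - y)); first by rewrite e affine3.
by rewrite -addrA [y + (_ - y)]addrCA subrr addr0.
Qed.

Lemma affine_sum (t : {set Z}) (x y : Z) : t \in affine_sts -> x \in t -> y \in t -> x != y ->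
  t = [set x; y; - x - y].
Proof.
rewrite inE => /existsP[a /existsP[b /andP[ab /eqP ->]]].
have e1 : - a - (- a - b) = b by rewrite opprD !opprK addKr.
have e2 : - b - (- a - b) = a by rewrite opprD !opprK addrCA addNr addr0.
have e3 : - (- a - b) - a = b by rewrite opprD !opprK addrAC subrr add0r.
have e4 : - (- a - b) - b = a by rewrite opprD !opprK addrK.
have e5 : - b - a = - a - b by rewrite addrC.
rewrite !inE -!orbA => /or3P[]/eqP -> /or3P[]/eqP ->; rewrite ?eqxx// => _;
  rewrite ?e1 ?e2 ?e3 ?e4 ?e5; apply/setP => z; rewrite !inE;
  by case: (z == a); case: (z == b); case: (z == _).
Qed.

Lemma affine_stsP : sts affine_sts.
Proof.
split=> [|x y xy].
  apply/pstsP; split=> [t|t t' x y tA tB xy xt yt xt' yt'].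
    rewrite inE => /existsP[a /existsP[b /andP[ab /eqP ->]]].
    have [h1 h2] := affine_third ab.
    by rewrite setUC cardsU1 !inE negb_or h1 h2 cards2 ab.
  by rewrite (affine_sum tA xt yt xy) (affine_sum tB xt' yt' xy).
apply/covbyP; exists [set x; y; - x - y]; rewrite !inE !eqxx !orbT; split=> //.
by apply/existsP; exists x; apply/existsP; exists y; rewrite xy eqxx.
Qed.
End Affine.

Section Assemble.
Variables (V Z : finType) (T : {set {set V}}) (B : {set {set Z}}) (M : Z -> V -> V).
Hypothesis hT : psts T.
Hypothesis hB : sts B.
Hypothesis MK : forall i, involutive (M i).
Hypothesis Mu : forall i x, uncov T x (M i x).
Hypothesis Me : forall x y, uncov T x y -> exists i, M i x = y /\ forall j, M j x = y -> j = i.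

(** Pairs of old points are covered by [T] or by the matching that contains them, mixed pairs by the
    matching of the new point, pairs of new points by [B]. *)
Definition joined : {set {set V + Z}} :=
  [set (inl @: t : {set V + Z}) | t : {set V} in T] :|: [set (inr @: t : {set V + Z}) | t : {set Z} in B] :|:
  [set [set (inl u.2 : V + Z); inl (M u.1 u.2); inr u.1] | u : Z * V].

Definition blk i x : {set V + Z} := [set inl x; inl (M i x); inr i].

Lemma in_blk i x : (forall y, (inl y \in blk i x) = (y == x) || (y == M i x)) /\
  (forall j, (inr j \in blk i x) = (j == i)).
Proof. by split=> y; rewrite !inE /= ?orbF. Qed.

Lemma blkK i x : blk i (M i x) = blk i x.
Proof. by rewrite /blk MK [X in X :|: _]setUC. Qed.

Lemma in_inl (t : {set V}) : (forall x, (inl x \in (inl @: t : {set V + Z})) = (x \in t)) /\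
  (forall j, (inr j \in (inl @: t : {set V + Z})) = false).
Proof.
split=> y; first by rewrite mem_imset//; exact: inl_inj.
by apply/negP => /imsetP[].
Qed.

Lemma in_inr (t : {set Z}) : (forall x, (inl x \in (inr @: t : {set V + Z})) = false) /\
  (forall j, (inr j \in (inr @: t : {set V + Z})) = (j \in t)).
Proof.
split=> y; last by rewrite mem_imset//; exact: inr_inj.
by apply/negP => /imsetP[].
Qed.

Lemma joinedP t : reflect [\/ exists2 t0, t0 \in T & t = inl @: t0, exists2 t0, t0 \in B & t = inr @: t0 |
  exists i x, t = blk i x] (t \in joined).
Proof.
rewrite /joined !in_setU -orbA; apply: (iffP or3P) => -[].
- by case/imsetP => t0 h ->; constructor 1; exists t0.
- by case/imsetP => t0 h ->; constructor 2; exists t0.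
- by case/imsetP => -[i x] _ ->; constructor 3; exists i, x.
- by case=> t0 h ->; constructor 1; rewrite imset_f.
- by case=> t0 h ->; constructor 2; rewrite imset_f.
- by case=> i [x ->]; constructor 3; apply/imsetP; exists (i, x).
Qed.

Lemma joined_ll t x y : t \in joined -> inl x \in t -> inl y \in t -> x != y ->
  (exists t0, [/\ t0 \in T, x \in t0, y \in t0 & t = inl @: t0]) \/ (exists i, M i x = y /\ t = blk i x).
Proof.
case/joinedP => [[t0 h ->]|[t0 h ->]|[i [x0 ->]]].
- by rewrite !(in_inl t0).1 => xt yt _; left; exists t0.
- by rewrite (in_inr t0).1.
rewrite !(in_blk i x0).1 => /orP[]/eqP -> /orP[]/eqP ->; rewrite ?eqxx// => _; right; exists i.
  by [].
by rewrite MK blkK.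
Qed.

Lemma joined_lr t x j : t \in joined -> inl x \in t -> inr j \in t -> t = blk j x.
Proof.
case/joinedP => [[t0 h ->]|[t0 h ->]|[i [x0 ->]]].
- by rewrite (in_inl t0).2.
- by rewrite (in_inr t0).1.
rewrite (in_blk i x0).1 (in_blk i x0).2 => /orP[]/eqP -> /eqP -> //.
by rewrite blkK.
Qed.

Lemma joined_rr t i j : t \in joined -> inr i \in t -> inr j \in t -> i != j ->
  exists t0, [/\ t0 \in B, i \in t0, j \in t0 & t = inr @: t0].
Proof.
case/joinedP => [[t0 h ->]|[t0 h ->]|[k [x0 ->]]].
- by rewrite (in_inl t0).2.
- by rewrite !(in_inr t0).2 => it jt _; exists t0.
by rewrite !(in_blk k x0).2 => /eqP -> /eqP ->; rewrite eqxx.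
Qed.

Lemma joined_inl (t0 : {set V}) : (inl @: t0 \in joined) = (t0 \in T).
Proof.
apply/joinedP/idP => [[[t1 h /(imset_inj (@inl_inj _ _)) ->]//|[t1 h e]|[i [x e]]]|h]; last by constructor 1; exists t0.
  have /pstsP[c3 _] := hB.1; have : (0 < #|t1|)%N by rewrite c3.
  case/card_gt0P => z zt; have : inr z \in (inr @: t1 : {set V + Z}) by rewrite (in_inr t1).2.
  by rewrite -e (in_inl t0).2.
have : inr i \in blk i x by rewrite (in_blk i x).2.
by rewrite -e (in_inl t0).2.
Qed.

Lemma joined_sts : sts joined.
Proof.
have /pstsP[T3 Tu] := hT; have [/pstsP[B3 Bu] Bc] := hB.
have Mne i x : x != M i x by have /uncovP[] := Mu i x.
have blkJ i x : blk i x \in joined by apply/joinedP; constructor 3; exists i, x.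
have nocov t0 i x : t0 \in T -> x \in t0 -> M i x \in t0 -> False.
  by move=> h h1 h2; have /uncovP[_ /(_ t0 h h1 h2)] := Mu i x.
split=> [|[x|i] [y|j] xy].
- apply/pstsP; split=> [t /joinedP[[t0 h ->]|[t0 h ->]|[i [x ->]]]|].
  + by rewrite card_imset ?T3//; exact: inl_inj.
  + by rewrite card_imset ?B3//; exact: inr_inj.
  + by rewrite /blk setUC cardsU1 !inE /= cards2 (inj_eq inl_inj) Mne.
  move=> t t' [x|i] [y|j] tJ tJ' xy xt yt xt' yt'.
  + have {}xy : x != y by apply: contra xy => /eqP ->.
    have [[t0 [h1 h2 h3 ->]]|[i [h1 ->]]] := joined_ll tJ xt yt xy;
    have [[t1 [h1' h2' h3' ->]]|[i' [h1' ->]]] := joined_ll tJ' xt' yt' xy.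
    * by rewrite (Tu t0 t1 x y).
    * by case: (@nocov t0 i' x); rewrite ?h1'.
    * by case: (@nocov t1 i x); rewrite ?h1.
    * have /Me[k [_ hk]] : uncov T x y by rewrite -h1.
      by rewrite (hk i h1) (hk i' h1').
  + by rewrite (joined_lr tJ xt yt) (joined_lr tJ' xt' yt').
  + by rewrite (joined_lr tJ yt xt) (joined_lr tJ' yt' xt').
  have {}xy : i != j by apply: contra xy => /eqP ->.
  have [t0 [h1 h2 h3 ->]] := joined_rr tJ xt yt xy; have [t1 [h1' h2' h3' ->]] := joined_rr tJ' xt' yt' xy.
  by rewrite (Bu t0 t1 i j).
- have {}xy : x != y by apply: contra xy => /eqP ->.
  have [/covbyP[t [tT xt yt]]|nc] := boolP (covby T x y).
    by apply/covbyP; exists (inl @: t); rewrite joined_inl !(in_inl t).1.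
  have /Me[i [e _]] : uncov T x y by rewrite uncovE xy.
  by apply/covbyP; exists (blk i x); rewrite blkJ !(in_blk i x).1 e !eqxx orbT.
- by apply/covbyP; exists (blk j x); rewrite blkJ (in_blk j x).1 (in_blk j x).2 !eqxx.
- by apply/covbyP; exists (blk i y); rewrite blkJ (in_blk i y).1 (in_blk i y).2 !eqxx.
have {}xy : i != j by apply: contra xy => /eqP ->.
have /covbyP[t [tB it jt]] := Bc i j xy.
apply/covbyP; exists (inr @: t); rewrite !(in_inr t).2; split=> //.
by apply/joinedP; constructor 2; exists t.
Qed.
End Assemble.

Lemma extend_sts (V : finType) (part : V -> 'I_4) (T : {set {set V}}) (q w k : nat) :
  psts T -> (q + w = 3 ^ k)%N ->
  (forall y, [/\ ndeg part 0 T y = 0%N, ndeg part 1 T y = q & ndeg part 2 T y = w]) ->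
  exists S : {set {set V + {ffun 'I_k -> 'F_3}}}, sts S /\ forall t : {set V}, (inl @: t \in S) = (t \in T).
Proof.
move=> hT hz hdeg.
pose e (c : nat) : rel V := fun x y => uncov T x y && (vtype part x y == c).
have esy c : symmetric (e c) by move=> x y; rewrite /e uncovC vtypeC.
(* The type 1 graph is bipartite by the parity of the part, the type 2 graph below by the half. *)
have [x y /andP[_ /eqP h]|x|M1 [a1 a2 a3]] := @factorization V (fun x => odd (part x)) q (e 1%N) (esy _).
- move: h; rewrite /vtype; case: (part x) => -[|[|[|[|//]]]] ?; case: (part y) => -[|[|[|[|//]]]] ?;
    by rewrite /ptype.
- by have [_ <- _] := hdeg x.
have [x y /andP[_ /eqP h]|x|M2 [b1 b2 b3]] := @factorization V (fun x => (1 < part x)%N) w (e 2%N) (esy _).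
- move: h; rewrite /vtype; case: (part x) => -[|[|[|[|//]]]] ?; case: (part y) => -[|[|[|[|//]]]] ?;
    by rewrite /ptype.
- by have [_ _ <-] := hdeg x.
have cZ : (q + w = #|{: {ffun 'I_k -> 'F_3}}|)%N by rewrite card_affine.
pose M (i : {ffun 'I_k -> 'F_3}) := match split (cast_ord (esym cZ) (enum_rank i)) with inl j => M1 j | inr j => M2 j end.
pose ix (j : 'I_(q + w)) := enum_val (cast_ord cZ j).
have Mix j : M (ix j) = match split j with inl j => M1 j | inr j => M2 j end.
  by rewrite /M /ix enum_valK cast_ordK.
have ixs i : i = ix (cast_ord (esym cZ) (enum_rank i)) by rewrite /ix cast_ordKV enum_rankK.
have MK i : involutive (M i).
  by move=> x; rewrite (ixs i) Mix; case: split => j; [exact: a1|exact: b1].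
have Mt j x : e (if split j is inl _ then 1%N else 2%N) x (M (ix j) x).
  by rewrite Mix; case: split => j'; [exact: a2|exact: b2].
have Mu i x : uncov T x (M i x) by rewrite (ixs i); have /andP[] := Mt (cast_ord (esym cZ) (enum_rank i)) x.
have Me x y : uncov T x y -> exists i, M i x = y /\ forall j, M j x = y -> j = i.
  move=> u; have [h0 _ _] := hdeg x.
  have n0 : vtype part x y != 0%N.
    apply: contraT; rewrite negbK => v0; move/eqP: h0; rewrite cards_eq0 => /eqP/setP/(_ y).
    by rewrite !inE u v0.
  have uq (c : nat) j : vtype part x y = c -> M (ix j) x = y -> (if split j is inl _ then 1%N else 2%N) = c.
    by move=> <- <-; have /andP[_ /eqP ->] := Mt j x.
  have [v1|v1] := eqVneq (vtype part x y) 1%N.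
    have [|i [i1 i2]] := a3 x y; first by rewrite /e u v1.
    exists (ix (unsplit (inl i))); split; first by rewrite Mix unsplitK.
    move=> j; rewrite (ixs j); move: (cast_ord _ _) => {}j h; congr ix.
    have := uq _ _ v1 h; move: h; rewrite Mix -{3}(splitK j); case: split => j' // /i2 -> //.
  have v2 : vtype part x y = 2%N.
    have := ptype_le2 (part x) (part y); rewrite -/(vtype part x y).
    by move: n0 v1; case: (vtype part x y) => [|[|[|]]].
  have [|i [i1 i2]] := b3 x y; first by rewrite /e u v2.
  exists (ix (unsplit (inr i))); split; first by rewrite Mix unsplitK.
  move=> j; rewrite (ixs j); move: (cast_ord _ _) => {}j h; congr ix.
  have := uq _ _ v2 h; move: h; rewrite Mix -{3}(splitK j); case: split => j' // /i2 -> //.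
exists (joined T (affine_sts k) M); split.
  by apply: joined_sts => //; exact: affine_stsP.
by move=> t; apply: joined_inl; exact: affine_stsP.
Qed.

(** * Labellings with the required statistics *)

Lemma card_ord_interval (n a b : nat) : (a <= b <= n)%N ->
  #|[set i : 'I_n | (a <= i < b)%N]| = (b - a)%N.
Proof.
move=> /andP[ab bn]; rewrite -sum1dep_card -(big_mkord (fun i => a <= i < b)%N (fun=> 1%N)).
rewrite (big_cat_nat (n := b))//= [X in (_ + X)%N]big_nat_cond [X in (_ + X)%N]big_pred0 ?addn0; last first.
  by move=> i; lia.
rewrite (big_cat_nat (n := a))//= big_nat_cond big_pred0 ?add0n; last by move=> i; lia.
rewrite big_nat_cond (eq_bigl (fun i => (a <= i < b)%N && true)); last by move=> i; lia.
by rewrite -big_nat_cond sum_nat_const_nat muln1.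
Qed.

Section FromLabelling.
Variables (V : finType) (T : {set {set V}}) (part : V -> 'I_4) (S : {set {set V}}).
Hypothesis hT : psts T.
Implicit Types (x y u w : V) (P Q : 'I_4) (t : {set V}) (c : nat).
Local Notation third := (third T).
Local Notation tri := (tri T).
Local Notation vtype := (vtype part).
Local Notation cov := (cov part).
Local Notation nbr := (nbr part).
Local Notation rainbow := (rainbow part).

Lemma cov_count (R : {set {set V}}) c y : R \subset T ->
  cov c R y = #|[set u | [&& third y u != u, tri y u \in R & vtype y u == c]]|.
Proof.
move=> /subsetP ST; rewrite -sum1_card (partition_big (tri y) (mem R))/=; last first.
  by move=> u; rewrite inE => /and3P[].
rewrite /Submission.cov; apply: eq_bigr => t tS; rewrite /Submission.nbr -sum1_card; apply: eq_bigl => u.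
rewrite !inE; apply/and4P/andP => [[ut yt uy tc]|[/and3P[h1 h2 h3] /eqP <-]].
  by have [h1 ->] := third_uniq hT (ST _ tS) yt ut uy; rewrite h1 tc -(third_uniq hT (ST _ tS) yt ut uy).2 tS eqxx.
have [_ _ uy _] := thirdP hT h1.
by rewrite h3 uy !inE !eqxx orbT.
Qed.

Lemma tri_rainbow y x : third y x != x ->
  rainbow (tri y x) = [&& part y != part x, part y != part (third y x) & part x != part (third y x)].
Proof.
move=> h; have [h1 h2 h3 h4] := thirdP hT h.
apply/rainbowP/and3P => [r|[p1 p2 p3]].
  by split; apply: r; rewrite ?inE ?eqxx ?orbT// eq_sym.
by apply/rainbowP; apply: rainbow_setT; rewrite // eq_sym.
Qed.

Definition lrainbow := [set t in T | rainbow t && (t \in S)].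

Lemma lrainbow_sub : lrainbow \subset T.
Proof. by apply/subsetP => t; rewrite inE => /andP[]. Qed.

Definition ldeg y P Q := #|[set x | [&& third y x != x, part x == P, part (third y x) == Q & tri y x \in S]]|.

(** The parts of [x] and of the third point in a rainbow triple at a point of part [P], with [x] at
    type [c]. There are 2 for type 1 and 4 for type 2, so that random removal makes type 2 degrees
    twice the type 1 degrees. *)
Definition dirs c P := [set u : 'I_4 * 'I_4 | [&& ptype P u.1 == c, u.2 != P & u.2 != u.1]].

Lemma card_dirs c P : (c == 1%N) || (c == 2%N) -> #|dirs c P| = (2 * c)%N.
Proof.
move=> hc; rewrite -sum1dep_card.
rewrite -(pair_big_dep (fun i => ptype P i == c) (fun i j => (j != P) && (j != i)) (fun _ _ => 1%N)) /=.
rewrite big_mkcond /= (eq_bigr (fun i => if ptype P i == c then (\sum_(j : 'I_4) nat_of_bool ((j != P) && (j != i)))%N else 0%N)); last first.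
  by move=> i _; case: ifP => // _; rewrite big_mkcond; apply: eq_bigr => j _; case: (_ && _).
rewrite !big_ord_recl !big_ord0.
by case: P => -[|[|[|[|//]]]] h; case/orP: hc => /eqP ->.
Qed.

Lemma cov_ldeg c y : (0 < c)%N -> cov c lrainbow y = (\sum_(u in dirs c (part y)) ldeg y u.1 u.2)%N.
Proof.
move=> c0; rewrite cov_count ?lrainbow_sub// -sum1_card.
rewrite (partition_big (fun x => (part x, part (third y x))) (mem (dirs c (part y))))/=; last first.
  move=> x; rewrite !inE => /and3P[h /and3P[_ r _] tc].
  by move: r; rewrite tri_rainbow// => /and3P[r1 r2 r3]; rewrite tc eq_sym r2 eq_sym r3.
apply: eq_bigr => -[P Q]; rewrite !inE /= => /and3P[h1 h2 h3].
rewrite /ldeg -sum1_card; apply: eq_bigl => x; rewrite !inE xpair_eqE.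
apply/andP/and4P => [[/and3P[a1 /and3P[a2 a3 a4] a5] /andP[a6 a7]]|[a1 /eqP a2 /eqP a3 a4]]; first by split.
have [b1 b2 b3 b4] := thirdP hT a1.
have pP : part y != P by apply: contraTneq h1 => ->; rewrite /ptype eqxx; case: (c) c0.
split; last by rewrite a2 a3 !eqxx.
by rewrite a1 b4 a4 tri_rainbow// a2 a3 pP eq_sym h2 eq_sym h3 /Submission.vtype a2 h1.
Qed.

Lemma lrainbow_covby y x P Q : third y x != x -> part x = P -> part (third y x) = Q ->
  P != Q -> part y != P -> part y != Q -> tri y x \in S -> covby lrainbow y x.
Proof.
move=> h hP hQ pq yp yq hs; have [b1 b2 b3 b4] := thirdP hT h.
apply/covbyP; exists (tri y x); rewrite inE b4 hs tri_rainbow// hP hQ yp yq pq.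
by rewrite !inE !eqxx orbT.
Qed.

Lemma apex_ldeg y Q1 Q2 : ptype (part y) Q1 == 2%N -> ptype (part y) Q2 == 2%N -> Q1 != Q2 ->
  (ldeg y Q1 Q2 <= #|[set t in lrainbow | (y \in t) && (nbr 1 t y == 0%N)]|)%N.
Proof.
move=> q1 q2 q12; rewrite /ldeg; set X := [set x | _].
have XP x : x \in X -> [/\ third y x != x, part x = Q1, part (third y x) = Q2 & tri y x \in S].
  by rewrite inE => /and4P[h1 /eqP h2 /eqP h3 h4].
have pne Q : ptype (part y) Q == 2%N -> part y != Q by apply: contraTneq => <-; rewrite /ptype eqxx.
rewrite -(card_in_imset (f := tri y)); last first.
  move=> x x' /XP[h1 h2 h3 h4] /XP[h1' h2' h3' h4'] e.
  have : x \in tri y x' by rewrite -e !inE eqxx orbT.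
  have [_ _ xy _] := thirdP hT h1; rewrite !inE (negbTE xy)/= => /orP[/eqP//|/eqP e'].
  by move: q12; rewrite -h2 e' h3' eqxx.
apply: subset_leq_card; apply/subsetP => t /imsetP[x /XP[h1 h2 h3 h4] ->].
have [b1 b2 b3 b4] := thirdP hT h1.
rewrite !inE eqxx b4 h4 tri_rainbow// h2 h3 !pne// q12/=.
rewrite /Submission.tri nbr3//; last by rewrite eq_sym.
  by rewrite /Submission.vtype h2 h3 (eqP q1) (eqP q2).
by rewrite eq_sym.
by rewrite eq_sym.
Qed.

Lemma deg_llab y : (#|[set t in lrainbow | y \in t]| <= #|[set x | third y x != x & tri y x \in S]|)%N.
Proof.
have /pstsP[T3 _] := hT.
apply: leq_trans (leq_imset_card (tri y) _); apply: subset_leq_card; apply/subsetP => t.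
rewrite !inE => /andP[/and3P[tT r tS] yt].
have : (0 < #|t :\ y|)%N by have := cardsD1 y t; rewrite yt T3// add1n => -[<-].
case/card_gt0P => x; rewrite !inE => /andP[xy xt].
have [h1 e] := third_uniq hT tT yt xt xy.
by apply/imsetP; exists x; rewrite // inE h1 -e.
Qed.
End FromLabelling.

Lemma sum_zero_pairs (V : finType) (part : V -> 'I_4) (T : {set {set V}}) :
  (\sum_(P : 'I_4) #|[set u : V * V | [&& uncov T u.1 u.2, part u.1 == P & part u.2 == P]]| =
   2 * #|zero_edges part T|)%N.
Proof.
rewrite -sum_ndeg_zero sum_ndeg -sum1_card (partition_big (fun u : V * V => part u.1) predT)//=.
apply: eq_bigr => P _; rewrite -sum1_card; apply: eq_bigl => -[x y]; rewrite !inE /vtype ptype0 /=.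
by case: (uncov T x y) => //=; rewrite andbC; case: (eqVneq (part x) P) => [->|]; rewrite ?andbF// eq_sym andbT.
Qed.

Section StatValues.
Variables (V : finType) (T : {set {set V}}) (R : realType) (L : nat).
Local Notation A := ('I_4 * 'I_L.+1)%type.
Variable al : {ffun V + {set V} -> A}.
Implicit Types (S : {set 'I_L.+1}) (P Q : 'I_4).

Definition labelled S := [set t : {set V} | lab al t \in S].

Lemma n_degE y P Q S : n_deg T R y P Q S al = (ldeg T (part al) (labelled S) y P Q)%:R.
Proof.
rewrite /n_deg lsumE /ldeg; congr (_%:R); apply: eq_card => x.
by rewrite !inE /cs_deg !sat_vtx sat_trp /= andbT.
Qed.

Lemma n_labE y S : n_lab T R y S al = #|[set x | third T y x != x & tri T y x \in labelled S]|%:R.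
Proof.
rewrite /n_lab lsumE; congr (_%:R); apply: eq_card => x.
by rewrite !inE /cs_lab sat_trp /= andbT.
Qed.

Lemma n_absE y z P Q S : n_abs T R y z P Q S al =
  #|[set x | g_abs T L y z x && [&& part al x == P, part al (third T y x) == Q, part al (third T z x) == Q,
     tri T y x \in labelled S & tri T z x \in labelled S]]|%:R.
Proof.
rewrite /n_abs lsumE; congr (_%:R); apply: eq_card => x.
by rewrite !inE /cs_abs !sat_vtx !sat_trp /= andbT.
Qed.

Lemma n_swapE y z P Q S F : n_swap T R y z P Q S F al =
  #|[set x | g_swap T L y z x && [&& part al x == P, part al (third T y x) == Q, part al (third T z x) == Q,
     part al (third T z (third T y x)) == P,
     tri T y x \in labelled F, tri T z x \in labelled S & tri T z (third T y x) \in labelled S]]|%:R.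
Proof.
rewrite /n_swap lsumE; congr (_%:R); apply: eq_card => x.
by rewrite !inE /cs_swap !sat_vtx !sat_trp /= andbT.
Qed.

Lemma n_pairE Delta P : n_pair' T R Delta P al =
  (Delta.+1%:R)^-1 * #|[set u : V * V | [&& uncov T u.1 u.2, part al u.1 == P & part al u.2 == P]]|%:R.
Proof.
rewrite /n_pair' /n_pair lsumE; congr (_ * _%:R); apply: eq_card => x.
by rewrite !inE /cs_pair !sat_vtx /= andbT.
Qed.
End StatValues.

Section Windows.
Variables (R : realType) (v Delta g x : nat).
Hypothesis v0 : (0 < v)%N.

Let V0 : (0 : R) < v%:R. Proof. by rewrite ltr0n. Qed.

(** A label set of size 16 m among 4 v labels, divided over the 16 pairs of parts, gives mean g m /
    (4 v); this is nearly m because g is nearly 4 v. *)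
Lemma window_deg (m : nat) : `|x%:R - g%:R * ((16 * m)%:R / (4 * v)%:R / 16)| <= Delta%:R :> R ->
  (4 * v <= g + Delta + 1)%N -> (g <= 4 * v)%N -> (16 * m <= 2 * v)%N -> (0 < Delta)%N ->
  (m <= x + 2 * Delta)%N /\ (x <= m + Delta)%N.
Proof.
move=> h g1 g2 mv D0; have vv := V0.
have e : g%:R * ((16 * m)%:R / (4 * v)%:R / 16) = (g * m)%:R / (4 * v)%:R :> R.
  by rewrite !natrM; field; rewrite lt0r_neq0.
have v4 : (0 : R) < (4 * v)%:R by rewrite ltr0n muln_gt0.
have lo : m%:R - Delta%:R <= (g * m)%:R / (4 * v)%:R :> R.
  rewrite ler_pdivlMr// mulrBl -!natrM lerBlDr -natrD ler_nat; nia.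
have hi : (g * m)%:R / (4 * v)%:R <= m%:R :> R.
  by rewrite ler_pdivrMr// -natrM ler_nat mulnC leq_mul2l g2 orbT.
move: h; rewrite e ler_norml => /andP[h1 h2].
by split; rewrite -(ler_nat R) natrD ?natrM; lra.
Qed.

Lemma window_lab (m : nat) : `|x%:R - g%:R * ((16 * m)%:R / (4 * v)%:R)| <= Delta%:R :> R ->
  (g <= 4 * v)%N -> (x <= 16 * m + Delta)%N.
Proof.
move=> h g2; have v4 : (0 : R) < (4 * v)%:R by rewrite ltr0n muln_gt0.
have hi : g%:R * ((16 * m)%:R / (4 * v)%:R) <= (16 * m)%:R :> R.
  by rewrite mulrA ler_pdivrMr// -!natrM ler_nat mulnC leq_mul2l g2 orbT.
move: h; rewrite ler_norml => /andP[h1 h2].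
by rewrite -(ler_nat R) natrD; lra.
Qed.

Lemma window_sq (m tau : nat) (q : R) : `|x%:R - q| <= Delta%:R :> R ->
  (16 * v * (tau + Delta) <= m ^ 2)%N -> (m ^ 2)%:R / (16 * v)%:R <= q -> (tau <= x)%N.
Proof.
move=> h hm hq; have v4 : (0 : R) < (16 * v)%:R by rewrite ltr0n muln_gt0.
have h2 : (tau + Delta)%:R <= q.
  by apply: le_trans hq; rewrite ler_pdivlMr// -natrM ler_nat mulnC.
move: h; rewrite ler_norml => /andP[h1 h3].
by rewrite -(ler_nat R); rewrite natrD in h2; lra.
Qed.

Lemma mean_abs (m : nat) : (2 * v <= g)%N ->
  (m ^ 2)%:R / (16 * v)%:R <= g%:R * (((16 * m)%:R / (4 * v)%:R) ^+ 2 / 64) :> R.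
Proof.
move=> hg; have vv := V0.
have -> : g%:R * (((16 * m)%:R / (4 * v)%:R) ^+ 2 / 64) = g%:R * m%:R ^+ 2 / (4 * v%:R ^+ 2) :> R.
  by rewrite !natrM; field; rewrite lt0r_neq0.
have hg' : 2 * v%:R <= g%:R :> R by rewrite -natrM ler_nat.
have -> : (m ^ 2)%:R / (16 * v)%:R = (v%:R / 4 * m%:R ^+ 2) / (4 * v%:R ^+ 2) :> R.
  by rewrite natrX natrM; field; rewrite lt0r_neq0.
rewrite ler_pM2r; last by rewrite invr_gt0 mulr_gt0// exprn_gt0.
by rewrite ler_wpM2r ?sqr_ge0//; lra.
Qed.

Lemma mean_swap (m : nat) : (2 * v <= g)%N ->
  (m ^ 2)%:R / (16 * v)%:R <= g%:R * (((16 * m)%:R / (4 * v)%:R) ^+ 2 * ((2 * v)%:R / (4 * v)%:R) / 256) :> R.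
Proof.
move=> hg; have vv := V0.
have -> : g%:R * (((16 * m)%:R / (4 * v)%:R) ^+ 2 * ((2 * v)%:R / (4 * v)%:R) / 256) =
  g%:R * m%:R ^+ 2 / (32 * v%:R ^+ 2) :> R.
  by rewrite !natrM; field; rewrite lt0r_neq0.
have hg' : 2 * v%:R <= g%:R :> R by rewrite -natrM ler_nat.
have -> : (m ^ 2)%:R / (16 * v)%:R = (2 * v%:R * m%:R ^+ 2) / (32 * v%:R ^+ 2) :> R.
  by rewrite natrX natrM; field; rewrite lt0r_neq0.
rewrite ler_pM2r; last by rewrite invr_gt0 mulr_gt0// exprn_gt0.
by rewrite ler_wpM2r ?sqr_ge0.
Qed.

Lemma window_pair (U : nat) : `|(Delta.+1%:R)^-1 * x%:R - (Delta.+1%:R)^-1 * (U%:R / 16)| <= Delta%:R :> R ->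
  (U <= 16 * x + 16 * (Delta.+1 * Delta))%N.
Proof.
have D0 : (0 : R) < Delta.+1%:R by rewrite ltr0n.
rewrite -mulrBr normrM gtr0_norm ?invr_gt0// ler_pdivrMl// ler_norml => /andP[h1 h2].
rewrite -(ler_nat R) natrD !natrM; lra.
Qed.
End Windows.

Section FixPsts.
Variables (R : realType) (V : finType) (T : {set {set V}}) (y0 : V).
Variables (v Delta cap cap4 z Sb Sb4 tau k : nat) (s t : R).
Let eta := (30 * Delta + 4 * cap)%N.
(** Chosen so that 3 m1 + 8 eta is about z for m1 = 2 (m - 2 Delta): the middle of the window from 7
    eta to 9 eta in [fix_core]. *)
Let m := ((z + 12 * Delta - 8 * eta) %/ 6)%N.
(** Just enough apexes: as Delta <= cap, mX - 2 Delta >= 102 cap >= 90 Delta + 12 cap = 3 eta. *)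
Let mX := (104 * cap)%N.
Let bX := (16 * mX + Delta)%N.
Let kappa := (4 * eta + bX)%N.

Lemma fix_psts : psts T -> #|V| = (4 * v)%N -> (forall x, lv T x <= Delta)%N ->
  0 < s -> s * 9 <= 1 / 2 -> 4 * t <= k%:R -> t + 9 * k%:R <= Delta%:R ->
  200 * #|V|%:R ^+ 2 * expR (s ^+ 2 * (63 * #|V|%:R) - s * t) < 1 ->
  (0 < Delta <= cap)%N -> (8 * v + 16 * (Delta.+1 * Delta) <= \sum_x lv T x)%N ->
  (16 * m + 16 * mX <= 2 * v)%N -> (3 * Delta + 5 <= 2 * v)%N -> (2 * Delta <= m)%N -> (8 * eta <= z)%N ->
  (16 * v * (tau + Delta) <= m ^ 2)%N ->
  (16 * v * Delta <= cap * Sb)%N -> (6 * (Delta + cap) + Sb < tau)%N ->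
  (0 < cap4)%N -> (16 * v * kappa <= cap4 * Sb4)%N ->
  (9 * (kappa + cap4) + Sb4 + 6 * (Delta + cap) < tau)%N ->
  odd z -> (3 %| v * (z + 2 * v + 1))%N ->
  exists (part : V -> 'I_4) (T' : {set {set V}}) (q w : nat), [/\ psts T', (q + w = z)%N,
    forall y, [/\ ndeg part 0 T' y = 0%N, ndeg part 1 T' y = q & ndeg part 2 T' y = w],
    (#|T' :\: T| <= 4 * v * (Delta + kappa))%N &
    (#|T :\: T'| <= 4 * v * (z + bX + kappa))%N].
Proof.
move=> hT cV lvT s0 s9 tk tD hexp /andP[D0 Dc] hU hm hv5 hm2 hz8 htau hSb htau1 c40 hSb4 htau4 oz z3.
have v0 : (0 < v)%N by clear - hv5; lia.
(* The 4 v labels are cut into disjoint intervals for [R], for [X] and, the upper half, for [F];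
   disjointness of the three stocks of triples is then automatic. *)
pose L := (4 * v).-1; have L1 : L.+1 = (4 * v)%N by rewrite /L prednK// muln_gt0.
pose SR := [set i : 'I_L.+1 | (0 <= i < 16 * m)%N].
pose SX := [set i : 'I_L.+1 | (16 * m <= i < 16 * m + 16 * mX)%N].
pose SF := [set i : 'I_L.+1 | (2 * v <= i < 4 * v)%N].
have cR : #|SR| = (16 * m)%N by rewrite card_ord_interval ?subn0// L1; clear - hm; lia.
have cX : #|SX| = (16 * mX)%N by rewrite card_ord_interval ?addKn// L1; clear - hm; lia.
have cF : #|SF| = (2 * v)%N by rewrite card_ord_interval ?L1; clear - hm; lia.
have [al [hpart hstat]] := @good_labelling V T hT R L Delta v lvT cV SR SX SF s t k s0 s9 tk v0 hexp.
have {}hstat j : `|stat T R Delta SR SX SF j al - stat_mean T R Delta SR SX SF j| <= Delta%:R.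
  exact: le_trans (hstat j) tD.
pose part := part al.
pose Rs := lrainbow T part (labelled al SR); pose Xs := lrainbow T part (labelled al SX).
pose Fs := [set t in T | t \in labelled al SF].
have gdeg y : (4 * v <= #|[set x | g_deg T y x]| + Delta + 1)%N /\ (#|[set x | g_deg T y x]| <= 4 * v)%N.
  have := card_g_deg hT y; rewrite cV; have := lvT y; clear; lia.
have hR y P Q : (m <= ldeg T part (labelled al SR) y P Q + 2 * Delta)%N /\ (ldeg T part (labelled al SR) y P Q <= m + Delta)%N.
  have [g1 g2] := gdeg y; have := hstat (inl (inl (inl (inr (true, y, P, Q))))).
  rewrite /= n_degE cR L1 => h; apply: (window_deg v0 h) => //; clear - hm; lia.
have hX y P Q : (mX <= ldeg T part (labelled al SX) y P Q + 2 * Delta)%N.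
  have [g1 g2] := gdeg y; have := hstat (inl (inl (inl (inr (false, y, P, Q))))).
  rewrite /= n_degE cX L1 => h.
  by have [] := window_deg v0 h g1 g2 _ D0; first by clear - hm; lia.
have hL y : (#|[set t in Xs | y \in t]| <= bX)%N.
  apply: leq_trans (deg_llab part _ hT y) _; have [g1 g2] := gdeg y.
  have := hstat (inl (inl (inl (inl (inr y))))); rewrite /= n_labE cX L1 => h.
  exact: (window_lab v0 h g2).
have hE : (v <= #|zero_edges part T|)%N.
  have h P : (\sum_x lv T x <= 16 * #|[set u : V * V | [&& uncov T u.1 u.2, part u.1 == P & part u.2 == P]]| + 16 * (Delta.+1 * Delta))%N.
    have := hstat (inr P); rewrite /= n_pairE card_uncov_pairs => {}h.
    exact: window_pair h.
  have : (\sum_(P : 'I_4) (8 * v + 16 * (Delta.+1 * Delta)) <= \sum_(P : 'I_4) (16 * #|[set u : V * V | [&& uncov T u.1 u.2, part u.1 == P & part u.2 == P]]| + 16 * (Delta.+1 * Delta)))%N.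
    by apply: leq_sum => P _; apply: leq_trans hU (h P).
  rewrite sum_nat_const card_ord big_split/= sum_nat_const card_ord -[X in (_ <= X + _)%N -> _]big_distrr/= sum_zero_pairs.
  by move: #|zero_edges part T| (Delta.+1 * Delta)%N => e W; clear; lia.
have E0le : (#|zero_edges part T| <= 4 * v * Delta)%N.
  rewrite -cV -sum_nat_const; apply: (@leq_trans (\sum_y ndeg part 0 T y)).
    by rewrite sum_ndeg_zero; clear; lia.
  apply: leq_sum => y _; apply: leq_trans (lvT y); apply: subset_leq_card.
  by apply/subsetP => u; rewrite !inE => /andP[].
pose m1 := (2 * (m - 2 * Delta))%N; pose eps := (12 * Delta)%N.
have hcov y : (m1 <= cov part 1 Rs y <= m1 + eps)%N && (2 * m1 <= cov part 2 Rs y <= 2 * m1 + eps)%N.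
  have b (c : nat) : (c == 1%N) || (c == 2%N) ->
      (2 * c * (m - 2 * Delta) <= cov part c Rs y <= 2 * c * (m + Delta))%N.
    move=> hc; have c0 : (0 < c)%N by case/orP: hc => /eqP ->.
    rewrite cov_ldeg// -(card_dirs (part y) hc) -!sum_nat_const; apply/andP; split; apply: leq_sum => u _.
      by have [h1 _] := hR y u.1 u.2; clear - h1; lia.
    by have [_ h1] := hR y u.1 u.2.
  have := b 1%N isT; have := b 2%N isT; rewrite /m1 /eps; clear - hm2; lia.
have card3 (A : {set {set V}}) u : A \subset T -> u \in A -> #|u| = 3%N.
  by have /pstsP[h _] := hT => /subsetP h1 /h1/h.
have Rsub : Rs \subset T := lrainbow_sub _ _ _.
have Xsub : Xs \subset T := lrainbow_sub _ _ _.
have inRs u : u \in Rs -> rainbow part u && (u \in labelled al SR) by rewrite inE => /andP[].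
have inXs u : u \in Xs -> rainbow part u && (u \in labelled al SX) by rewrite inE => /andP[].
have dj (A B : {set {set V}}) : (forall u, u \in A -> u \in B -> False) -> [disjoint A & B].
  by move=> h; rewrite disjoint_subset; apply/subsetP => u uA; rewrite inE; apply/negP => /(h u uA).
have g2v_abs y w : y != w -> (2 * v <= #|[set x | g_abs T L y w x]|)%N.
  move=> yw; have := card_g_abs hT L yw; rewrite cV; have := lvT y; have := lvT w; clear - hv5; lia.
have g2v_swap y w : y != w -> (2 * v <= #|[set x | g_swap T L y w x]|)%N.
  move=> yw; have := card_g_swap hT L yw; rewrite cV; have := lvT y; have := lvT w; clear - hv5; lia.
have opt_abs a b (c : nat) : a != b -> part a = part b -> (c == 1%N) || (c == 2%N) ->
    (tau <= #|[set x | [&& vtype part a x == c, covby Rs a x & covby Rs b x]]|)%N.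
  move=> ab pab hc.
  have : (0 < #|dirs c (part a)|)%N by rewrite card_dirs//; case/orP: hc => /eqP ->.
  case/card_gt0P => -[P Q]; rewrite inE /= => /and3P[h1 h2 h3].
  have aP : part a != P.
    by apply: contraTneq hc => e; rewrite -(eqP h1) -e /ptype eqxx.
  have := hstat (inl (inl (inr (a, b, P, Q)))); rewrite /= n_absE cR L1 => h.
  apply: leq_trans (window_sq v0 h htau (mean_abs R v0 _ (g2v_abs a b ab))) _.
  apply: subset_leq_card; apply/subsetP => x; rewrite 2!inE.
  case/andP=> /andP[/andP[_ xa] xb] /and5P[/eqP p1 /eqP p2 /eqP p3 l1 l2].
  rewrite {1}/vtype -/part in p1 p2 p3 *; rewrite p1 h1/=; apply/andP; split.
    by apply: (lrainbow_covby hT xa p1 p2) => //; rewrite 1?eq_sym.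
  have PQ : P != Q by rewrite eq_sym.
  by apply: (lrainbow_covby hT xb p1 p3) => //; rewrite -?pab// eq_sym.
have opt_swap y w : y != w -> part y = part w ->
    (tau <= #|[set p | [&& vtype part y p == 1%N, vtype part y (third T y p) == 2%N, third T y p != p,
        tri T y p \in Fs, covby Rs w p & covby Rs w (third T y p)]]|)%N.
  move=> yw pyw.
  have [[P Q] hPQ] : exists u, u \in [set u : 'I_4 * 'I_4 | (ptype (part y) u.1 == 1%N) && (ptype (part y) u.2 == 2%N)].
    have ex (c : nat) : (c == 1%N) || (c == 2%N) -> exists P, ptype (part y) P == c.
      move=> hc; have : (0 < #|dirs c (part y)|)%N by rewrite card_dirs//; case/orP: hc => /eqP ->.
      by case/card_gt0P => -[P Q]; rewrite inE /= => /and3P[h1 _ _]; exists P.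
    have [P hP] := ex 1%N isT; have [Q hQ] := ex 2%N isT.
    by exists (P, Q); rewrite inE hP hQ.
  move: hPQ; rewrite inE /= => /andP[hP hQ].
  have yP : part y != P by apply: contraTneq hP => <-; rewrite /ptype eqxx.
  have yQ : part y != Q by apply: contraTneq hQ => <-; rewrite /ptype eqxx.
  have PQ : P != Q by apply: contraTneq hP => ->; rewrite (eqP hQ).
  have := hstat (inl (inr (y, w, P, Q))); rewrite /= n_swapE cR cF L1 => h.
  apply: leq_trans (window_sq v0 h htau (mean_swap R v0 _ (g2v_swap y w yw))) _.
  apply: subset_leq_card; apply/subsetP => x; rewrite 2!inE.
  case/andP=> /andP[_ /and3P[xy xw xyw]] /and5P[/eqP p1 /eqP p2 /eqP p3 /eqP p4 /and3P[l1 l2 l3]].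
  have [_ _ _ tT] := thirdP hT xy.
  rewrite {1 2}/vtype -/part in p1 p2 p3 p4 *; rewrite p1 p2 hP hQ xy /= !inE tT/=.
  rewrite !inE in l1; rewrite l1/=; apply/andP; split.
    by apply: (lrainbow_covby hT xw p1 p3) => //; rewrite -?pyw.
  have QP : Q != P by rewrite eq_sym.
  by apply: (lrainbow_covby hT xyw p2 p4) => //; rewrite -?pyw.
have kXb y : (mX - 2 * Delta <= #|[set t in Xs | (y \in t) && (nbr part 1 t y == 0%N)]|)%N.
  have [Q1 [Q2 [q1 q2 q12]]] : exists Q1 Q2, [/\ ptype (part y) Q1 == 2%N, ptype (part y) Q2 == 2%N & Q1 != Q2].
    clear; case: (part y) => -[|[|[|[|//]]]] h;
    [exists 2, 3|exists 2, 3|exists 0, 1|exists 0, 1]; by split.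
  apply: leq_trans (_ : (_ <= ldeg T part (labelled al SX) y Q1 Q2)%N) _; last exact: apex_ldeg.
  by have := hX y Q1 Q2; clear; lia.
have FsT : Fs \subset T by apply/subsetP => u; rewrite inE => /andP[].
have dRX : [disjoint Rs & Xs].
  apply: dj => u /inRs/andP[_ h1] /inXs/andP[_ h2]; move: h1 h2; rewrite !inE; clear; lia.
have dRF : [disjoint Rs & Fs].
  apply: dj => u /inRs/andP[_ h1]; rewrite inE => /andP[_ h2]; move: h1 h2; rewrite !inE; clear - hm; lia.
have dXF : [disjoint Xs & Fs].
  apply: dj => u /inXs/andP[_ h1]; rewrite inE => /andP[_ h2]; move: h1 h2; rewrite !inE; clear - hm; lia.
have eeta : (2 * eps + 6 * Delta + 4 * cap = eta)%N by rewrite /eps /eta; clear; lia.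
have core := @fix_core V part T Rs Xs Fs y0 v z m1 eps Delta (mX - 2 * Delta) bX cap Sb tau cap4 Sb4 hpart v0 hT Rsub Xsub FsT dRX dRF dXF.
cbv zeta in core; rewrite eeta -/kappa in core.
have hz : (3 * m1 + 7 * eta <= z <= 3 * m1 + 9 * eta)%N.
  have := divn_eq (z + 12 * Delta - 8 * eta) 6; rewrite -/m.
  have := ltn_pmod (z + 12 * Delta - 8 * eta) (isT : 0 < 6)%N.
  move: (_ %% 6)%N => rr; rewrite /m1; clear - hm2 hz8 D0; rewrite /eta in hz8 *; move: m hm2 => mm; lia.
have hk : (3 * eta <= mX - 2 * Delta)%N by rewrite /eta /mX; clear - Dc; lia.
have cap0 : (0 < cap)%N by clear - D0 Dc; lia.
have hSb' : (4 * #|zero_edges part T| <= cap * Sb)%N.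
  by apply: leq_trans hSb; rewrite -!mulnA; move: E0le; clear; nia.
have [T' [q [w [f1 f2 f3 f4 f5]]]] := core (fun u h => proj1 (andP (inRs u h))) (fun u h => proj1 (andP (inXs u h)))
  lvT opt_abs cap0 hSb' htau1 hcov kXb hL opt_swap hE hz hk c40 hSb4 htau4 oz z3.
exists part, T', q, w; split=> //.
  by apply: leq_trans f4 _; rewrite mulnDr leq_add2r.
have dist3 (a b c d : nat) : (a * (b + c + d) = a * b + a * c + a * d)%N by rewrite !mulnDr.
rewrite dist3; apply: leq_trans f5 _; rewrite leq_add2r; apply: leq_add.
  rewrite -cV -sum_nat_const; apply: (@leq_trans (\sum_y cov part 2 Rs y)).
    rewrite sum_cov -sum1_card; apply: leq_sum => u uR.
    by have /andP[ur _] := inRs u uR; have [_ ->] := sum_nbr_rainbow ur (card3 _ _ Rsub uR).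
  apply: leq_sum => y _; have /andP[_ /andP[_ h]] := hcov y; apply: leq_trans h _.
  case/andP: hz => h _; apply: leq_trans h; rewrite -eeta; clear; lia.
rewrite -cV -sum_nat_const; apply: (@leq_trans (\sum_y #|[set u in Xs | y \in u]|)); last first.
  by apply: leq_sum => y _; exact: hL.
rewrite (eq_bigr (fun y => \sum_(u in Xs | y \in u) 1)%N); last by move=> y _; rewrite sum1dep_card.
rewrite (exchange_big_dep (mem Xs))/=; last by move=> y u _ /andP[].
rewrite -sum1_card; apply: leq_sum => u uX; rewrite (eq_bigl (mem u)) ?sum1_card ?(card3 _ _ Xsub uX)//.
by move=> y; rewrite uX.
Qed.
End FixPsts.

(** * Large monochromatic components *)

Section Components.
Variables (T : finType) (H : {set {set T}}).
Implicit Types (x y : T) (A C : {set T}) (F G : {set {set T}}).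

Lemma shadow_sym F : symmetric (shadow F).
Proof. by move=> x y; rewrite /shadow eq_sym setUC. Qed.

Lemma shadow_edge F e x y : e \in F -> x \in e -> y \in e -> connect (shadow F) x y.
Proof.
move=> eF xe ye; have [->|xy] := eqVneq x y; first exact: connect0.
apply: connect1; rewrite /shadow xy; apply/existsP; exists e; rewrite eF.
by apply/subsetP => z; rewrite !inE => /orP[]/eqP ->.
Qed.

Lemma component_class x : component H [set y | connect (shadow H) x y].
Proof.
set C := [set y | _]; pose F := [set e in H | e \subset C].
have csym : connect_sym (shadow H) by apply: sym_connect_sym; exact: shadow_sym.
have xC : x \in C by rewrite inE connect0.
have eC e y : e \in H -> y \in e -> y \in C -> e \in F.
  move=> eH ye; rewrite !inE eH => xy; apply/subsetP => z ze; rewrite inE.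
  exact: connect_trans xy (shadow_edge eH ye ze).
apply/existsP; exists F; apply/andP; split.
  apply/and4P; split.
  - by apply/set0Pn; exists x.
  - by apply/subsetP => e; rewrite inE => /andP[].
  - by apply/'forall_implyP => e; rewrite inE => /andP[].
  have h y : y \in C -> connect (shadow F) x y.
    rewrite inE => /connectP[p hp ->]; have : x \in C by [].
    elim: p {1 2 3 4}x hp => [|z p IH] u /=; first by rewrite connect0.
    case/andP => uz hp uC.
    have /andP[_ /existsP[e /andP[eH /subsetP sub]]] := uz.
    have ue : u \in e by apply: sub; rewrite !inE eqxx.
    have ze : z \in e by apply: sub; rewrite !inE eqxx orbT.
    have eF := eC e u eH ue uC.
    apply: connect_trans (shadow_edge eF ue ze) (IH z hp _).
    by move: eF; rewrite inE => /andP[_ /subsetP/(_ z ze)].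
  apply/'forall_implyP => y yC; apply/'forall_implyP => z zC.
  apply: connect_trans (h z zC); rewrite sym_connect_sym; [exact: h|exact: shadow_sym].
apply/forallP => A; apply/forallP => G; apply/implyP => /and3P[/and4P[A0 GH GA Ac] CA FG].
have AC : A = C.
  apply/eqP; rewrite eqEsubset CA andbT; apply/subsetP => y yA; rewrite inE.
  have xA := subsetP CA _ xC.
  have /implyP/(_ xA)/forallP/(_ y)/implyP/(_ yA) := forallP Ac x.
  apply: connect_sub => u w /andP[uw /existsP[e /andP[eG sub]]]; apply: connect1.
  by rewrite /shadow uw; apply/existsP; exists e; rewrite (subsetP GH).
rewrite AC eqxx eqEsubset FG andbT; apply/subsetP => e eG.
rewrite inE (subsetP GH)//= -AC.
by have /implyP/(_ eG) := forallP GA e.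
Qed.
End Components.

(** Take a smallest union [A] of classes with at least 4 m points and a class [C] in it. If [C] has
    4 m points itself, it works, as no class is almost everything. Otherwise [A :\: C] is below 4 m
    by minimality, so [A] is below 8 m and leaves 4 m outside. *)
Lemma balanced_split (T : finType) (e : rel T) (m : nat) : connect_sym e -> (12 * m <= #|T|)%N -> (0 < m)%N ->
  (forall x, #|[set y | connect e x y]| < #|T| - 4 * m)%N ->
  exists A : {set T}, [/\ forall x y, e x y -> (x \in A) = (y \in A), (4 * m <= #|A|)%N & (4 * m <= #|~: A|)%N].
Proof.
move=> es hm m0 hc.
pose ok (A : {set T}) := [forall x, forall y, e x y ==> ((x \in A) == (y \in A))] && (4 * m <= #|A|)%N.
have okT : ok [set: T].
  rewrite /ok cardsT; apply/andP; split; last by lia.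
  by apply/forallP => x; apply/forallP => y; rewrite !inE eqxx implybT.
case: (@arg_minnP _ [set: T] ok (fun A => #|A|) okT) => A /andP[Ac Am] min.
have [x xA] : exists x, x \in A by apply/card_gt0P; lia.
set C := [set y | connect e x y]; have Cc u w : e u w -> (u \in C) = (w \in C).
  by move=> uw; rewrite !inE; apply: (same_connect_r es (connect1 uw)).
have {}Ac u w : e u w -> (u \in A) = (w \in A).
  by move=> uw; have /forallP/(_ u)/forallP/(_ w)/implyP/(_ uw)/eqP := Ac.
have xC : x \in C by rewrite inE connect0.
have cT (B : {set T}) : (#|B| + #|~: B| = #|T|)%N by rewrite cardsC.
have [hC|hC] := leqP (4 * m) #|C|.
  by exists C; split=> //; have := cT C; have := hc x; rewrite -/C; lia.
exists A; split=> //; have lt : (#|A :\: C| < 4 * m)%N.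
  rewrite ltnNge; apply/negP => h.
  have : (#|A| <= #|A :\: C|)%N.
    apply: min; rewrite /ok h andbT; apply/forallP => u; apply/forallP => w; apply/implyP => uw.
    by rewrite !in_setD (Ac u w uw) (Cc u w uw).
  have := cardsD1 x A; rewrite xA => e1.
  have : (#|A :\: C| <= #|A :\ x|)%N by apply: subset_leq_card; rewrite setDS// sub1set.
  by lia.
have : (#|A :&: C| <= #|C|)%N by rewrite subset_leq_card// subsetIr.
by have := cT A; have := cardsID C A; lia.
Qed.

Lemma ord3_third (i j : 'I_3) : i != j -> exists l : 'I_3, [/\ l != i, l != j & forall a, [\/ a = i, a = j | a = l]].
Proof.
have ne (a b : 'I_3) : (a != b) = (nat_of_ord a != nat_of_ord b) by [].
rewrite ne => ij; have i3 := ltn_ord i; have j3 := ltn_ord j.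
have l3 : (3 - i - j < 3)%N by lia.
exists (Ordinal l3); split=> [||a]; rewrite ?ne /=; try lia.
have a3 := ltn_ord a.
have [h|[h|h]] : (nat_of_ord a = i \/ nat_of_ord a = j \/ nat_of_ord a = 3 - i - j)%N by lia.
- by constructor 1; apply/val_inj.
- by constructor 2; apply/val_inj.
- by constructor 3; apply/val_inj.
Qed.

(** A cell is a vertex of the cube. Each face consists of four cells with at least 4 m points
    together, so it contains a cell with m points. Let u be such a large cell and w i a large cell
    on the face opposite to u in direction i; three of these cells, or u with an antipode, are
    separated by every coordinate. *)
Lemma three_cells (m n : nat) (T : finType) (s : 'I_3 -> {set T}) : #|T| = n -> (12 * m <= n)%N ->
  (forall i, (4 * m <= #|s i|)%N && (4 * m <= #|~: s i|)%N) ->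
  exists X1 X2 X3 : {set T}, [/\ [/\ #|X1| = m, #|X2| = m & #|X3| = m],
    [/\ [disjoint X1 & X2], [disjoint X1 & X3] & [disjoint X2 & X3]] &
    forall i x1 x2 x3, x1 \in X1 -> x2 \in X2 -> x3 \in X3 ->
      ~~ (((x1 \in s i) == (x2 \in s i)) && ((x1 \in s i) == (x3 \in s i)))].
Proof.
move=> cT mn hs; pose pat x : {ffun 'I_3 -> bool} := [ffun i => x \in s i].
pose cell u := [set x | pat x == u].
have big i (b : bool) : exists u : {ffun 'I_3 -> bool}, u i = b /\ (m <= #|cell u|)%N.
  pose half := if b then s i else ~: s i.
  have hh : (4 * m <= #|half|)%N by have /andP[] := hs i; rewrite /half; case: (b).
  have [u hu|no] := pickP (fun u : {ffun 'I_3 -> bool} => (u i == b) && (m <= #|cell u|)%N).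
    by exists u; have /andP[/eqP] := hu.
  have hp x : (x \in half) = (pat x i == b) by rewrite /half ffunE; case: (b); rewrite ?inE; case: (_ \in _).
  have [m0|m0] := posnP m; first by exists [ffun _ => b]; rewrite ffunE m0.
  suff : (#|half| < 4 * m)%N by rewrite ltnNge hh.
  have -> : #|half| = (\sum_(u : {ffun 'I_3 -> bool} | u i == b) #|cell u|)%N.
    rewrite -sum1_card (partition_big pat (fun u => u i == b))/=; last by move=> x; rewrite hp.
    apply: eq_bigr => u ub; rewrite sum1dep_card; apply: eq_card => x; rewrite !inE hp.
    by case: (eqVneq (pat x) u) => [->|]; rewrite ?andbF// ub.
  have c4 : #|[set u : {ffun 'I_3 -> bool} | u i == b]| = 4%N.
    pose f (v : {ffun 'I_3 -> bool}) : {ffun 'I_3 -> bool} := [ffun j => if j == i then ~~ v j else v j].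
    have fK : involutive f by move=> v; apply/ffunP => j; rewrite !ffunE; case: (j == i); rewrite ?negbK.
    have e1 : #|[set u : {ffun 'I_3 -> bool} | u i == b]| = #|~: [set u : {ffun 'I_3 -> bool} | u i == b]|.
      rewrite -(card_imset _ (inv_inj fK)); apply: eq_card => v; rewrite !inE.
      apply/imsetP/idP => [[w]|vb]; first by rewrite inE => /eqP wb ->; rewrite ffunE eqxx wb; case: (b).
      by exists (f v); rewrite ?fK// inE ffunE eqxx; move: vb; case: (v i); case: (b).
    have := cardsC [set u : {ffun 'I_3 -> bool} | u i == b].
    by rewrite -e1 card_ffun card_bool card_ord; lia.
  have : (\sum_(u : {ffun 'I_3 -> bool} | u i == b) #|cell u| <= \sum_(u in [set u : {ffun 'I_3 -> bool} | u i == b]) m.-1)%N.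
    rewrite [leqRHS](eq_bigl (fun u : {ffun 'I_3 -> bool} => u i == b)); last by move=> u; rewrite inE.
    apply: leq_sum => u ub; have := no u; rewrite ub/= => /negbT; lia.
  by rewrite sum_nat_const c4; lia.
have sub (A : {set T}) : (m <= #|A|)%N -> exists X : {set T}, X \subset A /\ #|X| = m.
  move=> h; have : (0 < #|[set B : {set T} | (B \subset A) && (#|B| == m)]|)%N by rewrite cards_draws bin_gt0.
  by case/card_gt0P => B; rewrite inE => /andP[h1 /eqP h2]; exists B.
have dcell u v (X Y : {set T}) : u != v -> X \subset cell u -> Y \subset cell v -> [disjoint X & Y].
  move=> uv /subsetP Xu /subsetP Yv; rewrite disjoint_subset; apply/subsetP => x xX; rewrite inE.
  apply/negP => xY; move: uv; have := Xu x xX; have := Yv x xY; rewrite !inE => /eqP <- /eqP <-.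
  by rewrite eqxx.
have inC u (X : {set T}) x i : X \subset cell u -> x \in X -> (x \in s i) = u i.
  by move=> /subsetP h /h; rewrite inE => /eqP <-; rewrite ffunE.
have three u v w : (m <= #|cell u|)%N -> (m <= #|cell v|)%N -> (m <= #|cell w|)%N ->
    (forall i, ~~ ((u i == v i) && (u i == w i))) -> u != v -> u != w -> v != w ->
  exists X1 X2 X3 : {set T}, [/\ [/\ #|X1| = m, #|X2| = m & #|X3| = m],
    [/\ [disjoint X1 & X2], [disjoint X1 & X3] & [disjoint X2 & X3]] &
    forall i x1 x2 x3, x1 \in X1 -> x2 \in X2 -> x3 \in X3 ->
      ~~ (((x1 \in s i) == (x2 \in s i)) && ((x1 \in s i) == (x3 \in s i)))].
  move=> /sub[X1 [s1 c1]] /sub[X2 [s2 c2]] /sub[X3 [s3 c3]] h uv uw vw.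
  exists X1, X2, X3; split=> //.
    by split; [exact: dcell uv s1 s2|exact: dcell uw s1 s3|exact: dcell vw s2 s3].
  by move=> i x1 x2 x3 h1 h2 h3; rewrite (inC u X1)// (inC v X2)// (inC w X3).
have [u [_ bu]] := big ord0 true.
have [w hw] := @fin_all_exists 'I_3 (fun=> {ffun 'I_3 -> bool}) (fun i v => v i = ~~ u i /\ (m <= #|cell v|)%N)
  (fun i => big i (~~ u i)).
have neq (a b : {ffun 'I_3 -> bool}) (i : 'I_3) : a i != b i -> a != b by apply: contraNneq => ->.
(* An antipodal pair is separated by all three coordinates, so the third set is arbitrary; 12 m <= n
   leaves room for it. *)
have [/existsP[i /forallP anti]|na] := boolP [exists i, [forall j, w i j == ~~ u j]].
  have [X1 [s1 c1]] := sub _ bu; have [X2 [s2 c2]] := sub _ (hw i).2.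
  have [|X3 [s3 c3]] := sub (~: (X1 :|: X2)).
    have := cardsC (X1 :|: X2); have l : (#|X1 :|: X2| <= #|X1| + #|X2|)%N := leq_card_setU X1 X2.
    by rewrite cT; lia.
  exists X1, X2, X3; split=> //.
    split; first by apply: dcell s1 s2; apply: (neq _ _ ord0); rewrite (eqP (anti _)); case: (u _).
      by rewrite disjoint_sym disjoints_subset (subset_trans s3)// setCS subsetUl.
    by rewrite disjoint_sym disjoints_subset (subset_trans s3)// setCS subsetUr.
  move=> j x1 x2 x3 h1 h2 _; rewrite (inC u X1)// (inC (w i) X2)// (eqP (anti j)).
  by case: (u j).
(* Here [w i] agrees with [u] in direction l only, and [w l] takes care of that direction. *)
have [/existsP[i /existsP[l /andP[/eqP hl /forallP hj]]]|all1] :=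
    boolP [exists i, [exists l, (w i l == u l) && [forall j, (j != l) ==> (w i j != u j)]]].
  have il : i != l by apply/eqP => e; move: hl; rewrite -e (hw i).1; case: (u i).
  apply: (three u (w i) (w l) bu (hw i).2 (hw l).2) => [a|||].
  - have [->|al] := eqVneq a l; first by rewrite (hw l).1; case: (u l); rewrite andbF.
    by have /implyP/(_ al) := hj a; rewrite eq_sym => /negbTE ->.
  - by apply: (neq _ _ i); rewrite (hw i).1; case: (u i).
  - by apply: (neq _ _ l); rewrite (hw l).1; case: (u l).
  by apply: (neq _ _ l); rewrite (hw l).1 hl; case: (u l).
(* In the remaining case each [w i] is the neighbour of [u] in direction i; then in every direction
   i the cell [w i] differs from the two others. *)
have only i j : i != j -> w i j = u j.
  move=> ij; apply/eqP; apply: contraT => wj; have [l [li lj la]] := ord3_third ij.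
  have wi : w i i != u i by rewrite (hw i).1; case: (u i).
  have [wl|wl] := eqVneq (w i l) (u l).
    case/negP: all1; apply/existsP; exists i; apply/existsP; exists l; rewrite wl eqxx.
    by apply/forallP => a; apply/implyP; case: (la a) => ->; rewrite ?eqxx.
  case/negP: na; apply/existsP; exists i; apply/forallP => a.
  by case: (la a) => ->; [move: wi|move: wj|move: wl]; case: (w i _); case: (u _).
pose i0 : 'I_3 := @Ordinal 3 0 isT; pose i1 : 'I_3 := @Ordinal 3 1 isT; pose i2 : 'I_3 := @Ordinal 3 2 isT.
have wne i j : i != j -> w i != w j.
  by move=> ij; apply: (neq _ _ i); rewrite (hw i).1 (only j i) 1?eq_sym//; case: (u i).
apply: (three (w i0) (w i1) (w i2) (hw _).2 (hw _).2 (hw _).2) => [a|||]; try exact: wne.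
have [->|a0] := eqVneq a i0; first by rewrite (hw i0).1 (only i1 i0)//; case: (u i0).
have [->|a1] := eqVneq a i1; first by rewrite (hw i1).1 (only i0 i1)//; case: (u i1).
have -> : a = i2.
  by apply/val_inj; move: a0 a1 (ltn_ord a); rewrite -!(inj_eq val_inj) /=; lia.
by rewrite (hw i2).1 (only i0 i2)// (only i1 i2)//; case: (u i2).
Qed.

Lemma mc_of_no_hole (T : finType) (S : {set {set T}}) (m : nat) : (12 * m <= #|T|)%N -> (0 < m)%N ->
  (forall X1 X2 X3 : {set T}, #|X1| = m -> #|X2| = m -> #|X3| = m ->
     [disjoint X1 & X2] -> [disjoint X1 & X3] -> [disjoint X2 & X3] ->
     exists e, e \in S /\ [/\ ~~ [disjoint e & X1], ~~ [disjoint e & X2] & ~~ [disjoint e & X3]]) ->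
  (#|T| - 4 * m <= mc 3 S)%N.
Proof.
move=> hm m0 hole.
suff hl : has_large_mono_component 3 S (#|T| - 4 * m).
  have lt : (#|T| - 4 * m < #|T|.+1)%N by rewrite ltnS leq_subr.
  exact: (leq_bigmax_cond (Ordinal lt)).
apply: contraT; rewrite negb_forall => /existsP[c]; rewrite negb_exists => /forallP hc.
have hsz i x : (#|[set y | connect (shadow (color_class S c i)) x y]| < #|T| - 4 * m)%N.
  rewrite ltnNge; apply/negP => h; have /negP := hc i; apply; apply/existsP.
  by exists [set y | connect (shadow (color_class S c i)) x y]; rewrite component_class.
have [s hs] := @fin_all_exists 'I_3 (fun=> {set T}) (fun i A =>
   [/\ forall x y, shadow (color_class S c i) x y -> (x \in A) = (y \in A), (4 * m <= #|A|)%N & (4 * m <= #|~: A|)%N])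
   (fun i => balanced_split (sym_connect_sym (@shadow_sym _ _)) hm m0 (hsz i)).
have [|X1 [X2 [X3 [[c1 c2 c3] [d1 d2 d3] hX]]]] := @three_cells m #|T| T s erefl hm.
  by move=> i; have [_ -> ->] := hs i.
have [e [eS [/pred0Pn[x1 /andP[e1 h1]] /pred0Pn[x2 /andP[e2 h2]] /pred0Pn[x3 /andP[e3 h3]]]]] := hole _ _ _ c1 c2 c3 d1 d2 d3.
have eq x y : x \in e -> y \in e -> (x \in s (c e)) = (y \in s (c e)).
  move=> xe ye; have [->//|xy] := eqVneq x y; have [h _ _] := hs (c e); apply: h.
  rewrite /shadow xy; apply/existsP; exists e; rewrite inE eS eqxx.
  by apply/subsetP => z; rewrite !inE => /orP[]/eqP ->.
by have := hX (c e) x1 x2 x3 h1 h2 h3; rewrite (eq x1 x2)// (eq x2 x3)// eqxx.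
Qed.

(** * Systems with a hole *)

Section Systems.
Variable V : finType.
Implicit Types (S M : {set {set V}}) (t b : {set V}) (x y : V).

Definition systems := [set S : {set {set V}} | psts S && [forall x, forall y, (x != y) ==> covby S x y]].

Lemma systemsP S : reflect (sts S) (S \in systems).
Proof.
rewrite inE; apply: (iffP andP) => -[h1 h2]; split=> //.
  by move=> x y; have /forallP/(_ x)/forallP/(_ y)/implyP := h2.
by apply/forallP => x; apply/forallP => y; apply/implyP; apply: h2.
Qed.

(** With a single part all pairs have type 0, and the degree count for types specializes to the
    usual double counting. *)
Lemma sts_card S : sts S -> (6 * #|S| = #|V| * #|V|.-1)%N.
Proof.
move=> [hS hc]; pose part (x : V) : 'I_4 := ord0.
have v0 x y : vtype part x y = 0%N by rewrite /vtype /ptype eqxx.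
have nt y : ntot part 0 y = #|V|.-1.
  rewrite -(cardC1 y); apply: eq_card => x; rewrite !inE v0 andbT.
  by [].
have nd y : ndeg part 0 S y = 0%N.
  apply/eqP; rewrite cards_eq0; apply/eqP/setP => x; rewrite !inE uncovE.
  by have [->|xy] := eqVneq y x; rewrite //= hc.
have /pstsP[c3 _] := hS.
rewrite -sum_nat_const (eq_bigr (fun y => cov part 0 S y)) => [|y _]; last first.
  by rewrite -(nt y) -(ndeg_cov part 0 y hS) nd.
rewrite sum_cov mulnC -sum_nat_const; apply: eq_bigr => t tS.
have z (c : nat) : (0 < c)%N -> (\sum_y nbr part c t y = 0)%N.
  move=> c0; rewrite big1// => y _; apply/eqP; rewrite cards_eq0; apply/eqP/setP => x.
  by rewrite !inE v0 [0%N == c]eq_sym (gtn_eqF c0) !andbF.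
have z1 := z 1%N isT.
by have := sum_nbr_all part (c3 t tS); rewrite z1 !addn0.
Qed.

Definition overlap t b := (1 < #|t :&: b|)%N.

(** The three pairs of [t] are covered by triples of [S], distinct because none of them contains all
    of [t]. These are the three conflicts behind the cubic decay. *)
Lemma sts_maximal S t : sts S -> #|t| = 3%N -> t \notin S -> (2 < #|[set b in S | overlap t b]|)%N.
Proof.
move=> [/pstsP[S3 Su] Sc] t3 tS.
have [a [b [d [ab ad bd et]]]] := card3P t3.
have key x y z : t = [set x; y; z] -> x != y -> exists u, [/\ u \in S, x \in u, y \in u & z \notin u].
  move=> e xy; have /covbyP[u [uS xu yu]] := Sc x y xy.
  exists u; split=> //; apply: contra tS => zu.
  suff -> : t = u by [].
  apply/eqP; rewrite eqEcard t3 S3// andbT e; apply/subsetP => w.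
  by rewrite !inE -orbA => /or3P[]/eqP ->.
have e2 : t = [set a; d; b] by rewrite et -!setUA [[set b] :|: _]setUC.
have e3 : t = [set b; d; a] by rewrite et [RHS]setUC -!setUA.
have [u1 [h1 h2 h3 h4]] := key a b d et ab.
have [u2 [k1 k2 k3 k4]] := key a d b e2 ad.
have [u3 [l1 l2 l3 l4]] := key b d a e3 bd.
have at_ : a \in t by rewrite et !inE eqxx.
have bt : b \in t by rewrite et !inE eqxx orbT.
have dt : d \in t by rewrite et !inE eqxx !orbT.
have ov x y (u : {set V}) : x != y -> x \in t -> y \in t -> x \in u -> y \in u -> overlap t u by exact: card_gt1_setI.
have n12 : u1 != u2 by apply: contraNneq k4 => <-.
have n13 : u1 != u3 by apply: contraNneq l4 => <-.
have n23 : u2 != u3 by apply: contraNneq l4 => <-.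
have -> : 3%N = #|[set u1; u2; u3]| by rewrite setUC cardsU1 !inE negb_or eq_sym n13 eq_sym n23 cards2 n12.
apply: subset_leq_card; apply/subsetP => u; rewrite !inE -orbA => /or3P[]/eqP ->.
- by rewrite h1 (ov a b).
- by rewrite k1 (ov a d).
- by rewrite l1 (ov b d).
Qed.

Definition crosses (X : {set V} * {set V} * {set V}) t :=
  [&& ~~ [disjoint t & X.1.1], ~~ [disjoint t & X.1.2] & ~~ [disjoint t & X.2]].

Definition hole_systems X := [set S in systems | [forall t in S, ~~ crosses X t]].

Lemma card_crossing (X1 X2 X3 : {set V}) : [disjoint X1 & X2] -> [disjoint X1 & X3] -> [disjoint X2 & X3] ->
  (#|X1| * #|X2| * #|X3| <= #|[set t : {set V} | (#|t| == 3%N) && crosses (X1, X2, X3) t]|)%N.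
Proof.
move=> d12 d13 d23; rewrite -!cardsX.
have dj (A B : {set V}) x y : [disjoint A & B] -> x \in A -> y \in B -> x != y.
  by move=> d xA yB; apply: contraTneq xA => ->; rewrite (disjointFl d yB).
rewrite -(card_in_imset (f := fun u : V * V * V => [set u.1.1; u.1.2; u.2])); last first.
  move=> [[x1 x2] x3] [[y1 y2] y3]; rewrite !inE /= => /andP[/andP[a1 a2] a3] /andP[/andP[b1 b2] b3] /setP e.
  have m1 : x1 \in [set y1; y2; y3] by rewrite -e !inE eqxx.
  have m2 : x2 \in [set y1; y2; y3] by rewrite -e !inE eqxx orbT.
  have m3 : x3 \in [set y1; y2; y3] by rewrite -e !inE eqxx !orbT.
  move: m1; rewrite !inE (negbTE (dj _ _ _ _ d12 a1 b2)) (negbTE (dj _ _ _ _ d13 a1 b3)) !orbF => /eqP ->.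
  move: m2; rewrite !inE [x2 == y1]eq_sym (negbTE (dj _ _ _ _ d12 b1 a2)) (negbTE (dj _ _ _ _ d23 a2 b3)) orbF => /eqP ->.
  move: m3; rewrite !inE [x3 == y1]eq_sym (negbTE (dj _ _ _ _ d13 b1 a3)) [x3 == y2]eq_sym (negbTE (dj _ _ _ _ d23 b2 a3)) => /eqP ->.
  by [].
apply: subset_leq_card; apply/subsetP => t /imsetP[[[x1 x2] x3]]; rewrite !inE /= => /andP[/andP[a1 a2] a3] ->.
rewrite setUC cardsU1 !inE negb_or [x3 == x1]eq_sym (dj _ _ _ _ d13 a1 a3) [x3 == x2]eq_sym (dj _ _ _ _ d23 a2 a3).
rewrite cards2 (dj _ _ _ _ d12 a1 a2) /=; apply/and3P; split; apply/pred0Pn.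
- by exists x1; rewrite /= a1 !inE eqxx orbT.
- by exists x2; rewrite /= a2 !inE eqxx !orbT.
- by exists x3; rewrite /= a3 !inE eqxx.
Qed.

Lemma hole_systems_le (R : realType) (X : {set V} * {set V} * {set V}) (tb : R) :
  let k := (#|V| * #|V|.-1 %/ 6)%N in
  [disjoint X.1.1 & X.1.2] -> [disjoint X.1.1 & X.2] -> [disjoint X.1.2 & X.2] ->
  (0 < k)%N -> 0 < tb -> 'C(#|V|, 3)%:R - (#|X.1.1| * #|X.1.2| * #|X.2|)%:R <= tb ->
  (0 < #|hole_systems X|)%N ->
  ln #|hole_systems X|%:R <= k%:R * (ln tb - ln k%:R - 2) + 2 * (ln k%:R + 1)
     + 2 * Num.sqrt (k%:R ^+ 3 / tb) * (1 + ln k%:R).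
Proof.
move=> k d12 d13 d23 k0 tb0 htb h0.
pose TT := [set t : {set V} | (#|t| == 3%N) && ~~ crosses X t].
apply: (@greedy_count_le R _ overlap TT) => //.
  apply: le_trans htb; rewrite lerBrDr -natrD ler_nat -(card_draws V 3%N).
  rewrite -[leqRHS](cardsID [set t : {set V} | ~~ crosses X t]); apply: leq_add.
    by apply: subset_leq_card; apply/subsetP => t; rewrite !inE.
  case: X d12 d13 d23 {h0 TT} => -[X1 X2] X3 d12 d13 d23; apply: leq_trans (card_crossing d12 d13 d23) _.
  by apply: subset_leq_card; apply/subsetP => t; rewrite !inE negbK andbC.
move=> M; rewrite inE => /andP[/systemsP hM /forallP hX].
have /pstsP[M3 Mu] := hM.1.
split.
- apply/andP; split; first by apply/subsetP => t tM; rewrite inE M3// eqxx; have /implyP := hX t; apply.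
  apply/'forall_implyP => t tM; apply/'forall_implyP => b bM; apply/implyP; apply: contra => h.
  have [x [y [xt [yt xy]]]] : exists x y, x \in t :&: b /\ (y \in t :&: b /\ x != y).
    by have /card_gt1P[x [y [h1 h2 h3]]] := h; exists x, y.
  move: xt yt; rewrite !inE => /andP[a1 a2] /andP[a3 a4].
  by apply/eqP; apply: (Mu t b x y).
- by rewrite /k -(sts_card hM) mulKn.
by move=> t; rewrite inE => /andP[/eqP t3 _] tM; exact: sts_maximal.
Qed.
End Systems.

Lemma systems_transport (V W : finType) : #|V| = #|W| -> (#|systems V| <= #|systems W|)%N.
Proof.
move=> e; pose f (x : V) : W := enum_val (cast_ord e (enum_rank x)).
pose g (y : W) : V := enum_val (cast_ord (esym e) (enum_rank y)).
have fK : cancel f g by move=> x; rewrite /f /g enum_valK cast_ordK enum_rankK.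
have gK : cancel g f by move=> x; rewrite /f /g enum_valK cast_ordKV enum_rankK.
have fi := can_inj fK.
pose F (S : {set {set V}}) : {set {set W}} := [set f @: t | t : {set V} in S].
have iF : injective F by apply: imset_inj; exact: imset_inj.
rewrite -(card_imset _ iF); apply: subset_leq_card; apply/subsetP => S' /imsetP[S /systemsP[/pstsP[S3 Su] Sc] ->].
apply/systemsP; split=> [|x y xy].
  apply/pstsP; split=> [t /imsetP[t0 h ->]|t t' x y /imsetP[t0 h ->] /imsetP[t1 h' ->] xy].
    by rewrite card_imset// S3.
  rewrite -[x]gK -[y]gK !mem_imset// => h1 h2 h3 h4.
  by rewrite (Su t0 t1 (g x) (g y))//; apply: contra xy => /eqP/(can_inj gK) ->.
have /covbyP[t [tS xt yt]] : covby S (g x) (g y) by apply: Sc; apply: contra xy => /eqP/(can_inj gK) ->.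
by apply/covbyP; exists (f @: t); rewrite imset_f// -[x]gK -[y]gK !mem_imset.
Qed.

Lemma steiner_systems n : STS n = systems 'I_n.
Proof.
apply/setP => S; rewrite inE; apply/andP/systemsP => [[/'forall_implyP h1 /forallP h2]|[/pstsP[S3 Su] Sc]].
  have un (x y : 'I_n) : x != y -> #|[set e in S | [set x; y] \subset e]| = 1%N.
    by move=> xy; have /forallP/(_ y)/implyP/(_ xy)/eqP := h2 x.
  split=> [|x y xy].
    apply/pstsP; split=> [t tS|t t' x y tS t'S xy xt yt xt' yt']; first by apply/eqP; apply: h1.
    have /eqP/cards1P[e0 he] := un x y xy.
    have sub u : u \in S -> x \in u -> y \in u -> u = e0.
      move=> uS xu yu; apply/set1P; rewrite -he inE uS; apply/subsetP => w.
      by rewrite !inE => /orP[]/eqP ->.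
    by rewrite (sub t)// (sub t').
  have : (0 < #|[set e in S | [set x; y] \subset e]|)%N by rewrite un.
  case/card_gt0P => e; rewrite inE => /andP[eS /subsetP sub]; apply/covbyP; exists e.
  by split=> //; apply: sub; rewrite !inE eqxx ?orbT.
split; first by apply/'forall_implyP => e /S3 ->.
apply/forallP => x; apply/forallP => y; apply/implyP => xy; apply/cards1P.
have /covbyP[e [eS xe ye]] := Sc x y xy; exists e; apply/setP => u; rewrite !inE.
apply/andP/eqP => [[uS /subsetP sub]|->]; last first.
  by split=> //; apply/subsetP => w; rewrite !inE => /orP[]/eqP ->.
by apply: (Su u e x y) => //; apply: sub; rewrite !inE eqxx ?orbT.
Qed.

(** A set of at most [f] elements is the image of a partial function from ['I_f]; the value [None]
    pads smaller sets. *)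
Lemma card_small_subsets (X : finType) (A : {set X}) f :
  (#|[set B : {set X} | (B \subset A) && (#|B| <= f)%N]| <= #|A|.+1 ^ f)%N.
Proof.
pose Y := {ffun 'I_f -> option {x | x \in A}}.
have cY : #|{: Y}| = (#|A|.+1 ^ f)%N by rewrite card_ffun card_option card_sig card_ord.
rewrite -cY; pose G (y : Y) : {set X} := [set x | [exists i, omap val (y i) == Some x]].
rewrite -cardsT; apply: leq_trans (_ : (_ <= #|G @: [set: Y]|)%N) _; last exact: leq_imset_card.
apply: subset_leq_card; apply/subsetP => B; rewrite inE => /andP[/subsetP BA Bf].
pose y : Y := [ffun i : 'I_f => obind (fun x => insub x) (onth (enum B) i)].
apply/imsetP; exists y => //; apply/setP => x; rewrite inE; apply/idP/existsP => [xB|[i]].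
  have xe : x \in enum B by rewrite mem_enum.
  have lt : (index x (enum B) < f)%N by apply: leq_trans Bf; rewrite cardE index_mem.
  exists (Ordinal lt); rewrite ffunE /=.
  have -> : onth (enum B) (index x (enum B)) = Some x.
    have := onthTE (enum B) (index x (enum B)); have := odflt_onth x (enum B) (index x (enum B)).
    by rewrite index_mem xe nth_index//; case: onth => //= z ->.
  by rewrite /= insubT ?BA.
rewrite ffunE; case e: (onth (enum B) i) => [z|]//=; case: insubP => //= u _ uz /eqP[<-].
by rewrite uz -mem_enum; apply/onthP; exists i.
Qed.

(** * Many Steiner triple systems *)

Lemma sum_lv (V : finType) (T : {set {set V}}) : psts T ->
  (\sum_x lv T x + 6 * #|T| = #|V| * #|V|.-1)%N.
Proof.
move=> hT; pose part (x : V) : 'I_4 := ord0.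
have v0 x y : vtype part x y = 0%N by rewrite /vtype /ptype eqxx.
have nt y : ntot part 0 y = #|V|.-1.
  by rewrite -(cardC1 y); apply: eq_card => x; rewrite !inE v0 andbT.
have /pstsP[c3 _] := hT.
have -> : (6 * #|T| = \sum_y cov part 0 T y)%N.
  rewrite sum_cov mulnC -sum_nat_const; apply: eq_bigr => t tT.
  have z : (\sum_y nbr part 1 t y = 0)%N.
    rewrite big1// => y _; apply/eqP; rewrite cards_eq0; apply/eqP/setP => x.
    by rewrite !inE v0 !andbF.
  by have := sum_nbr_all part (c3 t tT); rewrite z !addn0.
rewrite -big_split/= -sum_nat_const; apply: eq_bigr => y _.
rewrite -(nt y) -(ndeg_cov part 0 y hT); congr (_ + _)%N; apply: eq_card => x.
by rewrite !inE v0 andbT.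
Qed.

Section Lower.
Variables (R : realType) (V : finType).
Variables (v Delta cap cap4 j Sb Sb4 tau k kT : nat) (s t : R).
Let z := (3 ^ j)%N.
Let eta := (30 * Delta + 4 * cap)%N.
Let m := ((z + 12 * Delta - 8 * eta) %/ 6)%N.
Let mX := (104 * cap)%N.
Let bX := (16 * mX + Delta)%N.
Let kappa := (4 * eta + bX)%N.

(** [T] can be recovered from the Steiner system and the two differences between [T] and its altered
    version [T']; the power counts the possible differences, which are small sets of triples. *)
Lemma systems_lower : #|V| = (4 * v)%N ->
  0 < s -> s * 9 <= 1 / 2 -> 4 * t <= k%:R -> t + 9 * k%:R <= Delta%:R ->
  200 * #|V|%:R ^+ 2 * expR (s ^+ 2 * (63 * #|V|%:R) - s * t) < 1 ->
  (0 < Delta <= cap)%N -> (8 * v + 16 * (Delta.+1 * Delta) + 6 * kT <= #|V| * #|V|.-1)%N ->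
  (16 * m + 16 * mX <= 2 * v)%N -> (3 * Delta + 5 <= 2 * v)%N -> (2 * Delta <= m)%N -> (8 * eta <= z)%N ->
  (16 * v * (tau + Delta) <= m ^ 2)%N ->
  (16 * v * Delta <= cap * Sb)%N -> (6 * (Delta + cap) + Sb < tau)%N ->
  (0 < cap4)%N -> (16 * v * kappa <= cap4 * Sb4)%N ->
  (9 * (kappa + cap4) + Sb4 + 6 * (Delta + cap) < tau)%N ->
  (3 %| v * (z + 2 * v + 1))%N ->
  (#|good_psts V kT Delta| <= #|systems (V + {ffun 'I_j -> 'F_3})%type| *
     'C(#|V|, 3).+1 ^ (4 * v * (Delta + kappa) + 4 * v * (z + bX + kappa)))%N.
Proof.
move=> cV s0 s9 tk tD hexp hDc hU hm hv5 hm2 hz8 htau hSb htau1 c40 hSb4 htau4 z3.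
have oz : odd z by rewrite /z oddX orbT.
pose Z := {ffun 'I_j -> 'F_3}.
pose Tr := [set u : {set V} | #|u| == 3%N].
have cTr : #|Tr| = 'C(#|V|, 3) by rewrite -(card_draws V 3%N); apply: eq_card => u; rewrite !inE.
set f1 := (4 * v * (Delta + kappa))%N; set f2 := (4 * v * (z + bX + kappa))%N.
pose small f := [set B : {set {set V}} | (B \subset Tr) && (#|B| <= f)%N].
have csmall f : (#|small f| <= 'C(#|V|, 3).+1 ^ f)%N by rewrite -cTr; exact: card_small_subsets.
pose rec (u : {set {set V + Z}} * ({set {set V}} * {set {set V}})) : {set {set V}} :=
  [set e : {set V} | ((inl @: e : {set V + Z}) \in u.1) && (e \notin u.2.1)] :|: u.2.2.
apply: (@leq_trans #|rec @: setX (systems (V + Z)%type) (setX (small f1) (small f2))|).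
  apply: subset_leq_card; apply/subsetP => T; rewrite inE => /and3P[hT /eqP cT /forallP lvT].
  have hU' : (8 * v + 16 * (Delta.+1 * Delta) <= \sum_x lv T x)%N.
    by rewrite -(leq_add2r (6 * kT)) -{2}cT (sum_lv hT).
  have v0 : (0 < #|V|)%N by rewrite cV; clear - hv5; lia.
  have [y0 _] := card_gt0P v0.
  have [part [T' [q [w [h1 h2 h3 h4 h5]]]]] := fix_psts y0 hT cV lvT s0 s9 tk tD hexp hDc hU' hm hv5 hm2 hz8 htau hSb htau1 c40 hSb4 htau4 oz z3.
  have [S [hS hST]] := extend_sts h1 h2 h3.
  have tr (A : {set {set V}}) : psts A -> A \subset Tr.
    by move=> /pstsP[A3 _]; apply/subsetP => u /A3; rewrite inE => ->.
  apply/imsetP; exists (S, (T' :\: T, T :\: T')).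
    rewrite !in_setX; apply/and3P; split; first exact/systemsP.
      by rewrite inE h4 andbT (subset_trans (subsetDl _ _))// tr.
    by rewrite inE h5 andbT (subset_trans (subsetDl _ _))// tr.
  apply/setP => u; rewrite in_setU inE /= hST !in_setD.
  by case: (u \in T); case: (u \in T').
apply: leq_trans (leq_imset_card _ _) _; rewrite !cardsX leq_mul2l expnD; apply/orP; right.
exact: leq_mul.
Qed.
End Lower.

(** * Choice of the parameters *)

Section ParameterBounds.
Variables (K A Q g n v z : nat).
Hypothesis hK : (1000 * 1000 <= K)%N.
Hypothesis hQ : (Q * Q = A * (K ^ 4))%N.
Hypothesis KQ : (K <= Q)%N.
Hypothesis KA : (K <= A)%N.
Hypothesis g0 : (0 < g)%N.
Hypothesis nlo : (A ^ 3 * g <= n)%N.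
Hypothesis nhi : (n <= 2 * (A ^ 3 * g))%N.
Hypothesis hn : n = (4 * v + z)%N.
Hypothesis zn : (1000 * z <= n)%N.
Hypothesis zlo : (A * A * g * Q <= 9 * z)%N.
Let cap := (A * g)%N.
Let cap4 := (A * cap)%N.
Let Sb := (K * cap4)%N.
Let tau := (K * Sb)%N.
Let eta := (30 * g + 4 * cap)%N.
Let m := ((z + 12 * g - 8 * eta) %/ 6)%N.
Let mX := (104 * cap)%N.
Let bX := (16 * mX + g)%N.
Let kappa := (4 * eta + bX)%N.

(** Along g, cap, cap4, Sb, tau each quantity is at least 10^6 times the previous one. The size of Q
    comes from 16 v (tau + g) <= m^2: the left side is of order A K^2 cap4^2, while m is at least z
    / 7 and 9 z at least Q cap4; with Q^2 = A K^4 a factor K^2 is to spare. *)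
Lemma parameter_bounds :
  [/\ [/\ (0 < g <= cap)%N, (16 * m + 16 * mX <= 2 * v)%N, (3 * g + 5 <= 2 * v)%N, (2 * g <= m)%N & (8 * eta <= z)%N],
   [/\ (16 * v * (tau + g) <= m ^ 2)%N, (16 * v * g <= cap * Sb)%N, (6 * (g + cap) + Sb < tau)%N & (0 < cap4)%N],
   (16 * v * kappa <= cap4 * Sb)%N, (9 * (kappa + cap4) + Sb + 6 * (g + cap) < tau)%N &
   (4 * v * (g + kappa) + 4 * v * (z + bX + kappa) <= 2 * n * z)%N].
Proof.
have A3 : (A ^ 3 * g = A * cap4)%N by rewrite /cap4 /cap; lia.
have lo : (A * cap4 <= 4 * v + z)%N by rewrite -hn -A3.
have hi : (4 * v + z <= 2 * (A * cap4))%N by rewrite -hn -A3.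
have zl : (Q * cap4 <= 9 * z)%N by apply: leq_trans zlo; rewrite /cap4 /cap; lia.
have e1 : (1000 * 1000 * g <= cap)%N by rewrite /cap leq_mul2r (leq_trans hK KA) orbT.
have e2 : (1000 * 1000 * cap <= cap4)%N by rewrite /cap4 leq_mul2r (leq_trans hK KA) orbT.
have e3 : (1000 * 1000 * cap4 <= Sb)%N by rewrite /Sb leq_mul2r hK orbT.
have e4 : (1000 * 1000 * Sb <= tau)%N by rewrite /tau leq_mul2r hK orbT.
have e5 : (1000 * 1000 * cap4 <= Q * cap4)%N by rewrite leq_mul2r (leq_trans hK KQ) orbT.
have zn' : (1000 * z <= 4 * v + z)%N by rewrite -hn.
have b0 : (8 * eta <= z)%N by rewrite /eta; clear - e1 e2 e5 zl; lia.
have b1 : (z <= 7 * m)%N.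
  rewrite /m; have := divn_eq (z + 12 * g - 8 * eta) 6; have := ltn_pmod (z + 12 * g - 8 * eta) (isT : 0 < 6)%N.
  move: (_ %/ 6)%N (_ %% 6)%N => mm rr; rewrite /eta in b0 *; clear - e1 e2 e5 zl b0 g0; lia.
have b2 : (m <= z)%N.
  rewrite /m; apply: leq_trans (leq_div2r 6 (_ : _ <= z * 6)%N) _; last by rewrite mulnK.
  by clear - e1 e2 e5 zl; lia.
have p7 : (16 * v * g <= cap * Sb)%N.
  have h : (16 * v * g <= 8 * (A * cap4) * g)%N by rewrite leq_mul2r; apply/orP; right; clear - hi; lia.
  apply: leq_trans h _; have -> : (8 * (A * cap4) * g = 8 * cap4 * cap)%N by rewrite /cap; lia.
  by rewrite mulnC leq_mul2l; apply/orP; right; clear - e3; lia.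
have kap : (kappa <= 2 * 1000 * cap)%N by rewrite /kappa /bX /mX /eta; clear - e1; lia.
have p9 : (16 * v * kappa <= cap4 * Sb)%N.
  have h : (16 * v * kappa <= 8 * (A * cap4) * (2 * 1000 * cap))%N by apply: leq_mul => //; clear - hi; lia.
  apply: leq_trans h _; have -> : (8 * (A * cap4) * (2 * 1000 * cap) = cap4 * (16 * 1000 * cap4))%N by rewrite {3}/cap4; clear; lia.
  by rewrite leq_mul2l; apply/orP; right; clear - e3; lia.
have p6 : (16 * v * (tau + g) <= m ^ 2)%N.
  have h : (16 * v * (tau + g) <= 8 * (A * cap4) * (2 * tau))%N.
    by apply: leq_mul; [clear - hi; lia|clear - e1 e2 e3 e4; lia].
  apply: leq_trans h _; rewrite -(@leq_pmul2l (63 * 63))//.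
  apply: (@leq_trans ((9 * z) ^ 2)); last first.
    have -> : (63 * 63 * m ^ 2 = (9 * (7 * m)) ^ 2)%N by rewrite !expnMn; clear; lia.
    by rewrite leq_sqr leq_mul2l b1 orbT.
  apply: (@leq_trans ((Q * cap4) ^ 2)); last by rewrite leq_sqr.
  rewrite expnMn -[(Q ^ 2)%N]mulnn hQ /tau /Sb.
  have -> : (63 * 63 * (8 * (A * cap4) * (2 * (K * (K * cap4)))) = (63 * 63 * 16) * (A * K ^ 2 * cap4 ^ 2))%N.
    by move: (cap4) => C; clear; rewrite -!mulnn; lia.
  have -> : (A * K ^ 4 * cap4 ^ 2 = (K ^ 2) * (A * K ^ 2 * cap4 ^ 2))%N.
    have -> : (K ^ 4 = K ^ 2 * K ^ 2)%N by rewrite -expnD.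
    by rewrite mulnA mulnCA !mulnA.
  rewrite leq_mul2r; apply/orP; right.
  have : (1000 * 1000 * (1000 * 1000) <= K ^ 2)%N by rewrite -mulnn leq_mul.
  by move: (K ^ 2)%N; clear; lia.
split=> //.
- split=> //.
  + by rewrite g0; clear - e1; lia.
  + by rewrite /mX; clear - b2 zn' e1 e2 e5 zl; lia.
  + by clear - zn' e1 e2 e5 zl g0; lia.
  + by clear - b1 e1 e2 e5 zl; lia.
- split=> //.
  + by clear - e1 e2 e3 e4 g0; lia.
  + by clear - e1 e2 g0; lia.
- by clear - kap e1 e2 e3 e4 g0; lia.
have -> : (2 * n * z = n * (2 * z))%N by rewrite mulnAC mulnC.
rewrite -mulnDr; apply: leq_mul; first by rewrite hn; clear; lia.
by rewrite /bX /mX; clear - kap e1 e2 e5 zl; lia.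
Qed.
End ParameterBounds.

(** * Comparing the entropies *)

Section EntropyGap.
Variable R : realType.
Implicit Types x z k p : R.

Lemma ln_shift x z (D := x - z - 2) : 0 <= z -> 0 < x -> x / 2 <= D -> ln x - 2 * (z + 2) / x <= ln D.
Proof.
move=> z0 x0 xD; have D0 : 0 < D by lra.
have e : ln D = ln x + ln (D / x).
  by rewrite -lnM ?posrE ?divr_gt0// mulrC divfK// gt_eqF.
rewrite e lerD2l; apply: le_trans (ln_ge_1B (divr_gt0 D0 x0)).
rewrite invf_div -subr_ge0.
have -> : 1 - x / D - - (2 * (z + 2) / x) = ((z + 2) / (x * D)) * (2 * D - x).
  by rewrite /D; field; rewrite -/D !gt_eqF.
by rewrite mulr_ge0 ?divr_ge0 ?mulr_ge0//; lra.
Qed.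

(** The price of running the process on only x - z of the x points: it is of order x z ln x. *)
Lemma entropy_lower x z (N := (x - z) * (x - z - 1) / 2) (D := x - z - 2) (w := x * (x - 1) / 6) :
  1000 <= x -> 0 <= z -> 1000 * z <= x ->
  w * (ln x - 2) - N / 3 * (ln D - 2) <= x * z / 3 * ln x + x * (z + 2) / 3.
Proof.
move=> x1 z0 zx; have x0 : 0 < x by lra.
have xD : x / 2 <= D by rewrite /D; lra.
have h := ln_shift z0 x0 xD; rewrite -/D in h.
have L0 : 0 <= ln x by rewrite ln_ge0; lra.
have N0 : 0 <= N / 3 by rewrite /N !divr_ge0// mulr_ge0; lra.
have N1 : N / 3 <= x * x / 6 by rewrite /N; nra.
have N2 : w - N / 3 <= x * z / 3 by rewrite /N /w; nra.
have N3 : N / 3 <= w by rewrite /N /w; nra.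
have h1 : N / 3 * (ln x - 2 - 2 * (z + 2) / x) <= N / 3 * (ln D - 2).
  by apply: ler_wpM2l => //; lra.
have h2 : N / 3 * (2 * (z + 2) / x) <= x * (z + 2) / 3.
  have u0 : 0 <= 2 * (z + 2) / x by rewrite divr_ge0; lra.
  apply: le_trans (ler_wpM2r u0 N1) _; rewrite le_eqVlt; apply/orP; left; apply/eqP; field.
  by rewrite gt_eqF.
have h3 : (w - N / 3) * ln x <= x * z / 3 * ln x by apply: ler_wpM2r.
move: h1 h2 h3 N3; set l := ln x; set l' := ln D; set u := 2 * (z + 2) / x.
move: (N / 3) => n3; clear; nra.
Qed.

(** The gain of a hole: a fraction 6 / k^3 of all triples is forbidden, and each of the w triples of
    a system loses about that much entropy. *)
Lemma entropy_upper x k (w := x * (x - 1) / 6) (tb := x ^+ 3 / 6 - x ^+ 3 / k ^+ 3) :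
  1000 <= x -> 1000 <= k -> w * (ln tb - ln w - 2) <= w * (ln x - 2) - 6 * w / k ^+ 3 + x.
Proof.
move=> x1 k1; have x0 : 0 < x by lra.
have k0 : 0 < k by lra.
have c0 : 0 < 1 - 6 / k ^+ 3.
  rewrite subr_gt0 ltr_pdivrMr ?exprn_gt0// mul1r; apply: lt_le_trans (_ : k <= _); first by lra.
  by rewrite -[leLHS]expr1 ler_weXn2l//; lra.
have x3 : 0 < x ^+ 3 / 6 by rewrite divr_gt0// exprn_gt0.
have x2 : 0 < x ^+ 2 / 6 by rewrite divr_gt0// exprn_gt0.
have e1 : ln tb <= ln x + ln (x ^+ 2 / 6) - 6 / k ^+ 3.
  have -> : tb = (x * (x ^+ 2 / 6)) * (1 - 6 / k ^+ 3) by rewrite /tb; field; rewrite gt_eqF.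
  have q0 : 0 < x * (x ^+ 2 / 6) by rewrite mulr_gt0.
  rewrite lnM ?posrE// lnM ?posrE//.
  by have := ln_leB1 c0; lra.
have xm : 0 < (x - 1) / x by rewrite divr_gt0//; lra.
have e2 : ln (x ^+ 2 / 6) - (x - 1)^-1 <= ln w.
  have -> : w = (x ^+ 2 / 6) * ((x - 1) / x) by rewrite /w; field; rewrite gt_eqF.
  have := ln_ge_1B xm; rewrite invf_div; set a := x ^+ 2 / 6 in x2 *; set b := (x - 1) / x in xm *.
  rewrite lnM ?posrE//.
  have -> : 1 - x / (x - 1) = - (x - 1)^-1 by field; rewrite gt_eqF//; lra.
  lra.
have w0 : 0 < w by rewrite /w divr_gt0// mulr_gt0//; lra.
have e3 : w * (ln tb - ln w - 2) <= w * (ln x - 2 - 6 / k ^+ 3 + (x - 1)^-1).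
  by rewrite ler_wpM2l ?(ltW w0)//; lra.
apply: le_trans e3 _.
have -> : w * (ln x - 2 - 6 / k ^+ 3 + (x - 1)^-1) = w * (ln x - 2) - 6 * w / k ^+ 3 + x / 6.
  by rewrite /w; field; rewrite !gt_eqF//; lra.
lra.
Qed.

Lemma entropy_sqrt x k (w := x * (x - 1) / 6) (tb := x ^+ 3 / 6 - x ^+ 3 / k ^+ 3) :
  1000 * 1000 <= k -> k ^+ 20 <= x -> ln x <= 3400 * k ->
  2 * Num.sqrt (w ^+ 3 / tb) * (1 + ln w) <= x ^+ 2 / k ^+ 4.
Proof.
move=> k1 kx hL; have k0 : 0 < k by lra.
have kle i j : (i <= j)%N -> k ^+ i <= k ^+ j by move=> ij; rewrite ler_weXn2l//; lra.
have kn0 i : 0 < k ^+ i by rewrite exprn_gt0.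
have xk : k <= x by apply: le_trans kx; rewrite -{1}[k]expr1 kle.
have x0 : 0 < x by lra.
have L0 : 0 <= ln x by rewrite ln_ge0; lra.
pose r := Num.sqrt x; have r0 : 0 < r by rewrite sqrtr_gt0.
have rr : r ^+ 2 = x by rewrite sqr_sqrtr// ltW.
have kr : k ^+ 10 <= r.
  have nn (a : R) : 0 < a -> a \is Num.nneg by move=> a0; rewrite nnegrE ltW.
  by rewrite -(@ler_pXn2r _ 2 isT _ _ (nn _ (kn0 10%N)) (nn _ r0)) rr -exprM.
have w0 : 0 < w by rewrite /w divr_gt0// mulr_gt0; lra.
have wx : w <= x ^+ 2 / 6 by rewrite /w expr2; nra.
have tb0 : x ^+ 3 / 12 <= tb.
  have h : x ^+ 3 / k ^+ 3 <= x ^+ 3 / 12.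
    rewrite ler_pM2l ?exprn_gt0// lef_pV2 ?posrE//; apply: le_trans (_ : k ^+ 1 <= _); last exact: kle.
    by rewrite expr1; lra.
  by rewrite /tb; lra.
have x3 : 0 < x ^+ 3 by rewrite exprn_gt0.
have tbp : 0 < tb by lra.
have ratio : w ^+ 3 / tb <= (r ^+ 3) ^+ 2.
  have -> : (r ^+ 3) ^+ 2 = x ^+ 3 by rewrite -rr -!exprM.
  rewrite ler_pdivrMr//.
  have h : w ^+ 3 <= (x ^+ 2 / 6) ^+ 3 by rewrite lerXn2r ?nnegrE// ltW// divr_gt0// exprn_gt0.
  apply: le_trans h _; apply: le_trans (_ : x ^+ 3 * (x ^+ 3 / 12) <= _); last by rewrite ler_pM2l.
  have -> : (x ^+ 2 / 6) ^+ 3 = x ^+ 3 * x ^+ 3 / 216 by field.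
  have : 0 < x ^+ 3 * x ^+ 3 by rewrite mulr_gt0.
  rewrite [X in _ -> _ <= X]mulrA; move: (x ^+ 3 * x ^+ 3) => X; clear; lra.
have sq : Num.sqrt (w ^+ 3 / tb) <= r ^+ 3.
  by apply: le_trans (ler_wsqrtr ratio) _; rewrite sqrtr_sqr ger0_norm// exprn_ge0// ltW.
have lw : ln w <= 2 * ln x.
  rewrite mulr_natl -lnXn// ler_ln ?posrE ?exprn_gt0//; apply: le_trans wx _.
  by have := exprn_gt0 2 x0; lra.
have -> : x ^+ 2 / k ^+ 4 = r ^+ 3 * (r / k ^+ 4) by rewrite -rr; field; rewrite gt_eqF.
have s0 : 0 <= Num.sqrt (w ^+ 3 / tb) by exact: sqrtr_ge0.
apply: le_trans (_ : 2 * r ^+ 3 * (1 + 2 * ln x) <= _).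
  apply: le_trans (_ : 2 * Num.sqrt (w ^+ 3 / tb) * (1 + 2 * ln x) <= _).
    by rewrite ler_wpM2l ?mulr_ge0//; lra.
  by rewrite ler_wpM2r// ?ler_wpM2l//; lra.
have -> : 2 * r ^+ 3 * (1 + 2 * ln x) = r ^+ 3 * (2 * (1 + 2 * ln x)) by ring.
rewrite ler_pM2l ?exprn_gt0// ler_pdivlMr//; apply: le_trans kr.
have -> : k ^+ 10 = k ^+ 6 * k ^+ 4 by rewrite -exprD.
rewrite ler_pM2r//; apply: le_trans (_ : k ^+ 2 <= _); last exact: kle.
by rewrite expr2; nra.
Qed.

(** The unit is E = x^2 / k^4. The gain is k E up to x / k^3, and all losses together are a small
    multiple of E: a logarithm costs a factor 3400 k at most, and this is paid for by z k^8 <= x and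
    p k^8 <= 1. *)
Lemma entropy_gap x k z p (N := (x - z) * (x - z - 1) / 2) (D := x - z - 2) (w := x * (x - 1) / 6)
    (tb := x ^+ 3 / 6 - x ^+ 3 / k ^+ 3) (G H lS C f : R) :
  1000 * 1000 <= k -> k ^+ 20 <= x -> ln x <= 3400 * k -> 0 <= z -> z * k ^+ 8 <= x ->
  0 <= p -> p * k ^+ 8 <= 1 ->
  N / 3 * (ln D - 2) - p * (N / 3) * (ln D + 1) - 2 * (k ^+ 5)^-1 * (N / 3) - ln N - 3 <= G ->
  G - f * C <= lS -> 0 <= f -> f <= 2 * x * z -> C <= 3 * ln x ->
  H <= w * (ln tb - ln w - 2) + 2 * (ln w + 1) + 2 * Num.sqrt (w ^+ 3 / tb) * (1 + ln w) ->
  H - lS <= - (x ^+ 2 / (2 * k ^+ 3)).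
Proof.
move=> k1 kx hL z0 zx p0 pk hG hlS f0 hf hC hH; move: hG hlS hH.
have hsq := entropy_sqrt k1 kx hL; rewrite -/w -/tb in hsq.
have k0 : 0 < k by clear - k1; lra.
have k1' : 1 <= k by clear - k1; lra.
have kle i j : (i <= j)%N -> k ^+ i <= k ^+ j by move=> ij; rewrite ler_weXn2l.
have kn0 i : 0 < k ^+ i by rewrite exprn_gt0.
have xk : k <= x by apply: le_trans kx; rewrite -{1}[k]expr1 kle.
have x0 : 0 < x := lt_le_trans k0 xk.
have L0 : 0 <= ln x by apply: ln_ge0; exact: le_trans k1' xk.
set E := x ^+ 2 / k ^+ 4 in hsq.
have E0 : 0 < E by rewrite divr_gt0// exprn_gt0.
have kz : k * z <= x.
  apply: le_trans zx; rewrite mulrC ler_wpM2l//; rewrite -{1}[k]expr1; exact: kle.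
have zx3 : 1000 * z <= x by clear - k1 z0 kz; nra.
have x1000 : 1000 <= x by clear - k1 xk; lra.
have k1000 : 1000 <= k by clear - k1; lra.
have hlow := entropy_lower x1000 z0 zx3; rewrite -/N -/D -/w in hlow.
have hup := entropy_upper x1000 k1000; rewrite -/w -/tb in hup.
have xkE i : (i <= 16)%N -> x * k ^+ i <= E.
  move=> i16; rewrite /E ler_pdivlMr// -mulrA -exprD expr2 ler_pM2l//; apply: le_trans kx; apply: kle; clear - i16; lia.
have xE : 1000 * 1000 * x <= E.
  by apply: le_trans (xkE 1%N isT); rewrite expr1 mulrC ler_pM2l.
have zE : 1000 * 1000 * (x * z * k) <= E.
  apply: le_trans (_ : k * (x * z * k) <= _); first by rewrite ler_wpM2r// !mulr_ge0// ltW.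
  rewrite /E ler_pdivlMr//.
  have -> : k * (x * z * k) * k ^+ 4 = x * (z * k ^+ 6) by ring.
  by rewrite expr2 ler_pM2l//; apply: le_trans zx; rewrite ler_wpM2l// kle.
have zL : x * z * ln x <= 3400 * (x * z * k).
  have : x * z * ln x <= x * z * (3400 * k) by rewrite ler_wpM2l// mulr_ge0// ltW.
  by move=> h; apply: le_trans h _; rewrite le_eqVlt; apply/orP; left; apply/eqP; ring.
have xz : x * z <= x * z * k by rewrite ler_peMr// mulr_ge0// ltW.
have LE : 100 * ln x <= E by apply: le_trans xE; have := ln_leB1 x0; clear - x0; lra.
have w0 : 0 < w by rewrite /w divr_gt0// mulr_gt0//; clear - x1000; lra.
have wx : w <= x ^+ 2 by rewrite /w expr2; clear - x1000; nra.
have ln2 : ln (x ^+ 2) = 2 * ln x by rewrite lnXn// mulr_natl.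
have lw : ln w <= 2 * ln x by rewrite -ln2 ler_ln ?posrE ?exprn_gt0.
have N0 : 0 < N by rewrite /N divr_gt0// mulr_gt0; clear - x1000 zx3; lra.
have Nx : N <= x ^+ 2 / 2 by rewrite /N expr2; clear - x1000 zx3 z0; nra.
have lN : ln N <= 2 * ln x.
  by rewrite -ln2 ler_ln ?posrE ?exprn_gt0//; apply: le_trans Nx _; have := exprn_gt0 2 x0; move: (x ^+ 2) => X; clear; lra.
have D0 : 1 <= D by rewrite /D; clear - x1000 zx3; lra.
have lD : ln D <= ln x by rewrite ler_ln ?posrE /D; clear - x1000 zx3 z0; lra.
have lD0 : 0 <= ln D by apply: ln_ge0.
clearbody N D.
have Ek5' : 1000 * ((k ^+ 5)^-1 * (N / 3)) <= E.
  rewrite /E ler_pdivlMr//.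
  have -> : 1000 * ((k ^+ 5)^-1 * (N / 3)) * k ^+ 4 = 1000 * N / 3 / k by field; rewrite gt_eqF.
  rewrite ler_pdivrMr//; have := exprn_gt0 2 x0; move: (x ^+ 2) Nx => X Nx X0; clear - k1 Nx N0 X0; nra.
have pE : p * (N / 3) * (ln D + 1) <= E.
  apply: le_trans (_ : p * (N / 3) * (k ^+ 4) <= _).
    apply: ler_wpM2l; first by rewrite mulr_ge0// divr_ge0// ltW.
    apply: le_trans (_ : k ^+ 2 <= _); last exact: kle.
    by apply: le_trans (_ : ln x + 1 <= _); [rewrite lerD2r|rewrite expr2; clear - hL k1; nra].
  rewrite /E ler_pdivlMr//.
  have -> : p * (N / 3) * k ^+ 4 * k ^+ 4 = p * k ^+ 8 * (N / 3) by ring.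
  apply: le_trans (_ : 1 * (N / 3) <= _); first by rewrite ler_wpM2r// divr_ge0// ltW.
  by have := exprn_gt0 2 x0; move: (x ^+ 2) Nx => X Nx X0; clear - Nx X0; lra.
have fE : f * C <= 3 * (2 * (x * z * ln x)).
  apply: le_trans (_ : f * (3 * ln x) <= _); first by rewrite ler_wpM2l.
  have -> : 3 * (2 * (x * z * ln x)) = 2 * x * z * (3 * ln x) by ring.
  by rewrite ler_wpM2r// mulr_ge0.
have gain : 6 * w / k ^+ 3 = k * E - x / k ^+ 3.
  by rewrite /w /E; field; rewrite gt_eqF.
have xk3 : x / k ^+ 3 <= x by rewrite ler_pdivrMr// ler_peMr ?(ltW x0)//; apply: exprn_ege1.
have tgt : x ^+ 2 / (2 * k ^+ 3) = k * E / 2 by rewrite /E; field; rewrite gt_eqF.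
rewrite tgt.
have kE : 1000 * 1000 * E <= k * E by rewrite ler_wpM2r// ltW.
move=> hG hlS hH; move: hH hup hlow hG hlS zL zE xz fE pE Ek5' lN lw LE xE gain xk3 kE hsq.
move: (w * (ln tb - ln w - 2)) (w * (ln x - 2)) (N / 3 * (ln D - 2)) => a1 a2 a3.
move: (p * (N / 3) * (ln D + 1)) (f * C) (2 * Num.sqrt (w ^+ 3 / tb) * (1 + ln w)) => a4 a5 a6.
have -> : 2 * (k ^+ 5)^-1 * (N / 3) = 2 * ((k ^+ 5)^-1 * (N / 3)) by ring.
have -> : x * z / 3 * ln x = x * z * ln x / 3 by ring.
have -> : x * (z + 2) / 3 = x * z / 3 + x * 2 / 3 by ring.
move: ((k ^+ 5)^-1 * (N / 3)) (x * z * ln x) (x * z * k) (x * z) (6 * w / k ^+ 3) (x / k ^+ 3) (k * E) => a7 a8 a9 a10 a11 a12 a13.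
move: (ln x) (ln w) (ln N) L0 x1000 E0 => l1 l2 l3; clearbody E; clear.
lra.
Qed.
End EntropyGap.

(** * Instantiating the parameters *)

(** Powers of 3 alternate between 1 and 3 modulo 4, so for odd n one of two consecutive powers is
    congruent to n; this costs the second factor 3 in the upper bound. *)
Lemma pow3_near (n M : nat) : odd n -> (9 * M <= n)%N -> (0 < M)%N ->
  exists j, [/\ (0 < j)%N, (M * 3 ^ j <= n)%N, (n < 9 * (M * 3 ^ j))%N & (4 %| n - 3 ^ j)%N].
Proof.
move=> on hM M0.
have par j : (3 ^ j %% 4 = if odd j then 3 else 1)%N.
  elim: j => // j IH; rewrite expnS -modnMmr IH /=; by case: (odd j).
have n4 : (n %% 4 = 1 \/ n %% 4 = 3)%N.
  by have := odd_double_half n; rewrite on => e; have := divn_eq n 4; have := ltn_pmod n (isT : 0 < 4)%N; lia.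
have [j0 [h1 h2 h3]] : exists j0, [/\ (1 < j0)%N, (M * 3 ^ j0 <= n)%N & (n < M * 3 ^ j0.+1)%N].
  have q0 : (0 < n %/ M)%N by rewrite divn_gt0// (leq_trans _ hM)// leq_pmull.
  have /andP[l1 l2] := trunc_log_bounds (isT : 1 < 3)%N q0.
  exists (trunc_log 3 (n %/ M)); split.
  - by apply: trunc_log_max => //; rewrite leq_divRL.
  - by rewrite mulnC -leq_divRL.
  - by rewrite mulnC -ltn_divLR.
have fin j : (3 ^ j <= n)%N -> (n %% 4 = 3 ^ j %% 4)%N -> (4 %| n - 3 ^ j)%N.
  by move=> le /eqP e; rewrite -eqn_mod_dvd.
have le3 j : (M * 3 ^ j <= n)%N -> (3 ^ j <= n)%N by apply: leq_trans; rewrite leq_pmull.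
have [e|ne] := eqVneq (n %% 4)%N (3 ^ j0 %% 4)%N.
  exists j0; split=> //; [lia|rewrite expnS in h3; lia|exact: fin (le3 _ h2) e].
case: j0 h1 h2 h3 ne => // j h1 h2 h3 ne.
have h2' : (M * 3 ^ j <= n)%N by apply: leq_trans h2; rewrite leq_mul2l leq_pexp2l ?orbT.
exists j; split=> //; first by move: h3; rewrite !expnS; lia.
apply: fin (le3 _ h2') _; move: ne; rewrite !par /=; case: (odd j) => /=; case: n4 => ->; by [].
Qed.

(** The exponent s^2 63 x - s t is smallest at s = t / (126 x), with value - t^2 / (252 x). With k
    about g / 10 and t = k / 4, t is n / K^60 up to a constant, so t^2 / n is at least K^2, far
    above ln n. *)
Lemma label_params (R : realType) (K g n v : nat) : (1000 * 1000 <= K)%N ->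
  (n <= 2 * (K ^ 60 * g))%N -> (g <= n)%N -> (4 * v <= n)%N -> (K ^ 130 <= n)%N ->
  ln n%:R <= 3400 * K%:R :> R ->
  exists (s t : R) (k : nat), [/\ 0 < s, s * 9 <= 1 / 2, 4 * t <= k%:R, t + 9 * k%:R <= g%:R &
    200 * (4 * v)%:R ^+ 2 * expR (s ^+ 2 * (63 * (4 * v)%:R) - s * t) < 1].
Proof.
move=> hK hn gn vn nK hL.
have K0 : (0 < K)%N by clear - hK; lia.
set x : R := n%:R in hL; set q : R := K%:R in hL; set a : R := (K ^ 60)%:R.
have q1 : 1000 * 1000 <= q by rewrite /q -natrM ler_nat.
have a1 : 1 <= a by rewrite ler1n expn_gt0 K0.
have xa : a ^+ 2 * q ^+ 10 <= x.
  by rewrite /a /q /x !natrX -exprM -exprD -natrX ler_nat.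
have g20 : (20 <= g)%N.
  have h : (K ^ 60 * K ^ 70 <= K ^ 60 * (2 * g))%N by rewrite -expnD (leq_trans nK)// (leq_trans hn)// mulnCA.
  rewrite leq_pmul2l ?expn_gt0 ?K0// in h.
  have h2 : (K ^ 1 <= K ^ 70)%N by rewrite leq_pexp2l.
  by move: (K ^ 70)%N h h2 => P h; rewrite expn1 => h2; clear - h h2 hK; lia.
pose k := (g %/ 10)%N.
have k1 : (10 * k <= g)%N by rewrite mulnC leq_divM.
have k2 : (g <= 20 * k)%N by rewrite /k; have := divn_eq g 10; have := ltn_pmod g (isT : 0 < 10)%N; clear - g20; lia.
have k0 : 0 < k%:R :> R by rewrite ltr0n; clear - k2 g20; lia.
pose t : R := k%:R / 4; pose s : R := t / (126 * x).
have x1 : 1 <= x by rewrite ler1n; apply: leq_trans nK; rewrite expn_gt0 K0.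
have x0 : 0 < x by lra.
have t0 : 0 < t by rewrite /t divr_gt0.
have s0 : 0 < s by rewrite /s divr_gt0// mulr_gt0.
have kx : k%:R <= x by rewrite ler_nat (leq_trans _ gn)// (leq_trans _ k1)// leq_pmull.
exists s, t, k; split=> //.
- rewrite /s mulrAC ler_pdivrMr ?mulr_gt0// /t; clear - kx x0; lra.
- by rewrite /t; clear; lra.
- have : (10 * k)%:R <= g%:R :> R by rewrite ler_nat.
  by rewrite natrM /t; clear - k0; lra.
set y : R := (4 * v)%:R; have yx : y <= x by rewrite ler_nat.
have y0 : 0 <= y by rewrite ler0n.
pose B := t ^+ 2 / (252 * x).
have hB : s ^+ 2 * (63 * y) - s * t <= - B.
  have h : s ^+ 2 * (63 * y) <= s ^+ 2 * (63 * x) by rewrite ler_wpM2l ?sqr_ge0// ler_pM2l.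
  have e : s ^+ 2 * (63 * x) - s * t = - B by rewrite /s /B; field; rewrite gt_eqF.
  by rewrite -e lerD2r.
have gx : x <= 2 * a * g%:R by rewrite /a -!natrM ler_nat -mulnA.
have tx : x <= 160 * a * t.
  apply: le_trans gx _; have : g%:R <= 20 * k%:R :> R by rewrite -natrM ler_nat.
  have -> : 160 * a * t = 2 * a * (20 * k%:R) by rewrite /t; field.
  by move=> h; rewrite ler_pM2l//; lra.
have Bq : q ^+ 2 <= B.
  rewrite /B ler_pdivlMr ?mulr_gt0//.
  have at0 : 0 <= 160 * a * t := le_trans (ltW x0) tx.
  have h : x ^+ 2 <= (160 * a * t) ^+ 2 by apply: lerXn2r; rewrite ?nnegrE// ltW.
  have a20 : 0 < a ^+ 2 by rewrite exprn_gt0//; lra.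
  have xx : a ^+ 2 * q ^+ 10 * x <= x ^+ 2 by rewrite expr2 ler_pM2r.
  have q4 : (160 * 160) * 252 * q ^+ 2 <= q ^+ 10.
    have -> : q ^+ 10 = q ^+ 8 * q ^+ 2 by rewrite -exprD.
    rewrite ler_pM2r ?exprn_gt0//; last by lra.
    apply: le_trans (_ : q ^+ 2 <= _); first by rewrite expr2; clear - q1; nra.
    by rewrite ler_weXn2l//; lra.
  rewrite -(ler_pM2l a20); have -> : a ^+ 2 * t ^+ 2 = (160 * a * t) ^+ 2 / (160 * 160) by field.
  have p160 : (0 : R) < 160 * 160 by rewrite mulr_gt0.
  rewrite ler_pdivlMr//.
  have -> : a ^+ 2 * (q ^+ 2 * (252 * x)) * (160 * 160) = a ^+ 2 * ((160 * 160) * 252 * q ^+ 2) * x by ring.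
  by apply: le_trans (le_trans xx h); rewrite ler_pM2r// ler_pM2l.
have lt1 : 200 * y ^+ 2 <= 200 * x ^+ 2.
  by rewrite ler_pM2l//; apply: lerXn2r; rewrite ?nnegrE// ltW.
have x20 : 0 < 200 * x ^+ 2 by rewrite mulr_gt0// exprn_gt0.
have e200 : (0 : R) < 200 by [].
have lnb : ln (200 * x ^+ 2) < B.
  have h := ln_leB1 e200; apply: lt_le_trans Bq; rewrite lnM ?posrE ?exprn_gt0// lnXn// mulr2n expr2.
  have q2 : 10 * 1000 * q <= q * q by rewrite ler_wpM2r; clear - q1; lra.
  by move: (q * q) h hL q1 q2 => qq h hL q1 q2; clear - h hL q1 q2; lra.
have hexp : 200 * x ^+ 2 < expR B by rewrite -[ltLHS]lnK ?posrE// ltr_expR.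
apply: le_lt_trans (_ : 200 * x ^+ 2 * expR (- B) < 1); last by rewrite expRN ltr_pdivrMr ?expR_gt0// mul1r.
by apply: ler_pM; rewrite ?expR_ge0 ?ler_expR// mulr_ge0// sqr_ge0.
Qed.

(** The process stops when the uncovered fraction p is about g / (8 v), the value at which the
    degree bound 2 (4 v) p reaches g; [X] is the corresponding number of uncovered pairs. *)
Lemma psts_params (R : realType) (K g n v : nat) (N : R := 'C(4 * v, 2)%:R) : (1000 * 1000 <= K)%N ->
  (1000 <= g)%N -> (1000 * g <= v)%N -> (K ^ 60 * g <= n)%N -> (n <= 2 * (K ^ 60 * g))%N ->
  (4 * v <= n)%N -> (n <= 8 * v)%N ->
  exists k : nat, let p := 1 - 3 * k%:R / N in
    [/\ (0 < k)%N, (8 * v + 16 * (g.+1 * g) + 6 * k <= 4 * v * (4 * v).-1)%N,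
        2 * (4 * v)%:R * p <= g%:R, p * K%:R ^+ 8 <= 1 & (K%:R ^+ 61)^-1 <= p].
Proof.
move=> hK g1 gv nlo nhi vn nv.
have K0 : (0 < K)%N by clear - hK; lia.
pose u := (4 * v).-1; have u1 : (4 * v = u.+1)%N by rewrite /u prednK//; clear - g1 gv; lia.
have NE : ('C(4 * v, 2) = 2 * v * u)%N.
  by rewrite bin2 -/u (_ : 4 * v * u = (2 * v * u).*2)%N ?doubleK// -mul2n; clear; lia.
pose X := (g * u %/ 4)%N.
have X1 : (4 * X <= g * u)%N by rewrite mulnC leq_divM.
have X2 : (g * u <= 4 * X + 3)%N by rewrite /X; have := divn_eq (g * u) 4; have := ltn_pmod (g * u) (isT : 0 < 4)%N; clear; lia.
have gu : (1000 * u <= g * u)%N by rewrite leq_mul2r g1 orbT.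
have u2 : (3000 <= u)%N by clear - u1 gv g1; lia.
have XN : (X + 10 <= 2 * v * u)%N.
  have : (g * u <= v * u)%N by rewrite leq_mul2r; apply/orP; right; clear - gv; lia.
  clear - X1 gu u2; lia.
pose k := ((2 * v * u - X + 2) %/ 3)%N.
have k1 : (3 * k <= 2 * v * u - X + 2)%N by rewrite mulnC leq_divM.
have k2 : (2 * v * u - X <= 3 * k)%N.
  by rewrite /k; have := divn_eq (2 * v * u - X + 2) 3; have := ltn_pmod (2 * v * u - X + 2) (isT : 0 < 3)%N; clear; lia.
pose W := (2 * v * u - 3 * k)%N.
have W1 : (W <= X)%N by rewrite /W; clear - k2; lia.
have W2 : (X <= W + 2)%N by rewrite /W; clear - k1 XN; lia.
have kN : (3 * k <= 2 * v * u)%N by clear - k1 X2 gu u2 XN; lia.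
have N0 : 0 < N by rewrite /N NE ltr0n !muln_gt0/=; clear - u2 g1 gv; lia.
have pE : 1 - 3 * k%:R / N = W%:R / N.
  rewrite /W natrB// -NE -/N natrM; field; by rewrite gt_eqF.
exists k; rewrite /= pE; split.
- by clear - k2 XN X2 gu u2; rewrite lt0n; apply/eqP => e; move: k2; rewrite e; lia.
- have e : (4 * v * u = 2 * (2 * v * u))%N by clear; lia.
  rewrite -/u e.
  have h3 : (g * u >= 3 * (g * v))%N by rewrite mulnCA leq_mul2l; apply/orP; right; clear - u1 g1 gv; lia.
  have h4 : (1000 * (g * g) <= g * v)%N by rewrite mulnCA leq_mul2l gv orbT.
  have h5 : (1000 * v <= g * v)%N by rewrite leq_mul2r g1 orbT.
  have h6 : (g.+1 * g = g * g + g)%N by rewrite mulSn addnC.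
  rewrite h6; move: (g * u)%N (g * v)%N (g * g)%N (2 * v * u)%N h3 h4 h5 X1 X2 k1 XN => a b c d; clear - gv g1; lia.
- rewrite mulrA ler_pdivrMr// /N NE -!natrM ler_nat.
  apply: (@leq_trans (2 * (4 * v) * X)); first by rewrite leq_mul2l W1 orbT.
  have -> : (2 * (4 * v) * X = 2 * v * (4 * X))%N by clear; lia.
  have -> : (g * (2 * v * u) = 2 * v * (g * u))%N by clear; lia.
  by rewrite leq_mul2l X1 orbT.
- rewrite mulrAC ler_pdivrMr// mul1r /N NE -natrX -natrM ler_nat.
  apply: (@leq_trans (X * K ^ 8)); first by rewrite leq_mul2r W1 orbT.
  have h : (K ^ 8 * g <= 8 * v)%N.
    by apply: leq_trans nv; apply: leq_trans nlo; rewrite leq_mul2r leq_pexp2l ?orbT.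
  rewrite -(@leq_pmul2l 4)// mulnA.
  apply: (@leq_trans (g * u * K ^ 8)); first by rewrite leq_mul2r X1 orbT.
  have -> : (g * u * K ^ 8 = K ^ 8 * g * u)%N by move: (K ^ 8)%N; clear; lia.
  by apply: leq_trans (leq_mul h (leqnn u)) _; clear; lia.
rewrite ler_pdivlMr// ler_pdivrMl ?exprn_gt0 ?ltr0n// /N NE -natrX -natrM ler_nat.
have h : (2 * v <= K ^ 60 * g)%N by clear - vn nhi; lia.
rewrite expnS -(@leq_pmul2l 8)//.
apply: (@leq_trans (K * K ^ 60 * (g * u))); last first.
  rewrite [leqRHS]mulnCA leq_mul2l; apply/orP; right; clear - X2 W2 gu u2; lia.
have -> : (K * K ^ 60 * (g * u) = K * (K ^ 60 * g) * u)%N by move: (K ^ 60)%N; clear; lia.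
have -> : (8 * (2 * v * u) = 8 * (2 * v) * u)%N by rewrite !mulnA.
rewrite leq_mul2r; apply/orP; right; apply: leq_mul => //; clear - hK; lia.
Qed.

Lemma ln_size (R : realType) (K n : nat) (x : R := n%:R) (q : R := K%:R) : (0 < K)%N -> (0 < n)%N ->
  (n < K ^ 3400)%N -> ln x <= 3400 * q.
Proof.
move=> K0 n0 nhi.
have q0 : 0 < q by rewrite ltr0n K0.
have x0 : 0 < x by rewrite ltr0n n0.
have h : x <= q ^+ 3400 by rewrite /x /q -natrX ler_nat ltnW.
have h2 : ln x <= ln (q ^+ 3400) by rewrite ler_ln ?posrE ?exprn_gt0.
apply: le_trans h2 _; rewrite lnXn// -[leLHS]mulr_natl ler_pM2l//.
by apply: le_trans (ln_leB1 q0) _; rewrite lerBlDr lerDl.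
Qed.

Lemma bin3_le m : (6 * 'C(m, 3) <= m ^ 3)%N.
Proof.
have := bin_ffact m 3; rewrite (_ : 3`! = 6)%N// mulnC => ->.
rewrite !ffactnS ffactn0 muln1 expnS expnS expn1.
by apply: leq_mul => //; apply: leq_mul; rewrite ?leq_pred// (leq_trans (leq_pred _))// leq_pred.
Qed.

(** Nonemptiness of [STS n] comes out of the same count: there are good partial systems, and each is
    altered into a full one. *)
Lemma steiner_entropy (R : realType) (K n : nat) (x : R := n%:R) (q : R := K%:R) :
  (1000 * 1000 <= K)%N -> (K ^ 1700 <= n)%N -> (n < K ^ 3400)%N -> n = 1 %[mod 6] \/ n = 3 %[mod 6] ->
  exists (z : nat) (p f C : R),
  let N := (x - z%:R) * (x - z%:R - 1) / 2 in let D := x - z%:R - 2 in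
  [/\ z%:R * q ^+ 8 <= x, 0 <= p /\ p * q ^+ 8 <= 1, 0 <= f /\ f <= 2 * x * z%:R,
    C <= 3 * ln x /\ (0 < #|STS n|)%N &
    N / 3 * (ln D - 2) - p * (N / 3) * (ln D + 1) - 2 * (q ^+ 5)^-1 * (N / 3) - ln N - 3 - f * C
      <= ln #|STS n|%:R].
Proof.
move=> hK nlo nhi n6.
have K0 : (0 < K)%N by apply: leq_trans hK.
have n0 : (0 < n)%N by apply: leq_trans nlo; rewrite expn_gt0 K0.
have lnq : ln x <= 3400 * q := @ln_size R K n K0 n0 nhi.
have pow_le i : (i <= 1700)%N -> (K ^ i <= n)%N by move=> hi; apply: leq_trans nlo; rewrite leq_pexp2l.
have K1 : (1 < K)%N by apply: leq_trans hK.
have on : odd n.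
  have := divn_eq n 6; case: n6 => -> ->; rewrite oddD oddM andbF//.
have M0 : (0 < K ^ 8)%N by rewrite expn_gt0 K0.
have h9 : (9 * K ^ 8 <= n)%N.
  by apply: leq_trans (pow_le 9%N isT); rewrite [leqRHS]expnS leq_mul2r; apply/orP; right; clear - hK; lia.
have [j [j0 hz1 hz2 hz4]] := pow3_near on h9 M0.
set z := (3 ^ j)%N in hz1 hz2 hz4.
have z_le : (z <= n)%N by apply: leq_trans hz1; rewrite leq_pmull.
pose v := ((n - z) %/ 4)%N.
have nv : n = (4 * v + z)%N by rewrite /v mulnC divnK// subnK.
(* The bound on the leave degrees. With A = K^20 and Q = K^12, A^3 g is about n and A^2 Q g = K^52 g
   about n / K^8, the size of z. *)
pose g := (n %/ K ^ 60)%N.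
have K60 : (0 < K ^ 60)%N by rewrite expn_gt0 K0.
have g1 : (K ^ 60 * g <= n)%N by rewrite mulnC leq_divM.
have glt : (n < K ^ 60 * g.+1)%N by rewrite mulnC -ltn_divLR.
have gK : (K <= g)%N.
  by rewrite leq_divRL// -expnS; apply: pow_le.
have g1000 : (1000 * 1000 <= g)%N by exact: leq_trans hK gK.
have g2 : (n <= 2 * (K ^ 60 * g))%N.
  apply: leq_trans (ltnW glt) _; rewrite mulnCA leq_mul2l; apply/orP; right; clear - g1000; lia.
have A3 : ((K ^ 20) ^ 3 * g = K ^ 60 * g)%N by rewrite -expnM.
have zn : (1000 * z <= n)%N.
  apply: leq_trans hz1; rewrite leq_mul2r; apply/orP; right.
  by rewrite expnS; apply: leq_trans (_ : K * 1 <= _)%N; [clear - hK; lia|rewrite leq_mul2l expn_gt0 K0 orbT].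
have zlo : (K ^ 20 * K ^ 20 * g * K ^ 12 <= 9 * z)%N.
  rewrite -(leq_pmul2l M0).
  have -> : (K ^ 8 * (K ^ 20 * K ^ 20 * g * K ^ 12) = K ^ 60 * g)%N.
    rewrite -expnD [(_ * g * _)%N]mulnAC -expnD mulnA -expnD.
    by [].
  by apply: leq_trans g1 (leq_trans (ltnW hz2) _); rewrite mulnCA.
have hQ : (K ^ 12 * K ^ 12 = K ^ 20 * K ^ 4)%N by rewrite -!expnD.
have KP i : (0 < i)%N -> (K <= K ^ i)%N by move=> i0; rewrite -{1}[K]expn1 leq_pexp2l.
have g0 : (0 < g)%N by exact: leq_trans g1000.
have vn : (4 * v <= n)%N by rewrite nv leq_addr.
have vn8 : (n <= 8 * v)%N by clear - nv zn; lia.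
have gv : (1000 * g <= v)%N.
  have h : (1000 * 1000 * g <= K ^ 60 * g)%N by rewrite leq_mul2r (leq_trans hK (KP 60%N isT)) orbT.
  by clear - h g1 vn8; lia.
have gn : (g <= n)%N by apply: leq_trans g1; rewrite leq_pmull.
(* Modulo 3, v = 4 v = n since 3 divides z, so v is 0 or 1; in the latter case 2 v + 1 is divisible
   by 3. *)
have z3 : (3 %| v * (z + 2 * v + 1))%N.
  have [w ew] : exists w, z = (3 * w)%N by exists (3 ^ j.-1)%N; rewrite -expnS prednK.
  have [c [e|e]] : exists c, v = (3 * c)%N \/ v = (3 * c + 1)%N.
    exists (v %/ 3)%N; have := divn_eq v 3; have := ltn_pmod v (isT : 0 < 3)%N.
    have := divn_eq n 6; case: n6 => ->; rewrite nv ew; clear; lia.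
  - by rewrite e -mulnA dvdn_mulr.
  - by rewrite dvdn_mull// ew e; apply/dvdnP; exists (w + 2 * c + 1)%N; clear; lia.
have g1000' : (1000 <= g)%N by clear - g1000; lia.
have [s [t [k [l1 l2 l3 l4 l5]]]] := @label_params R K g n v hK g2 gn vn (pow_le 130%N isT) lnq.
have [kT [m1 m2 m3 m4 m5]] := @psts_params R K g n v hK g1000' gv g1 g2 vn vn8.
have pb := @parameter_bounds K (K ^ 20) (K ^ 12) g n v z hK hQ (KP 12%N isT) (KP 20%N isT) g0.
rewrite !A3 in pb; have {pb} [[pb1 pb2 pb3 pb4 pb5] [pb6 pb7 pb8 pb9] pb10 pb11 pb12] := pb g1 g2 nv zn zlo.

set Nr : R := 'C(4 * v, 2)%:R in m3 m4 m5.
set p := 1 - 3 * kT%:R / Nr in m3 m4 m5.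
have q0 : 0 < q by rewrite ltr0n K0.
have q1 : 1000 * 1000 <= q by rewrite /q -natrM ler_nat.
have q1' : 1 <= q by clear - q1; lra.
have qn i : 0 < q ^+ i by rewrite exprn_gt0.
have qle a b : (a <= b)%N -> q ^+ a <= q ^+ b by move=> ab; rewrite ler_weXn2l.
have x0 : 0 < x by rewrite ltr0n n0.
have qx i : (i <= 1700)%N -> q ^+ i <= x by move=> hi; rewrite /q /x -natrX ler_nat pow_le.
have hD : (K ^ 1600 <= 4 * v - 2)%N.
  have h : (1000 * 1000 * K ^ 1600 <= n)%N.
    apply: leq_trans (pow_le 1601%N isT); rewrite [leqRHS]expnS leq_mul2r hK orbT.
    by [].
  have P0 : (0 < K ^ 1600)%N by rewrite expn_gt0 K0.
  by move: (K ^ 1600)%N h P0 => P h P0; clear - h P0 vn8; lia.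
set Dr : R := (4 * v - 2)%:R.
have Dq : q ^+ 1600 <= Dr by rewrite /q /Dr -natrX ler_nat.
have Dge i : (i <= 1600)%N -> q ^+ i <= Dr by move=> hi; apply: le_trans (qle _ _ hi) Dq.
have pp : 0 < p by apply: lt_le_trans m5; rewrite invr_gt0.
have D0 : 0 < Dr by apply: lt_le_trans Dq.
have N2 : ('C(4 * v, 2) * 2 = 4 * v * (4 * v).-1)%N.
  by have := bin_ffact (4 * v) 2; rewrite (_ : 2`! = 2)%N// !ffactnS ffactn0 muln1.
have DN : 6 * Dr <= Nr.
  rewrite /Dr /Nr -natrM ler_nat -(@leq_pmul2r 2)// N2.
  apply: (@leq_trans (12 * (4 * v).-1)); first by clear; lia.
  by rewrite leq_mul2r; apply/orP; right; clear - gv g1000'; lia.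
have lnx : 20 <= ln x.
  apply: le_trans (_ : ln (q ^+ 40) <= _); last by rewrite ler_ln ?posrE// qx.
  rewrite lnXn// -[leRHS]mulr_natl; have := ln_ge_1B q0.
  have : q^-1 <= 1 / 2 by rewrite div1r lef_pV2 ?posrE//; clear - q1; lra.
  by clear; lra.
(* Here beta = 3 ln n, so that exp beta = n^3 exceeds 4 N. *)
have b53 : 53 <= 3 * ln x by clear - lnx; lra.
have x3E : expR (3 * ln x) = x ^+ 3.
  by rewrite mulr_natl -lnXn// lnK// posrE exprn_gt0.
have bN : 4 * Nr <= expR (3 * ln x).
  rewrite x3E /Nr /x -natrX -natrM ler_nat.
  have -> : (4 * 'C(4 * v, 2) = 2 * (4 * v * (4 * v).-1))%N by rewrite -N2; clear; lia.
  rewrite !expnS expn0 muln1; apply: leq_mul; first by clear - vn gv g1000'; lia.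
  by apply: leq_mul => //; apply: leq_trans vn; rewrite leq_pred.
have t0 : 0 <= (q ^+ 5)^-1 by rewrite invr_ge0 ltW.
have t4 : (q ^+ 5)^-1 <= 1 / 4.
  rewrite div1r lef_pV2 ?posrE//; apply: le_trans (qle 1%N 5%N isT); rewrite expr1; clear - q1; lra.
(* The origin of 1700: D >= q^1600 gives a root of at least q^800; p^13 >= q^-793 and theta = q^-5
   leave q^2, which exceeds 3 ln n <= 10200 q. *)
have bl : 3 * ln x <= (q ^+ 5)^-1 * Num.sqrt Dr * p ^+ 13.
  apply: (@le_trans _ _ (q ^+ 2)).
    by move: lnq; rewrite expr2; clear - q1; nra.
  have sD : q ^+ 800 <= Num.sqrt Dr.
    have nn (a : R) : 0 <= a -> a \is Num.nneg by rewrite nnegrE.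
    rewrite -(@ler_pXn2r _ 2 isT _ _ (nn _ (ltW (qn 800%N))) (nn _ (sqrtr_ge0 _))).
    by rewrite sqr_sqrtr ?(ltW D0)// -exprM.
  have pe : ((q ^+ 61)^-1) ^+ 13 <= p ^+ 13.
    by apply: lerXn2r => //; rewrite nnegrE ?invr_ge0 ltW.
  have e : q ^+ 2 = (q ^+ 5)^-1 * q ^+ 800 * ((q ^+ 61)^-1) ^+ 13.
    have -> : q ^+ 800 = q ^+ 2 * (q ^+ 5 * q ^+ (61 * 13)) by rewrite -!exprD.
    rewrite exprVn -exprM; have := qn 5%N; have := qn (61 * 13)%N.
    move: (q ^+ 2) (q ^+ 5) (q ^+ (61 * 13)) => a b c c0 b0; clear - b0 c0.
    by field; rewrite !gt_eqF.
  rewrite e; apply: ler_pM => //; rewrite ?exprn_ge0 ?invr_ge0 ?(ltW (qn _))//.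
    by apply: mulr_ge0; [exact: t0|exact: ltW (qn _)].
  by rewrite ler_wpM2l.
have np : q <= Dr * p.
  have -> : q = q ^+ 62 * (q ^+ 61)^-1 by rewrite exprS mulfK ?gt_eqF.
  by apply: ler_pM => //; rewrite ?invr_ge0 ?(ltW (qn _))//; apply: Dge.
have Dp4 : 4 <= Dr * p ^+ 2.
  apply: le_trans (_ : q <= _); first by clear - q1; lra.
  have -> : q = q ^+ 123 * ((q ^+ 61)^-1) ^+ 2.
    have -> : q ^+ 123 = q * q ^+ (61 * 2) by rewrite -exprS.
    by rewrite exprVn -exprM mulfK ?gt_eqF.
  apply: ler_pM; rewrite ?exprn_ge0 ?invr_ge0 ?(ltW (qn _))//; first exact: Dge.
  by apply: lerXn2r => //; rewrite nnegrE ?invr_ge0 ltW.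
have np8 : 8 <= (4 * v)%:R * p.
  apply: le_trans (_ : q <= _); first by clear - q1; lra.
  by apply: le_trans np _; rewrite ler_pM2r// ler_nat leq_subr.
have G := @ln_good_psts 'I_(4 * v) R kT (3 * ln x) (q ^+ 5)^-1 g.
have P := @good_psts_ge 'I_(4 * v) R kT (3 * ln x) (q ^+ 5)^-1 g.
rewrite card_ord /= -/Nr -/Dr -/p in G P.
have {}G := G m1 DN b53 bN t0 t4 pp bl Dp4 np8 m3.
have {}P := P DN b53 bN t0 t4 pp bl Dp4 np8 m3.
have N0 : 0 < Nr by apply: lt_le_trans DN; rewrite mulr_gt0.
have good0 : (0 < #|good_psts 'I_(4 * v) kT g|)%N.
  rewrite -(ltr_nat R); apply: lt_le_trans P; apply: mulr_gt0; first by rewrite divr_gt0.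
  apply: prodr_gt0 => i _.
  have pi : 0 < 1 - 3 * i%:R / Nr.
    apply: lt_le_trans pp _; rewrite lerD2l lerN2 ler_pM2r ?invr_gt0// ler_pM2l// ler_nat ltnW//.
  by rewrite !divr_gt0// ?mulr_gt0 ?exprn_gt0// subr_gt0; clear - t4; lra.
have cV : #|'I_(4 * v)| = (4 * v)%N by rewrite card_ord.
have m2' : (8 * v + 16 * (g.+1 * g) + 6 * kT <= #|'I_(4 * v)| * #|'I_(4 * v)|.-1)%N by rewrite card_ord.
have l5' : 200 * #|'I_(4 * v)|%:R ^+ 2 * expR (s ^+ 2 * (63 * #|'I_(4 * v)|%:R) - s * t) < 1 by rewrite card_ord.
have := systems_lower cV l1 l2 l3 l4 l5' pb1 m2' pb2 pb3 pb4 pb5 pb6 pb7 pb8 pb9 pb10 pb11 z3.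
rewrite card_ord; set F := (4 * v * _ + _)%N => hsys.
have hS : (#|systems ('I_(4 * v) + {ffun 'I_j -> 'F_3})%type| <= #|STS n|)%N.
  by rewrite steiner_systems; apply: systems_transport; rewrite card_sum card_affine !card_ord nv.
have {}hsys : (#|good_psts 'I_(4 * v) kT g| <= #|STS n| * 'C(4 * v, 3).+1 ^ F)%N.
  by apply: leq_trans hsys _; rewrite leq_mul2r hS orbT.
have S0 : (0 < #|STS n|)%N by have := leq_trans good0 hsys; rewrite muln_gt0 => /andP[].
have xz : x - z%:R = (4 * v)%:R by rewrite /x {1}nv natrD addrK.
have NE : (x - z%:R) * (x - z%:R - 1) / 2 = Nr.
  have v1 : (0 < 4 * v)%N by clear - gv g1000'; lia.
  have e : Nr * 2 = (4 * v)%:R * ((4 * v)%:R - 1).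
    by rewrite /Nr -natrM N2 [LHS]natrM -subn1 natrB.
  by rewrite xz -e mulfK// pnatr_eq0.
have DE : x - z%:R - 2 = Dr by rewrite xz /Dr natrB//; clear - gv g1000'; lia.
exists z, p, F%:R, (ln 'C(4 * v, 3).+1%:R); rewrite /= NE DE; split.
- by rewrite mulrC /q /x -natrX -natrM ler_nat.
- by split; [exact: ltW|exact: m4].
- by rewrite ler0n; split=> //; rewrite /x -!natrM ler_nat.
- split=> //; rewrite [3 * _]mulr_natl -lnXn// ler_ln ?posrE ?exprn_gt0 ?ltr0n// /x -natrX ler_nat.
  have h := bin3_le (4 * v); have h2 : ((4 * v) ^ 3 <= n ^ 3)%N by rewrite leq_exp2r.
  have h3 : (2 <= n ^ 3)%N by apply: leq_trans (_ : n ^ 1 <= _)%N; [clear - vn gv g1000'; rewrite expn1; lia|rewrite leq_pexp2l].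
  by move: ('C(4 * v, 3)) ((4 * v) ^ 3)%N (n ^ 3)%N h h2 h3 => a b c; clear; lia.
rewrite lerBlDr; apply: le_trans G _.
have h : ln #|good_psts 'I_(4 * v) kT g|%:R <= ln (#|STS n| * 'C(4 * v, 3).+1 ^ F)%:R :> R.
  by rewrite ler_ln ?posrE ?ltr0n ?ler_nat// muln_gt0 S0 expn_gt0.
apply: le_trans h _; rewrite natrM natrX lnM ?posrE ?ltr0n// ?exprn_gt0 ?ltr0n// lnXn ?ltr0n//.
by rewrite -[ln _ *+ F]mulr_natl.
Qed.

Lemma hole_ratio (R : realType) (K n : nat) (X : {set 'I_n} * {set 'I_n} * {set 'I_n}) :
  (1000 * 1000 <= K)%N -> (K ^ 1700 <= n)%N -> (n < K ^ 3400)%N -> n = 1 %[mod 6] \/ n = 3 %[mod 6] ->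
  [disjoint X.1.1 & X.1.2] -> [disjoint X.1.1 & X.2] -> [disjoint X.1.2 & X.2] ->
  (n <= K * #|X.1.1|)%N -> (n <= K * #|X.1.2|)%N -> (n <= K * #|X.2|)%N ->
  #|hole_systems X|%:R <= #|STS n|%:R * expR (- (n%:R ^+ 2 / (2 * K%:R ^+ 3))) :> R.
Proof.
move=> hK nlo nhi n6 d12 d13 d23 c1 c2 c3.
have [z [p [f [C [hz [p0 hp] [f0 hf] [hC S0] hG]]]]] := steiner_entropy R hK nlo nhi n6.
have K0 : (0 < K)%N by apply: leq_trans hK.
have n0 : (0 < n)%N by apply: leq_trans nlo; rewrite expn_gt0 K0.
set x : R := n%:R in hz hf hC hG *; set q : R := K%:R in hz hp hG *.
have lnq : ln x <= 3400 * q := @ln_size R K n K0 n0 nhi.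
have q1 : 1000 * 1000 <= q by rewrite /q -natrM ler_nat.
have q0 : 0 < q by clear - q1; lra.
have x0 : 0 < x by rewrite ltr0n.
have Kn i : (i <= 1700)%N -> (K ^ i <= n)%N by move=> hi; apply: leq_trans nlo; rewrite leq_pexp2l.
have qx : q ^+ 20 <= x by rewrite /q /x -natrX ler_nat Kn.
have xb : 1000 * 1000 <= x.
  by apply: le_trans q1 _; rewrite /q /x ler_nat -[K]expn1 Kn.
have [->|h0] := posnP #|hole_systems X|; first by rewrite mulr_ge0 ?expR_ge0.
pose tb := x ^+ 3 / 6 - x ^+ 3 / q ^+ 3.
have x3 : 0 < x ^+ 3 by rewrite exprn_gt0.
have q3 : 0 < q ^+ 3 by rewrite exprn_gt0.
have tb0 : 0 < tb.
  rewrite subr_gt0 ltr_pM2l// ltf_pV2 ?posrE//; apply: lt_le_trans (_ : q ^+ 1 <= _); first by rewrite expr1; clear - q1; lra.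
  by rewrite ler_weXn2l//; clear - q1; lra.
have kE : ((n * n.-1 %/ 6)%N * 6 = n * n.-1)%N.
  rewrite divnK//; have := divn_eq n 6; set c := (n %/ 6)%N.
  case: n6 => ->; rewrite modn_small// => ->; apply/dvdnP.
    by exists ((c * 6 + 1) * c)%N; rewrite (_ : (c * 6 + 1).-1 = c * 6)%N; clear; lia.
  by exists ((2 * c + 1) * (3 * c + 1))%N; rewrite (_ : (c * 6 + 3).-1 = c * 6 + 2)%N; clear; lia.
have kR : (n * n.-1 %/ 6)%N%:R = x * (x - 1) / 6 :> R.
  have e : (n * n.-1 %/ 6)%N%:R * 6 = x * (x - 1) :> R by rewrite -natrM kE natrM -subn1 natrB.
  by rewrite -e mulfK// pnatr_eq0.
have k0 : (0 < n * n.-1 %/ 6)%N.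
  rewrite -(ltr_nat R) kR divr_gt0// mulr_gt0//; clear - xb; lra.
have cX (A : {set 'I_n}) : (n <= K * #|A|)%N -> x / q <= #|A|%:R.
  by move=> h; rewrite ler_pdivrMr// mulrC -natrM ler_nat.
have htb : 'C(#|'I_n|, 3)%:R - (#|X.1.1| * #|X.1.2| * #|X.2|)%:R <= tb.
  rewrite card_ord /tb; apply: lerB.
    by rewrite ler_pdivlMr// mulrC -natrM /x -natrX ler_nat bin3_le.
  have -> : x ^+ 3 / q ^+ 3 = x / q * (x / q) * (x / q) by field; rewrite gt_eqF.
  have xq : 0 <= x / q by rewrite ltW ?divr_gt0.
  move: (cX _ c1) (cX _ c2) (cX _ c3) xq; rewrite !natrM; move: (x / q) => y h1 h2 h3 y0.
  by apply: ler_pM => //; rewrite ?mulr_ge0//; apply: ler_pM.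
have := @hole_systems_le 'I_n R X tb; rewrite card_ord /= kR => hH.
move: htb; rewrite card_ord => htb; move: hH => /(_ d12 d13 d23 k0 tb0 htb h0) hH.
have gap := entropy_gap q1 qx lnq (ler0n R z) hz p0 hp (lexx _) hG f0 hf hC hH.
rewrite -ler_ln ?posrE ?mulr_gt0 ?expR_gt0 ?ltr0n// lnM ?posrE ?expR_gt0 ?ltr0n// expRK.
by move: gap; rewrite -/x -/q; move: (ln _) (ln _) (_ / _) => a b c; clear; lra.
Qed.

(** * Union bound over the holes and conclusion *)

Lemma bad_systems (R : realType) (K n : nat) : (1000 * 1000 <= K)%N -> (K ^ 1700 <= n)%N ->
  (n < K ^ 3400)%N -> n = 1 %[mod 6] \/ n = 3 %[mod 6] ->
  #|[set S in STS n | (mc 3 S < n - 4 * (n %/ K).+1)%N]|%:R * n%:R <= #|STS n|%:R :> R.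
Proof.
move=> hK nlo nhi n6; set h := (n %/ K).+1.
have K0 : (0 < K)%N by apply: leq_trans hK.
have Kn i : (i <= 1700)%N -> (K ^ i <= n)%N by move=> hi; apply: leq_trans nlo; rewrite leq_pexp2l.
have n0 : (0 < n)%N by apply: leq_trans nlo; rewrite expn_gt0 K0.
have hn : (n <= K * h)%N by rewrite mulnC ltnW// -ltn_divLR.
have h12 : (12 * h <= n)%N.
  have a1 : (K * (n %/ K) <= n)%N by rewrite mulnC leq_divM.
  have a2 : (1000 * 1000 * (n %/ K) <= K * (n %/ K))%N by rewrite leq_mul2r hK orbT.
  have a3 : (K <= n)%N by rewrite -[K]expn1 Kn.
  by rewrite /h; move: (n %/ K)%N a1 a2 => d a1 a2; clear - hK a1 a2 a3; lia.
pose XX := [set X : {set 'I_n} * {set 'I_n} * {set 'I_n} |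
  [&& [&& #|X.1.1| == h, #|X.1.2| == h & #|X.2| == h], [disjoint X.1.1 & X.1.2], [disjoint X.1.1 & X.2] &
    [disjoint X.1.2 & X.2]]].
set x : R := n%:R; set B := x ^+ 2 / (2 * K%:R ^+ 3).
have cover : (#|[set S in STS n | (mc 3 S < n - 4 * h)%N]| <= \sum_(X in XX) #|hole_systems X|)%N.
  apply: leq_trans (_ : (#|\bigcup_(X in XX) hole_systems X| <= _)%N); last exact: Submission.leq_card_bigcup.
  apply: subset_leq_card; apply/subsetP => S; rewrite inE steiner_systems => /andP[Ss hmc].
  apply: contraLR hmc => /bigcupP nX; rewrite -leqNgt.
  have := @mc_of_no_hole 'I_n S h; rewrite card_ord; apply=> // X1 X2 X3 c1 c2 c3 d12 d13 d23.
  have [/existsP[e /andP[eS ec]]|no] := boolP [exists e in S, crosses (X1, X2, X3) e].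
    by exists e; split=> //; apply/and3P.
  case: nX; exists (X1, X2, X3); first by rewrite inE /= c1 c2 c3 eqxx d12 d13 d23.
  rewrite inE Ss; apply/forallP => e; apply/implyP => eS.
  by move: no; rewrite negb_exists => /forallP/(_ e); rewrite eS.
have hsum : #|[set S in STS n | (mc 3 S < n - 4 * h)%N]|%:R <= #|XX|%:R * (#|STS n|%:R * expR (- B)) :> R.
  apply: le_trans (_ : (\sum_(X in XX) #|hole_systems X|)%N%:R <= _); first by rewrite ler_nat.
  rewrite natr_sum mulr_natl -sumr_const; apply: ler_sum => X.
  rewrite inE => /and4P[/and3P[/eqP e1 /eqP e2 /eqP e3] d12 d13 d23].
  by apply: hole_ratio => //; rewrite ?e1 ?e2 ?e3.
have cXX : (#|XX| <= 2 ^ n * 2 ^ n * 2 ^ n)%N.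
  have c2 : #|{: {set 'I_n}}| = (2 ^ n)%N by rewrite -cardsT -powersetT card_powerset cardsT card_ord.
  by apply: leq_trans (max_card _) _; rewrite !card_prod c2.
have x0 : 0 < x by rewrite ltr0n.
have e2 : (2 ^ n)%:R <= expR x :> R.
  rewrite natrX /x -[n%:R]mul1r expRM_natr.
  by rewrite lerXn2r ?nnegrE ?expR_ge0//; have := expR_ge1Dx (1 : R).
have xe : x <= expR x by have := expR_ge1Dx x; lra.
have q1 : 1000 * 1000 <= K%:R :> R by rewrite -natrM ler_nat.
have BK : 4 * x <= B.
  have Kq0 : 0 < K%:R :> R by rewrite ltr0n.
  have q0 : 0 < K%:R ^+ 3 :> R by rewrite exprn_gt0// ltr0n.
  rewrite /B ler_pdivlMr ?mulr_gt0//.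
  have -> : 4 * x * (2 * K%:R ^+ 3) = x * (8 * K%:R ^+ 3) by ring.
  rewrite expr2 ler_pM2l//; apply: le_trans (_ : K%:R ^+ 4 <= _); last by rewrite /x -natrX ler_nat Kn.
  by rewrite [leRHS]exprS ler_pM2r//; clear - q1; lra.
(* The three factors 2^n and the factor n are each at most exp n, and the exponent B is at least 4
   n. *)
have big : (2 ^ n * 2 ^ n * 2 ^ n)%:R * x * expR (- B) <= 1.
  rewrite expRN ler_pdivrMr ?expR_gt0// mul1r.
  have B4 : expR (4 * x) <= expR B by rewrite ler_expR.
  apply: le_trans B4.
  have -> : 4 * x = x + x + x + x by ring.
  by rewrite !expRD !natrM; do 3?[apply: ler_pM; rewrite ?mulr_ge0 ?ler0n ?(ltW x0)//].
have S0 : 0 <= #|STS n|%:R :> R by rewrite ler0n.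
apply: le_trans (_ : #|XX|%:R * (#|STS n|%:R * expR (- B)) * x <= _); first by rewrite ler_wpM2r// ltW.
apply: le_trans (_ : #|STS n|%:R * ((2 ^ n * 2 ^ n * 2 ^ n)%:R * x * expR (- B)) <= _); last first.
  by rewrite -[leRHS]mulr1 ler_wpM2l.
have -> : #|XX|%:R * (#|STS n|%:R * expR (- B)) * x = #|STS n|%:R * (#|XX|%:R * x * expR (- B)) by ring.
rewrite ler_wpM2l// ler_wpM2r ?expR_ge0// ler_wpM2r ?(ltW x0)// ler_nat.
exact: cXX.
Qed.

Lemma root_scale (n : nat) : exists m, (0 < n -> m ^ 1700 <= n < m.+1 ^ 1700)%N.
Proof.
case: n => [|n]; first by exists 0%N.
have ex : exists m, (m ^ 1700 <= n.+1)%N by exists 1%N; rewrite exp1n.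
have bd m : (m ^ 1700 <= n.+1)%N -> (m <= n.+1)%N.
  by apply: leq_trans; case: m => // m; rewrite -{1}[m.+1]expn1 leq_pexp2l.
case: (ex_maxnP ex bd) => m hm mx; exists m => _; rewrite hm /= ltnNge.
by apply/negP => /mx; rewrite ltnn.
Qed.

Lemma large_component_prob (R : realType) : exists2 d : R, 0 < d & exists n0 : nat, forall n, (n0 <= n)%N ->
  n = 1 %[mod 6] \/ n = 3 %[mod 6] ->
  1 - n%:R^-1 <= finite_uniform_prob R (STS n) (fun S => n%:R - 2 * n%:R `^ (1 - d) <= (mc 3 S)%:R) <= 1.
Proof.
(* As n < K^3400, this exponent 1 / 6800 gives n^d <= sqrt K, hence 4 n^d <= K. Together with h K <=
   2 n it yields 4 h <= 2 n^(1 - d). *)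
have [d d0 dE] : exists2 d : R, 0 < d & 3400%:R * d = 2^-1.
  have k0 : 0 < 3400%:R :> R by rewrite ltr0n.
  by exists (3400%:R^-1 / 2); rewrite ?divr_gt0 ?invr_gt0// mulrA mulfV ?mul1r// gt_eqF.
exists d => //.
have [n0 hn0] : exists n0, n0 = ((1000 * 1000) ^ 1700)%N by exists ((1000 * 1000) ^ 1700)%N.
exists n0.+1 => n nn n6.
have n0' : (0 < n)%N by apply: leq_trans nn.
have [K hK'] := root_scale n; have {hK'} /andP[k1 k2] := hK' n0'.
have hK : (1000 * 1000 <= K)%N.
  rewrite leqNgt; apply/negP => lt.
  have : (K.+1 ^ 1700 <= n0)%N by rewrite hn0 leq_exp2r.
  by rewrite leqNgt => /negP; apply; apply: ltn_trans k2.
(* By maximality of the root n < (K + 1)^1700, and K + 1 <= K^2. *)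
clear n0 hn0 nn; have nhi : (n < K ^ 3400)%N.
  apply: leq_trans k2 _; have -> : (K ^ 3400 = (K ^ 2) ^ 1700)%N by rewrite -expnM.
  rewrite leq_exp2r// expnS expn1.
  by clear - hK; nia.
have K0 : (0 < K)%N by apply: leq_trans hK.
have bad := bad_systems R hK k1 nhi n6.
have [z [p [f [C [_ _ _ [_ S0] _]]]]] := steiner_entropy R hK k1 nhi n6.
set h := (n %/ K).+1 in bad.
have x0 : 0 < n%:R :> R by rewrite ltr0n.
have S0' : 0 < #|STS n|%:R :> R by rewrite ltr0n.
have q0 : 0 < K%:R :> R by rewrite ltr0n.
have q1 : 1000 * 1000 <= K%:R :> R by rewrite -natrM ler_nat.
have pw : n%:R `^ d * 4 <= K%:R :> R.
  have h1 : n%:R `^ d <= (K%:R ^+ 3400) `^ d :> R.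
    have -> : K%:R ^+ 3400 = (K ^ 3400)%N%:R :> R by rewrite natrX.
    by apply: (ge0_ler_powR (ltW d0)); rewrite ?nnegrE ?ler0n// ler_nat ltnW.
  have h2 : (K%:R ^+ 3400) `^ d = Num.sqrt K%:R :> R.
    by rewrite -powR_mulrn ?ler0n// -powRrM dE powR12_sqrt ?ler0n.
  rewrite h2 in h1; apply: le_trans (ler_wpM2r _ h1) _ => //.
  rewrite -[leRHS]sqr_sqrtr ?(ltW q0)// expr2 ler_wpM2l ?sqrtr_ge0//.
  have -> : (4 : R) = Num.sqrt (4 ^+ 2) by rewrite sqrtr_sqr ger0_norm.
  by rewrite ler_wsqrtr// expr2; clear - q1; lra.
have mcn (S : {set {set 'I_n}}) : (n - 4 * h <= mc 3 S)%N -> n%:R - 2 * n%:R `^ (1 - d) <= (mc 3 S)%:R :> R.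
  move=> hm; apply: le_trans (_ : (n - 4 * h)%N%:R <= _); last by rewrite ler_nat.
  apply: le_trans (_ : n%:R - (4 * h)%N%:R <= _); last first.
    by rewrite lerBlDr -natrD ler_nat; clear; lia.
  rewrite lerD2l lerN2 natrM.
  have nd : n%:R `^ (1 - d) * n%:R `^ d = n%:R :> R.
    by rewrite -powRD ?subrK ?powRr1 ?(ltW x0)// gt_eqF// implybT.
  have hh : h%:R * K%:R <= 2 * n%:R :> R.
    rewrite -!natrM ler_nat /h mulSn.
    have a1 : (n %/ K * K <= n)%N by exact: leq_divM.
    have a3 : (K <= n)%N by apply: leq_trans k1; rewrite -{1}[K]expn1 leq_pexp2l.
    by move: (n %/ K * K)%N a1 => c a1; clear - a1 a3; lia.
  have pd0 : 0 < n%:R `^ d :> R by rewrite powR_gt0.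
  rewrite -(ler_pM2r pd0) -[leRHS]mulrA nd.
  have -> : 4 * h%:R * n%:R `^ d = h%:R * (n%:R `^ d * 4) by ring.
  by apply: le_trans hh; rewrite ler_wpM2l.
rewrite /finite_uniform_prob; apply/andP; split; last first.
  by rewrite ler_pdivrMr// mul1r ler_nat; apply: subset_leq_card; apply/subsetP => S; rewrite inE => /andP[].
rewrite ler_pdivlMr// mulrBl mul1r lerBlDr.
set G := [set S in STS n | _].
have : (#|STS n| <= #|G| + #|[set S in STS n | (mc 3 S < n - 4 * h)%N]|)%N.
  apply: leq_trans (leq_card_setU _ _); apply: subset_leq_card; apply/subsetP => S hS.
  rewrite in_setU; apply/orP; move: (mcn S); rewrite leqNgt => mcS.
  have /orP[lt|le] := orbN (mc 3 S < n - 4 * h)%N; [right|left].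
    by rewrite in_set hS.
  by rewrite /G in_set hS; apply: mcS.
rewrite -(ler_nat R) natrD => hle; apply: le_trans hle _; rewrite lerD2l mulrC ler_pdivlMr//.
Qed.

From mathcomp Require Import all_classical all_reals all_analysis.
Import numFieldNormedType.Exports.
Local Open Scope classical_set_scope.
Local Open Scope ring_scope.

Theorem theorem1p4 (R : realType) :
  exists delta : R, 0 < delta /\
    finite_uniform_prob R (STS n)
      (fun S => n%:R - 2 * n%:R `^ (1 - delta) <= (mc 3 S)%:R)
      @[n --> within admissible \oo] --> (1 : R).
Proof.
have [d d0 [n0 H]] := large_component_prob R.
exists d; split=> //.
apply/cvgrPdist_le => e e0; rewrite near_withinE; near=> n => adm.
have nn0 : (n0 <= n)%N by near: n; exact: nbhs_infty_ge.
have ne : n%:R^-1 <= e.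
  have h : e^-1 <= n%:R by near: n; exact: nbhs_infty_ger.
  by rewrite -[leRHS]invrK lef_pV2 ?posrE ?invr_gt0//; apply: lt_le_trans h; rewrite invr_gt0.
have /andP[lo hi] := H n nn0 adm.
rewrite ger0_norm ?subr_ge0// lerBlDr; move: lo; rewrite lerBlDr => lo.
by apply: le_trans lo _; rewrite addrC lerD2r.
Unshelve. all: end_near.
Qed.
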